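(* Let $f_0$ be a meromorphic function of finite order $\rho$ such that: (M1) there exists a pole $b$ of $f_0$ with $b\notin\overline{\mathrm{Sing}(f_0^{-1})}$, of multiplicity $q$; (M2) there are constants $s_0>0$, $Q>0$ and $\alpha>-1-1/q$ such that $|f_0'(z)|\leq Q|z|^{\alpha}$ for $z\in f_0^{-1}(U_0)$, $|z|\to\infty$, where $U_0=B(b,s_0)$. Then there exist $\varepsilon,\delta>0$ such that if $(\lambda_n),(c_n)$ are sequences in $\mathbb{C}$ with $\lambda_n,\lambda_n^{-1}\in B(1,\delta)$ and $|c_n|<\varepsilon$ for each $n$, then $$\mathrm{HD}(\mathcal{J}_r(F_A))\geq\frac{\rho}{\alpha+1+1/q}.$$
   Context: $\mathrm{Sing}(f^{-1})$ is the set of finite critical and asymptotic values. Given $(\lambda_n),(c_n)$: $\hat f_n(z)=\lambda_nf_0(z)+c_n$, $F_A^n=\hat f_n\circ\dots\circ\hat f_1$. The Julia set $\mathcal{J}(F_A)$ is the complement in $\mathbb{C}$ of the set of points having a neighborhood on which all $F_A^n$ are defined and form a normal family. The radial Julia set $\mathcal{J}_r(F_A)$ is the set of $z\in\mathcal{J}(F_A)$ with all $F_A^n(z)$ defined and some $\delta>0$ such that for infinitely many $n$ the disk $B(F_A^n(z),\delta)$ can be pulled back univalently along the orbit of $z$. HD is Hausdorff dimension. *)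

(* Defs.v *)
From Stdlib Require Import Reals List.
From Coquelicot Require Import Coquelicot.

Open Scope R_scope.

Definition disk (z : C) (r : R) (w : C) : Prop := Cmod (w - z)%C < r.

Definition holo_at (f : C -> C) (z : C) : Prop := exists l : C, is_derive f z l.

(* f has a pole of order m >= 1 at p : near p, f z = g z / (z - p)^m with
   g holomorphic near p and g p <> 0 (the value f p itself is irrelevant). *)
Definition is_pole (f : C -> C) (p : C) (m : nat) : Prop :=
  (0 < m)%nat /\
  exists (r : R) (g : C -> C), 0 < r /\
    (forall w, disk p r w -> holo_at g w) /\ g p <> 0%C /\
    (forall w, disk p r w -> w <> p -> f w = (g w / Cpow (w - p) m)%C).

Definition poles (f : C -> C) (p : C) : Prop := exists m, is_pole f p m.

(* f : C -> C is meromorphic on C: holomorphic off its poles.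
   (Its values at the poles are meaningless.) *)
Definition meromorphic (f : C -> C) : Prop :=
  forall z, ~ poles f z -> holo_at f z.

(* multiplicity of a pole (0 if p is not a pole) *)
Definition pole_mult (f : C -> C) (p : C) : R :=
  real (Rbar_lub (fun x => exists m, is_pole f p m /\ x = Finite (INR m))).

Definition logplus (x : R) : R := Rmax 0 (ln x).

Definition Cpolar (r t : R) : C := (RtoC r * (cos t, sin t))%C.

(* proximity function m(r,f) = (1/2pi) int_0^{2pi} log^+|f(r e^{it})| dt,
   the integral of the nonnegative integrand being the supremum of the
   (Riemann) integrals of its truncations (monotone convergence). *)
Definition prox (f : C -> C) (r : R) : R :=
  / (2 * PI) *
  real (Rbar_lub (fun x => exists M : R, x =
     Finite (RInt (fun t => Rmin (logplus (Cmod (f (Cpolar r t)))) M) 0 (2 * PI)))).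

Fixpoint sum_poles (r : R) (l : list (C * nat)%type) : R :=
  match l with
  | nil => 0
  | (p, m) :: l' => INR m * ln (r / Cmod p) + sum_poles r l'
  end.

(* integrated counting function of poles
   N(r,f) = sum_{0<|p|<=r} mult_p log (r/|p|) + n(0,f) log r *)
Definition count_poles (f : C -> C) (r : R) : R :=
  real (Rbar_lub (fun x => exists l : list (C * nat)%type,
     List.NoDup (List.map fst l) /\
     List.Forall (fun pm : (C * nat)%type => is_pole f (fst pm) (snd pm) /\
                       0 < Cmod (fst pm) <= r) l /\
     x = Finite (sum_poles r l)))
  + pole_mult f 0%C * ln r.

Definition nev_T (f : C -> C) (r : R) : R := prox f r + count_poles f r.

Definition order (f : C -> C) : Rbar :=
  Rbar_glb (fun y => exists R0 : R, y =
    Rbar_lub (fun x => exists r : R, R0 < r /\ 1 < r /\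
                                     x = Finite (ln (nev_T f r) / ln r))).

Definition critical_value (f : C -> C) (w : C) : Prop :=
  exists c, ~ poles f c /\ is_derive f c (RtoC 0) /\ f c = w.

Definition asymptotic_value (f : C -> C) (a : C) : Prop :=
  exists gam : R -> C,
    (forall t, 0 <= t -> continuous gam t) /\
    filterlim (fun t => Cmod (gam t)) (Rbar_locally p_infty) (Rbar_locally p_infty) /\
    filterlim (fun t => f (gam t)) (Rbar_locally p_infty) (locally a).

Definition sing_set (f : C -> C) (w : C) : Prop :=
  critical_value f w \/ asymptotic_value f w.

Definition in_closure (A : C -> Prop) (z : C) : Prop :=
  forall r, 0 < r -> exists w, A w /\ disk z r w.

(** * Non-autonomous iteration
   hat f_{n+1} z = lam n * f0 z + c n   (the paper's (lambda_{n+1}, c_{n+1}) is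
   (lam n, c n) here), F 0 = id, F (n+1) = hat f_{n+1} o F n. *)

Fixpoint Fiter (f0 : C -> C) (lam c : nat -> C) (n : nat) (z : C) : C :=
  match n with
  | O => z
  | S k => (lam k * f0 (Fiter f0 lam c k z) + c k)%C
  end.

Definition Fdef (f0 : C -> C) (lam c : nat -> C) (n : nat) (z : C) : Prop :=
  forall k, (k < n)%nat -> ~ poles f0 (Fiter f0 lam c k z).

(* chordal metric on the Riemann sphere  C u {oo} = option C *)
Definition chordal (u v : option C) : R :=
  match u, v with
  | Some z, Some w =>
      2 * Cmod (z - w)%C / sqrt ((1 + Cmod z ^ 2) * (1 + Cmod w ^ 2))
  | Some z, None | None, Some z => 2 / sqrt (1 + Cmod z ^ 2)
  | None, None => 0
  end.

Definition loc_unif_cv (U : C -> Prop) (g : nat -> C -> C) (h : C -> option C) : Prop :=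
  forall z, U z -> exists r, 0 < r /\
    forall eps, 0 < eps -> exists N, forall k w, (N <= k)%nat -> U w -> disk z r w ->
      chordal (Some (g k w)) (h w) < eps.

Definition normal_family (U : C -> Prop) (g : nat -> C -> C) : Prop :=
  forall phi : nat -> nat, (forall k, (phi k < phi (S k))%nat) ->
  exists psi : nat -> nat, (forall k, (psi k < psi (S k))%nat) /\
  exists h : C -> option C, loc_unif_cv U (fun k => g (phi (psi k))) h.

Definition open_set (U : C -> Prop) : Prop :=
  forall z, U z -> exists r, 0 < r /\ forall w, disk z r w -> U w.

Definition julia (f0 : C -> C) (lam c : nat -> C) (z : C) : Prop :=
  ~ (exists U : C -> Prop, open_set U /\ U z /\
       (forall n w, U w -> Fdef f0 lam c n w) /\
       normal_family U (Fiter f0 lam c)).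

(* B(F^n z, delta) can be pulled back univalently along the orbit of z:
   there is an open V containing z on which F^n is defined and which F^n maps
   injectively onto B(F^n z, delta) (the inverse being the branch). *)
Definition univ_pullback (f0 : C -> C) (lam c : nat -> C) (n : nat) (z : C)
  (delta : R) : Prop :=
  exists V : C -> Prop, open_set V /\ V z /\
    (forall w, V w -> Fdef f0 lam c n w) /\
    (forall w1 w2, V w1 -> V w2 -> Fiter f0 lam c n w1 = Fiter f0 lam c n w2 -> w1 = w2) /\
    (forall y, disk (Fiter f0 lam c n z) delta y <->
               exists w, V w /\ Fiter f0 lam c n w = y).

Definition radial_julia (f0 : C -> C) (lam c : nat -> C) (z : C) : Prop :=
  julia f0 lam c z /\ (forall n, Fdef f0 lam c n z) /\
  exists delta, 0 < delta /\
    forall N, exists n, (N <= n)%nat /\ univ_pullback f0 lam c n z delta.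

Definition diam (U : C -> Prop) : Rbar :=
  Rbar_lub (fun x => exists u v, U u /\ U v /\ x = Finite (Cmod (u - v)%C)).

(* diam(U)^t for t > 0, with diam(empty)^t = 0 *)
Definition diam_pow (t : R) (U : C -> Prop) : Rbar :=
  match diam U with
  | Finite d => Finite (if Rlt_dec 0 d then Rpower d t else 0)
  | p_infty => p_infty
  | m_infty => Finite 0
  end.

Fixpoint psum (t : R) (U : nat -> C -> Prop) (n : nat) : Rbar :=
  match n with
  | O => Finite 0
  | S k => Rbar_plus (psum t U k) (diam_pow t (U k))
  end.

Definition hausdorff_pre (t delta : R) (A : C -> Prop) : Rbar :=
  Rbar_glb (fun s => exists U : nat -> C -> Prop,
     (forall i, Rbar_le (diam (U i)) (Finite delta)) /\
     (forall x, A x -> exists i, U i x) /\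
     s = Rbar_lub (fun v => exists n, v = psum t U n)).

Definition hausdorff_measure (t : R) (A : C -> Prop) : Rbar :=
  Rbar_lub (fun v => exists delta, 0 < delta /\ v = hausdorff_pre t delta A).

Definition HD (A : C -> Prop) : Rbar :=
  Rbar_glb (fun x => exists t, 0 < t /\ x = Finite t /\
                                hausdorff_measure t A = Finite 0).

(* Main.v *)
(* Over a disc B(b, S) free of singular values every point z_j of f^{-1}(b) carries a univalent
   inverse branch of f, whose size is controlled by a weak Koebe theorem (Bloch's argument for
   log (psi - a)). Composed with the inverse branches of f at the pole b, these branches form, for
   the pairs hat f_{2n+2} o hat f_{2n+1}, a non-autonomous iterated function system whose maps
   contract distances by a factor of at least c |z_j|^{-(alpha + 1 + 1/q)}. Its limit set lies in
   the radial Julia set, and a mass-distribution argument shows that its dimension is at least t as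
   soon as the t-th powers of these factors over some finite set of z_j have sum at least 1.
   If the sum of the |z_j|^{-tau} converged for some tau < rho, Jensen's inequality for
   u = prod (z - z_j)/(Kr) * prod (2r/(z - p))^m / (f - b), with p ranging over the poles, would
   give T(r) = O(r^tau), which contradicts the order rho of f.
   All complex analysis is derived from Goursat's theorem on rectangles, through a maximum
   principle that tolerates finitely many isolated singularities with mild growth. *)

Require Import Defs.
From Stdlib Require Import Reals Lra Lia List Classical ClassicalEpsilon.
From Coquelicot Require Import Coquelicot.

Open Scope R_scope.

Implicit Types (f g : C -> C) (z l : C).

(** One map sends a point near the pole [b] close to infinity and the next one brings it back to the
    disc at [b]; hence the pairs. The exponent splits accordingly: by (M2) the branch of f_0 at z_j
    has derivative at least a multiple of |z_j|^(-alpha), and the inverse branch at a pole of order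
    q contributes |z_j|^(-(1+1/q)). Only lower bounds for derivatives enter the dimension estimate,
    so a single crude Koebe constant, 320 PI, serves throughout. All inverse branches are those of
    f_0: the affine maps w -> (w - c)/lambda move their arguments by less than the margins between
    nested discs, so the bounds do not depend on the level and one finite alphabet serves all
    levels. HD is an infimum over the exponents of zero measure, so the argument assumes zero
    measure for some t with t (alpha + 1 + 1/q) < rho. This strict gap absorbs every multiplicative
    constant: since the sum of |z_j|^(-tau) diverges, finite sums over z_j of large modulus are as
    large as desired. *)

Lemma Cmod_sub_sym (a b : C) : Cmod (a - b) = Cmod (b - a).
Proof. rewrite <- Cmod_opp. f_equal. ring. Qed.

Lemma Cmod_sub_trans (a b c : C) : Cmod (a - c) <= Cmod (a - b) + Cmod (b - c).
Proof. replace (a - c)%C with ((a - b) + (b - c))%C by ring. apply Cmod_triangle. Qed.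

Lemma Cmod_sub_ge (a b : C) : Cmod a - Cmod b <= Cmod (a - b).
Proof.
  pose proof (Cmod_triangle (a - b) b) as H.
  replace (a - b + b)%C with a in H by ring. lra.
Qed.

Lemma Cmod_sub_le (a b : C) : Cmod (a - b) <= Cmod a + Cmod b.
Proof.
  pose proof (Cmod_triangle a (- b)) as H. rewrite Cmod_opp in H. exact H.
Qed.

Lemma Cmod_sub_0 (a : C) : Cmod (a - a) = 0.
Proof. replace (a - a)%C with (RtoC 0) by ring. apply Cmod_0. Qed.

Lemma Cmod_sub_eq0 (a b : C) : Cmod (a - b) = 0 -> a = b.
Proof. intros H. apply Cmod_eq_0 in H. apply Ceq_minus. exact H. Qed.

Lemma Cmod_sub_pos (a b : C) : a <> b -> 0 < Cmod (a - b).
Proof. intros H. apply Cmod_gt_0. intros E. apply H. apply Ceq_minus. exact E. Qed.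

(** * Complex differentiability in epsilon-delta form *)

Definition cderiv (f : C -> C) (z l : C) : Prop :=
  forall e, 0 < e -> exists d, 0 < d /\ forall w, Cmod (w - z) < d ->
    Cmod (f w - f z - l * (w - z)) <= e * Cmod (w - z).

Definition ccont (f : C -> C) (z : C) : Prop :=
  forall e, 0 < e -> exists d, 0 < d /\ forall w, Cmod (w - z) < d -> Cmod (f w - f z) < e.

Lemma is_derive_cderiv (f : C -> C) (z l : C) : is_derive f z l <-> cderiv f z l.
Proof.
  split.
  - intros [_ H] e He.
    specialize (H z (fun P HP => HP) (mkposreal e He)).
    destruct H as [d Hd]. exists d. split. apply cond_pos.
    intros w Hw. specialize (Hd w Hw). simpl in Hd.
    replace (f w - f z - l * (w - z))%C with (f w - f z - (w - z) * l)%C by ring.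
    exact Hd.
  - intros H. split.
    + apply is_linear_scal_l.
    + intros x Hx.
      pose proof (@is_filter_lim_locally_unique C_AbsRing (AbsRing_NormedModule C_AbsRing) z x Hx) as E.
      simpl in E. subst x.
      intros e. destruct (H e (cond_pos e)) as [d [Hd Hw]].
      exists (mkposreal d Hd). intros w Hb. specialize (Hw w Hb).
      replace (f w - f z - l * (w - z))%C with (f w - f z - (w - z) * l)%C in Hw by ring.
      exact Hw.
Qed.

Lemma cderiv_ccont f z l : cderiv f z l -> ccont f z.
Proof.
  intros H e He. destruct (H 1 Rlt_0_1) as [d [Hd Hw]].
  set (M := 1 + Cmod l). assert (HM : 0 < M) by (unfold M; pose proof (Cmod_ge_0 l); lra).
  exists (Rmin d (e / M)). split.
  { apply Rmin_glb_lt; auto. apply Rdiv_lt_0_compat; auto. }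
  intros w Hwd.
  assert (H1 : Cmod (w - z) < d) by (eapply Rlt_le_trans; [exact Hwd|apply Rmin_l]).
  assert (H2 : Cmod (w - z) < e / M) by (eapply Rlt_le_trans; [exact Hwd|apply Rmin_r]).
  specialize (Hw w H1).
  apply Rle_lt_trans with (M * Cmod (w - z)).
  - pose proof (Cmod_triangle (f w - f z - l * (w - z)) (l * (w - z))) as T.
    rewrite Cmod_mult in T.
    replace (f w - f z - l * (w - z) + l * (w - z))%C with (f w - f z)%C in T by ring.
    unfold M. lra.
  - apply (Rmult_lt_compat_l M) in H2; auto.
    replace (M * (e / M)) with e in H2 by (field; lra). exact H2.
Qed.

Lemma cderiv_ext_loc f g z l : (exists d, 0 < d /\ forall w, Cmod (w - z) < d -> f w = g w) ->
  cderiv f z l -> cderiv g z l.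
Proof.
  intros [d [Hd He]] H e Hep. destruct (H e Hep) as [d' [Hd' Hw]].
  exists (Rmin d d'). split. apply Rmin_glb_lt; auto.
  intros w Hwd. rewrite <- !He.
  - apply Hw. eapply Rlt_le_trans; [exact Hwd|apply Rmin_r].
  - rewrite Cmod_sub_0. exact Hd.
  - eapply Rlt_le_trans; [exact Hwd|apply Rmin_l].
Qed.

Lemma cderiv_ext f g z l : (forall w, f w = g w) -> cderiv f z l -> cderiv g z l.
Proof. intros H. apply cderiv_ext_loc. exists 1. split. lra. auto. Qed.

Lemma ccont_ext_loc f g z : (exists d, 0 < d /\ forall w, Cmod (w - z) < d -> f w = g w) ->
  ccont f z -> ccont g z.
Proof.
  intros [d [Hd He]] H e Hep. destruct (H e Hep) as [d' [Hd' Hw]].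
  exists (Rmin d d'). split. apply Rmin_glb_lt; auto.
  intros w Hwd. rewrite <- !He.
  - apply Hw. eapply Rlt_le_trans; [exact Hwd|apply Rmin_r].
  - rewrite Cmod_sub_0. exact Hd.
  - eapply Rlt_le_trans; [exact Hwd|apply Rmin_l].
Qed.

Lemma cderiv_eq f z l (m : C) : l = m -> cderiv f z l -> cderiv f z m.
Proof. intros ->. auto. Qed.

Lemma cderiv_const (a z : C) : cderiv (fun _ => a) z 0.
Proof.
  intros e He. exists 1. split. lra. intros w _.
  replace (a - a - 0 * (w - z))%C with (RtoC 0) by ring. rewrite Cmod_0.
  apply Rmult_le_pos. lra. apply Cmod_ge_0.
Qed.

Lemma cderiv_id (z : C) : cderiv (fun w => w) z 1.
Proof.
  intros e He. exists 1. split. lra. intros w _.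
  replace (w - z - 1 * (w - z))%C with (RtoC 0) by ring. rewrite Cmod_0.
  apply Rmult_le_pos. lra. apply Cmod_ge_0.
Qed.

Lemma cderiv_plus f g z l (m : C) : cderiv f z l -> cderiv g z m ->
  cderiv (fun w => f w + g w)%C z (l + m).
Proof.
  intros Hf Hg e He. destruct (Hf (e/2)) as [d1 [Hd1 H1]]. lra.
  destruct (Hg (e/2)) as [d2 [Hd2 H2]]. lra.
  exists (Rmin d1 d2). split. apply Rmin_glb_lt; auto.
  intros w Hw. pose proof (Rmin_l d1 d2). pose proof (Rmin_r d1 d2).
  specialize (H1 w ltac:(lra)). specialize (H2 w ltac:(lra)).
  replace (f w + g w - (f z + g z) - (l + m) * (w - z))%C with
    ((f w - f z - l * (w - z)) + (g w - g z - m * (w - z)))%C by ring.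
  eapply Rle_trans. apply Cmod_triangle. lra.
Qed.

Lemma cderiv_opp f z l : cderiv f z l -> cderiv (fun w => - f w)%C z (- l).
Proof.
  intros Hf e He. destruct (Hf e He) as [d [Hd H]].
  exists d. split; auto. intros w Hw.
  replace (- f w - - f z - - l * (w - z))%C with (- (f w - f z - l * (w - z)))%C by ring.
  rewrite Cmod_opp. auto.
Qed.

Lemma cderiv_minus f g z l (m : C) : cderiv f z l -> cderiv g z m ->
  cderiv (fun w => f w - g w)%C z (l - m).
Proof. intros Hf Hg. apply (cderiv_plus f (fun w => - g w)%C); auto. apply cderiv_opp; auto. Qed.

Lemma cderiv_mult f g z l (m : C) : cderiv f z l -> cderiv g z m ->
  cderiv (fun w => f w * g w)%C z (l * g z + f z * m).
Proof.
  intros Hf Hg e He.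
  set (A := Cmod (g z) + Cmod l + Cmod (f z) + 1).
  pose proof (Cmod_ge_0 (g z)) as p1. pose proof (Cmod_ge_0 l) as p2.
  pose proof (Cmod_ge_0 (f z)) as p3.
  assert (HA : 0 < A) by (unfold A; lra).
  set (e1 := Rmin 1 (e / A)).
  assert (He1 : 0 < e1) by (apply Rmin_glb_lt; [lra|apply Rdiv_lt_0_compat; auto]).
  assert (He1A : e1 * A <= e).
  { apply Rle_trans with (e / A * A). apply Rmult_le_compat_r. lra. apply Rmin_r.
    right. field. lra. }
  assert (He11 : e1 <= 1) by apply Rmin_l.
  destruct (Hf e1 He1) as [d1 [Hd1 H1]].
  destruct (Hg e1 He1) as [d2 [Hd2 H2]].
  destruct (cderiv_ccont _ _ _ Hg e1 He1) as [d3 [Hd3 H3]].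
  exists (Rmin d1 (Rmin d2 d3)). split. repeat apply Rmin_glb_lt; auto.
  intros w Hw. pose proof (Rmin_l d1 (Rmin d2 d3)). pose proof (Rmin_r d1 (Rmin d2 d3)).
  pose proof (Rmin_l d2 d3). pose proof (Rmin_r d2 d3).
  specialize (H1 w ltac:(lra)). specialize (H2 w ltac:(lra)). specialize (H3 w ltac:(lra)).
  replace (f w * g w - f z * g z - (l * g z + f z * m) * (w - z))%C with
    ((f w - f z - l * (w - z)) * g w + (l * (w - z) * (g w - g z)
      + f z * (g w - g z - m * (w - z))))%C by ring.
  assert (G : Cmod (g w) <= Cmod (g z) + e1).
  { pose proof (Cmod_sub_ge (g w) (g z)). lra. }
  set (h := Cmod (w - z)) in *. assert (Hh : 0 <= h) by apply Cmod_ge_0.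
  eapply Rle_trans. apply Cmod_triangle.
  eapply Rle_trans. apply Rplus_le_compat_l, Cmod_triangle.
  rewrite !Cmod_mult. fold h.
  apply Rle_trans with (e1 * A * h); [|apply Rmult_le_compat_r; auto].
  assert (T1 : Cmod (f w - f z - l * (w - z)) * Cmod (g w) <= e1 * h * (Cmod (g z) + 1)).
  { apply Rmult_le_compat; auto using Cmod_ge_0. lra. }
  assert (T2 : Cmod l * h * Cmod (g w - g z) <= Cmod l * h * e1).
  { apply Rmult_le_compat_l. apply Rmult_le_pos; auto. lra. }
  assert (T3 : Cmod (f z) * Cmod (g w - g z - m * (w - z)) <= Cmod (f z) * (e1 * h)).
  { apply Rmult_le_compat_l; auto. }
  unfold A. nra.
Qed.

Lemma cderiv_scal (a : C) f z l : cderiv f z l -> cderiv (fun w => a * f w)%C z (a * l).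
Proof.
  intros H. eapply cderiv_eq; [|apply (cderiv_mult (fun _ => a) f); [apply cderiv_const|exact H]]. cbv beta. ring.
Qed.

Lemma cderiv_comp f g z l (m : C) : cderiv f (g z) l -> cderiv g z m ->
  cderiv (fun w => f (g w)) z (l * m).
Proof.
  intros Hf Hg e He.
  set (A := Cmod l + Cmod m + 1).
  pose proof (Cmod_ge_0 l) as p2. pose proof (Cmod_ge_0 m) as p3.
  assert (HA : 0 < A) by (unfold A; lra).
  set (e1 := Rmin 1 (e / A)).
  assert (He1 : 0 < e1) by (apply Rmin_glb_lt; [lra|apply Rdiv_lt_0_compat; auto]).
  assert (He1A : e1 * A <= e).
  { apply Rle_trans with (e / A * A). apply Rmult_le_compat_r. lra. apply Rmin_r.
    right. field. lra. }
  assert (He11 : e1 <= 1) by apply Rmin_l.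
  destruct (Hf e1 He1) as [d1 [Hd1 H1]].
  destruct (Hg e1 He1) as [d2 [Hd2 H2]].
  destruct (cderiv_ccont _ _ _ Hg d1 Hd1) as [d3 [Hd3 H3]].
  exists (Rmin d2 d3). split. apply Rmin_glb_lt; auto.
  intros w Hw. pose proof (Rmin_l d2 d3). pose proof (Rmin_r d2 d3).
  specialize (H2 w ltac:(lra)). specialize (H3 w ltac:(lra)). specialize (H1 _ H3).
  set (h := Cmod (w - z)) in *. assert (Hh : 0 <= h) by apply Cmod_ge_0.
  assert (G : Cmod (g w - g z) <= (Cmod m + e1) * h).
  { pose proof (Cmod_triangle (g w - g z - m * (w - z)) (m * (w - z))) as T.
    replace (g w - g z - m * (w - z) + m * (w - z))%C with (g w - g z)%C in T by ring.
    rewrite Cmod_mult in T. fold h in T. lra. }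
  replace (f (g w) - f (g z) - l * m * (w - z))%C with
    ((f (g w) - f (g z) - l * (g w - g z)) + l * (g w - g z - m * (w - z)))%C by ring.
  eapply Rle_trans. apply Cmod_triangle. rewrite Cmod_mult.
  apply Rle_trans with (e1 * A * h); [|apply Rmult_le_compat_r; auto].
  assert (T2 : Cmod l * Cmod (g w - g z - m * (w - z)) <= Cmod l * (e1 * h)).
  { apply Rmult_le_compat_l; auto. }
  assert (T1 : e1 * Cmod (g w - g z) <= e1 * ((Cmod m + 1) * h)).
  { apply Rmult_le_compat_l; try lra. nra. }
  unfold A. nra.
Qed.

Lemma cderiv_Cinv (z : C) : z <> 0%C -> cderiv (fun w => / w)%C z (- / (z * z)).
Proof.
  intros Hz e He. assert (pz : 0 < Cmod z) by (apply Cmod_gt_0; auto).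
  set (a := Cmod z) in *.
  exists (Rmin (a / 2) (e * a * a * a / 2)). split.
  { apply Rmin_glb_lt; try lra. repeat apply Rmult_lt_0_compat; lra. }
  intros w Hw. pose proof (Rmin_l (a / 2) (e * a * a * a / 2)).
  pose proof (Rmin_r (a / 2) (e * a * a * a / 2)).
  assert (Hwa : a / 2 <= Cmod w).
  { pose proof (Cmod_sub_ge z w). rewrite Cmod_sub_sym in H1. fold a in H1. lra. }
  assert (Hw0 : w <> 0%C) by (apply Cmod_gt_0; lra).
  replace (/ w - / z - - / (z * z) * (w - z))%C with ((w - z) * (w - z) / (w * (z * z)))%C
    by (field; auto).
  rewrite Cmod_div by (repeat apply Cmult_neq_0; auto).
  rewrite !Cmod_mult. fold a. set (h := Cmod (w - z)) in *.
  assert (Hh : 0 <= h) by apply Cmod_ge_0.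
  apply Rle_trans with (h * h / (a / 2 * (a * a))).
  - apply Rmult_le_compat_l. nra. apply Rinv_le_contravar. repeat apply Rmult_lt_0_compat; lra.
    apply Rmult_le_compat_r; nra.
  - replace (h * h / (a / 2 * (a * a))) with (h * (h * (2 / (a * a * a)))) by (field; lra).
    rewrite (Rmult_comm e). apply Rmult_le_compat_l; auto.
    apply Rle_trans with (e * a * a * a / 2 * (2 / (a * a * a))).
    + apply Rmult_le_compat_r; try lra. apply Rdiv_le_0_compat; try lra.
      repeat apply Rmult_lt_0_compat; lra.
    + right. field. lra.
Qed.

Lemma cderiv_inv f z l : f z <> 0%C -> cderiv f z l ->
  cderiv (fun w => / f w)%C z (- l / (f z * f z)).
Proof.
  intros Hz H. eapply cderiv_eq; [|apply (cderiv_comp Cinv f); [apply cderiv_Cinv; exact Hz|exact H]].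
  field. auto.
Qed.

Lemma cderiv_div f g z l (m : C) : g z <> 0%C -> cderiv f z l -> cderiv g z m ->
  cderiv (fun w => f w / g w)%C z (l / g z - f z * m / (g z * g z)).
Proof.
  intros Hz Hf Hg. eapply cderiv_eq; [|apply (cderiv_mult f (fun w => / g w)%C); [exact Hf|apply cderiv_inv; eauto]].
  cbv beta. field. auto.
Qed.

Lemma cderiv_pow f z l n : cderiv f z l ->
  cderiv (fun w => Cpow (f w) n) z (INR n * Cpow (f z) (pred n) * l).
Proof.
  intros H. induction n.
  - simpl. eapply cderiv_eq; [|apply cderiv_const]. ring.
  - rewrite S_INR, RtoC_plus. simpl pred.
    eapply cderiv_eq; [|apply (cderiv_mult f (fun w => Cpow (f w) n)); [exact H|exact IHn]].
    cbv beta. destruct n; simpl. ring. ring.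
Qed.

Definition cholo (f : C -> C) (z : C) : Prop := exists l, cderiv f z l.

Lemma holo_at_cholo f z : holo_at f z <-> cholo f z.
Proof. split; intros [l H]; exists l; apply is_derive_cderiv; exact H. Qed.

Lemma cholo_const a z : cholo (fun _ => a) z.
Proof. eexists. apply cderiv_const. Qed.
Lemma cholo_id z : cholo (fun w => w) z.
Proof. eexists. apply cderiv_id. Qed.
Lemma cholo_plus f g z : cholo f z -> cholo g z -> cholo (fun w => f w + g w)%C z.
Proof. intros [l Hl] [m Hm]. eexists. apply cderiv_plus; eauto. Qed.
Lemma cholo_minus f g z : cholo f z -> cholo g z -> cholo (fun w => f w - g w)%C z.
Proof. intros [l Hl] [m Hm]. eexists. apply cderiv_minus; eauto. Qed.
Lemma cholo_mult f g z : cholo f z -> cholo g z -> cholo (fun w => f w * g w)%C z.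
Proof. intros [l Hl] [m Hm]. eexists. apply cderiv_mult; eauto. Qed.
Lemma cholo_div f g z : g z <> 0%C -> cholo f z -> cholo g z -> cholo (fun w => f w / g w)%C z.
Proof. intros H [l Hl] [m Hm]. eexists. apply cderiv_div; eauto. Qed.
Lemma cholo_inv f z : f z <> 0%C -> cholo f z -> cholo (fun w => / f w)%C z.
Proof. intros H [l Hl]. eexists. apply cderiv_inv; eauto. Qed.
Lemma cholo_pow f z n : cholo f z -> cholo (fun w => Cpow (f w) n) z.
Proof. intros [l Hl]. eexists. apply cderiv_pow; eauto. Qed.
Lemma cholo_comp f g z : cholo f (g z) -> cholo g z -> cholo (fun w => f (g w)) z.
Proof. intros [l Hl] [m Hm]. eexists. apply (cderiv_comp f g); eauto. Qed.
Lemma cholo_ccont f z : cholo f z -> ccont f z.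
Proof. intros [l H]. eapply cderiv_ccont; eauto. Qed.
Lemma cholo_ext_loc f g z : (exists d, 0 < d /\ forall w, Cmod (w - z) < d -> f w = g w) ->
  cholo f z -> cholo g z.
Proof. intros H [l Hl]. exists l. eapply cderiv_ext_loc; eauto. Qed.

Lemma ccont_nonzero f z : ccont f z -> f z <> 0%C ->
  exists d, 0 < d /\ forall w, Cmod (w - z) < d -> f w <> 0%C.
Proof.
  intros H Hz. apply Cmod_gt_0 in Hz. destruct (H _ Hz) as [d [Hd Hw]].
  exists d. split; auto. intros w Hwd E. specialize (Hw w Hwd). rewrite E in Hw.
  replace (0 - f z)%C with (- f z)%C in Hw by ring. rewrite Cmod_opp in Hw. lra.
Qed.

(** Implicit differentiation of a lift [p (k x) = h x]: continuity of [k] brings [k x] into the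
    range where [p] is nearly linear, and the error, at most half of |l| |k x - k w|, is absorbed on
    the left. It differentiates logarithms and inverse branches once these are known to be
    continuous. *)
Lemma cderiv_lift (p h k : C -> C) (w l m : C) :
  ccont k w -> cderiv p (k w) l -> l <> 0%C -> cderiv h w m ->
  (exists d, 0 < d /\ forall x, Cmod (x - w) < d -> p (k x) = h x) ->
  cderiv k w (m / l).
Proof.
  intros Hk Hp Hl Hh [d0 [Hd0 Heq]] e He.
  assert (pl : 0 < Cmod l) by (apply Cmod_gt_0; auto).
  pose proof (Cmod_ge_0 m) as pm.
  set (a := Cmod l) in *.
  (* |k x - k w| <= B |x - w| near w *)
  set (B := 2 * (Cmod m + 1) / a).
  assert (HB : 0 < B) by (unfold B; apply Rdiv_lt_0_compat; lra).
  (* The first bound on [e1] permits the absorption that yields [B]; the second makes the resulting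
     term [e1 * B] at most half of the allowed error [e * a]. *)
  set (e1 := Rmin (a / 2) (e * a / 2 / B)).
  assert (He1 : 0 < e1).
  { apply Rmin_glb_lt. lra. apply Rdiv_lt_0_compat; auto. nra. }
  set (e2 := Rmin 1 (e * a / 2)).
  assert (He2 : 0 < e2). { apply Rmin_glb_lt. lra. nra. }
  destruct (Hp e1 He1) as [d1 [Hd1 H1]].
  destruct (Hk d1 Hd1) as [d2 [Hd2 H2]].
  destruct (Hh e2 He2) as [d3 [Hd3 H3]].
  exists (Rmin d0 (Rmin d2 d3)). split. repeat apply Rmin_glb_lt; auto.
  intros x Hx. pose proof (Rmin_l d0 (Rmin d2 d3)). pose proof (Rmin_r d0 (Rmin d2 d3)).
  pose proof (Rmin_l d2 d3). pose proof (Rmin_r d2 d3).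
  specialize (H2 x ltac:(lra)). specialize (H1 _ H2). specialize (H3 x ltac:(lra)).
  rewrite (Heq x) in H1 by lra. rewrite (Heq w) in H1 by (rewrite Cmod_sub_0; lra).
  set (D := Cmod (k x - k w)) in *. set (t := Cmod (x - w)) in *.
  assert (Ht : 0 <= t) by apply Cmod_ge_0. assert (HD : 0 <= D) by apply Cmod_ge_0.
  assert (E1 : e1 <= a / 2) by apply Rmin_l.
  assert (E1' : e1 * B <= e * a / 2).
  { apply Rle_trans with (e * a / 2 / B * B). apply Rmult_le_compat_r. lra. apply Rmin_r.
    right. field. lra. }
  assert (E2 : e2 <= 1) by apply Rmin_l. assert (E2' : e2 <= e * a / 2) by apply Rmin_r.
  assert (HDB : D <= B * t).
  { assert (a * D <= e1 * D + (e2 + Cmod m) * t).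
    { unfold a, D. rewrite <- Cmod_mult.
      replace (l * (k x - k w))%C with
        (- (h x - h w - l * (k x - k w)) + ((h x - h w - m * (x - w)) + m * (x - w)))%C by ring.
      eapply Rle_trans. apply Cmod_triangle. rewrite Cmod_opp.
      eapply Rle_trans. apply Rplus_le_compat_l, Cmod_triangle.
      rewrite Cmod_mult. fold t. unfold D in H1. lra. }
    assert (a / 2 * D <= (1 + Cmod m) * t) by nra.
    apply Rmult_le_reg_l with (a / 2). lra.
    unfold B. replace (a / 2 * (2 * (Cmod m + 1) / a * t)) with ((1 + Cmod m) * t) by (field; lra).
    assumption. }
  replace (k x - k w - m / l * (x - w))%C with
    (((h x - h w - m * (x - w)) - (h x - h w - l * (k x - k w))) / l)%C by (field; auto).
  rewrite Cmod_div by auto. fold a.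
  apply Rle_trans with ((e2 * t + e1 * D) / a).
  - apply Rmult_le_compat_r. left. apply Rinv_0_lt_compat. lra.
    eapply Rle_trans. apply Cmod_sub_le. lra.
  - apply Rle_trans with ((e * a / 2 * t + e * a / 2 * t) / a).
    + apply Rmult_le_compat_r. left. apply Rinv_0_lt_compat. lra.
      apply Rplus_le_compat. apply Rmult_le_compat_r; auto.
      apply Rle_trans with (e1 * (B * t)). apply Rmult_le_compat_l; lra. nra.
    + right. field. lra.
Qed.

(** * Compactness by bisection *)

Lemma half_pow_small (L d : R) : 0 < d -> exists n, L * (/ 2) ^ n < d.
Proof.
  intros Hd. destruct (pow_lt_1_zero (/ 2)) with (y := d / (Rabs L + 1)) as [N HN].
  { rewrite Rabs_pos_eq; lra. }
  { apply Rdiv_lt_0_compat; auto. pose proof (Rabs_pos L); lra. }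
  exists N. specialize (HN N (le_n N)). rewrite Rabs_pos_eq in HN by (apply pow_le; lra).
  assert (0 < (/2) ^ N) by (apply pow_lt; lra).
  pose proof (Rabs_pos L). pose proof (Rle_abs L).
  apply Rle_lt_trans with ((Rabs L + 1) * (/2) ^ N).
  - apply Rmult_le_compat_r; lra.
  - apply (Rmult_lt_compat_l (Rabs L + 1)) in HN; [|lra].
    replace ((Rabs L + 1) * (d / (Rabs L + 1))) with d in HN by (field; lra). exact HN.
Qed.

Lemma nested_point (u v : nat -> R) : (forall n, u n <= u (S n)) -> (forall n, v (S n) <= v n) ->
  (forall n, u n <= v n) -> exists x, forall n, u n <= x <= v n.
Proof.
  intros Hu Hv Huv.
  assert (Mu : forall n k, u n <= u (n + k)%nat).
  { intros n k. induction k. rewrite Nat.add_0_r. lra. rewrite Nat.add_succ_r. eapply Rle_trans; eauto. }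
  assert (Mv : forall n k, v (n + k)%nat <= v n).
  { intros n k. induction k. rewrite Nat.add_0_r. lra. rewrite Nat.add_succ_r. eapply Rle_trans; eauto. }
  assert (Hmn : forall m n, u m <= v n).
  { intros m n. pose proof (Mu m n). pose proof (Mv n m). rewrite (Nat.add_comm n m) in H0.
    pose proof (Huv (m + n)%nat). lra. }
  destruct (completeness (fun x => exists n, x = u n)) as [x [Hx1 Hx2]].
  - exists (v O). intros y [n ->]. apply Hmn.
  - exists (u O). exists O. reflexivity.
  - exists x. intros n. split.
    + apply Hx1. exists n. reflexivity.
    + apply Hx2. intros y [m ->]. apply Hmn.
Qed.

(* Two-dimensional bisection; every compactness argument below is an instance of it. *)
Lemma cousin (P : R -> R -> R -> R -> Prop) (a b c d : R) :
  a <= b -> c <= d ->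
  (forall x0 x1 y0 y1, a <= x0 -> x0 <= x1 -> x1 <= b -> c <= y0 -> y0 <= y1 -> y1 <= d ->
     P x0 ((x0 + x1) / 2) y0 ((y0 + y1) / 2) -> P ((x0 + x1) / 2) x1 y0 ((y0 + y1) / 2) ->
     P x0 ((x0 + x1) / 2) ((y0 + y1) / 2) y1 -> P ((x0 + x1) / 2) x1 ((y0 + y1) / 2) y1 ->
     P x0 x1 y0 y1) ->
  (forall x y, a <= x <= b -> c <= y <= d -> exists e, 0 < e /\
     forall x0 x1 y0 y1, a <= x0 -> x0 <= x -> x <= x1 -> x1 <= b ->
       c <= y0 -> y0 <= y -> y <= y1 -> y1 <= d ->
       x1 - x0 < e -> y1 - y0 < e -> P x0 x1 y0 y1) ->
  P a b c d.
Proof.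
  intros Hab Hcd Hadd Hloc. apply NNPP. intros Hn.
  set (bad := fun q : R * R * R * R => let '(x0, x1, y0, y1) := q in
    a <= x0 /\ x0 <= x1 /\ x1 <= b /\ c <= y0 /\ y0 <= y1 /\ y1 <= d /\ ~ P x0 x1 y0 y1).
  set (sub := fun q q' : R * R * R * R => let '(x0, x1, y0, y1) := q in let '(x0', x1', y0', y1') := q' in
    x0 <= x0' /\ x1' <= x1 /\ y0 <= y0' /\ y1' <= y1 /\ x1' - x0' = (x1 - x0) / 2 /\ y1' - y0' = (y1 - y0) / 2).
  (* A bad quarter exists only by contradiction, so it has to be selected by choice; carrying the
     proof of badness along with the rectangle lets the nested sequence be defined by recursion. *)
  assert (step : forall s : {q | bad q}, {s' : {q | bad q} | sub (proj1_sig s) (proj1_sig s')}).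
  { intros [[[[x0 x1] y0] y1] Hq]. apply constructive_indefinite_description.
    simpl. destruct Hq as (h1 & h2 & h3 & h4 & h5 & h6 & h7).
    assert (Hor : exists q', bad q' /\ sub (x0, x1, y0, y1) q').
    { destruct (classic (P x0 ((x0 + x1) / 2) y0 ((y0 + y1) / 2))) as [p1|p1].
      destruct (classic (P ((x0 + x1) / 2) x1 y0 ((y0 + y1) / 2))) as [p2|p2].
      destruct (classic (P x0 ((x0 + x1) / 2) ((y0 + y1) / 2) y1)) as [p3|p3].
      destruct (classic (P ((x0 + x1) / 2) x1 ((y0 + y1) / 2) y1)) as [p4|p4].
      - exfalso. apply h7. apply Hadd; assumption.
      - eexists (_, _, _, _). split; [|]; simpl; repeat split; try exact p4; lra.
      - eexists (_, _, _, _). split; [|]; simpl; repeat split; try exact p3; lra.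
      - eexists (_, _, _, _). split; [|]; simpl; repeat split; try exact p2; lra.
      - eexists (_, _, _, _). split; [|]; simpl; repeat split; try exact p1; lra. }
    destruct Hor as [q' [Hb Hs]]. exists (exist _ q' Hb). exact Hs. }
  assert (b0 : bad (a, b, c, d)) by (simpl; repeat split; auto; lra).
  set (s := fix s n := match n with O => exist bad (a, b, c, d) b0 | S k => proj1_sig (step (s k)) end).
  set (X0 := fun n => fst (fst (fst (proj1_sig (s n))))).
  set (X1 := fun n => snd (fst (fst (proj1_sig (s n))))).
  set (Y0 := fun n => snd (fst (proj1_sig (s n)))).
  set (Y1 := fun n => snd (proj1_sig (s n))).
  assert (Hbad : forall n, a <= X0 n /\ X0 n <= X1 n /\ X1 n <= b /\ c <= Y0 n /\ Y0 n <= Y1 n /\ Y1 n <= d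
    /\ ~ P (X0 n) (X1 n) (Y0 n) (Y1 n)).
  { intros n. unfold X0, X1, Y0, Y1. destruct (s n) as [[[[x0 x1] y0] y1] Hq]. exact Hq. }
  assert (Hsub : forall n, X0 n <= X0 (S n) /\ X1 (S n) <= X1 n /\ Y0 n <= Y0 (S n) /\ Y1 (S n) <= Y1 n
    /\ X1 (S n) - X0 (S n) = (X1 n - X0 n) / 2 /\ Y1 (S n) - Y0 (S n) = (Y1 n - Y0 n) / 2).
  { intros n. unfold X0, X1, Y0, Y1. simpl. destruct (step (s n)) as [[[[[x0 x1] y0] y1] Hq] Hs]. simpl.
    destruct (s n) as [[[[x0' x1'] y0'] y1'] Hq']. exact Hs. }
  assert (Wx : forall n, X1 n - X0 n = (b - a) * (/ 2) ^ n).
  { induction n. unfold X0, X1; simpl; ring. destruct (Hsub n) as (_ & _ & _ & _ & E & _). rewrite E, IHn. simpl. field. }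
  assert (Wy : forall n, Y1 n - Y0 n = (d - c) * (/ 2) ^ n).
  { induction n. unfold Y0, Y1; simpl; ring. destruct (Hsub n) as (_ & _ & _ & _ & _ & E). rewrite E, IHn. simpl. field. }
  destruct (nested_point X0 X1) as [x Hx]; try (intros n; apply Hsub); try (intros n; apply Hbad).
  destruct (nested_point Y0 Y1) as [y Hy]; try (intros n; apply Hsub); try (intros n; apply Hbad).
  destruct (Hloc x y) as [e [He HP]].
  { specialize (Hx O). unfold X0, X1 in Hx. simpl in Hx. exact Hx. }
  { specialize (Hy O). unfold Y0, Y1 in Hy. simpl in Hy. exact Hy. }
  destruct (half_pow_small (b - a + (d - c)) e He) as [n Hnn].
  destruct (Hbad n) as (h1 & h2 & h3 & h4 & h5 & h6 & h7). apply h7.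
  assert (0 < (/ 2) ^ n) by (apply pow_lt; lra).
  specialize (Hx n). specialize (Hy n). specialize (Wx n). specialize (Wy n).
  apply HP; try tauto; rewrite ?Wx, ?Wy; nra.
Qed.

Lemma Rabs_Re_le (z : C) : Rabs (Re z) <= Cmod z.
Proof. apply re_le_Cmod. Qed.

Lemma Rabs_Im_le (z : C) : Rabs (Im z) <= Cmod z.
Proof. pose proof (Rmax_Cmod z). pose proof (Rmax_r (Rabs (fst z)) (Rabs (snd z))). unfold Im. lra. Qed.

Lemma Cmod_le_Re_Im (z : C) : Cmod z <= Rabs (Re z) + Rabs (Im z).
Proof.
  pose proof (Cmod_triangle (RtoC (Re z)) (Ci * RtoC (Im z))) as H.
  replace (Re z + Ci * Im z)%C with z in H.
  - rewrite Cmod_mult, Cmod_Ci, !Cmod_R in H. lra.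
  - destruct z as [x y]. unfold Re, Im, Ci, Cplus, Cmult, RtoC; simpl. f_equal; ring.
Qed.

(** [P] is a property of sets that passes to subsets and unions, as in a finite-subcover argument.
    Bisection works on a rectangle, so points outside the disc occur too; for these only the part of
    a small neighbourhood that lies in the disc is examined. *)
Lemma disc_cousin (P : (C -> Prop) -> Prop) (z0 : C) (r : R) :
  (forall A B, P A -> P B -> P (fun z => A z \/ B z)) ->
  (forall A B : C -> Prop, (forall z, A z -> B z) -> P B -> P A) ->
  (forall z, Cmod (z - z0) <= r -> exists d, 0 < d /\ P (fun w => Cmod (w - z) < d)) ->
  (forall z, r < Cmod (z - z0) -> exists d, 0 < d /\ P (fun w => Cmod (w - z) < d /\ Cmod (w - z0) <= r)) ->
  P (fun z => Cmod (z - z0) <= r).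
Proof.
  intros HU HS HL HO.
  set (Q := fun x0 x1 y0 y1 => P (fun z => x0 <= Re z <= x1 /\ y0 <= Im z <= y1 /\ Cmod (z - z0) <= r)).
  (* [r] may be negative, in which case the disc is empty; the absolute value keeps the sides of the
     square in order. *)
  set (r' := Rabs r).
  assert (HQ : Q (Re z0 - r') (Re z0 + r') (Im z0 - r') (Im z0 + r')).
  { pose proof (Rabs_pos r) as pr. fold r' in pr. apply cousin; try lra.
    - unfold Q. intros x0 x1 y0 y1 _ _ _ _ _ _ q1 q2 q3 q4.
      eapply HS; [|exact (HU _ _ (HU _ _ q1 q2) (HU _ _ q3 q4))].
      intros z (Hx & Hy & Hz). simpl.
      destruct (Rle_dec (Re z) ((x0 + x1) / 2)); destruct (Rle_dec (Im z) ((y0 + y1) / 2)).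
      + left. left. repeat split; lra.
      + right. left. repeat split; lra.
      + left. right. repeat split; lra.
      + right. right. repeat split; lra.
    - intros x y Hx Hy.
      assert (K : forall d, 0 < d -> forall x0 x1 y0 y1, x0 <= x -> x <= x1 -> y0 <= y -> y <= y1 ->
        x1 - x0 < d / 2 -> y1 - y0 < d / 2 -> forall w, (x0 <= Re w <= x1 /\ y0 <= Im w <= y1 /\ Cmod (w - z0) <= r) ->
        Cmod (w - (x, y)) < d).
      { intros d Hd x0 x1 y0 y1 a1 a2 a3 a4 a5 a6 w (b1 & b2 & _).
        eapply Rle_lt_trans. apply Cmod_le_Re_Im. destruct w as [u v].
        unfold Re, Im in *. simpl in *.
        assert (Rabs (u + - x) < d / 2) by (apply Rabs_def1; lra).
        assert (Rabs (v + - y) < d / 2) by (apply Rabs_def1; lra). lra. }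
      destruct (Rle_dec (Cmod ((x, y) - z0)) r) as [Hin|Hout].
      + destruct (HL _ Hin) as [d [Hd Hp]]. exists (d / 2). split. lra.
        intros x0 x1 y0 y1 _ a1 a2 _ _ a3 a4 _ a5 a6. unfold Q. eapply HS; [|exact Hp].
        cbv beta. apply K; auto.
      + destruct (HO (x, y)) as [d [Hd Hp]]. lra. exists (d / 2). split. lra.
        intros x0 x1 y0 y1 _ a1 a2 _ _ a3 a4 _ a5 a6. unfold Q. eapply HS; [|exact Hp].
        cbv beta. intros w Hw. split. apply (K d Hd x0 x1 y0 y1); auto. apply Hw. }
  eapply HS; [|exact HQ]. intros z Hz. cbv beta.
  pose proof (Rabs_Re_le (z - z0)). pose proof (Rabs_Im_le (z - z0)).
  pose proof (Rle_abs r). fold r' in H1.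
  assert (Re (z - z0) = Re z - Re z0) by (destruct z, z0; reflexivity).
  assert (Im (z - z0) = Im z - Im z0) by (destruct z, z0; reflexivity).
  rewrite H2 in H. rewrite H3 in H0.
  apply Rabs_le_between in H. apply Rabs_le_between in H0.
  repeat split; try lra.
Qed.

(** Once [P] holds of the empty set, the condition at outside points is automatic: a small disc
    about such a point misses the closed disc. *)
Lemma disc_compact (P : (C -> Prop) -> Prop) (z0 : C) (r : R) :
  P (fun _ => False) ->
  (forall A B, P A -> P B -> P (fun z => A z \/ B z)) ->
  (forall A B : C -> Prop, (forall z, A z -> B z) -> P B -> P A) ->
  (forall z, Cmod (z - z0) <= r -> exists d, 0 < d /\ P (fun w => Cmod (w - z) < d)) ->
  P (fun z => Cmod (z - z0) <= r).
Proof.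
  intros H0 HU HS HL. apply disc_cousin; auto.
  intros z Hz. exists (Cmod (z - z0) - r). split. lra.
  eapply HS; [|exact H0]. intros w [H1 H2].
  pose proof (Cmod_sub_trans z w z0). rewrite (Cmod_sub_sym z w) in H. lra.
Qed.

Lemma ccont_bounded_disc (f : C -> C) (z0 : C) (r : R) :
  (forall z, Cmod (z - z0) <= r -> ccont f z) ->
  exists M, 0 < M /\ forall z, Cmod (z - z0) <= r -> Cmod (f z) <= M.
Proof.
  intros H.
  apply (disc_compact (fun A => exists M, 0 < M /\ forall z, A z -> Cmod (f z) <= M)).
  - exists 1. split. lra. tauto.
  - intros A B [M [HM HA]] [N [HN HB]]. exists (M + N). split. lra.
    intros z [Hz|Hz]; [specialize (HA z Hz)|specialize (HB z Hz)]; lra.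
  - intros A B HAB [M [HM HB]]. exists M. auto.
  - intros z Hz. destruct (H z Hz 1 Rlt_0_1) as [d [Hd Hw]]. exists d. split; auto.
    exists (Cmod (f z) + 1). pose proof (Cmod_ge_0 (f z)). split. lra.
    intros w Hwd. specialize (Hw w Hwd). pose proof (Cmod_sub_ge (f w) (f z)). lra.
Qed.

(** * The complex exponential *)

Lemma is_derive_eps (f : R -> R) (x l : R) : is_derive f x l ->
  forall e, 0 < e -> exists d, 0 < d /\ forall y, Rabs (y - x) < d ->
    Rabs (f y - f x - l * (y - x)) <= e * Rabs (y - x).
Proof.
  intros [_ H] e He.
  specialize (H x (fun P HP => HP) (mkposreal e He)).
  destruct H as [d Hd]. exists d. split. apply cond_pos.
  intros y Hy. specialize (Hd y Hy). simpl in Hd.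
  replace (f y - f x - l * (y - x)) with (f y - f x - (y - x) * l) by ring.
  exact Hd.
Qed.

Definition Cexp (z : C) : C := (exp (Re z) * cos (Im z), exp (Re z) * sin (Im z)).

Lemma Cexp_plus (a b : C) : Cexp (a + b) = (Cexp a * Cexp b)%C.
Proof.
  destruct a as [x y], b as [u v]. unfold Cexp, Cmult, Cplus, Re, Im; simpl.
  rewrite exp_plus, cos_plus, sin_plus. f_equal; ring.
Qed.

Lemma Cmod_Cexp (z : C) : Cmod (Cexp z) = exp (Re z).
Proof.
  unfold Cexp, Cmod; simpl.
  replace (_ + _) with (exp (Re z) * exp (Re z) * (sin (Im z) * sin (Im z) + cos (Im z) * cos (Im z))) by ring.
  pose proof (sin2_cos2 (Im z)) as H. unfold Rsqr in H. rewrite H, Rmult_1_r.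
  apply sqrt_square. left. apply exp_pos.
Qed.

Lemma Cexp_nz (z : C) : Cexp z <> 0%C.
Proof. apply Cmod_gt_0. rewrite Cmod_Cexp. apply exp_pos. Qed.

Lemma Cexp_0 : Cexp 0 = 1%C.
Proof. unfold Cexp, Re, Im; simpl. rewrite exp_0, cos_0, sin_0. unfold RtoC. f_equal; ring. Qed.

Lemma cderiv_Cexp_0 : cderiv Cexp 0 1.
Proof.
  intros e He.
  (* The remainders below add up to 4 e1 h for the real part ([Q1]) and 5 e1 h for the imaginary
     part ([Q2]), whence the 9. *)
  set (e1 := Rmin 1 (e / 9)). assert (He1 : 0 < e1) by (apply Rmin_glb_lt; lra).
  assert (e11 : e1 <= 1) by apply Rmin_l. assert (e1e : e1 <= e / 9) by apply Rmin_r.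
  destruct (is_derive_eps exp 0 1) with (e := e1) as [d1 [Hd1 H1]]; auto.
  { pose proof (is_derive_exp 0) as K. rewrite exp_0 in K. exact K. }
  destruct (is_derive_eps cos 0 0) with (e := e1) as [d2 [Hd2 H2]]; auto.
  { pose proof (is_derive_cos 0) as K. rewrite sin_0, Ropp_0 in K. exact K. }
  destruct (is_derive_eps sin 0 1) with (e := e1) as [d3 [Hd3 H3]]; auto.
  { pose proof (is_derive_sin 0) as K. rewrite cos_0 in K. exact K. }
  rewrite exp_0 in H1. rewrite cos_0 in H2. rewrite sin_0 in H3.
  set (d := Rmin (Rmin d1 e1) (Rmin d2 d3)).
  assert (Dd : 0 < d /\ d <= d1 /\ d <= e1 /\ d <= d2 /\ d <= d3).
  { unfold d. pose proof (Rmin_l (Rmin d1 e1) (Rmin d2 d3)). pose proof (Rmin_r (Rmin d1 e1) (Rmin d2 d3)).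
    pose proof (Rmin_l d1 e1). pose proof (Rmin_r d1 e1). pose proof (Rmin_l d2 d3). pose proof (Rmin_r d2 d3).
    split. repeat (apply Rmin_glb_lt; auto). repeat split; eauto using Rle_trans. }
  destruct Dd as (Dd0 & Dd1 & Dd2 & Dd3 & Dd4).
  exists d. split. exact Dd0. intros w. rewrite Cexp_0.
  replace (w - 0)%C with w by ring. intros Hw.
  pose proof (Rabs_Re_le w) as Rx. pose proof (Rabs_Im_le w) as Ry.
  destruct w as [x y]. set (h := Cmod (x, y)) in *. unfold Re, Im in Rx, Ry. simpl in Rx, Ry.
  eapply Rle_trans. apply Cmod_le_Re_Im. unfold Cexp, Re, Im, Cminus, Cplus, Copp, Cmult, RtoC; simpl.
  specialize (H1 x). specialize (H2 y). specialize (H3 y). rewrite ?Rminus_0_r in *.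
  specialize (H1 ltac:(lra)). specialize (H2 ltac:(lra)). specialize (H3 ltac:(lra)).
  assert (ex3 : 0 < exp x <= 3).
  { split. apply exp_pos. apply Rle_trans with (exp 1). 2: apply exp_le_3.
    left. apply exp_increasing. pose proof (Rle_abs x). lra. }
  assert (A : Rabs (exp x - 1) <= 2 * Rabs x).
  { replace (exp x - 1) with ((exp x - 1 - 1 * x) + x) by ring. eapply Rle_trans. apply Rabs_triang.
    pose proof (Rabs_pos x). nra. }
  assert (B : Rabs (sin y) <= 2 * Rabs y).
  { replace (sin y) with ((sin y - 1 * y) + y) by ring. eapply Rle_trans. apply Rabs_triang.
    pose proof (Rabs_pos y). nra. }
  assert (Q1 : Rabs (exp x * cos y + - (1) + - (1 * x - 0 * y)) <= 3 * (e1 * h) + e1 * h).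
  { replace (exp x * cos y + - (1) + - (1 * x - 0 * y)) with
      (exp x * (cos y - 1 - 0 * y) + (exp x - 1 - 1 * x)) by ring.
    eapply Rle_trans. apply Rabs_triang. rewrite Rabs_mult, (Rabs_pos_eq (exp x)) by lra.
    pose proof (Rabs_pos (cos y - 1 - 0 * y)). pose proof (Rabs_pos x). pose proof (Rabs_pos y).
    apply Rplus_le_compat. apply Rmult_le_compat; try lra. nra. nra. }
  assert (Q2 : Rabs (exp x * sin y + - 0 + - (1 * y + 0 * x)) <= 5 * e1 * h).
  { replace (exp x * sin y + - 0 + - (1 * y + 0 * x)) with
      ((exp x - 1) * sin y + (sin y - 1 * y)) by ring.
    eapply Rle_trans. apply Rabs_triang. rewrite Rabs_mult.
    pose proof (Rabs_pos x). pose proof (Rabs_pos y). pose proof (Rabs_pos (exp x - 1)). pose proof (Rabs_pos (sin y)).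
    apply Rle_trans with (2 * Rabs x * (2 * Rabs y) + e1 * Rabs y).
    apply Rplus_le_compat; auto. apply Rmult_le_compat; auto.
    assert (Rabs x * Rabs y <= e1 * h). apply Rmult_le_compat; lra.
    assert (e1 * Rabs y <= e1 * h) by (apply Rmult_le_compat_l; lra). lra. }
  assert (0 <= h) by apply Cmod_ge_0.
  eapply Rle_trans; [apply Rplus_le_compat; eassumption|]. nra.
Qed.

(** The addition theorem moves the point to 0. *)
Lemma cderiv_Cexp (z : C) : cderiv Cexp z (Cexp z).
Proof.
  apply cderiv_ext with (f := fun w => (Cexp z * Cexp (w - z))%C).
  { intros w. rewrite <- Cexp_plus. f_equal. ring. }
  eapply cderiv_eq; [|apply cderiv_scal, (cderiv_comp Cexp (fun w => w - z)%C)].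
  2: { replace (z - z)%C with (RtoC 0) by ring. apply cderiv_Cexp_0. }
  2: { apply cderiv_minus. apply cderiv_id. apply cderiv_const. }
  ring.
Qed.

(** * Goursat's theorem and the maximum principle *)

Lemma RInt_between (f : R -> R) (a b m M : R) : a <= b -> ex_RInt f a b ->
  (forall x, a <= x <= b -> m <= f x <= M) -> m * (b - a) <= RInt f a b <= M * (b - a).
Proof.
  intros Hab Hex H.
  pose proof (RInt_const a b m) as E1. pose proof (RInt_const a b M) as E2.
  unfold scal in E1, E2; simpl in E1, E2; unfold mult in E1, E2; simpl in E1, E2.
  rewrite (Rmult_comm m), (Rmult_comm M), <- E1, <- E2.
  split; apply RInt_le; auto; try apply ex_RInt_const; intros x Hx; apply H; lra.
Qed.

Lemma continuous_eps (f : R -> R) (x : R) :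
  (forall e, 0 < e -> exists d, 0 < d /\ forall y, Rabs (y - x) < d -> Rabs (f y - f x) < e) ->
  continuous f x.
Proof.
  intros H P [e He]. destruct (H e (cond_pos e)) as [d [Hd Hy]].
  exists (mkposreal d Hd). intros y Hb. apply He. apply Hy. exact Hb.
Qed.

Lemma Cmod_horizontal (x x' y : R) : Cmod ((x, y) - (x', y)) = Rabs (x - x').
Proof.
  rewrite <- Cmod_R. f_equal. unfold Cminus, Cplus, Copp, RtoC; simpl. f_equal; ring.
Qed.

Lemma Cmod_vertical (x y y' : R) : Cmod ((x, y) - (x, y')) = Rabs (y - y').
Proof.
  replace ((x, y) - (x, y'))%C with (Ci * RtoC (y - y'))%C.
  rewrite Cmod_mult, Cmod_Ci, Cmod_R. ring.
  unfold Cminus, Cplus, Copp, RtoC, Cmult, Ci; simpl. f_equal; ring.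
Qed.

Lemma Re_minus (a b : C) : Re (a - b) = Re a - Re b.
Proof. destruct a, b; reflexivity. Qed.
Lemma Im_minus (a b : C) : Im (a - b) = Im a - Im b.
Proof. destruct a, b; reflexivity. Qed.

Lemma continuous_Re_vertical g x y : ccont g (x, y) -> continuous (fun t => Re (g (x, t))) y.
Proof.
  intros H. apply continuous_eps. intros e He. destruct (H e He) as [d [Hd Hw]].
  exists d. split; auto. intros t Ht. rewrite <- Re_minus.
  eapply Rle_lt_trans. apply Rabs_Re_le. apply Hw. rewrite Cmod_vertical. exact Ht.
Qed.

Lemma continuous_Im_horizontal g x y : ccont g (x, y) -> continuous (fun t => Im (g (t, y))) x.
Proof.
  intros H. apply continuous_eps. intros e He. destruct (H e He) as [d [Hd Hw]].
  exists d. split; auto. intros t Ht. rewrite <- Im_minus.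
  eapply Rle_lt_trans. apply Rabs_Im_le. apply Hw. rewrite Cmod_horizontal. exact Ht.
Qed.

(* The imaginary part of the integral of g dz around the boundary of a rectangle. *)
Definition loop (g : C -> C) (x0 x1 y0 y1 : R) : R :=
  RInt (fun x => Im (g (x, y0)) - Im (g (x, y1))) x0 x1 +
  RInt (fun y => Re (g (x1, y)) - Re (g (x0, y))) y0 y1.

(** For the affine part of [g] the horizontal and the vertical integrals are minus and plus [Re l]
    times the area, and they cancel. What survives is the remainder, of size [e * s], integrated
    over sides of total length at most 2 s. *)
Lemma loop_local g p l e d x0 x1 y0 y1 :
  0 < e ->
  (forall x y, x0 <= x <= x1 -> y0 <= y <= y1 -> ccont g (x, y)) ->
  (forall w, Cmod (w - p) < d -> Cmod (g w - g p - l * (w - p)) <= e * Cmod (w - p)) ->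
  x0 <= Re p <= x1 -> y0 <= Im p <= y1 -> (x1 - x0) + (y1 - y0) < d ->
  Rabs (loop g x0 x1 y0 y1) <= 4 * e * ((x1 - x0) + (y1 - y0)) ^ 2.
Proof.
  intros He Hc Hl Hx Hy Hd. destruct p as [px py]. unfold Re, Im in Hx, Hy; simpl in Hx, Hy.
  set (s := (x1 - x0) + (y1 - y0)) in *.
  set (r := fun w => (g w - g (px, py) - l * (w - (px, py)))%C).
  assert (Hr : forall x y, x0 <= x <= x1 -> y0 <= y <= y1 -> Cmod (r (x, y)) <= e * s).
  { intros x y Hx' Hy'.
    assert (Cmod ((x, y) - (px, py)) <= s).
    { eapply Rle_trans. apply Cmod_le_Re_Im. unfold Re, Im; simpl.
      apply Rplus_le_compat; apply Rabs_le; lra. }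
    eapply Rle_trans. apply Hl. lra. apply Rmult_le_compat_l; lra. }
  assert (HI : forall x y, Im (g (x, y)) = Im (r (x, y)) + Im (g (px, py)) + Re l * (y - py) + Im l * (x - px)).
  { intros x y. unfold r. destruct (g (x, y)), (g (px, py)), l. unfold Re, Im; simpl. ring. }
  assert (HR : forall x y, Re (g (x, y)) = Re (r (x, y)) + Re (g (px, py)) + Re l * (x - px) - Im l * (y - py)).
  { intros x y. unfold r. destruct (g (x, y)), (g (px, py)), l. unfold Re, Im; simpl. ring. }
  assert (Ri : forall x y, x0 <= x <= x1 -> y0 <= y <= y1 -> - (e * s) <= Im (r (x, y)) <= e * s).
  { intros x y h1 h2. apply Rabs_le_between. eapply Rle_trans. apply Rabs_Im_le. auto. }
  assert (Rr : forall x y, x0 <= x <= x1 -> y0 <= y <= y1 -> - (e * s) <= Re (r (x, y)) <= e * s).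
  { intros x y h1 h2. apply Rabs_le_between. eapply Rle_trans. apply Rabs_Re_le. auto. }
  destruct (RInt_between (fun x => Im (g (x, y0)) - Im (g (x, y1))) x0 x1
    (- (2 * e * s) - Re l * (y1 - y0)) (2 * e * s - Re l * (y1 - y0))) as [A1 A2].
  { lra. }
  { apply (ex_RInt_continuous (V := R_CompleteNormedModule)). intros x. rewrite Rmin_left, Rmax_right by lra. intros Hx'.
    apply (continuous_minus (V := R_NormedModule)); apply continuous_Im_horizontal, Hc; lra. }
  { intros x Hx'. rewrite (HI x y0), (HI x y1). pose proof (Ri x y0 ltac:(lra) ltac:(lra)). pose proof (Ri x y1 ltac:(lra) ltac:(lra)).
    split; lra. }
  destruct (RInt_between (fun y => Re (g (x1, y)) - Re (g (x0, y))) y0 y1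
    (- (2 * e * s) + Re l * (x1 - x0)) (2 * e * s + Re l * (x1 - x0))) as [B1 B2].
  { lra. }
  { apply (ex_RInt_continuous (V := R_CompleteNormedModule)). intros x. rewrite Rmin_left, Rmax_right by lra. intros Hx'.
    apply (continuous_minus (V := R_NormedModule)); apply continuous_Re_vertical, Hc; lra. }
  { intros x Hx'. rewrite (HR x1 x), (HR x0 x). pose proof (Rr x0 x ltac:(lra) ltac:(lra)). pose proof (Rr x1 x ltac:(lra) ltac:(lra)).
    split; lra. }
  assert (0 <= e * s) by (apply Rmult_le_pos; unfold s; lra).
  assert (Es : e * s * (x1 - x0) + e * s * (y1 - y0) = e * s ^ 2) by (unfold s; ring).
  assert (0 <= e * s ^ 2) by (apply Rmult_le_pos; [lra|apply pow2_ge_0]).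
  unfold loop. apply Rabs_le. split; nra.
Qed.

Lemma loop_split g x0 xm x1 y0 ym y1 :
  x0 <= xm <= x1 -> y0 <= ym <= y1 ->
  (forall x y, x0 <= x <= x1 -> y0 <= y <= y1 -> ccont g (x, y)) ->
  loop g x0 x1 y0 y1 = loop g x0 xm y0 ym + loop g xm x1 y0 ym + loop g x0 xm ym y1 + loop g xm x1 ym y1.
Proof.
  intros Hx Hy Hc.
  assert (EI : forall y a b, x0 <= a -> a <= b -> b <= x1 -> y0 <= y <= y1 -> ex_RInt (fun x => Im (g (x, y))) a b).
  { intros y a b h1 h2 h3 h4. apply (ex_RInt_continuous (V := R_CompleteNormedModule)). intros x. rewrite Rmin_left, Rmax_right by lra.
    intros Hx'. apply continuous_Im_horizontal, Hc; lra. }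
  assert (ER : forall x a b, y0 <= a -> a <= b -> b <= y1 -> x0 <= x <= x1 -> ex_RInt (fun y => Re (g (x, y))) a b).
  { intros x a b h1 h2 h3 h4. apply (ex_RInt_continuous (V := R_CompleteNormedModule)). intros y. rewrite Rmin_left, Rmax_right by lra.
    intros Hy'. apply continuous_Re_vertical, Hc; lra. }
  assert (MI : forall ya yb a b, x0 <= a -> a <= b -> b <= x1 -> y0 <= ya <= y1 -> y0 <= yb <= y1 ->
    RInt (fun x => Im (g (x, ya)) - Im (g (x, yb))) a b = RInt (fun x => Im (g (x, ya))) a b - RInt (fun x => Im (g (x, yb))) a b).
  { intros. apply (RInt_minus (V := R_CompleteNormedModule)); apply EI; auto. }
  assert (MR : forall xa xb a b, y0 <= a -> a <= b -> b <= y1 -> x0 <= xa <= x1 -> x0 <= xb <= x1 ->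
    RInt (fun y => Re (g (xa, y)) - Re (g (xb, y))) a b = RInt (fun y => Re (g (xa, y))) a b - RInt (fun y => Re (g (xb, y))) a b).
  { intros. apply (RInt_minus (V := R_CompleteNormedModule)); apply ER; auto. }
  assert (CI : forall y, y0 <= y <= y1 -> RInt (fun x => Im (g (x, y))) x0 x1 =
    RInt (fun x => Im (g (x, y))) x0 xm + RInt (fun x => Im (g (x, y))) xm x1).
  { intros y h. symmetry. apply (RInt_Chasles (V := R_CompleteNormedModule)); apply EI; lra. }
  assert (CR : forall x, x0 <= x <= x1 -> RInt (fun y => Re (g (x, y))) y0 y1 =
    RInt (fun y => Re (g (x, y))) y0 ym + RInt (fun y => Re (g (x, y))) ym y1).
  { intros y h. symmetry. apply (RInt_Chasles (V := R_CompleteNormedModule)); apply ER; lra. }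
  unfold loop. rewrite !MI, !MR by lra. rewrite !CI, !CR by lra. ring.
Qed.

(** The estimate of [loop_local] is compatible with quartering, since each quarter has a quarter of
    the squared half-perimeter. So [cousin] carries it to the whole rectangle, and [e] is
    arbitrary. *)
Lemma goursat g x0 x1 y0 y1 : x0 <= x1 -> y0 <= y1 ->
  (forall x y, x0 <= x <= x1 -> y0 <= y <= y1 -> cholo g (x, y)) ->
  loop g x0 x1 y0 y1 = 0.
Proof.
  intros Hx Hy Hg.
  assert (K : forall e, 0 < e -> Rabs (loop g x0 x1 y0 y1) <= 4 * e * ((x1 - x0) + (y1 - y0)) ^ 2).
  { intros e He.
    apply (cousin (fun a b c d => Rabs (loop g a b c d) <= 4 * e * ((b - a) + (d - c)) ^ 2)); auto.
    - intros a b c d h1 h2 h3 h4 h5 h6 q1 q2 q3 q4.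
      rewrite (loop_split g a ((a + b) / 2) b c ((c + d) / 2) d); try lra.
      2: { intros x y ? ?. apply cholo_ccont, Hg; lra. }
      eapply Rle_trans; [apply Rabs_triang|].
      eapply Rle_trans; [apply Rplus_le_compat_r, Rabs_triang|].
      eapply Rle_trans; [apply Rplus_le_compat_r, Rplus_le_compat_r, Rabs_triang|].
      eapply Rle_trans. repeat apply Rplus_le_compat; eassumption. right. field.
    - intros x y h1 h2. destruct (Hg x y h1 h2) as [l Hl].
      destruct (Hl e He) as [d [Hd Hw]]. exists (d / 2). split. lra.
      intros a b c d' k1 k2 k3 k4 k5 k6 k7 k8 k9 k10.
      apply (loop_local g (x, y) l e d); auto; unfold Re, Im; simpl; try lra.
      intros u v ? ?. apply cholo_ccont, Hg; lra. }
  destruct (Req_dec (loop g x0 x1 y0 y1) 0) as [E|E]; auto. exfalso.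
  apply Rabs_pos_lt in E. set (L := Rabs (loop g x0 x1 y0 y1)) in *.
  set (s := ((x1 - x0) + (y1 - y0)) ^ 2) in *. assert (0 <= s) by apply pow2_ge_0.
  specialize (K (L / (8 * (s + 1)))).
  assert (0 < L / (8 * (s + 1))) by (apply Rdiv_lt_0_compat; lra).
  specialize (K H0). apply (Rmult_le_compat_r (s + 1)) in K; try lra.
  replace (4 * (L / (8 * (s + 1))) * s * (s + 1)) with (L / 2 * s) in K by (field; lra). nra.
Qed.

Lemma RInt_le_const (f : R -> R) (a b M : R) : a <= b -> ex_RInt f a b ->
  (forall x, a <= x <= b -> f x <= M) -> RInt f a b <= M * (b - a).
Proof.
  intros Hab Hex H. pose proof (RInt_const a b M) as E2.
  unfold scal in E2; simpl in E2; unfold mult in E2; simpl in E2.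
  rewrite (Rmult_comm M), <- E2.
  apply RInt_le; auto; try apply ex_RInt_const; intros x Hx; apply H; lra.
Qed.

(* Goursat on [-N, ln r] x [0, 2 PI] in the coordinate w = log (z - z0): the horizontal sides
   cancel by periodicity, so the circle mean of Re f does not depend on the radius. *)
Lemma Re_center_le (f : C -> C) (z0 : C) (r M : R) : 0 < r ->
  (forall z, Cmod (z - z0) <= r -> cholo f z) ->
  (forall z, Cmod (z - z0) = r -> Re (f z) <= M) -> Re (f z0) <= M.
Proof.
  intros Hr Hf HM. apply Rnot_lt_le. intros Hlt.
  set (e := (Re (f z0) - M) / 2). assert (He : 0 < e) by (unfold e; lra).
  destruct (cholo_ccont _ _ (Hf z0 ltac:(rewrite Cmod_sub_0; lra)) e He) as [d [Hd Hc]].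
  (* The left edge of the rectangle corresponds to a circle so small that [Re f] stays above
     [Re (f z0) - e] on it. As [e] is half of the assumed excess over [M], the two edge integrals
     differ by at least 2 PI e, which Goursat forbids. *)
  set (x0 := Rmin (ln r) (ln (d / 2))).
  assert (Hx0 : x0 <= ln r) by apply Rmin_l.
  assert (Hx0d : exp x0 < d).
  { apply Rle_lt_trans with (exp (ln (d / 2))).
    destruct (Rmin_r (ln r) (ln (d / 2))) as [K|K]. left. apply exp_increasing. exact K.
    right. unfold x0. rewrite K. reflexivity. rewrite exp_ln; lra. }
  set (g := fun w => f (z0 + Cexp w)%C).
  assert (Hmod : forall w, Cmod (z0 + Cexp w - z0) = exp (Re w)).
  { intros w. rewrite <- Cmod_Cexp. f_equal. ring. }
  assert (Hg : forall x y, x0 <= x <= ln r -> 0 <= y <= 2 * PI -> cholo g (x, y)).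
  { intros x y Hx _. apply (cholo_comp f (fun w => z0 + Cexp w)%C).
    - apply Hf. rewrite Hmod. simpl. rewrite <- (exp_ln r) by auto.
      destruct (proj2 Hx) as [K|K]. left. apply exp_increasing. exact K. right. rewrite K. reflexivity.
    - apply cholo_plus. apply cholo_const. eexists. apply cderiv_Cexp. }
  pose proof PI_RGT_0 as Hpi.
  pose proof (goursat g x0 (ln r) 0 (2 * PI) Hx0 ltac:(lra) Hg) as HL.
  unfold loop in HL.
  rewrite (RInt_ext _ (fun _ => 0)) in HL.
  2: { intros x _. unfold g. replace (Cexp (x, 2 * PI)) with (Cexp (x, 0)). simpl. ring.
       unfold Cexp; simpl. rewrite cos_0, sin_0, cos_2PI, sin_2PI. reflexivity. }
  rewrite RInt_const in HL. unfold scal in HL; simpl in HL. unfold mult in HL; simpl in HL.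
  rewrite Rmult_0_r, Rplus_0_l in HL.
  assert (K : RInt (fun y => Re (g (ln r, y)) - Re (g (x0, y))) 0 (2 * PI) <= - e * (2 * PI - 0)).
  { apply RInt_le_const. lra.
    - apply (ex_RInt_continuous (V := R_CompleteNormedModule)). intros y. rewrite Rmin_left, Rmax_right by lra. intros Hy.
      apply (continuous_minus (V := R_NormedModule)); apply continuous_Re_vertical, cholo_ccont, Hg; lra.
    - intros y Hy.
      assert (A : Re (g (ln r, y)) <= M).
      { apply HM. rewrite Hmod. simpl. apply exp_ln. exact Hr. }
      assert (B : Re (f z0) - e <= Re (g (x0, y))).
      { assert (Hq : Cmod (g (x0, y) - f z0) < e).
        { apply Hc. rewrite Hmod. simpl. exact Hx0d. }
        pose proof (Rabs_Re_le (g (x0, y) - f z0)) as Ra. rewrite Re_minus in Ra.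
        apply Rabs_le_between in Ra. lra. }
      unfold e in *; lra. }
  rewrite HL in K. nra.
Qed.

Lemma Cconj_mult_self (z : C) : (Cconj z * z)%C = RtoC (Cmod z * Cmod z).
Proof.
  pose proof (Cmod2_conj z) as H. replace (Cmod z * Cmod z) with (Cmod z ^ 2) by ring.
  rewrite H. ring.
Qed.

(** A rotation reduces the modulus to the real part: [Cconj (f z0) * f] has the value |f z0|^2 at
    the centre. *)
Lemma Cmod_center_le (f : C -> C) (z0 : C) (r M : R) : 0 < r ->
  (forall z, Cmod (z - z0) <= r -> cholo f z) ->
  (forall z, Cmod (z - z0) = r -> Cmod (f z) <= M) -> Cmod (f z0) <= M.
Proof.
  intros Hr Hf HM. set (a := f z0).
  pose proof (Cmod_ge_0 a) as Ha0.
  destruct (Req_dec (Cmod a) 0) as [Z|NZ].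
  { rewrite Z. apply Rle_trans with (Cmod (f (z0 + r)%C)). apply Cmod_ge_0. apply HM.
    replace (z0 + r - z0)%C with (RtoC r) by ring. rewrite Cmod_R. apply Rabs_pos_eq. lra. }
  assert (K : Re (Cconj a * f z0) <= Cmod a * M).
  { apply (Re_center_le (fun z => Cconj a * f z)%C z0 r (Cmod a * M)); auto.
    - intros z Hz. apply cholo_mult. apply cholo_const. auto.
    - intros z Hz. eapply Rle_trans. apply Rle_abs. eapply Rle_trans. apply Rabs_Re_le.
      rewrite Cmod_mult, Cmod_conj. apply Rmult_le_compat_l; auto. }
  fold a in K. rewrite Cconj_mult_self in K. simpl in K.
  apply Rmult_le_reg_l with (Cmod a); lra.
Qed.

(** It shows that w -> (w + a)/(1 + conj(a) w) preserves the closed unit disc and its boundary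
    circle when |a| < 1. *)
Lemma mobius_identity (a w : C) :
  Cmod (1 + Cconj a * w) ^ 2 - Cmod (w + a) ^ 2 = (1 - Cmod a ^ 2) * (1 - Cmod w ^ 2).
Proof.
  rewrite !Cmod2_alt. destruct a as [x y], w as [u v].
  unfold Re, Im, Cconj, Cplus, Cmult, RtoC; simpl. ring.
Qed.

Lemma sq_le_reg (x y : R) : 0 <= y -> x ^ 2 <= y ^ 2 -> x <= y.
Proof. intros. nra. Qed.

Lemma mobius_denom_nz (a w : C) : Cmod a < 1 -> Cmod w <= 1 -> (1 + Cconj a * w)%C <> 0%C.
Proof.
  intros Ha Hw. apply Cmod_gt_0. pose proof (Cmod_sub_ge 1 (- (Cconj a * w))) as K.
  rewrite Cmod_opp, Cmod_1, Cmod_mult, Cmod_conj in K.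
  replace (1 - - (Cconj a * w))%C with (1 + Cconj a * w)%C in K by ring.
  pose proof (Cmod_ge_0 a). pose proof (Cmod_ge_0 w). nra.
Qed.

(** The Moebius map [phi] from the unit disc to the given disc sends 0 to [z] and circle to circle,
    so the bound at the centre becomes a bound at every interior point. *)
Lemma max_principle (f : C -> C) (z0 : C) (r M : R) : 0 < r ->
  (forall z, Cmod (z - z0) <= r -> cholo f z) ->
  (forall z, Cmod (z - z0) = r -> Cmod (f z) <= M) ->
  forall z, Cmod (z - z0) <= r -> Cmod (f z) <= M.
Proof.
  intros Hr Hf HM z [Hz|Hz]; auto.
  set (a := ((z - z0) / r)%C).
  assert (Hrz : RtoC r <> 0%C) by (intros E; apply RtoC_inj in E; lra).
  assert (Ha : Cmod a < 1).
  { unfold a. rewrite Cmod_div by auto. rewrite Cmod_R, Rabs_pos_eq by lra.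
    apply Rmult_lt_reg_r with r; auto. unfold Rdiv. rewrite Rmult_assoc, Rinv_l by lra. lra. }
  set (phi := fun w => (z0 + r * ((w + a) / (1 + Cconj a * w)))%C).
  assert (Hphi : forall w, Cmod w <= 1 -> Cmod (phi w - z0) = r * (Cmod (w + a) / Cmod (1 + Cconj a * w))).
  { intros w Hw. unfold phi. replace (z0 + r * ((w + a) / (1 + Cconj a * w)) - z0)%C
      with (r * ((w + a) / (1 + Cconj a * w)))%C by ring.
    rewrite Cmod_mult, Cmod_R, Rabs_pos_eq by lra. rewrite Cmod_div by (apply mobius_denom_nz; auto). reflexivity. }
  assert (E0 : phi 0%C = z).
  { unfold phi. replace (1 + Cconj a * 0)%C with (RtoC 1) by ring. unfold a. field. auto. }
  rewrite <- E0.
  apply (Cmod_center_le (fun w => f (phi w)) 0 1 M). lra.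
  - intros w Hw. replace (w - 0)%C with w in Hw by ring.
    apply (cholo_comp f phi).
    + apply Hf. rewrite Hphi by auto. pose proof (mobius_identity a w) as I.
      pose proof (mobius_denom_nz a w Ha Hw) as D. apply Cmod_gt_0 in D.
      pose proof (Cmod_ge_0 a). pose proof (Cmod_ge_0 w).
      assert (0 <= (1 - Cmod a ^ 2) * (1 - Cmod w ^ 2)) by (apply Rmult_le_pos; nra).
      assert (Cmod (w + a) <= Cmod (1 + Cconj a * w)) by (apply sq_le_reg; lra).
      apply Rmult_le_reg_r with (Cmod (1 + Cconj a * w)); auto.
      replace (r * (Cmod (w + a) / Cmod (1 + Cconj a * w)) * Cmod (1 + Cconj a * w)) with (r * Cmod (w + a)) by (field; lra).
      nra.
    + unfold phi. apply cholo_plus. apply cholo_const. apply cholo_mult. apply cholo_const.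
      apply cholo_div. apply mobius_denom_nz; auto.
      apply cholo_plus. apply cholo_id. apply cholo_const.
      apply cholo_plus. apply cholo_const. apply cholo_mult. apply cholo_const. apply cholo_id.
  - intros w Hw. replace (w - 0)%C with w in Hw by ring. apply HM. rewrite Hphi by lra.
    pose proof (mobius_identity a w) as I. rewrite Hw in I.
    pose proof (mobius_denom_nz a w Ha ltac:(lra)) as D. apply Cmod_gt_0 in D.
    pose proof (Cmod_ge_0 (w + a)).
    assert (E : Cmod (w + a) = Cmod (1 + Cconj a * w)) by (apply Rle_antisym; apply sq_le_reg; lra).
    rewrite E. field. lra.
Qed.

(** * Removable singularities and the Schwarz lemmas *)

Fixpoint sqprod (E : list C) (w : C) : C :=
  match E with nil => 1 | a :: E' => (w - a) * (w - a) * sqprod E' w end%C.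

Lemma cholo_sqprod E z : cholo (sqprod E) z.
Proof.
  induction E as [|a E IH]; simpl. apply cholo_const.
  apply (cholo_mult (fun w => (w - a) * (w - a))%C (sqprod E)); auto.
  apply cholo_mult; apply cholo_minus; try apply cholo_id; apply cholo_const.
Qed.

Lemma sqprod_nz E z : ~ In z E -> sqprod E z <> 0%C.
Proof.
  induction E as [|a E IH]; simpl; intros H. apply C1_nz.
  apply Cmult_neq_0; [|apply IH; tauto].
  assert ((z - a)%C <> 0%C) by (apply Cminus_eq_contra; intros K; subst; tauto).
  apply Cmult_neq_0; auto.
Qed.

Lemma sqprod_bound E z0 R : exists K, 0 < K /\ forall w, Cmod (w - z0) <= R -> Cmod (sqprod E w) <= K.
Proof. apply ccont_bounded_disc. intros z _. apply cholo_ccont, cholo_sqprod. Qed.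

(** The factors are squared for the sake of this estimate: the product with a function that is
    bounded near [a] is then O(|w - a|^2), hence differentiable at [a] whatever the value of that
    function there. *)
Lemma sqprod_quadratic E a R : In a E -> exists K, 0 < K /\ forall w, Cmod (w - a) <= R ->
  Cmod (sqprod E w) <= K * (Cmod (w - a) * Cmod (w - a)).
Proof.
  induction E as [|b E IH]; simpl; intros H. tauto.
  destruct H as [->|H].
  - destruct (sqprod_bound E a R) as [K [HK HB]]. exists K. split; auto.
    intros w Hw. rewrite !Cmod_mult. specialize (HB w Hw).
    pose proof (Cmod_ge_0 (w - a)). rewrite (Rmult_comm K). apply Rmult_le_compat_l; nra.
  - destruct (IH H) as [K [HK HB]].
    destruct (sqprod_bound (b :: nil) a R) as [K' [HK' HB']]. exists (K' * K). split. nra.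
    intros w Hw. specialize (HB w Hw). specialize (HB' w Hw). simpl in HB'.
    rewrite Cmult_1_r in HB'. rewrite Cmod_mult. rewrite Rmult_assoc.
    apply Rmult_le_compat; auto using Cmod_ge_0.
Qed.

Lemma not_In_open (E : list C) z : ~ In z E -> exists d, 0 < d /\ forall w, Cmod (w - z) < d -> ~ In w E.
Proof.
  intros H. destruct (ccont_nonzero (sqprod E) z) as [d [Hd Hw]].
  apply cholo_ccont, cholo_sqprod. apply sqprod_nz; auto.
  exists d. split; auto. intros w Hwd Hin. apply (Hw w Hwd).
  destruct (sqprod_quadratic E w 0 Hin) as [K [HK HB]]. specialize (HB w).
  rewrite Cmod_sub_0 in HB. specialize (HB (Rle_refl 0)). apply Cmod_eq_0.
  pose proof (Cmod_ge_0 (sqprod E w)). lra.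
Qed.

Lemma sqprod_in E a : In a E -> sqprod E a = 0%C.
Proof.
  intros Hin. destruct (sqprod_quadratic E a 0 Hin) as [K [HK HB]]. specialize (HB a).
  rewrite Cmod_sub_0 in HB. specialize (HB (Rle_refl 0)). apply Cmod_eq_0.
  pose proof (Cmod_ge_0 (sqprod E a)). lra.
Qed.

(** The tensor power trick: if x > M > 0, then (x/M)^n is unbounded and cannot stay below D/c. *)
Lemma pow_compare (c D x M : R) : 0 < c -> 0 <= M -> 0 <= x ->
  (forall n, c * x ^ n <= D * M ^ n) -> x <= M.
Proof.
  intros Hc HM Hx H. apply Rnot_lt_le. intros Hlt.
  destruct (Req_dec M 0) as [->|NZ].
  { specialize (H 1%nat). simpl in H. nra. }
  assert (Hq : 1 < x / M).
  { apply Rmult_lt_reg_r with M. lra. unfold Rdiv. rewrite Rmult_assoc, Rinv_l by lra. lra. }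
  destruct (Pow_x_infinity (x / M)) with (b := Rabs (D / c) + 1) as [N HN].
  { rewrite Rabs_pos_eq; lra. }
  specialize (HN N (le_n N)). specialize (H N).
  rewrite Rabs_pos_eq in HN by (apply pow_le; lra).
  assert (HMN : 0 < M ^ N) by (apply pow_lt; lra).
  assert ((x / M) ^ N <= D / c).
  { unfold Rdiv. rewrite Rpow_mult_distr, pow_inv.
    apply Rmult_le_reg_r with (M ^ N * c). nra.
    replace (x ^ N * / M ^ N * (M ^ N * c)) with (c * x ^ N) by (field; lra).
    replace (D * / c * (M ^ N * c)) with (D * M ^ N) by (field; lra). exact H. }
  pose proof (Rle_abs (D / c)). lra.
Qed.

(* Removable singularities at E are absorbed by applying the maximum principle to
   sqprod E * f ^ n and letting n tend to infinity. *)
Lemma max_principle_exc (E : list C) (f : C -> C) (z0 : C) (r M : R) : 0 < r -> 0 <= M ->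
  (forall z, Cmod (z - z0) <= r -> ~ In z E -> cholo f z) ->
  (forall a, In a E -> exists d B, 0 < d /\ forall z, Cmod (z - a) < d -> ~ In z E -> Cmod (f z) <= B) ->
  (forall z, Cmod (z - z0) = r -> ~ In z E -> Cmod (f z) <= M) ->
  forall z, Cmod (z - z0) <= r -> ~ In z E -> Cmod (f z) <= M.
Proof.
  intros Hr HM Hf HE HC z Hz HzE.
  destruct (sqprod_bound E z0 r) as [D [HD HDb]].
  apply pow_compare with (c := Cmod (sqprod E z)) (D := D); auto using Cmod_ge_0.
  { apply Cmod_gt_0, sqprod_nz; auto. }
  intros n. set (G := fun w => (sqprod E w * Cpow (f w) n)%C).
  replace (Cmod (sqprod E z) * Cmod (f z) ^ n) with (Cmod (G z)) by (unfold G; rewrite Cmod_mult, Cmod_pow; reflexivity).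
  apply (max_principle G z0 r); auto.
  - intros w Hw. destruct (classic (In w E)) as [Hin|Hout].
    + destruct (HE w Hin) as [d [B [Hd HB]]].
      destruct (sqprod_quadratic E w d Hin) as [K [HK HKb]].
      set (B' := Rabs B + 1). assert (HB' : 0 < B') by (unfold B'; pose proof (Rabs_pos B); lra).
      assert (HBn : 0 < B' ^ n) by (apply pow_lt; auto).
      (* [G] has derivative 0 at an exceptional point, because |G x| <= K h^2 B'^n nearby, with h
         the distance to that point. *)
      exists 0%C. intros e He. exists (Rmin d (e / (K * B' ^ n))). split.
      { apply Rmin_glb_lt; auto. apply Rdiv_lt_0_compat; nra. }
      intros x Hx. pose proof (Rmin_l d (e / (K * B' ^ n))). pose proof (Rmin_r d (e / (K * B' ^ n))).
      assert (Gw : G w = 0%C) by (unfold G; rewrite sqprod_in by auto; ring).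
      rewrite Gw. replace (G x - 0 - 0 * (x - w))%C with (G x) by ring.
      set (h := Cmod (x - w)) in *. assert (Hh : 0 <= h) by apply Cmod_ge_0.
      destruct (classic (In x E)) as [Hxin|Hxout].
      * unfold G. rewrite sqprod_in by auto. rewrite Cmult_0_l, Cmod_0. nra.
      * unfold G. rewrite Cmod_mult, Cmod_pow.
        apply Rle_trans with (K * (h * h) * B' ^ n).
        { apply Rmult_le_compat. apply Cmod_ge_0. apply pow_le, Cmod_ge_0.
          apply HKb. fold h. lra. apply pow_incr. split. apply Cmod_ge_0.
          specialize (HB x ltac:(fold h; lra) Hxout). unfold B'. pose proof (Rle_abs B). lra. }
        replace (K * (h * h) * B' ^ n) with (K * B' ^ n * h * h) by ring.
        apply Rmult_le_compat_r; auto.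
        apply Rle_trans with (K * B' ^ n * (e / (K * B' ^ n))).
        apply Rmult_le_compat_l. nra. lra. right. field. split; lra.
    + apply cholo_mult. apply cholo_sqprod. apply cholo_pow. auto.
  - intros w Hw. unfold G. rewrite Cmod_mult, Cmod_pow.
    destruct (classic (In w E)) as [Hin|Hout].
    + rewrite sqprod_in by auto. rewrite Cmod_0, Rmult_0_l. apply Rmult_le_pos. lra. apply pow_le; auto.
    + apply Rmult_le_compat. apply Cmod_ge_0. apply pow_le, Cmod_ge_0. apply HDb. lra.
      apply pow_incr. split. apply Cmod_ge_0. auto.
Qed.

Lemma Rle_mult_limit (q r M a : R) : 0 <= q -> a < r -> (forall r', a < r' < r -> q * r' <= M) -> q * r <= M.
Proof.
  intros Hq Ha H. apply Rnot_lt_le. intros Hlt.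
  assert (Hq0 : 0 < q).
  { destruct Hq; auto. subst q. specialize (H ((a + r) / 2) ltac:(lra)). lra. }
  set (r' := Rmax ((a + r) / 2) (r - (q * r - M) / (2 * q))).
  assert (0 < (q * r - M) / (2 * q)) by (apply Rdiv_lt_0_compat; lra).
  assert (r' < r) by (apply Rmax_lub_lt; lra).
  pose proof (Rmax_l ((a + r) / 2) (r - (q * r - M) / (2 * q))) as L1.
  pose proof (Rmax_r ((a + r) / 2) (r - (q * r - M) / (2 * q))) as L2. fold r' in L1, L2.
  specialize (H r' ltac:(lra)).
  apply (Rmult_le_compat_l q) in L2; [|lra].
  replace (q * (r - (q * r - M) / (2 * q))) with (q * r - (q * r - M) / 2) in L2 by (field; lra). lra.
Qed.

(** The maximum principle on the circle of radius r' bounds |q| inside it by M/r', and r' tends to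
    r. It is meant for difference quotients, whose removable singularities form [E]. *)
Lemma quotient_bound (E : list C) (q : C -> C) (p : C) (r M : R) : 0 < r -> 0 <= M ->
  (forall z, Cmod (z - p) < r -> ~ In z E -> cholo q z) ->
  (forall a, In a E -> exists d B, 0 < d /\ forall z, Cmod (z - a) < d -> ~ In z E -> Cmod (q z) <= B) ->
  (forall z, Cmod (z - p) < r -> ~ In z E -> Cmod (q z) * Cmod (z - p) <= M) ->
  forall z, Cmod (z - p) < r -> ~ In z E -> Cmod (q z) * r <= M.
Proof.
  intros Hr HM Hq HE Hb z Hz HzE.
  apply Rle_mult_limit with (a := Cmod (z - p)); auto using Cmod_ge_0.
  intros r' Hr'. pose proof (Cmod_ge_0 (z - p)).
  assert (K : Cmod (q z) <= M / r').
  { apply (max_principle_exc E q p r'); auto; try lra.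
    - apply Rdiv_le_0_compat; lra.
    - intros w Hw. apply Hq. lra.
    - intros w Hw HwE. specialize (Hb w ltac:(lra) HwE). rewrite Hw in Hb.
      apply Rmult_le_reg_r with r'. lra. unfold Rdiv. rewrite Rmult_assoc, Rinv_l by lra. lra. }
  apply (Rmult_le_compat_r r') in K; [|lra].
  replace (M / r' * r') with M in K by (field; lra). exact K.
Qed.

Lemma schwarz (f : C -> C) (p : C) (r M : R) : 0 < r ->
  (forall z, Cmod (z - p) < r -> cholo f z) ->
  (forall z, Cmod (z - p) < r -> Cmod (f z) <= M) -> f p = 0%C ->
  forall z, Cmod (z - p) < r -> Cmod (f z) <= M / r * Cmod (z - p).
Proof.
  intros Hr Hf HM H0 z Hz.
  assert (Hp : Cmod (p - p) < r) by (rewrite Cmod_sub_0; lra).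
  assert (HM0 : 0 <= M) by (eapply Rle_trans; [apply Cmod_ge_0|apply (HM p Hp)]).
  destruct (classic (z = p)) as [->|Hzp].
  { rewrite H0, Cmod_0, Cmod_sub_0. lra. }
  assert (nz : forall w, ~ In w (p :: nil) -> (w - p)%C <> 0%C).
  { intros w Hw E. apply Hw. left. symmetry. apply Ceq_minus. exact E. }
  assert (K : Cmod (f z / (z - p)) * r <= M).
  { apply (quotient_bound (p :: nil) (fun w => f w / (w - p))%C p r M); auto.
    - intros w Hw HwE. apply cholo_div; auto. apply cholo_minus. apply cholo_id. apply cholo_const.
    - intros a [<-|[]]. destruct (Hf p Hp) as [l Hl]. destruct (Hl 1 Rlt_0_1) as [d [Hd Hw]].
      exists d, (1 + Cmod l). split; auto. intros w Hwd HwE. specialize (Hw w Hwd).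
      specialize (nz w HwE). rewrite Cmod_div by auto. apply Cmod_gt_0 in nz.
      apply Rmult_le_reg_r with (Cmod (w - p)); auto. unfold Rdiv. rewrite Rmult_assoc, Rinv_l by lra.
      rewrite H0 in Hw. pose proof (Cmod_triangle (f w - 0 - l * (w - p)) (l * (w - p))) as T.
      replace (f w - 0 - l * (w - p) + l * (w - p))%C with (f w) in T by ring. rewrite Cmod_mult in T. lra.
    - intros w Hw HwE. specialize (nz w HwE). rewrite Cmod_div by auto. apply Cmod_gt_0 in nz.
      unfold Rdiv. rewrite Rmult_assoc, Rinv_l by lra. rewrite Rmult_1_r. auto.
    - simpl. intros [E|[]]. auto. }
  assert (Hn : (z - p)%C <> 0%C) by (apply Cminus_eq_contra; auto).
  rewrite Cmod_div in K by auto. apply Cmod_gt_0 in Hn.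
  apply (Rmult_le_compat_r (Cmod (z - p) / r)) in K; [|apply Rdiv_le_0_compat; lra].
  replace (Cmod (f z) / Cmod (z - p) * r * (Cmod (z - p) / r)) with (Cmod (f z)) in K by (field; lra).
  replace (M / r * Cmod (z - p)) with (M * (Cmod (z - p) / r)) by (field; lra). exact K.
Qed.

(* H := f / (z - p) tends to 0 at p; its difference quotients are bounded by the maximum principle,
   so H is Lipschitz at p and f / (z - p)^2 is bounded there. *)
Lemma schwarz2 (f : C -> C) (p : C) (r M : R) : 0 < r ->
  (forall z, Cmod (z - p) < r -> cholo f z) ->
  (forall z, Cmod (z - p) < r -> Cmod (f z) <= M) -> f p = 0%C -> cderiv f p 0 ->
  forall z, Cmod (z - p) < r -> Cmod (f z) <= M / r ^ 2 * Cmod (z - p) ^ 2.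
Proof.
  intros Hr Hf HM H0 Hd z Hz.
  assert (Hp : Cmod (p - p) < r) by (rewrite Cmod_sub_0; lra).
  assert (HM0 : 0 <= M) by (eapply Rle_trans; [apply Cmod_ge_0|apply (HM p Hp)]).
  assert (HMr : 0 <= M / r) by (apply Rdiv_le_0_compat; lra).
  pose proof (schwarz f p r M Hr Hf HM H0) as S1.
  set (H := fun w => (f w / (w - p))%C).
  assert (HH : forall w, Cmod (w - p) < r -> w <> p -> Cmod (H w) <= M / r).
  { intros w Hw Hwp. assert (Hn : (w - p)%C <> 0%C) by (apply Cminus_eq_contra; auto).
    unfold H. rewrite Cmod_div by auto. apply Cmod_gt_0 in Hn. specialize (S1 w Hw).
    apply Rmult_le_reg_r with (Cmod (w - p)); auto. unfold Rdiv at 1. rewrite Rmult_assoc, Rinv_l by lra. lra. }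
  assert (Hhol : forall w, Cmod (w - p) < r -> w <> p -> cholo H w).
  { intros w Hw Hwp. apply cholo_div; auto. apply Cminus_eq_contra; auto.
    apply cholo_minus. apply cholo_id. apply cholo_const. }
  (* The disc of radius r/2 about [w] stays in the disc about [p], where |H| <= M/r off [p]; hence
     |H x - H w| <= 2M/r, and the difference quotient is at most 4M/r^2. The bound for [H w] itself
     comes from letting [x] tend to [p], where [H] tends to 0. *)
  assert (Lip : forall w, 0 < Cmod (w - p) < r / 2 -> Cmod (H w) <= 4 * M / (r * r) * Cmod (w - p)).
  { intros w Hw. set (t := Cmod (w - p)) in *.
    assert (Hwp : w <> p) by (intros ->; unfold t in Hw; rewrite Cmod_sub_0 in Hw; lra).
    assert (D : forall x, Cmod (x - w) < r / 2 -> ~ In x (p :: w :: nil) ->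
      Cmod ((H x - H w) / (x - w)) * (r / 2) <= 2 * (M / r)).
    { apply (quotient_bound (p :: w :: nil) (fun x => (H x - H w) / (x - w))%C w (r / 2)); try lra.
      - intros x Hx HxE. simpl in HxE. apply cholo_div.
        + apply Cminus_eq_contra. intros ->. tauto.
        + apply cholo_minus. apply Hhol. pose proof (Cmod_sub_trans x w p). unfold t in *; lra.
          intros ->. tauto. apply cholo_const.
        + apply cholo_minus. apply cholo_id. apply cholo_const.
      - intros a [<-|[<-|[]]].
        + exists (t / 2), (2 * (M / r) / (t / 2)). split. lra. intros x Hx HxE. simpl in HxE.
          assert (Hn : (x - w)%C <> 0%C) by (apply Cminus_eq_contra; intros ->; tauto).
          rewrite Cmod_div by auto. apply Cmod_gt_0 in Hn.
          assert (t / 2 <= Cmod (x - w)).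
          { pose proof (Cmod_sub_trans w x p). rewrite (Cmod_sub_sym w x) in H1. unfold t in *. lra. }
          assert (Cmod (H x - H w) <= 2 * (M / r)).
          { eapply Rle_trans. apply Cmod_sub_le. pose proof (HH x ltac:(lra) ltac:(intros ->; tauto)).
            pose proof (HH w ltac:(unfold t in Hw; lra) Hwp). lra. }
          unfold Rdiv. apply Rmult_le_compat; auto using Cmod_ge_0.
          left; apply Rinv_0_lt_compat; lra. apply Rinv_le_contravar; lra.
        + destruct (Hhol w ltac:(unfold t in Hw; lra) Hwp) as [l Hl].
          destruct (Hl 1 Rlt_0_1) as [d [Hd' Hw']]. exists d, (1 + Cmod l). split; auto.
          intros x Hx HxE. simpl in HxE.
          assert (Hn : (x - w)%C <> 0%C) by (apply Cminus_eq_contra; intros ->; tauto).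
          rewrite Cmod_div by auto. apply Cmod_gt_0 in Hn. specialize (Hw' x Hx).
          apply Rmult_le_reg_r with (Cmod (x - w)); auto. unfold Rdiv. rewrite Rmult_assoc, Rinv_l by lra.
          pose proof (Cmod_triangle (H x - H w - l * (x - w)) (l * (x - w))) as T.
          replace (H x - H w - l * (x - w) + l * (x - w))%C with (H x - H w)%C in T by ring. rewrite Cmod_mult in T. lra.
      - intros x Hx HxE. simpl in HxE.
        assert (Hn : (x - w)%C <> 0%C) by (apply Cminus_eq_contra; intros ->; tauto).
        rewrite Cmod_div by auto. apply Cmod_gt_0 in Hn.
        unfold Rdiv at 1. rewrite Rmult_assoc, Rinv_l by lra. rewrite Rmult_1_r.
        eapply Rle_trans. apply Cmod_sub_le.
        pose proof (Cmod_sub_trans x w p).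
        pose proof (HH x ltac:(unfold t in *; lra) ltac:(intros ->; tauto)).
        pose proof (HH w ltac:(unfold t in Hw; lra) Hwp). lra. }
    apply Rnot_lt_le. intros Hlt.
    set (gap := Cmod (H w) - 4 * M / (r * r) * t). assert (Hgap : 0 < gap) by (unfold gap; lra).
    set (Cc := 4 * M / (r * r)) in *.
    assert (HCc : 0 <= Cc) by (unfold Cc; apply Rdiv_le_0_compat; nra).
    destruct (Hd (gap / 4) ltac:(lra)) as [d [Hd0 Hdd]].
    (* The four bounds serve, in order, to apply the derivative of [f] at [p], to make [x] differ
       from [w], to keep [x] in the disc of radius r/2 about [w], and to keep [Cc * h] below a
       quarter of the gap. *)
    set (h := Rmin (d / 2) (Rmin (t / 2) (Rmin ((r / 2 - t) / 2) (gap / (4 * (Cc + 1)))))).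
    assert (Hh : 0 < h).
    { unfold h. repeat apply Rmin_glb_lt; try lra. apply Rdiv_lt_0_compat; lra. }
    assert (h1 : h <= d / 2) by apply Rmin_l.
    assert (h2 : h <= t / 2) by (unfold h; eapply Rle_trans; [apply Rmin_r|apply Rmin_l]).
    assert (h3 : h <= (r / 2 - t) / 2) by (unfold h; eapply Rle_trans; [apply Rmin_r|]; eapply Rle_trans; [apply Rmin_r|apply Rmin_l]).
    assert (h4 : h <= gap / (4 * (Cc + 1))) by (unfold h; eapply Rle_trans; [apply Rmin_r|]; eapply Rle_trans; [apply Rmin_r|apply Rmin_r]).
    assert (h5 : Cc * h <= gap / 4).
    { apply Rle_trans with ((Cc + 1) * (gap / (4 * (Cc + 1)))).
      apply Rmult_le_compat; lra. right. field. lra. }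
    set (x := (p + h)%C).
    assert (Exp : Cmod (x - p) = h).
    { unfold x. replace (p + h - p)%C with (RtoC h) by ring. rewrite Cmod_R. apply Rabs_pos_eq. lra. }
    assert (Hxp : x <> p) by (intros K; rewrite K, Cmod_sub_0 in Exp; lra).
    assert (Hxw : x <> w) by (intros K; rewrite K in Exp; unfold t in *; lra).
    assert (Exw : Cmod (x - w) <= h + t).
    { pose proof (Cmod_sub_trans x p w). rewrite (Cmod_sub_sym p w) in H1. unfold t; lra. }
    specialize (D x ltac:(lra) ltac:(simpl; intros [K|[K|[]]]; auto)).
    rewrite Cmod_div in D by (apply Cminus_eq_contra; auto).
    assert (Px : 0 < Cmod (x - w)) by (apply Cmod_sub_pos; auto).
    assert (D' : Cmod (H x - H w) <= Cc * Cmod (x - w)).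
    { apply Rmult_le_reg_r with (r / 2 / Cmod (x - w)). apply Rdiv_lt_0_compat; lra.
      unfold Cc. replace (4 * M / (r * r) * Cmod (x - w) * (r / 2 / Cmod (x - w))) with (2 * (M / r)) by (field; lra).
      replace (Cmod (H x - H w) * (r / 2 / Cmod (x - w))) with (Cmod (H x - H w) / Cmod (x - w) * (r / 2)) by (field; lra). exact D. }
    assert (HX : Cmod (H x) <= gap / 4).
    { unfold H. rewrite Cmod_div by (apply Cminus_eq_contra; auto).
      specialize (Hdd x ltac:(lra)). rewrite H0 in Hdd.
      replace (f x - 0 - 0 * (x - p))%C with (f x) in Hdd by ring. rewrite Exp in *.
      apply Rmult_le_reg_r with h; auto. unfold Rdiv at 1. rewrite Rmult_assoc, Rinv_l by lra. lra. }
    pose proof (Cmod_sub_ge (H w) (H x)). rewrite (Cmod_sub_sym (H w)) in H1.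
    assert (Cc * Cmod (x - w) <= Cc * (h + t)) by (apply Rmult_le_compat_l; auto).
    unfold gap in *. nra. }
  destruct (classic (z = p)) as [->|Hzp].
  { rewrite H0, Cmod_0, Cmod_sub_0. simpl. lra. }
  assert (nz : forall w, ~ In w (p :: nil) -> (w - p)%C <> 0%C).
  { intros w Hw E. apply Hw. left. symmetry. apply Ceq_minus. exact E. }
  assert (K : Cmod (H z / (z - p)) * r <= M / r).
  { apply (quotient_bound (p :: nil) (fun w => H w / (w - p))%C p r (M / r)); auto.
    - intros w Hw HwE. apply cholo_div; auto. apply Hhol; auto. intros ->. apply HwE. left; reflexivity.
      apply cholo_minus. apply cholo_id. apply cholo_const.
    - intros a [<-|[]]. exists (r / 2), (4 * M / (r * r)). split. lra. intros w Hw HwE.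
      specialize (nz w HwE). rewrite Cmod_div by auto. apply Cmod_gt_0 in nz. specialize (Lip w ltac:(lra)).
      apply Rmult_le_reg_r with (Cmod (w - p)); auto. unfold Rdiv at 1. rewrite Rmult_assoc, Rinv_l by lra. lra.
    - intros w Hw HwE. specialize (nz w HwE). rewrite Cmod_div by auto. apply Cmod_gt_0 in nz.
      unfold Rdiv at 1. rewrite Rmult_assoc, Rinv_l by lra. rewrite Rmult_1_r. apply HH; auto.
      intros ->. apply HwE. left; reflexivity.
    - simpl. intros [E|[]]. auto. }
  assert (Hn : (z - p)%C <> 0%C) by (apply Cminus_eq_contra; auto).
  unfold H in K. rewrite !Cmod_div in K by auto. apply Cmod_gt_0 in Hn.
  apply (Rmult_le_compat_r (Cmod (z - p) ^ 2 / r)) in K; [|apply Rdiv_le_0_compat; [apply pow2_ge_0|lra]].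
  replace (Cmod (f z) / Cmod (z - p) / Cmod (z - p) * r * (Cmod (z - p) ^ 2 / r)) with (Cmod (f z)) in K by (field; lra).
  replace (M / r ^ 2 * Cmod (z - p) ^ 2) with (M / r * (Cmod (z - p) ^ 2 / r)) by (field; lra). exact K.
Qed.

(** * Cauchy estimates, the mean value inequality and local inverses *)

Lemma cderiv_bound_of_lip f p l K d : 0 < d -> cderiv f p l ->
  (forall z, Cmod (z - p) < d -> Cmod (f z - f p) <= K * Cmod (z - p)) -> Cmod l <= K.
Proof.
  intros Hd Hl HK. apply Rnot_lt_le. intros Hlt.
  destruct (Hl ((Cmod l - K) / 2) ltac:(lra)) as [d' [Hd' Hw]].
  set (h := Rmin d d' / 2). assert (Hm : 0 < Rmin d d') by (apply Rmin_glb_lt; auto).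
  assert (Hh : 0 < h) by (unfold h; lra).
  pose proof (Rmin_l d d'). pose proof (Rmin_r d d').
  set (x := (p + h)%C).
  assert (Exp : Cmod (x - p) = h).
  { unfold x. replace (p + h - p)%C with (RtoC h) by ring. rewrite Cmod_R. apply Rabs_pos_eq. lra. }
  specialize (Hw x ltac:(rewrite Exp; unfold h; lra)). specialize (HK x ltac:(rewrite Exp; unfold h; lra)).
  pose proof (Cmod_sub_ge (l * (x - p)) (- (f x - f p - l * (x - p)))) as T.
  replace (l * (x - p) - - (f x - f p - l * (x - p)))%C with (f x - f p)%C in T by ring.
  rewrite Cmod_opp, Cmod_mult in T. rewrite Exp in *. nra.
Qed.

(** The Schwarz lemma for [f - f p], which is bounded by 2M, takes the place of Cauchy's formula.
    The free centre [a] allows [M] to measure the distance of the image from any point. *)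
Lemma cauchy_estimate (f : C -> C) (p a l : C) (r M : R) : 0 < r ->
  (forall z, Cmod (z - p) < r -> cholo f z) ->
  (forall z, Cmod (z - p) < r -> Cmod (f z - a) <= M) -> cderiv f p l -> Cmod l <= 2 * M / r.
Proof.
  intros Hr Hf HM Hl. apply (cderiv_bound_of_lip f p l _ r); auto.
  intros z Hz. apply (schwarz (fun w => f w - f p)%C p r (2 * M)); auto.
  - intros w Hw. apply cholo_minus; auto. apply cholo_const.
  - intros w Hw. replace (f w - f p)%C with ((f w - a) - (f p - a))%C by ring.
    eapply Rle_trans. apply Cmod_sub_le. pose proof (HM w Hw).
    pose proof (HM p ltac:(rewrite Cmod_sub_0; lra)). lra.
  - ring.
Qed.

Lemma cderiv_unique f p l (m : C) : cderiv f p l -> cderiv f p m -> l = m.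
Proof.
  intros Hl Hm. apply Cmod_sub_eq0. apply Rle_antisym; [|apply Cmod_ge_0].
  pose proof (cderiv_minus _ _ _ _ _ Hl Hm) as H.
  apply (cderiv_bound_of_lip (fun w => f w - f w)%C p (l - m) 0 1); auto. lra.
  intros z _. replace (f z - f z - (f p - f p))%C with (RtoC 0) by ring. rewrite Cmod_0. lra.
Qed.

Definition dC (f : C -> C) (z : C) : C := epsilon (inhabits (RtoC 0)) (cderiv f z).

Lemma dC_spec f z : cholo f z -> cderiv f z (dC f z).
Proof. intros H. exact (epsilon_spec (inhabits (RtoC 0)) (cderiv f z) H). Qed.

Lemma dC_eq f z l : cderiv f z l -> dC f z = l.
Proof. intros H. apply cderiv_unique with f z; auto. apply dC_spec. exists l. exact H. Qed.

Lemma Re_scal_r (a : C) (t : R) : Re (a * t) = Re a * t.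
Proof. destruct a. unfold Re, RtoC; simpl. ring. Qed.

(** The real mean value theorem is applied along the segment to Re(conj(u) f) with u = f b - f a, a
    function whose total increment is |u|^2. *)
Lemma mean_value (f : C -> C) (a b : C) (K : R) :
  (forall t, 0 <= t <= 1 -> exists l, cderiv f (a + t * (b - a)) l /\ Cmod l <= K) ->
  Cmod (f b - f a) <= K * Cmod (b - a).
Proof.
  intros H. set (gm := fun t : R => (a + t * (b - a))%C). set (u := (f b - f a)%C).
  set (phi := fun t => Re (Cconj u * f (gm t))).
  set (df := fun t => Re (Cconj u * (dC f (gm t) * (b - a)))).
  assert (Hgm : forall t s : R, (gm t - gm s)%C = ((b - a) * RtoC (t - s))%C).
  { intros t s. unfold gm. rewrite RtoC_minus. ring. }
  assert (Hder : forall t, 0 <= t <= 1 -> is_derive phi t (df t)).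
  { intros t Ht. destruct (H t Ht) as [l [Hl _]].
    assert (El : dC f (gm t) = l) by (apply dC_eq; exact Hl). unfold df. rewrite El.
    split. apply is_linear_scal_l. intros x Hx.
    pose proof (is_filter_lim_locally_unique t x Hx) as E. simpl in E. subst x.
    intros [e He].
    set (A := Cmod u * Cmod (b - a) + 1).
    pose proof (Cmod_ge_0 u). pose proof (Cmod_ge_0 (b - a)).
    assert (HA : 0 < A) by (unfold A; nra).
    destruct (Hl (e / A)) as [d [Hd Hw]]. apply Rdiv_lt_0_compat; auto.
    assert (Hd' : 0 < d / (Cmod (b - a) + 1)) by (apply Rdiv_lt_0_compat; lra).
    exists (mkposreal _ Hd'). intros s Hs. simpl.
    change (Rabs (s - t) < d / (Cmod (b - a) + 1)) in Hs.
    assert (Hm : Cmod (gm s - gm t) = Cmod (b - a) * Rabs (s - t)) by (rewrite Hgm, Cmod_mult, Cmod_R; reflexivity).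
    specialize (Hw (gm s)). fold (gm t) in Hw. rewrite Hm in Hw.
    assert (Hlt : Cmod (b - a) * Rabs (s - t) < d).
    { apply Rle_lt_trans with ((Cmod (b - a) + 1) * Rabs (s - t)). pose proof (Rabs_pos (s - t)); nra.
      apply (Rmult_lt_compat_l (Cmod (b - a) + 1)) in Hs; [|lra].
      replace ((Cmod (b - a) + 1) * (d / (Cmod (b - a) + 1))) with d in Hs by (field; lra). exact Hs. }
    specialize (Hw Hlt).
    change (Rabs (phi s - phi t - (s - t) * Re (Cconj u * (l * (b - a)))) <= e * Rabs (s - t)).
    replace (phi s - phi t - (s - t) * Re (Cconj u * (l * (b - a)))) with
      (Re (Cconj u * (f (gm s) - f (gm t) - l * (gm s - gm t)))).
    2: { rewrite Hgm. unfold phi.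
         replace (Cconj u * (f (gm s) - f (gm t) - l * ((b - a) * RtoC (s - t))))%C with
           (Cconj u * f (gm s) - Cconj u * f (gm t) - (Cconj u * (l * (b - a))) * RtoC (s - t))%C by ring.
         rewrite !Re_minus, Re_scal_r. ring. }
    eapply Rle_trans. apply Rabs_Re_le. rewrite Cmod_mult, Cmod_conj.
    apply Rle_trans with (Cmod u * (e / A * (Cmod (b - a) * Rabs (s - t)))).
    apply Rmult_le_compat_l; auto.
    replace (Cmod u * (e / A * (Cmod (b - a) * Rabs (s - t)))) with (e * Rabs (s - t) * ((Cmod u * Cmod (b - a)) / A)) by (field; lra).
    rewrite <- (Rmult_1_r (e * Rabs (s - t))) at 2. apply Rmult_le_compat_l.
    apply Rmult_le_pos. lra. apply Rabs_pos.
    apply Rmult_le_reg_r with A; auto. unfold Rdiv. rewrite Rmult_assoc, Rinv_l by lra. unfold A; lra. }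
  destruct (MVT_gen phi 0 1 df) as [c [Hc E]].
  { intros x. rewrite Rmin_left, Rmax_right by lra. intros Hx. apply Hder. lra. }
  { intros x. rewrite Rmin_left, Rmax_right by lra. intros Hx.
    apply continuity_pt_filterlim. apply (ex_derive_continuous (V := R_NormedModule)).
    eexists. apply Hder. lra. }
  rewrite Rmin_left, Rmax_right in Hc by lra.
  replace (gm 1) with b in E by (unfold gm; ring).
  assert (E' : Cmod u * Cmod u = Re (Cconj u * (dC f (gm c) * (b - a)))).
  { unfold df in E. rewrite Rminus_0_r, Rmult_1_r in E. rewrite <- E.
    unfold phi. rewrite <- Re_minus.
    replace (gm 1) with b by (unfold gm; ring). replace (gm 0) with a by (unfold gm; ring).
    replace (Cconj u * f b - Cconj u * f a)%C with (Cconj u * u)%C by (unfold u; ring).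
    rewrite Cconj_mult_self. reflexivity. }
  destruct (H c Hc) as [l [Hl HK]]. assert (El : dC f (gm c) = l) by (apply dC_eq; exact Hl).
  rewrite El in E'.
  pose proof (Cmod_ge_0 u) as Hu. destruct (Req_dec (Cmod u) 0) as [Z|NZ].
  { rewrite Z. apply Rmult_le_pos; [|apply Cmod_ge_0]. eapply Rle_trans; [apply Cmod_ge_0|exact HK]. }
  apply Rmult_le_reg_l with (Cmod u). lra. rewrite E'.
  eapply Rle_trans. apply Rle_abs. eapply Rle_trans. apply Rabs_Re_le.
  rewrite !Cmod_mult, Cmod_conj. apply Rmult_le_compat_l; auto. apply Rmult_le_compat_r; auto. apply Cmod_ge_0.
Qed.

Lemma segment_in_disc (p a b : C) (r t : R) : 0 <= t <= 1 -> Cmod (a - p) < r -> Cmod (b - p) < r ->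
  Cmod (a + t * (b - a) - p) < r.
Proof.
  intros Ht Ha Hb.
  replace (a + t * (b - a) - p)%C with (RtoC (1 - t) * (a - p) + RtoC t * (b - p))%C by (rewrite RtoC_minus; ring).
  eapply Rle_lt_trans. apply Cmod_triangle. rewrite !Cmod_mult, !Cmod_R, !Rabs_pos_eq by lra.
  destruct (Req_dec t 0) as [->|]. lra. nra.
Qed.

Lemma mean_value_disc (f : C -> C) (p : C) (r K : R) :
  (forall z, Cmod (z - p) < r -> exists l, cderiv f z l /\ Cmod l <= K) ->
  forall a b, Cmod (a - p) < r -> Cmod (b - p) < r -> Cmod (f b - f a) <= K * Cmod (b - a).
Proof. intros H a b Ha Hb. apply mean_value. intros t Ht. apply H. apply segment_in_disc; auto. Qed.

(** If [w] were omitted, 1/(f - w) would be at most 2/m on the circle and larger than 2/m at the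
    centre. *)
Lemma disc_covering (f : C -> C) (p w : C) (r m : R) : 0 < r -> 
  (forall z, Cmod (z - p) <= r -> cholo f z) ->
  (forall z, Cmod (z - p) = r -> m <= Cmod (f z - f p)) -> Cmod (w - f p) < m / 2 ->
  exists z, Cmod (z - p) < r /\ f z = w.
Proof.
  intros Hr Hf Hm Hw. apply NNPP. intros Hn.
  assert (Hb : forall z, Cmod (z - p) = r -> m / 2 <= Cmod (f z - w)).
  { intros z Hz. specialize (Hm z Hz). pose proof (Cmod_sub_trans (f z) w (f p)). lra. }
  assert (Hne : forall z, Cmod (z - p) <= r -> (f z - w)%C <> 0%C).
  { intros z [Hz|Hz] E.
    - apply Hn. exists z. split; auto. apply Ceq_minus. exact E.
    - specialize (Hb z Hz). rewrite E, Cmod_0 in Hb. pose proof (Cmod_ge_0 (w - f p)). lra. }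
  assert (Hp : Cmod (p - p) <= r) by (rewrite Cmod_sub_0; lra).
  pose proof (Cmod_ge_0 (w - f p)).
  assert (K : Cmod (/ (f p - w)) <= / (m / 2)).
  { apply (max_principle (fun z => / (f z - w))%C p r); auto.
    - intros z Hz. apply cholo_inv; auto. apply cholo_minus; auto. apply cholo_const.
    - intros z Hz. rewrite Cmod_inv by (apply Hne; lra). apply Rinv_le_contravar. lra. auto. }
  rewrite Cmod_inv in K by (apply Hne; auto).
  specialize (Hne p Hp). apply Cmod_gt_0 in Hne. rewrite (Cmod_sub_sym w) in Hw.
  apply Rinv_lt_contravar in Hw; [lra|]. apply Rmult_lt_0_compat; lra.
Qed.

(** Write f = f p + l (z - p) + e. By [schwarz2] the remainder is quadratic, so on a small disc its
    derivative is at most |l|/2 and the linear part dominates. This gives injectivity with a rate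
    and, through [disc_covering], surjectivity onto a disc. *)
Lemma local_inverse (f : C -> C) (p l : C) (R : R) : 0 < R ->
  (forall z, Cmod (z - p) < R -> cholo f z) -> cderiv f p l -> l <> 0%C ->
  exists r m, 0 < r /\ r <= R /\ 0 < m /\
    (forall z z', Cmod (z - p) < r -> Cmod (z' - p) < r -> Cmod l / 2 * Cmod (z - z') <= Cmod (f z - f z')) /\
    (forall w, Cmod (w - f p) < m -> exists z, Cmod (z - p) < r /\ f z = w).
Proof.
  intros HR Hf Hl Hl0. assert (pl : 0 < Cmod l) by (apply Cmod_gt_0; auto).
  destruct (cderiv_ccont _ _ _ Hl 1 Rlt_0_1) as [d [Hd Hc]].
  set (R1 := Rmin R d). assert (HR1 : 0 < R1) by (apply Rmin_glb_lt; auto).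
  assert (R1R : R1 <= R) by apply Rmin_l. assert (R1d : R1 <= d) by apply Rmin_r.
  set (e := fun z => (f z - f p - l * (z - p))%C).
  assert (He : forall z, Cmod (z - p) < R1 -> cholo e z).
  { intros z Hz. unfold e. apply cholo_minus. apply cholo_minus. apply Hf; lra. apply cholo_const.
    apply cholo_mult. apply cholo_const. apply cholo_minus. apply cholo_id. apply cholo_const. }
  set (M := 1 + Cmod l * R1). assert (HM : 0 < M) by (unfold M; nra).
  assert (HeM : forall z, Cmod (z - p) < R1 -> Cmod (e z) <= M).
  { intros z Hz. unfold e. eapply Rle_trans. apply Cmod_sub_le. rewrite Cmod_mult.
    specialize (Hc z ltac:(lra)). unfold M. nra. }
  assert (e0 : e p = 0%C) by (unfold e; ring).
  assert (e'0 : cderiv e p 0).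
  { eapply cderiv_eq; [|unfold e; apply cderiv_minus; [apply cderiv_minus; [exact Hl|apply cderiv_const]|
      apply cderiv_scal, cderiv_minus; [apply cderiv_id|apply cderiv_const]]]. ring. }
  pose proof (schwarz2 e p R1 M HR1 He HeM e0 e'0) as S2.
  (* With this [r] the Cauchy estimate on discs of radius [r] gives |e'| <= 8 M r / R1^2 <=
     |l|/2. *)
  set (r := Rmin (R1 / 2) (Cmod l * R1 ^ 2 / (16 * M))).
  assert (HR12 : 0 < R1 ^ 2) by (apply pow_lt; auto).
  assert (Hr : 0 < r). { apply Rmin_glb_lt. lra. apply Rdiv_lt_0_compat; nra. }
  assert (rR : r <= R1 / 2) by apply Rmin_l.
  assert (rM : 16 * M / R1 ^ 2 * r <= Cmod l).
  { apply Rle_trans with (16 * M / R1 ^ 2 * (Cmod l * R1 ^ 2 / (16 * M))).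
    apply Rmult_le_compat_l. apply Rdiv_le_0_compat; lra. apply Rmin_r. right. field. lra. }
  assert (HLip : forall z z', Cmod (z - p) < r -> Cmod (z' - p) < r -> Cmod (e z - e z') <= Cmod l / 2 * Cmod (z - z')).
  { intros z z' Hz Hz'. apply (mean_value_disc e p r (Cmod l / 2)); auto.
    intros x Hx. destruct (He x ltac:(lra)) as [m Hm]. exists m. split; auto.
    assert (K : Cmod m <= 2 * (M / R1 ^ 2 * (2 * r) ^ 2) / r).
    { apply (cauchy_estimate e x 0 m r); auto.
      - intros y Hy. apply He. pose proof (Cmod_sub_trans y x p). lra.
      - intros y Hy. replace (e y - 0)%C with (e y) by ring.
        pose proof (Cmod_sub_trans y x p). eapply Rle_trans. apply S2. lra.
        apply Rmult_le_compat_l. apply Rdiv_le_0_compat; lra. apply pow_incr. split. apply Cmod_ge_0. lra. }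
    replace (2 * (M / R1 ^ 2 * (2 * r) ^ 2) / r) with (16 * M / R1 ^ 2 * r / 2) in K by (field; split; lra). lra. }
  assert (HInj : forall z z', Cmod (z - p) < r -> Cmod (z' - p) < r -> Cmod l / 2 * Cmod (z - z') <= Cmod (f z - f z')).
  { intros z z' Hz Hz'. specialize (HLip z z' Hz Hz').
    replace (f z - f z')%C with (l * (z - z') - - (e z - e z'))%C by (unfold e; ring).
    pose proof (Cmod_sub_ge (l * (z - z')) (- (e z - e z'))). rewrite Cmod_opp, Cmod_mult in H. lra. }
  exists r, (Cmod l * (r / 2) / 2 / 2). split; [auto|]. split; [lra|]. split. nra. split; auto.
  intros w Hw. destruct (disc_covering f p w (r / 2) (Cmod l * (r / 2) / 2)) as [z [Hz E]]; auto; try lra.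
  - intros z Hz. apply Hf. lra.
  - intros z Hz. specialize (HInj z p ltac:(lra) ltac:(rewrite Cmod_sub_0; lra)). rewrite Hz in HInj. lra.
  - exists z. split; auto. lra.
Qed.

(** * Logarithms and the weak Koebe theorem *)

Lemma Clog_near_1 : exists m (L : C -> C), 0 < m /\
  forall w, Cmod (w - 1) < m -> cholo L w /\ Cexp (L w) = w.
Proof.
  destruct (local_inverse Cexp 0 1 1) as [r [m [Hr [_ [Hm [Hinj Hsur]]]]]]; try lra.
  { intros z _. eexists. apply cderiv_Cexp. }
  { eapply cderiv_eq; [|apply cderiv_Cexp]. apply Cexp_0. }
  { apply C1_nz. }
  rewrite Cexp_0 in Hsur. rewrite Cmod_1 in Hinj.
  set (L := fun w => epsilon (inhabits (RtoC 0)) (fun z => Cmod (z - 0) < r /\ Cexp z = w)).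
  assert (HL : forall w, Cmod (w - 1) < m -> Cmod (L w - 0) < r /\ Cexp (L w) = w).
  { intros w Hw. exact (epsilon_spec (inhabits (RtoC 0)) _ (Hsur w Hw)). }
  exists m, L. split; auto. intros w Hw. split; [|apply HL; auto].
  exists (1 / Cexp (L w))%C. apply (cderiv_lift Cexp (fun x => x) L w).
  - intros e He. exists (Rmin (m - Cmod (w - 1)) (e / 4)). split. apply Rmin_glb_lt; lra.
    intros x Hx. pose proof (Rmin_l (m - Cmod (w - 1)) (e / 4)). pose proof (Rmin_r (m - Cmod (w - 1)) (e / 4)).
    pose proof (Cmod_sub_trans x w 1). destruct (HL x ltac:(lra)) as [A1 A2]. destruct (HL w Hw) as [B1 B2].
    specialize (Hinj _ _ A1 B1). rewrite A2, B2 in Hinj. lra.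
  - apply cderiv_Cexp.
  - apply Cexp_nz.
  - apply cderiv_id.
  - exists (m - Cmod (w - 1)). split. lra. intros x Hx. apply HL. pose proof (Cmod_sub_trans x w 1). lra.
Qed.

(* The logarithm of psi / psi z0 is the sum of the logarithms of the ratios of psi at consecutive
   points of a fine subdivision of the segment from z0 to w. *)
Lemma log_exists (psi : C -> C) (z0 : C) (R R' : R) : 0 < R' < R ->
  (forall w, Cmod (w - z0) < R -> cholo psi w) ->
  (forall w, Cmod (w - z0) < R -> psi w <> 0%C) ->
  exists k : C -> C, forall w, Cmod (w - z0) < R' -> cholo k w /\ Cexp (k w) = (psi w / psi z0)%C.
Proof.
  intros HR Hh Hn. destruct Clog_near_1 as [m [L [Hm HL]]].
  set (R1 := (R' + R) / 2).
  destruct (ccont_bounded_disc psi z0 R1) as [A [HA HAb]].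
  { intros z Hz. apply cholo_ccont, Hh. unfold R1 in *; lra. }
  destruct (ccont_bounded_disc (fun w => / psi w)%C z0 R1) as [B [HB HBb]].
  { intros z Hz. apply cholo_ccont, cholo_inv. apply Hn; unfold R1 in *; lra. apply Hh. unfold R1 in *; lra. }
  set (K := 2 * A / (R1 - R')).
  assert (HK : 0 < K) by (unfold K, R1; apply Rdiv_lt_0_compat; lra).
  assert (Hlip : forall a b, Cmod (a - z0) < R' -> Cmod (b - z0) < R' -> Cmod (psi b - psi a) <= K * Cmod (b - a)).
  { apply mean_value_disc. intros z Hz. destruct (Hh z ltac:(lra)) as [l Hl]. exists l. split; auto.
    unfold K. apply (cauchy_estimate psi z 0 l (R1 - R') A); auto. unfold R1; lra.
    - intros y Hy. pose proof (Cmod_sub_trans y z z0). apply Hh. unfold R1 in *; lra.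
    - intros y Hy. pose proof (Cmod_sub_trans y z z0). replace (psi y - 0)%C with (psi y) by ring. apply HAb. lra. }
  (* [psi] is [K]-Lipschitz and 1/psi is bounded by [B], so with [N] subdivision steps the ratio of
     [psi] at consecutive points is within [m] of 1, where [L] is a logarithm. *)
  destruct (INR_unbounded (K * R' * B / m)) as [N HN].
  assert (HN0 : 0 < INR N).
  { eapply Rle_lt_trans; [|exact HN]. apply Rdiv_le_0_compat; auto. apply Rmult_le_pos; nra. }
  set (pt := fun (w : C) (i : nat) => (z0 + RtoC (INR i / INR N) * (w - z0))%C).
  assert (Hpt : forall w i, Cmod (w - z0) < R' -> (i <= N)%nat -> Cmod (pt w i - z0) < R').
  { intros w i Hw Hi. unfold pt. replace (z0 + RtoC (INR i / INR N) * (w - z0) - z0)%C with (RtoC (INR i / INR N) * (w - z0))%C by ring.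
    apply le_INR in Hi. pose proof (pos_INR i).
    assert (0 <= INR i / INR N <= 1).
    { split. apply Rdiv_le_0_compat; lra. apply Rmult_le_reg_r with (INR N); auto. unfold Rdiv. rewrite Rmult_assoc, Rinv_l by lra. lra. }
    rewrite Cmod_mult, Cmod_R, Rabs_pos_eq by lra. pose proof (Cmod_ge_0 (w - z0)). nra. }
  assert (Hrat : forall w i, Cmod (w - z0) < R' -> (S i <= N)%nat -> Cmod (psi (pt w (S i)) / psi (pt w i) - 1) < m).
  { intros w i Hw Hi.
    pose proof (Hpt w (S i) Hw Hi) as P1. pose proof (Hpt w i Hw ltac:(lia)) as P0.
    assert (nz : psi (pt w i) <> 0%C) by (apply Hn; lra).
    replace (psi (pt w (S i)) / psi (pt w i) - 1)%C with ((psi (pt w (S i)) - psi (pt w i)) * / psi (pt w i))%C by (field; auto).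
    rewrite Cmod_mult. specialize (HBb (pt w i) ltac:(unfold R1; lra)). specialize (Hlip _ _ P0 P1).
    assert (Ed : Cmod (pt w (S i) - pt w i) = Cmod (w - z0) / INR N).
    { replace (pt w (S i) - pt w i)%C with (RtoC (/ INR N) * (w - z0))%C.
      rewrite Cmod_mult, Cmod_R, Rabs_pos_eq. unfold Rdiv; ring. left; apply Rinv_0_lt_compat; auto.
      unfold pt. replace (INR (S i) / INR N) with (INR i / INR N + / INR N) by (rewrite S_INR; field; lra).
      rewrite RtoC_plus. ring. }
    rewrite Ed in Hlip.
    apply Rle_lt_trans with (K * (Cmod (w - z0) / INR N) * B).
    apply Rmult_le_compat; auto using Cmod_ge_0.
    apply Rle_lt_trans with (K * (R' / INR N) * B).
    { apply Rmult_le_compat_r. lra. apply Rmult_le_compat_l. lra. unfold Rdiv. apply Rmult_le_compat_r.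
      left; apply Rinv_0_lt_compat; auto. lra. }
    apply (Rmult_lt_compat_r m) in HN; auto. replace (K * R' * B / m * m) with (K * R' * B) in HN by (field; lra).
    apply Rmult_lt_reg_r with (INR N); auto. replace (K * (R' / INR N) * B * INR N) with (K * R' * B) by (field; lra). lra. }
  set (kk := fix kk n w := match n with O => RtoC 0 | S i => (kk i w + L (psi (pt w (S i)) / psi (pt w i)))%C end).
  assert (Hkk : forall n w, (n <= N)%nat -> Cmod (w - z0) < R' -> cholo (kk n) w /\ Cexp (kk n w) = (psi (pt w n) / psi z0)%C).
  { induction n; intros w Hle Hw.
    - simpl. split. apply cholo_const. unfold pt. simpl INR. unfold Rdiv. rewrite Rmult_0_l.
      replace (z0 + 0 * (w - z0))%C with z0 by ring. rewrite Cexp_0. field. apply Hn. rewrite Cmod_sub_0; lra.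
    - destruct (IHn w ltac:(lia) Hw) as [I1 I2]. destruct (HL _ (Hrat w n Hw Hle)) as [L1 L2].
      assert (nz : forall i, (i <= N)%nat -> psi (pt w i) <> 0%C) by (intros i Hi; apply Hn; pose proof (Hpt w i Hw Hi); lra).
      assert (Hp : forall i, (i <= N)%nat -> cholo (fun w => psi (pt w i)) w).
      { intros i Hi. apply (cholo_comp psi (fun w => pt w i)). apply Hh. pose proof (Hpt w i Hw Hi); lra.
        unfold pt. apply cholo_plus. apply cholo_const. apply cholo_mult. apply cholo_const.
        apply cholo_minus. apply cholo_id. apply cholo_const. }
      split.
      + simpl. apply cholo_plus; auto. apply (cholo_comp L (fun w => psi (pt w (S n)) / psi (pt w n))%C); auto.
        apply cholo_div; auto. apply nz; lia. apply Hp; lia.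
      + simpl. rewrite Cexp_plus, I2, L2. field. split. apply Hn; rewrite Cmod_sub_0; lra. apply nz; lia. }
  exists (kk N). intros w Hw. destruct (Hkk N w (le_n N) Hw) as [K1 K2]. split; auto. rewrite K2. f_equal. f_equal.
  unfold pt. replace (INR N / INR N) with 1 by (field; lra). ring.
Qed.

Lemma Cexp_add_2PI (z : C) : Cexp (z + (0, 2 * PI)%R) = Cexp z.
Proof.
  destruct z as [x y]. unfold Cexp, Cplus, Re, Im; simpl. rewrite Rplus_0_r.
  rewrite cos_plus, sin_plus, cos_2PI, sin_2PI. f_equal; ring.
Qed.

(* Bloch's argument for k = log (psi - a): where (R - |w - w0|) |k'| is nearly maximal, k covers a disc of
   comparable radius, but its image contains no two points differing by 2 PI i. *)
Lemma koebe (psi : C -> C) (w0 a l : C) (r : R) : 0 < r ->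
  (forall w, Cmod (w - w0) < r -> cholo psi w) ->
  (forall w w', Cmod (w - w0) < r -> Cmod (w' - w0) < r -> psi w = psi w' -> w = w') ->
  (forall w, Cmod (w - w0) < r -> psi w <> a) -> cderiv psi w0 l ->
  r * Cmod l <= 320 * PI * Cmod (psi w0 - a).
Proof.
  intros Hr Hh Hinj Hom Hl. pose proof PI_RGT_0 as Hpi.
  assert (Hw0 : forall s, 0 < s -> Cmod (w0 - w0) < s) by (intros s Hs; rewrite Cmod_sub_0; auto).
  assert (nzP : forall w, Cmod (w - w0) < r -> (psi w - a)%C <> 0%C).
  { intros w Hw. apply Cminus_eq_contra. auto. }
  assert (nz0 := nzP w0 (Hw0 r Hr)). assert (pos0 : 0 < Cmod (psi w0 - a)) by (apply Cmod_gt_0; auto).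
  rewrite Rmult_comm. apply Rle_mult_limit with (a := 0); auto using Cmod_ge_0.
  (* Nested radii R < R1 < R2 < r: the logarithm [k] lives on the disc of radius [R2] and is bounded
     on the one of radius [R1], which makes the supremum over the disc of radius [R] finite. The
     bound for each [R] passes to [r]. *)
  intros R HR. set (R2 := (R + r) / 2).
  destruct (log_exists (fun w => psi w - a)%C w0 r R2) as [k Hk].
  { unfold R2; lra. }
  { intros w Hw. apply cholo_minus; auto. apply cholo_const. }
  { auto. }
  assert (Hkeq : forall w, Cmod (w - w0) < R2 -> psi w = (a + (psi w0 - a) * Cexp (k w))%C).
  { intros w Hw. destruct (Hk w Hw) as [_ E]. rewrite E. field. auto. }
  assert (kinj : forall w w', Cmod (w - w0) < R2 -> Cmod (w' - w0) < R2 -> Cexp (k w) = Cexp (k w') -> w = w').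
  { intros w w' h1 h2 E. apply Hinj; try (unfold R2 in *; lra). rewrite (Hkeq w h1), (Hkeq w' h2), E. reflexivity. }
  set (R1 := (R + R2) / 2).
  destruct (ccont_bounded_disc k w0 R1) as [A0 [HA0 HAb]].
  { intros z Hz. apply cholo_ccont, Hk. unfold R1, R2 in *; lra. }
  set (S := fun x => exists w, Cmod (w - w0) < R /\ x = (R - Cmod (w - w0)) * Cmod (dC k w)).
  assert (Sb : forall w, Cmod (w - w0) < R -> (R - Cmod (w - w0)) * Cmod (dC k w) <= R * (2 * A0 / (R1 - R))).
  { intros w Hw. pose proof (Cmod_ge_0 (w - w0)). apply Rmult_le_compat; try lra. apply Cmod_ge_0.
    apply (cauchy_estimate k w 0 (dC k w) (R1 - R) A0); try (unfold R1, R2; lra).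
    - intros z Hz. apply Hk. pose proof (Cmod_sub_trans z w w0). unfold R1, R2 in *; lra.
    - intros z Hz. replace (k z - 0)%C with (k z) by ring. apply HAb. pose proof (Cmod_sub_trans z w w0). lra.
    - apply dC_spec, Hk. unfold R2; lra. }
  destruct (completeness S) as [s [Hs1 Hs2]].
  { exists (R * (2 * A0 / (R1 - R))). intros x [w [Hw ->]]. auto. }
  { exists (R * Cmod (dC k w0)). exists w0. split. apply Hw0; lra. rewrite Cmod_sub_0. ring. }
  assert (Hs0 : R * Cmod (dC k w0) <= s).
  { apply Hs1. exists w0. split. apply Hw0; lra. rewrite Cmod_sub_0. ring. }
  assert (Hdk : dC k w0 = (l / (psi w0 - a))%C).
  { assert (Hd : cderiv psi w0 ((psi w0 - a) * (Cexp (k w0) * dC k w0))).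
    { apply cderiv_ext_loc with (f := fun w => (a + (psi w0 - a) * Cexp (k w))%C).
      - exists R2. split. unfold R2; lra. intros w Hw. symmetry. apply Hkeq; auto.
      - eapply cderiv_eq; [|apply cderiv_plus; [apply cderiv_const|apply cderiv_scal, (cderiv_comp Cexp k); [apply cderiv_Cexp|apply dC_spec, Hk]]].
        ring. apply Hw0. unfold R2; lra. }
    rewrite (cderiv_unique _ _ _ _ Hl Hd). destruct (Hk w0) as [_ E]. apply Hw0; unfold R2; lra.
    rewrite E. field. auto. }
  assert (Hs : s <= 320 * PI).
  { apply Rnot_lt_le. intros Hlt.
    assert (Hex : exists w, Cmod (w - w0) < R /\ s / 2 < (R - Cmod (w - w0)) * Cmod (dC k w)).
    { apply NNPP. intros Hno. assert (s <= s / 2); [|lra]. apply Hs2. intros x [w [Hw ->]].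
      apply Rnot_lt_le. intros K. apply Hno. exists w. auto. }
    destruct Hex as [w1 [Hw1 Hmax]].
    (* On the disc of radius [rho] about [w1] the quantity R - |w - w0| is at least [rho], so |k'|
       <= s/rho < 4A there, with A = |k' w1|. *)
    set (rho := (R - Cmod (w1 - w0)) / 2). assert (Hrho : 0 < rho) by (unfold rho; lra).
    set (A := Cmod (dC k w1)) in *.
    assert (HsA : s < 4 * rho * A) by (unfold rho; lra).
    assert (HA : 0 < A). { pose proof (Cmod_ge_0 (dC k w1)) as K. fold A in K. nra. }
    assert (Hd4 : forall w, Cmod (w - w1) < rho -> Cmod (dC k w) <= 4 * A).
    { intros w Hw. pose proof (Cmod_sub_trans w w1 w0) as T.
      assert (Hin : Cmod (w - w0) < R) by (unfold rho in *; lra).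
      assert (K : (R - Cmod (w - w0)) * Cmod (dC k w) <= s) by (apply Hs1; exists w; auto).
      assert (rho <= R - Cmod (w - w0)) by (unfold rho in *; lra).
      pose proof (Cmod_ge_0 (dC k w)). apply Rmult_le_reg_l with rho; auto. nra. }
    assert (Hkin : forall w, Cmod (w - w1) < rho -> Cmod (w - w0) < R2).
    { intros w Hw. pose proof (Cmod_sub_trans w w1 w0) as T. unfold rho, R2 in *; lra. }
    set (e := fun w => (k w - k w1 - dC k w1 * (w - w1))%C).
    assert (Hw11 : Cmod (w1 - w1) < rho) by (rewrite Cmod_sub_0; auto).
    assert (Hed : forall w, Cmod (w - w1) < rho -> cderiv e w (dC k w - dC k w1)).
    { intros w Hw. unfold e. eapply cderiv_eq; [|apply cderiv_minus; [apply cderiv_minus; [apply dC_spec, Hk; auto|apply cderiv_const]|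
      apply cderiv_scal, cderiv_minus; [apply cderiv_id|apply cderiv_const]]]. ring. }
    assert (e0 : e w1 = 0%C) by (unfold e; ring).
    assert (HeM : forall w, Cmod (w - w1) < rho -> Cmod (e w) <= 5 * A * rho).
    { intros w Hw. replace (e w) with (e w - e w1)%C by (rewrite e0; ring).
      apply Rle_trans with (5 * A * Cmod (w - w1)).
      - apply (mean_value_disc e w1 rho (5 * A)); auto. intros x Hx. eexists. split. apply Hed; auto.
        eapply Rle_trans. apply Cmod_sub_le. specialize (Hd4 x Hx). unfold A in *; lra.
      - apply Rmult_le_compat_l; lra. }
    assert (e'0 : cderiv e w1 0). { eapply cderiv_eq; [|apply Hed; auto]. ring. }
    assert (S2 := schwarz2 e w1 rho (5 * A * rho) Hrho (fun w Hw => ex_intro _ _ (Hed w Hw)) HeM e0 e'0).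
    (* On the circle of radius rho/10 the linear part has modulus A rho/10 and the error is at most
       A rho/20, so [k] covers the disc of radius A rho/40 about [k w1]. This radius exceeds s/160,
       hence 2 PI when s > 320 PI: the origin of the constant. *)
    destruct (disc_covering k w1 (k w1 + (0, 2 * PI)%R)%C (rho / 10) (A * rho / 20)) as [z [Hz Ez]].
    - lra.
    - intros z Hz. apply Hk, Hkin. lra.
    - intros z Hz. specialize (S2 z ltac:(lra)). rewrite Hz in S2.
      replace (5 * A * rho / rho ^ 2 * (rho / 10) ^ 2) with (A * rho / 20) in S2 by (field; lra).
      replace (k z - k w1)%C with (dC k w1 * (z - w1) - - e z)%C by (unfold e; ring).
      pose proof (Cmod_sub_ge (dC k w1 * (z - w1)) (- e z)) as T. rewrite Cmod_opp, Cmod_mult, Hz in T. fold A in T. lra.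
    - replace (k w1 + (0, 2 * PI)%R - k w1)%C with (Ci * RtoC (2 * PI))%C.
      + rewrite Cmod_mult, Cmod_Ci, Cmod_R, Rabs_pos_eq by lra. nra.
      + destruct (k w1) as [u v]. unfold Ci, RtoC, Cmult, Cplus, Cminus, Copp; simpl. apply injective_projections; simpl; ring.
    - assert (Ezw : z = w1).
      { apply kinj. apply Hkin; lra. apply Hkin; auto. rewrite Ez. apply Cexp_add_2PI. }
      rewrite Ezw in Ez. apply (f_equal Im) in Ez. destruct (k w1). unfold Im in Ez. simpl in Ez. lra. }
  rewrite Hdk, Cmod_div in Hs0 by auto.
  apply Rmult_le_reg_r with (/ Cmod (psi w0 - a)). apply Rinv_0_lt_compat; auto.
  rewrite (Rmult_assoc (320 * PI)), Rinv_r by lra. unfold Rdiv in Hs0.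
  replace (Cmod l * R * / Cmod (psi w0 - a)) with (R * (Cmod l * / Cmod (psi w0 - a))) by ring. lra.
Qed.

(** * Continuation of inverse branches along rays *)

Lemma interval_induction (P : R -> Prop) : P 0 ->
  (forall t, 0 < t <= 1 -> (forall s, 0 <= s < t -> P s) -> P t) ->
  (forall t, 0 <= t < 1 -> P t -> exists e, 0 < e /\ forall s, t <= s < t + e -> s <= 1 -> P s) ->
  forall t, 0 <= t <= 1 -> P t.
Proof.
  intros H0 Hc Ho.
  set (E := fun t => 0 <= t <= 1 /\ forall s, 0 <= s <= t -> P s).
  destruct (completeness E) as [m [Hm1 Hm2]].
  { exists 1. intros x [Hx _]. lra. }
  { exists 0. split. lra. intros s Hs. replace s with 0 by lra. exact H0. }
  assert (m0 : 0 <= m). { apply Hm1. split. lra. intros s Hs. replace s with 0 by lra. exact H0. }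
  assert (m1 : m <= 1). { apply Hm2. intros x [Hx _]. lra. }
  assert (Hlow : forall s, 0 <= s < m -> P s).
  { intros s Hs. apply NNPP. intros Hn. assert (m <= s); [|lra].
    apply Hm2. intros x [Hx HP]. apply Rnot_lt_le. intros Hlt. apply Hn, HP. lra. }
  assert (Hm : P m). { destruct m0 as [K|<-]; auto. }
  destruct m1 as [K|K].
  - exfalso. destruct (Ho m ltac:(lra) Hm) as [e [He HP]].
    set (m' := Rmin 1 (m + e / 2)).
    assert (A1 : m' <= 1) by apply Rmin_l. assert (A2 : m' <= m + e / 2) by apply Rmin_r.
    assert (A3 : m < m') by (apply Rmin_glb_lt; lra).
    assert (m' <= m); [|lra]. apply Hm1. split. lra.
    intros s Hs. destruct (Rlt_dec s m). apply Hlow; lra. apply HP; lra.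
  - subst m. intros t Ht. destruct (Rlt_dec t 1). apply Hlow; lra. replace t with 1 by lra. exact Hm.
Qed.

(** It is used in two situations: [Om] the complement of the poles with [D] a disc without singular
    values, and [Om] a punctured disc at a pole with [D] a disc far from 0. *)
Definition locally_regular (f : C -> C) (Om D : C -> Prop) : Prop :=
  forall z, Om z -> D (f z) ->
    (exists R, 0 < R /\ forall x, Cmod (x - z) < R -> Om x /\ cholo f x) /\ dC f z <> 0%C.

Definition section_at (f : C -> C) (Om : C -> Prop) (k : C -> C) (x : C) : Prop :=
  ccont k x /\ Om (k x) /\ f (k x) = x.

Lemma locally_injective f Om D z : locally_regular f Om D -> Om z -> D (f z) ->
  exists r, 0 < r /\ forall z1 z2, Cmod (z1 - z) < r -> Cmod (z2 - z) < r -> f z1 = f z2 -> z1 = z2.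
Proof.
  intros HL Hz HD. destruct (HL z Hz HD) as [[R [HR Hx]] Hl].
  destruct (local_inverse f z (dC f z) R) as [r [m (Hr & _ & Hm & Hinj & _)]]; auto.
  { intros x Hxz. apply Hx; auto. }
  { apply dC_spec, Hx. rewrite Cmod_sub_0; auto. }
  exists r. split; auto. intros z1 z2 h1 h2 E. specialize (Hinj z1 z2 h1 h2).
  apply Cmod_gt_0 in Hl. rewrite E, Cmod_sub_0 in Hinj. apply Cmod_sub_eq0.
  pose proof (Cmod_ge_0 (z1 - z2)). nra.
Qed.

Lemma local_section f Om D z : locally_regular f Om D -> Om z -> D (f z) ->
  exists e k, 0 < e /\ k (f z) = z /\ forall x, Cmod (x - f z) < e -> section_at f Om k x.
Proof.
  intros HL Hz HD. destruct (HL z Hz HD) as [[R [HR Hx]] Hl].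
  destruct (local_inverse f z (dC f z) R) as [r [m (Hr & HrR & Hm & Hinj & Hsur)]]; auto.
  { intros x Hxz. apply Hx; auto. }
  { apply dC_spec, Hx. rewrite Cmod_sub_0; auto. }
  apply Cmod_gt_0 in Hl. set (a := Cmod (dC f z) / 2) in *. assert (Ha : 0 < a) by (unfold a; lra).
  set (k := fun w => epsilon (inhabits z) (fun y => Cmod (y - z) < r /\ f y = w)).
  assert (Hk : forall w, Cmod (w - f z) < m -> Cmod (k w - z) < r /\ f (k w) = w).
  { intros w Hw. exact (epsilon_spec (inhabits z) _ (Hsur w Hw)). }
  exists m, k. split; auto. split.
  - destruct (Hk (f z)) as [K1 K2]. rewrite Cmod_sub_0; auto.
    specialize (Hinj (k (f z)) z K1 ltac:(rewrite Cmod_sub_0; auto)). rewrite K2, Cmod_sub_0 in Hinj.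
    apply Cmod_sub_eq0. pose proof (Cmod_ge_0 (k (f z) - z)). nra.
  - intros x Hxm. destruct (Hk x Hxm) as [K1 K2]. split; [|split; auto].
    + intros e He. exists (Rmin (m - Cmod (x - f z)) (a * e)). split. apply Rmin_glb_lt; nra.
      intros y Hy. pose proof (Rmin_l (m - Cmod (x - f z)) (a * e)). pose proof (Rmin_r (m - Cmod (x - f z)) (a * e)).
      pose proof (Cmod_sub_trans y x (f z)). destruct (Hk y ltac:(lra)) as [J1 J2].
      specialize (Hinj _ _ J1 K1). rewrite J2, K2 in Hinj.
      apply Rmult_lt_reg_l with a; auto. lra.
    + apply Hx. lra.
Qed.

Lemma Cmod_segment (x y : C) (t s : R) :
  Cmod ((x + t * (y - x)) - (x + s * (y - x))) = Rabs (t - s) * Cmod (y - x).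
Proof. rewrite <- Cmod_R, <- Cmod_mult. f_equal. rewrite RtoC_minus. ring. Qed.

Lemma segment_close (x y : C) (e t : R) : 0 < e -> exists d, 0 < d /\
  forall s, Rabs (s - t) < d -> Cmod ((x + s * (y - x)) - (x + t * (y - x))) < e.
Proof.
  intros He. pose proof (Cmod_ge_0 (y - x)). exists (e / (Cmod (y - x) + 1)). split.
  apply Rdiv_lt_0_compat; lra. intros s Hs. rewrite Cmod_segment.
  apply (Rmult_lt_compat_r (Cmod (y - x) + 1)) in Hs; [|lra].
  replace (e / (Cmod (y - x) + 1) * (Cmod (y - x) + 1)) with e in Hs by (field; lra).
  pose proof (Rabs_pos (s - t)). nra.
Qed.

(** The set of parameters where the two sections agree is closed by continuity and open by local
    injectivity of [f]. *)
Lemma section_unique f Om D k1 k2 (x y : C) : locally_regular f Om D ->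
  (forall t, 0 <= t <= 1 -> D (x + t * (y - x))%C /\
     section_at f Om k1 (x + t * (y - x)) /\ section_at f Om k2 (x + t * (y - x))) ->
  k1 x = k2 x -> k1 y = k2 y.
Proof.
  intros HL H E. set (p := fun t : R => (x + t * (y - x))%C).
  assert (Hall : forall t, 0 <= t <= 1 -> k1 (p t) = k2 (p t)).
  { apply interval_induction.
    - unfold p. replace (x + 0 * (y - x))%C with x by ring. exact E.
    - intros t Ht Hs. apply Cmod_sub_eq0. apply Rle_antisym; [|apply Cmod_ge_0].
      apply Rnot_lt_le. intros Hlt. set (g := Cmod (k1 (p t) - k2 (p t))) in *.
      destruct (H t ltac:(lra)) as (_ & [c1 _] & [c2 _]).
      destruct (c1 (g / 2) ltac:(lra)) as [d1 [Hd1 e1]]. destruct (c2 (g / 2) ltac:(lra)) as [d2 [Hd2 e2]].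
      destruct (segment_close x y (Rmin d1 d2) t) as [d [Hd Hc]]. apply Rmin_glb_lt; auto.
      set (s := Rmax 0 (t - d / 2)).
      assert (0 <= s) by apply Rmax_l. assert (t - d / 2 <= s) by apply Rmax_r.
      assert (s < t) by (apply Rmax_lub_lt; lra).
      assert (Hst : Rabs (s - t) < d) by (apply Rabs_def1; lra).
      specialize (Hc s Hst). pose proof (Rmin_l d1 d2). pose proof (Rmin_r d1 d2).
      specialize (e1 _ (Rlt_le_trans _ _ _ Hc H3)). specialize (e2 _ (Rlt_le_trans _ _ _ Hc H4)).
      specialize (Hs s ltac:(lra)). unfold p in Hs. rewrite Hs in e1. fold (p s) (p t) in e1, e2.
      pose proof (Cmod_sub_trans (k1 (p t)) (k2 (p s)) (k2 (p t))) as T.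
      rewrite (Cmod_sub_sym (k1 (p t)) (k2 (p s))) in T. fold g in T. lra.
    - intros t Ht Et. destruct (H t ltac:(lra)) as (HD & [c1 [o1 f1]] & [c2 [o2 f2]]). fold (p t) in *.
      destruct (locally_injective f Om D (k1 (p t)) HL o1) as [r [Hr Hinj]]. rewrite f1; auto.
      destruct (c1 r Hr) as [d1 [Hd1 e1]]. destruct (c2 r Hr) as [d2 [Hd2 e2]].
      destruct (segment_close x y (Rmin d1 d2) t) as [d [Hd Hc]]. apply Rmin_glb_lt; auto.
      exists d. split; auto. intros s Hs Hs1.
      assert (Hst : Rabs (s - t) < d) by (apply Rabs_def1; lra).
      specialize (Hc s Hst). pose proof (Rmin_l d1 d2). pose proof (Rmin_r d1 d2).
      specialize (e1 _ (Rlt_le_trans _ _ _ Hc H0)). specialize (e2 _ (Rlt_le_trans _ _ _ Hc H1)).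
      fold (p s) in e1, e2. rewrite <- Et in e2. apply Hinj; auto.
      destruct (H s ltac:(lra)) as (_ & [_ [_ g1]] & [_ [_ g2]]). fold (p s) in g1, g2. rewrite g1, g2. reflexivity. }
  specialize (Hall 1 ltac:(lra)). unfold p in Hall. replace (x + 1 * (y - x))%C with y in Hall by ring. exact Hall.
Qed.

Lemma segment_reparam (w0 w : C) (a t : R) :
  (w0 + RtoC t * ((w0 + RtoC a * (w - w0)) - w0))%C = (w0 + RtoC (t * a) * (w - w0))%C.
Proof. rewrite RtoC_mult. ring. Qed.

(* Sections of f are continued along the rays from w0, each time on a neighbourhood of a segment;
   such neighbourhoods are convex, so two continuations agree where they overlap. *)
Lemma lifting (f : C -> C) (Om D : C -> Prop) (w0 z0 : C) :
  (forall x y t, D x -> D y -> 0 <= t <= 1 -> D (x + RtoC t * (y - x))%C) -> Defs.open_set D ->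
  locally_regular f Om D ->
  (forall w (gm : R -> C), D w ->
     (forall t, 0 <= t < 1 -> Om (gm t) /\ f (gm t) = (w0 + RtoC t * (w - w0))%C) ->
     (forall t, 0 <= t < 1 -> forall e, 0 < e -> exists d, 0 < d /\
        forall s, 0 <= s < 1 -> Rabs (s - t) < d -> Cmod (gm s - gm t) < e) ->
     exists z, Om z /\ f z = w /\
       forall e t0, 0 < e -> t0 < 1 -> exists t, t0 < t < 1 /\ 0 <= t /\ Cmod (gm t - z) < e) ->
  D w0 -> Om z0 -> f z0 = w0 ->
  exists psi, psi w0 = z0 /\
    forall w, D w -> Om (psi w) /\ f (psi w) = w /\ cderiv psi w (/ dC f (psi w)).
Proof.
  intros Hconv Hopen HL HE HD0 HO0 Hf0.
  set (nb := fun (w : C) (a e : R) (x : C) => exists s, 0 <= s <= a /\ Cmod (x - (w0 + RtoC s * (w - w0))) < e).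
  assert (nbconv : forall w a e x y t, nb w a e x -> nb w a e y -> 0 <= t <= 1 -> nb w a e (x + RtoC t * (y - x))%C).
  { intros w a e x y t [s [Hs Hx]] [s' [Hs' Hy]] Ht. exists (s + t * (s' - s)). split. split; nra.
    replace (x + t * (y - x) - (w0 + RtoC (s + t * (s' - s)) * (w - w0)))%C with
      (RtoC (1 - t) * (x - (w0 + RtoC s * (w - w0))) + RtoC t * (y - (w0 + RtoC s' * (w - w0))))%C
      by (rewrite RtoC_plus, RtoC_mult, !RtoC_minus; ring).
    eapply Rle_lt_trans. apply Cmod_triangle. rewrite !Cmod_mult, !Cmod_R, !Rabs_pos_eq by lra.
    destruct (Req_dec t 0) as [->|]. lra. nra. }
  set (good := fun (w : C) (a : R) (ek : R * (C -> C)) => 0 < fst ek /\ snd ek w0 = z0 /\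
    forall x, nb w a (fst ek) x -> section_at f Om (snd ek) x).
  assert (Hseg : forall w s a, 0 <= a -> D w -> 0 <= s <= a -> a <= 1 -> D (w0 + RtoC s * (w - w0))%C).
  { intros w s a Ha Hw Hs Ha1. apply Hconv; auto. lra. }
  assert (Hnbs : forall w a e s, 0 < e -> 0 <= s <= a -> nb w a e (w0 + RtoC s * (w - w0))%C).
  { intros w a e s He Hs. exists s. split; auto. rewrite Cmod_sub_0. exact He. }
  assert (Huniq : forall w a b ek ek', D w -> 0 <= a <= 1 -> a <= b -> good w a ek -> good w b ek' ->
    snd ek (w0 + RtoC a * (w - w0))%C = snd ek' (w0 + RtoC a * (w - w0))%C).
  { intros w a b ek ek' Hw Ha Hab [e1 [i1 s1]] [e2 [i2 s2]].
    apply (section_unique f Om D (snd ek) (snd ek') w0); auto; [|congruence].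
    intros t Ht. rewrite segment_reparam. assert (0 <= t * a <= a) by nra.
    split. apply (Hseg w (t * a) a); lra || auto. split; [apply s1|apply s2]; apply Hnbs; lra. }
  assert (Hray : forall w, D w -> forall t, 0 <= t <= 1 -> exists ek, good w t ek).
  { intros w Hw. apply interval_induction.
    - destruct (local_section f Om D z0 HL HO0) as [e [k [He [Hk Hs]]]]. rewrite Hf0; auto.
      rewrite Hf0 in *. exists (e, k). split; auto. split; auto. simpl. intros x [s [Hs' Hx]].
      apply Hs. replace s with 0 in Hx by lra. replace (w0 + 0 * (w - w0))%C with w0 in Hx by ring. exact Hx.
    - intros t Ht Hlow.
      (* The sections chosen for different s < t need not be the same function, but by [Huniq] their
         values on the ray agree, so [gm] is one continuous lift of the ray, with parameter rescaled
         to [0, 1). *)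
      set (ek := fun s => epsilon (inhabits (0, (fun z => z) : C -> C)) (good w s)).
      assert (Hek : forall s, 0 <= s < t -> good w s (ek s)).
      { intros s Hs. exact (epsilon_spec _ _ (Hlow s Hs)). }
      set (ws := (w0 + RtoC t * (w - w0))%C). assert (Hws : D ws) by (apply (Hseg w t t); lra || auto).
      set (gm := fun u => snd (ek (u * t)) (w0 + RtoC (u * t) * (w - w0))%C).
      assert (Hut : forall u, 0 <= u < 1 -> 0 <= u * t < t) by (intros u Hu; split; nra).
      destruct (HE ws gm Hws) as [zs [Hzs [Efz Hcl]]].
      + intros u Hu. specialize (Hut u Hu). destruct (Hek _ Hut) as [e1 [_ s1]].
        destruct (s1 (w0 + RtoC (u * t) * (w - w0))%C) as [_ [o ff]]. apply Hnbs; lra.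
        split; auto. unfold gm. rewrite ff. unfold ws. rewrite segment_reparam. reflexivity.
      + intros u Hu e He. set (u' := (u + 1) / 2).
        assert (Hu' : 0 <= u' < 1) by (unfold u'; lra). assert (Huu : u < u') by (unfold u'; lra).
        destruct (Hek _ (Hut _ Hu')) as [e1 [i1 s1]].
        assert (Eg : forall v, 0 <= v <= u' -> gm v = snd (ek (u' * t)) (w0 + RtoC (v * t) * (w - w0))%C).
        { intros v Hv. unfold gm. apply (Huniq w (v * t) (u' * t)); auto; try nra.
          apply Hek. apply Hut. lra. }
        destruct (s1 (w0 + RtoC (u * t) * (w - w0))%C) as [cc _]. apply Hnbs; auto. nra.
        destruct (cc e He) as [d1 [Hd1 Hc1]].
        destruct (segment_close w0 w d1 (u * t) Hd1) as [d2 [Hd2 Hc2]].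
        exists (Rmin d2 (u' - u)). split. apply Rmin_glb_lt; lra.
        intros s Hs Hsu. pose proof (Rmin_l d2 (u' - u)). pose proof (Rmin_r d2 (u' - u)).
        apply Rabs_def2 in Hsu.
        rewrite !Eg by lra. apply Hc1, Hc2. rewrite <- Rmult_minus_distr_r, Rabs_mult, (Rabs_pos_eq t) by lra.
        assert (Rabs (s - u) < d2) by (apply Rabs_def1; lra). pose proof (Rabs_pos (s - u)). nra.
      (* Only a cluster point [zs] of the lift is known. It suffices: for one parameter [u] close to
         1, [gm u] and the value of the local section at [zs] lie in a disc where [f] is injective
         and have the same image, so they coincide; [section_unique] extends the agreement to the
         overlap. *)
      + destruct (local_section f Om D zs HL Hzs) as [e' [phi [He' [Hphi Hsphi]]]]. rewrite Efz; auto.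
        destruct (locally_injective f Om D zs HL Hzs) as [r [Hr Hinj]]. rewrite Efz; auto.
        rewrite Efz in *.
        destruct (Hopen ws Hws) as [eD [HeD HDb]].
        set (e2 := Rmin e' eD). assert (He2 : 0 < e2) by (apply Rmin_glb_lt; auto).
        assert (e2e : e2 <= e') by apply Rmin_l. assert (e2D : e2 <= eD) by apply Rmin_r.
        destruct (Hsphi ws) as [cphi _]. rewrite Cmod_sub_0; auto.
        destruct (cphi r Hr) as [eta [Heta Hceta]].
        destruct (segment_close w0 w (Rmin eta (e2 / 2)) t) as [d [Hd Hcd]]. apply Rmin_glb_lt; lra.
        destruct (Hcl r (1 - d) Hr ltac:(lra)) as [u [Hu [Hu0 Hur]]].
        set (s1 := u * t). assert (Hs1 : 0 <= s1 < t) by (apply Hut; lra).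
        assert (Hs1d : Rabs (s1 - t) < d).
        { unfold s1. apply Rabs_def1; nra. }
        specialize (Hcd s1 Hs1d). set (p1 := (w0 + RtoC s1 * (w - w0))%C) in *. fold ws in Hcd.
        pose proof (Rmin_l eta (e2 / 2)) as q1. pose proof (Rmin_r eta (e2 / 2)) as q2.
        destruct (Hek s1 Hs1) as [He1 [i1 sec1]]. set (k1 := snd (ek s1)) in *. set (e1 := fst (ek s1)) in *.
        assert (Eglue : phi p1 = k1 p1).
        { apply Hinj.
          - rewrite <- Hphi at 1. apply Hceta. lra.
          - exact Hur.
          - destruct (Hsphi p1 ltac:(lra)) as [_ [_ g1]]. rewrite g1.
            destruct (sec1 p1) as [_ [_ g2]]. apply Hnbs; lra. rewrite g2. reflexivity. }
        assert (Hagree : forall x, nb w s1 e1 x -> Cmod (x - ws) < e2 -> phi x = k1 x).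
        { intros x Hx Hxw. apply (section_unique f Om D phi k1 p1); auto.
          intros v Hv. assert (Hin : Cmod (p1 + v * (x - p1) - ws) < e2).
          { apply segment_in_disc; auto. lra. }
          split; [|split].
          - apply HDb. unfold disk. lra.
          - apply Hsphi. lra.
          - apply sec1. apply nbconv; auto. apply Hnbs; lra. }
        (* The local section near the end of the ray and the old section elsewhere; [Hagree] makes
           the seam invisible. *)
        set (K := fun x => if Rlt_dec (Cmod (x - ws)) e2 then phi x else k1 x).
        set (e3 := Rmin e1 (e2 / 2)). assert (He3 : 0 < e3) by (apply Rmin_glb_lt; lra).
        assert (e31 : e3 <= e1) by apply Rmin_l. assert (e32 : e3 <= e2 / 2) by apply Rmin_r.
        assert (Ksec1 : forall x, Cmod (x - ws) < e2 -> section_at f Om K x).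
        { intros x Hx. destruct (Hsphi x ltac:(lra)) as [c [o g]].
          assert (EK : K x = phi x) by (unfold K; destruct (Rlt_dec _ _); lra || reflexivity).
          split; [|rewrite EK; auto]. apply ccont_ext_loc with (f := phi); auto.
          exists (e2 - Cmod (x - ws)). split. lra. intros y Hy. pose proof (Cmod_sub_trans y x ws).
          unfold K. destruct (Rlt_dec _ _); lra || reflexivity. }
        assert (Ksec2 : forall x, nb w s1 e1 x -> section_at f Om K x).
        { intros x Hx. assert (EK : forall y, nb w s1 e1 y -> K y = k1 y).
          { intros y Hy. unfold K. destruct (Rlt_dec _ _); auto. }
          destruct (sec1 x Hx) as [c [o g]]. split; [|rewrite (EK x Hx); auto].
          apply ccont_ext_loc with (f := k1); auto. destruct Hx as [s [Hs Hxs]].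
          exists (e1 - Cmod (x - (w0 + RtoC s * (w - w0)))). split. lra. intros y Hy. symmetry. apply EK.
          exists s. split; auto. pose proof (Cmod_sub_trans y x (w0 + RtoC s * (w - w0))). lra. }
        exists (e3, K). split; [exact He3|]. split.
        * simpl. unfold K. destruct (Rlt_dec _ _) as [Hlt|]; auto.
          rewrite Hagree; auto. replace w0 with (w0 + RtoC 0 * (w - w0))%C at 1 by ring. apply Hnbs; lra.
        * simpl. intros x [s [Hs Hx]]. destruct (Rle_dec s s1) as [Hss|Hss].
          { apply Ksec2. exists s. split. lra. lra. }
          apply Ksec1. pose proof (Cmod_sub_trans x (w0 + RtoC s * (w - w0)) ws) as T.
          assert (Cmod (w0 + RtoC s * (w - w0) - ws) <= Cmod (p1 - ws)).
          { unfold p1, ws. rewrite !Cmod_segment. apply Rmult_le_compat_r. apply Cmod_ge_0.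
            rewrite <- (Rabs_Ropp (s - t)), <- (Rabs_Ropp (s1 - t)), !Rabs_pos_eq by lra. lra. }
          lra.
    - intros t Ht [[e k] [He [Hi Hs]]]. simpl in *.
      destruct (segment_close w0 w (e / 2) t) as [d [Hd Hc]]. lra.
      exists d. split; auto. intros s Hst Hs1. exists (e / 2, k). split. simpl; lra. split; auto. simpl.
      intros x [u [Hu Hx]]. apply Hs. destruct (Rle_dec u t) as [Hut|Hut].
      + exists u. split; lra.
      + exists t. split. lra. pose proof (Cmod_sub_trans x (w0 + RtoC u * (w - w0)) (w0 + RtoC t * (w - w0))) as T.
        specialize (Hc u ltac:(apply Rabs_def1; lra)). lra. }
  set (ek := fun w => epsilon (inhabits (0, (fun z => z) : C -> C)) (good w 1)).
  assert (Hek : forall w, D w -> good w 1 (ek w)).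
  { intros w Hw. exact (epsilon_spec _ _ (Hray w Hw 1 ltac:(lra))). }
  set (psi := fun w => snd (ek w) w).
  assert (E1 : forall w : C, (w0 + 1 * (w - w0))%C = w) by (intros w; ring).
  assert (Hpsi : forall w, D w -> section_at f Om psi w).
  { intros w Hw. destruct (Hek w Hw) as [He [Hi Hs]]. set (e := fst (ek w)) in *. set (k := snd (ek w)) in *.
    destruct (Hopen w Hw) as [eD [HeD HDb]].
    (* [psi] takes its value at each point from a different section. Near [w] it agrees with the
       section [k] of the ray to [w], because the neighbourhood of that ray contains the segments
       from [w0] to all nearby points. *)
    assert (Hnear : forall x, Cmod (x - w) < Rmin e eD -> k x = psi x).
    { intros x Hx. pose proof (Rmin_l e eD). pose proof (Rmin_r e eD).
      assert (HDx : D x) by (apply HDb; unfold disk; lra).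
      destruct (Hek x HDx) as [He' [Hi' Hs']]. unfold psi.
      apply (section_unique f Om D k (snd (ek x)) w0); auto; [|congruence].
      intros t Ht. split; [|split].
      - apply Hconv; auto.
      - apply Hs. exists t. split; auto.
        replace (w0 + t * (x - w0) - (w0 + t * (w - w0)))%C with (t * (x - w))%C by ring.
        rewrite Cmod_mult, Cmod_R, Rabs_pos_eq by lra. pose proof (Cmod_ge_0 (x - w)). nra.
      - apply Hs'. apply Hnbs; auto. }
    destruct (Hs w) as [c [o g]]. { rewrite <- (E1 w) at 2. apply Hnbs; auto. lra. }
    assert (Ew : k w = psi w) by reflexivity.
    split; [|rewrite <- Ew; auto]. apply ccont_ext_loc with (f := k); auto.
    exists (Rmin e eD). split; auto. apply Rmin_glb_lt; auto. }
  exists psi. split. apply Hek; auto.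
  intros w Hw. destruct (Hpsi w Hw) as [c [o g]]. split; auto. split; auto.
  destruct (HL (psi w) o) as [[R [HR Hx]] Hl]. rewrite g; auto.
  eapply cderiv_eq; [|apply (cderiv_lift f (fun x => x) psi w (dC f (psi w)) 1); auto].
  - field. auto.
  - apply dC_spec, Hx. rewrite Cmod_sub_0; auto.
  - apply cderiv_id.
  - destruct (Hopen w Hw) as [eD [HeD HDb]]. exists eD. split; auto. intros x Hxd. apply Hpsi, HDb. exact Hxd.
Qed.

(** * Poles and asymptotic values *)

Lemma pole_local f p (m : nat) : is_pole f p m -> exists d c g, 0 < d /\ d <= 1 /\ 0 < c /\ g p <> 0%C /\
  (forall w, Cmod (w - p) < d -> cholo g w) /\
  (forall w, Cmod (w - p) < d -> w <> p -> cholo f w /\ c <= Cmod (g w) /\ f w = (g w / Cpow (w - p) m)%C).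
Proof.
  intros [Hm [r [g [Hr [Hg [Hgp Hf]]]]]].
  assert (Hg' : forall w, Cmod (w - p) < r -> cholo g w) by (intros w Hw; apply holo_at_cholo, Hg; exact Hw).
  assert (pg : 0 < Cmod (g p)) by (apply Cmod_gt_0; auto).
  destruct (cholo_ccont g p (Hg' p ltac:(rewrite Cmod_sub_0; auto)) (Cmod (g p) / 2)) as [d1 [Hd1 Hc]]. lra.
  set (d := Rmin 1 (Rmin r d1)). assert (Hd : 0 < d) by (repeat apply Rmin_glb_lt; lra).
  assert (d1' : d <= 1) by apply Rmin_l.
  assert (dr : d <= r) by (eapply Rle_trans; [apply Rmin_r|apply Rmin_l]).
  assert (dd : d <= d1) by (eapply Rle_trans; [apply Rmin_r|apply Rmin_r]).
  exists d, (Cmod (g p) / 2), g. repeat split; auto; try lra.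
  - intros w Hw. apply Hg'. lra.
  - apply cholo_ext_loc with (f := fun w => (g w / Cpow (w - p) m)%C).
    + pose proof (Cmod_sub_pos w p H0). exists (Rmin (r - Cmod (w - p)) (Cmod (w - p))). split.
      apply Rmin_glb_lt; lra. intros x Hx. pose proof (Rmin_l (r - Cmod (w - p)) (Cmod (w - p))).
      pose proof (Rmin_r (r - Cmod (w - p)) (Cmod (w - p))).
      pose proof (Cmod_sub_trans x w p). pose proof (Cmod_sub_trans w x p). rewrite (Cmod_sub_sym w x) in H5.
      symmetry. apply Hf. unfold disk; lra. intros ->. rewrite Cmod_sub_sym in Hx. lra.
    + apply cholo_div. apply Cpow_nz, Cminus_eq_contra; auto. apply Hg'. lra.
      apply (cholo_pow (fun w => w - p)%C). apply cholo_minus. apply cholo_id. apply cholo_const.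
  - specialize (Hc w ltac:(lra)). pose proof (Cmod_sub_ge (g p) (g w)). rewrite (Cmod_sub_sym (g p)) in H1. lra.
  - apply Hf; auto. unfold disk. lra.
Qed.

Lemma pow_le_self (x : R) (m : nat) : (0 < m)%nat -> 0 <= x <= 1 -> x ^ m <= x.
Proof.
  intros Hm Hx. destruct m. lia. simpl. rewrite <- (Rmult_1_r x) at 3.
  apply Rmult_le_compat_l. lra. rewrite <- (pow1 m). apply pow_incr. lra.
Qed.

Lemma pole_blowup f p (m : nat) M : is_pole f p m -> exists d, 0 < d /\ forall w, Cmod (w - p) < d -> w <> p ->
  cholo f w /\ M < Cmod (f w).
Proof.
  intros Hp. destruct (pole_local f p m Hp) as [d [c [g (Hd & Hd1 & Hc & _ & _ & Hf)]]].
  destruct Hp as [Hm _].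
  exists (Rmin d (c / (Rabs M + 1))). pose proof (Rabs_pos M). split.
  { apply Rmin_glb_lt; auto. apply Rdiv_lt_0_compat; lra. }
  intros w Hw Hwp. pose proof (Rmin_l d (c / (Rabs M + 1))). pose proof (Rmin_r d (c / (Rabs M + 1))).
  destruct (Hf w ltac:(lra) Hwp) as [H2 [H3 E]]. split; auto. rewrite E.
  assert (Hn : (w - p)%C <> 0%C) by (apply Cminus_eq_contra; auto).
  rewrite Cmod_div, Cmod_pow by (apply Cpow_nz; auto). apply Cmod_gt_0 in Hn.
  set (x := Cmod (w - p)) in *. assert (x ^ m <= x) by (apply pow_le_self; auto; lra).
  assert (0 < x ^ m) by (apply pow_lt; auto).
  assert (Hx : x < c / (Rabs M + 1)) by lra.
  apply (Rmult_lt_compat_r (Rabs M + 1)) in Hx; [|lra].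
  replace (c / (Rabs M + 1) * (Rabs M + 1)) with c in Hx by (field; lra).
  apply Rmult_lt_reg_r with (x ^ m); auto. unfold Rdiv. rewrite Rmult_assoc, Rinv_l by lra.
  pose proof (Rle_abs M). nra.
Qed.

Lemma exists_near (p : C) (d : R) : 0 < d -> exists w, Cmod (w - p) < d /\ w <> p.
Proof.
  intros Hd. exists (p + RtoC (d / 2))%C.
  assert (E : Cmod (p + RtoC (d / 2) - p) = d / 2).
  { replace (p + RtoC (d / 2) - p)%C with (RtoC (d / 2)) by ring. rewrite Cmod_R. apply Rabs_pos_eq. lra. }
  split. lra. intros K. rewrite K, Cmod_sub_0 in E. lra.
Qed.

Lemma cholo_not_pole f z : cholo f z -> ~ poles f z.
Proof.
  intros H [m Hm]. destruct (cholo_ccont _ _ H 1 Rlt_0_1) as [d [Hd Hc]].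
  destruct (pole_blowup f z m (Cmod (f z) + 1) Hm) as [d' [Hd' Hb]].
  destruct (exists_near z (Rmin d d')) as [w [Hw Hwz]]. apply Rmin_glb_lt; auto.
  pose proof (Rmin_l d d'). pose proof (Rmin_r d d').
  specialize (Hc w ltac:(lra)). destruct (Hb w ltac:(lra) Hwz) as [_ K].
  pose proof (Cmod_sub_ge (f w) (f z)). lra.
Qed.

Lemma meromorphic_cholo f z : meromorphic f -> ~ poles f z -> cholo f z.
Proof. intros H Hz. apply holo_at_cholo. auto. Qed.

(** [f] is bounded near [z] by continuity and unbounded near every pole, so no pole lies close to
    [z]. *)
Lemma nonpole_open f z : meromorphic f -> ~ poles f z ->
  exists d, 0 < d /\ forall w, Cmod (w - z) < d -> ~ poles f w /\ cholo f w.
Proof.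
  intros Hf Hz. destruct (cholo_ccont _ _ (meromorphic_cholo f z Hf Hz) 1 Rlt_0_1) as [d [Hd Hc]].
  exists d. split; auto.
  assert (K : forall w, Cmod (w - z) < d -> ~ poles f w).
  { intros w Hw [m Hm]. destruct (pole_blowup f w m (Cmod (f z) + 1) Hm) as [d' [Hd' Hb]].
    destruct (exists_near w (Rmin (d - Cmod (w - z)) d')) as [x [Hx Hxw]]. apply Rmin_glb_lt; lra.
    pose proof (Rmin_l (d - Cmod (w - z)) d'). pose proof (Rmin_r (d - Cmod (w - z)) d').
    pose proof (Cmod_sub_trans x w z). specialize (Hc x ltac:(lra)).
    destruct (Hb x ltac:(lra) Hxw) as [_ K]. pose proof (Cmod_sub_ge (f x) (f z)). lra. }
  intros w Hw. split; auto. apply meromorphic_cholo; auto.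
Qed.

(** If every point had a neighbourhood that the path eventually leaves for good, compactness would
    make it leave the whole disc. *)
Lemma cluster_point (gm : R -> C) (M : R) :
  (forall t0, t0 < 1 -> exists t, t0 < t < 1 /\ 0 <= t /\ Cmod (gm t) <= M) ->
  exists z, forall e t0, 0 < e -> t0 < 1 -> exists t, t0 < t < 1 /\ 0 <= t /\ Cmod (gm t - z) < e.
Proof.
  intros H. apply NNPP. intros Hn.
  assert (K : exists t0, t0 < 1 /\ forall t, t0 < t < 1 -> 0 <= t -> ~ Cmod (gm t - 0) <= M).
  { apply (disc_compact (fun A => exists t0, t0 < 1 /\ forall t, t0 < t < 1 -> 0 <= t -> ~ A (gm t)) 0 M).
    - exists 0. split. lra. tauto.
    - intros A B [t1 [H1 HA]] [t2 [H2 HB]]. exists (Rmax t1 t2). split. apply Rmax_lub_lt; auto.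
      intros t Ht Ht0. pose proof (Rmax_l t1 t2). pose proof (Rmax_r t1 t2).
      intros [K|K]; [apply (HA t)|apply (HB t)]; auto; lra.
    - intros A B HAB [t1 [H1 HB]]. exists t1. split; auto. intros t Ht Ht0 K. apply (HB t); auto.
    - intros z _. apply NNPP. intros Hz. apply Hn. exists z. intros e t0 He Ht0. apply NNPP. intros Hno.
      apply Hz. exists e. split; auto. exists t0. split; auto. intros t Ht Ht' K. apply Hno. exists t. auto. }
  destruct K as [t0 [Ht0 K]]. destruct (H t0 Ht0) as [t [Ht [Ht' Hle]]]. apply (K t Ht Ht').
  replace (gm t - 0)%C with (gm t) by ring. exact Hle.
Qed.

Lemma continuous_C_eps (gm : R -> C) (t : R) :
  (forall e, 0 < e -> exists d, 0 < d /\ forall s, Rabs (s - t) < d -> Cmod (gm s - gm t) < e) ->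
  continuous gm t.
Proof.
  intros H P [e He]. destruct (H e (cond_pos e)) as [d [Hd Hs]].
  exists (mkposreal d Hd). intros s Hb. apply He. apply C_NormedModule_mixin_compat1. apply Hs. exact Hb.
Qed.

(** A lift that keeps returning to a bounded set has a cluster point, which is no pole because [f]
    stays bounded along the lift, and which lies over [w] by continuity. Otherwise the lift tends to
    infinity and [w] is an asymptotic value. *)
Lemma lifted_ray_cluster f b S w0 : meromorphic f ->
  (forall w, Cmod (w - b) < S -> ~ sing_set f w) -> 
  forall w (gm : R -> C), Cmod (w - b) < S ->
     (forall t, 0 <= t < 1 -> ~ poles f (gm t) /\ f (gm t) = (w0 + RtoC t * (w - w0))%C) ->
     (forall t, 0 <= t < 1 -> forall e, 0 < e -> exists d, 0 < d /\
        forall s, 0 <= s < 1 -> Rabs (s - t) < d -> Cmod (gm s - gm t) < e) ->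
     exists z, ~ poles f z /\ f z = w /\
       forall e t0, 0 < e -> t0 < 1 -> exists t, t0 < t < 1 /\ 0 <= t /\ Cmod (gm t - z) < e.
Proof.
  intros Hf Hsing w gm Hw Hgm Hcont.
  assert (Hlim : forall e, 0 < e -> exists t0, t0 < 1 /\ forall t, t0 < t < 1 -> 0 <= t -> Cmod (f (gm t) - w) < e).
  { intros e He. destruct (segment_close w0 w e 1 He) as [d [Hd Hc]]. exists (1 - d). split. lra.
    intros t Ht Ht0. destruct (Hgm t ltac:(lra)) as [_ E]. rewrite E.
    specialize (Hc t ltac:(apply Rabs_def1; lra)). replace (w0 + 1 * (w - w0))%C with w in Hc by ring. exact Hc. }
  destruct (classic (exists M, forall t0, t0 < 1 -> exists t, t0 < t < 1 /\ 0 <= t /\ Cmod (gm t) <= M)) as [[M HM]|Hinf].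
  - destruct (cluster_point gm M HM) as [z Hz]. exists z.
    assert (Hnp : ~ poles f z).
    { intros [m Hm]. destruct (pole_blowup f z m (Cmod w + 1) Hm) as [d [Hd Hb]].
      destruct (Hlim 1 Rlt_0_1) as [t0 [Ht0 Hl]]. destruct (Hz d t0 Hd Ht0) as [t [Ht [Ht' Hlt]]].
      assert (Hne : gm t <> z). { intros E. destruct (Hgm t ltac:(lra)) as [K _]. apply K. rewrite E. exists m. exact Hm. }
      destruct (Hb _ Hlt Hne) as [_ K]. specialize (Hl t Ht Ht'). pose proof (Cmod_sub_ge (f (gm t)) w). lra. }
    split; auto. split; auto.
    apply Cmod_sub_eq0. apply Rle_antisym; [|apply Cmod_ge_0]. apply Rnot_lt_le. intros Hlt.
    set (g := Cmod (f z - w)) in *.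
    destruct (cholo_ccont _ _ (meromorphic_cholo f z Hf Hnp) (g / 2)) as [d [Hd Hc]]. lra.
    destruct (Hlim (g / 2)) as [t0 [Ht0 Hl]]. lra.
    destruct (Hz d t0 Hd Ht0) as [t [Ht [Ht' Hlt']]]. specialize (Hc _ Hlt'). specialize (Hl t Ht Ht').
    pose proof (Cmod_sub_trans (f z) (f (gm t)) w) as T. rewrite (Cmod_sub_sym (f z) (f (gm t))) in T. fold g in T. lra.
  - exfalso. apply (Hsing w Hw). right.
    (* Reparametrisation of [0, 1) by the half-line. The absolute value is there because continuity
       at t = 0 is two-sided and the lift is controlled on [0, 1) only. *)
    set (u := fun t => Rabs t / (1 + Rabs t)).
    assert (Hu : forall t, 0 <= u t < 1).
    { intros t. unfold u. pose proof (Rabs_pos t). split. apply Rdiv_le_0_compat; lra.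
      apply Rmult_lt_reg_r with (1 + Rabs t). lra. unfold Rdiv. rewrite Rmult_assoc, Rinv_l by lra. lra. }
    assert (Hu1 : forall t0, t0 < 1 -> exists T, forall t, T < t -> t0 < u t).
    { intros t0 Ht0. exists (Rmax 0 (1 / (1 - t0))). intros t Ht.
      pose proof (Rmax_l 0 (1 / (1 - t0))). pose proof (Rmax_r 0 (1 / (1 - t0))).
      unfold u. rewrite Rabs_pos_eq by lra. apply Rmult_lt_reg_r with (1 + t). lra.
      unfold Rdiv. rewrite Rmult_assoc, Rinv_l by lra.
      assert (K : 1 / (1 - t0) < t) by lra. apply (Rmult_lt_compat_r (1 - t0)) in K; [|lra].
      replace (1 / (1 - t0) * (1 - t0)) with 1 in K by (field; lra). lra. }
    assert (Hulip : forall s t, Rabs (u s - u t) <= Rabs (s - t)).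
    { intros s t. unfold u. pose proof (Rabs_pos s). pose proof (Rabs_pos t).
      replace (Rabs s / (1 + Rabs s) - Rabs t / (1 + Rabs t)) with ((Rabs s - Rabs t) * / ((1 + Rabs s) * (1 + Rabs t))) by (field; lra).
      rewrite Rabs_mult, (Rabs_pos_eq (/ _)) by (left; apply Rinv_0_lt_compat; nra).
      apply Rle_trans with (Rabs (Rabs s - Rabs t) * 1).
      - apply Rmult_le_compat_l. apply Rabs_pos. rewrite <- Rinv_1. apply Rinv_le_contravar. lra. nra.
      - rewrite Rmult_1_r. apply Rabs_triang_inv2. }
    exists (fun t => gm (u t)). split; [|split].
    + intros t _. apply continuous_C_eps. intros e He. destruct (Hcont (u t) (Hu t) e He) as [d [Hd Hc]].
      exists d. split; auto. intros s Hs. apply Hc; auto. eapply Rle_lt_trans; [apply Hulip|exact Hs].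
    + intros P [M HM]. 
      assert (Hn : exists t0, t0 < 1 /\ forall t, t0 < t < 1 -> 0 <= t -> M < Cmod (gm t)).
      { apply NNPP. intros Hno. apply Hinf. exists M. intros t0 Ht0. apply NNPP. intros Hno'. apply Hno.
        exists t0. split; auto. intros t Ht Ht'. apply Rnot_le_lt. intros K. apply Hno'. exists t. auto. }
      destruct Hn as [t0 [Ht0 Hn]]. destruct (Hu1 t0 Ht0) as [T HT]. exists T. intros t Ht. apply HM.
      specialize (HT t Ht). specialize (Hu t). apply Hn; lra.
    + intros P [e He]. destruct (Hlim e (cond_pos e)) as [t0 [Ht0 Hl]]. destruct (Hu1 t0 Ht0) as [T HT].
      exists T. intros t Ht. apply He. apply C_NormedModule_mixin_compat1.
      specialize (HT t Ht). specialize (Hu t). apply Hl; lra.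
Qed.

(** * Branches over a disc free of singular values *)

Definition branch (f : C -> C) (b : C) (S : R) (psi : C -> C) : Prop :=
  forall w, Cmod (w - b) < S -> ~ poles f (psi w) /\ f (psi w) = w /\
    dC f (psi w) <> 0%C /\ cderiv psi w (/ dC f (psi w)).

Lemma nonsing_regular f b S : meromorphic f -> (forall w, Cmod (w - b) < S -> ~ sing_set f w) ->
  locally_regular f (fun z => ~ poles f z) (fun w => Cmod (w - b) < S).
Proof.
  intros Hf Hsing z Hz HD. split.
  - destruct (nonpole_open f z Hf Hz) as [d [Hd Hw]]. exists d. auto.
  - intros E. apply (Hsing _ HD). left. exists z. split; auto. split; auto.
    apply is_derive_cderiv. rewrite <- E. apply dC_spec, meromorphic_cholo; auto.
Qed.

Lemma branch_exists f b S z : meromorphic f -> (forall w, Cmod (w - b) < S -> ~ sing_set f w) ->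
  ~ poles f z -> Cmod (f z - b) < S -> exists psi, branch f b S psi /\ psi (f z) = z.
Proof.
  intros Hf Hsing Hz HD. pose proof (nonsing_regular f b S Hf Hsing) as HL.
  destruct (lifting f (fun z => ~ poles f z) (fun w => Cmod (w - b) < S) (f z) z) as [psi [E Hpsi]]; auto.
  - intros x y t Hx Hy Ht. apply segment_in_disc; auto.
  - intros x Hx. exists (S - Cmod (x - b)). split. lra. unfold disk. intros w Hw. pose proof (Cmod_sub_trans w x b). lra.
  - apply lifted_ray_cluster; auto.
  - exists psi. split; auto. intros w Hw. destruct (Hpsi w Hw) as (h1 & h2 & h3). repeat split; auto.
    apply (HL (psi w)); auto. rewrite h2; auto.
Qed.

Lemma branch_unique f b S psi1 psi2 x y : meromorphic f -> (forall w, Cmod (w - b) < S -> ~ sing_set f w) ->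
  branch f b S psi1 -> branch f b S psi2 -> Cmod (x - b) < S -> Cmod (y - b) < S ->
  psi1 x = psi2 x -> psi1 y = psi2 y.
Proof.
  intros Hf Hsing H1 H2 Hx Hy. apply (section_unique f (fun z => ~ poles f z) (fun w => Cmod (w - b) < S)).
  apply nonsing_regular; auto.
  assert (K : forall psi, branch f b S psi -> forall w, Cmod (w - b) < S -> section_at f (fun z => ~ poles f z) psi w).
  { intros psi Hp w Hw. destruct (Hp w Hw) as (h1 & h2 & h3 & h4). split; [|split]; auto. eapply cderiv_ccont; eauto. }
  intros t Ht. assert (Cmod (x + t * (y - x) - b) < S) by (apply segment_in_disc; auto). auto.
Qed.

Lemma branch_injective f b S psi w w' : branch f b S psi -> Cmod (w - b) < S -> Cmod (w' - b) < S ->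
  psi w = psi w' -> w = w'.
Proof.
  intros Hp Hw Hw' E. destruct (Hp w Hw) as (_ & h1 & _). destruct (Hp w' Hw') as (_ & h2 & _). congruence.
Qed.

(* A branch omits the b-points other than its own centre, so the Koebe bound controls its size. *)
Lemma branch_size f b S : meromorphic f -> 0 < S -> (forall w, Cmod (w - b) < S -> ~ sing_set f w) ->
  exists sg K, 0 < sg /\ sg < S /\ 0 < K /\
    forall psi, branch f b S psi -> forall w, Cmod (w - b) < sg ->
      Cmod (psi w - psi b) <= K * (1 + Cmod (psi b)) * Cmod (w - b).
Proof.
  intros Hf HS Hsing. pose proof PI_RGT_0 as Hpi. pose proof PI2_3_2 as Hpi2.
  set (k := 320 * PI). assert (Hk : 1 < k) by (unfold k, PI2 in *; lra).
  (* [sg] makes 2k/S * sg = 1/2. For the supremum [s] of |psi - z1| over the disc of radius [sg],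
     the Koebe bound then gives s <= |psi b - z1| + s/2. *)
  set (sg := S / (4 * k)). assert (Hsg : 0 < sg) by (unfold sg; apply Rdiv_lt_0_compat; lra).
  assert (HsgS : sg < S / 2).
  { unfold sg. apply Rmult_lt_reg_r with (4 * k). lra. unfold Rdiv. rewrite Rmult_assoc, Rinv_l by lra. nra. }
  assert (Hb0 : forall s, 0 < s -> Cmod (b - b) < s) by (intros s Hs; rewrite Cmod_sub_0; auto).
  (* One reference branch provides the value [z1] that every branch with another centre omits. If
     there is no branch at all, any constants do. *)
  destruct (classic (exists psi, branch f b S psi)) as [[psi1 Hp1]|Hno].
  2: { exists sg, 1. repeat split; try lra. intros psi Hp. exfalso. eauto. }
  set (z1 := psi1 b).
  destruct (ccont_bounded_disc (fun w => psi1 w - z1)%C b sg) as [M [HM HMb]].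
  { intros z Hz. apply cholo_ccont, cholo_minus; [|apply cholo_const]. eexists. apply Hp1. lra. }
  set (K0 := 2 * k / S * 2 * (1 + Cmod z1)).
  assert (HK0 : 0 < K0). { unfold K0. pose proof (Cmod_ge_0 z1). assert (0 < 2 * k / S) by (apply Rdiv_lt_0_compat; lra).
    apply Rmult_lt_0_compat; lra. }
  exists sg, (K0 + M / sg). assert (HMs : 0 < M / sg) by (apply Rdiv_lt_0_compat; lra).
  repeat split; try lra.
  intros psi Hp w Hw. set (z := psi b). pose proof (Cmod_ge_0 z) as Hz0. pose proof (Cmod_ge_0 (w - b)) as Hwb.
  assert (Hhol : forall x, Cmod (x - b) < S -> cholo psi x) by (intros x Hx; eexists; apply Hp; auto).
  destruct (classic (z = z1)) as [E|Hne].
  (* A branch centred at [z1] is the reference branch itself; the summand [M / sg] of the constant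
     is for this case. *)
  - assert (Eq : forall x, Cmod (x - b) < S -> psi x = psi1 x).
    { intros x Hx. apply (branch_unique f b S psi psi1 b x); auto. }
    apply Rle_trans with (M / sg * Cmod (w - b)).
    + rewrite Eq by lra. fold z. rewrite E.
      apply (schwarz (fun x => psi1 x - z1)%C b sg M); auto.
      * intros x Hx. apply cholo_minus; [|apply cholo_const]. eexists. apply Hp1. lra.
      * intros x Hx. apply HMb. lra.
      * unfold z1. ring.
    + apply Rmult_le_compat_r; auto. nra.
  - set (a := Cmod (z - z1)). assert (Ha : a <= (1 + Cmod z1) * (1 + Cmod z)).
    { unfold a. pose proof (Cmod_sub_le z z1). pose proof (Cmod_ge_0 z1). nra. }
    assert (Hder : forall x, Cmod (x - b) < S / 2 -> Cmod (/ dC f (psi x)) <= 2 * k / S * Cmod (psi x - z1)).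
    { intros x Hx. assert (Kb : S / 2 * Cmod (/ dC f (psi x)) <= k * Cmod (psi x - z1)).
      { assert (Hin : forall y, Cmod (y - x) < S / 2 -> Cmod (y - b) < S).
        { intros y Hy. pose proof (Cmod_sub_trans y x b). lra. }
        apply koebe; try lra.
        - intros y Hy. auto.
        - intros y y' Hy Hy'. apply (branch_injective f b S); auto.
        - intros y Hy Ey. destruct (Hp y (Hin y Hy)) as (_ & fy & _). rewrite Ey in fy.
          destruct (Hp1 b (Hb0 S HS)) as (_ & fb & _). fold z1 in fb. rewrite fb in fy. subst y. auto.
        - apply Hp. lra. }
      apply Rmult_le_reg_l with (S / 2). lra.
      replace (S / 2 * (2 * k / S * Cmod (psi x - z1))) with (k * Cmod (psi x - z1)) by (field; lra). exact Kb. }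
    destruct (completeness (fun v => exists x, Cmod (x - b) < sg /\ v = Cmod (psi x - z1))) as [s [Hs1 Hs2]].
    { destruct (ccont_bounded_disc (fun w => psi w - z1)%C b sg) as [M' [HM' HMb']].
      { intros x Hx. apply cholo_ccont, cholo_minus; [|apply cholo_const]. apply Hhol. lra. }
      exists M'. intros v [x [Hx ->]]. apply HMb'. lra. }
    { exists a, b. split. apply Hb0; auto. reflexivity. }
    assert (Hs0 : 0 <= s). { apply Rle_trans with a. apply Cmod_ge_0. apply Hs1. exists b. split. apply Hb0; auto. reflexivity. }
    assert (Hl : forall x, Cmod (x - b) < sg -> Cmod (psi x - z) <= 2 * k / S * s * Cmod (x - b)).
    { intros x Hx. apply (mean_value_disc psi b sg); auto. intros y Hy. eexists. split. apply Hp. lra.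
      eapply Rle_trans. apply Hder. lra. apply Rmult_le_compat_l. apply Rdiv_le_0_compat; lra. apply Hs1. exists y. auto. }
    assert (Hs : s <= 2 * a).
    { assert (s <= a + s / 2); [|lra]. apply Hs2. intros v [x [Hx ->]].
      pose proof (Cmod_sub_trans (psi x) z z1) as T. fold a in T. specialize (Hl x Hx).
      assert (2 * k / S * s * Cmod (x - b) <= 2 * k / S * s * sg).
      { apply Rmult_le_compat_l; [|lra]. apply Rmult_le_pos; auto. apply Rdiv_le_0_compat; lra. }
      replace (2 * k / S * s * sg) with (s / 2) in H by (unfold sg; field; lra). lra. }
    specialize (Hl w Hw). eapply Rle_trans. exact Hl. apply Rmult_le_compat_r; auto.
    assert (0 < 2 * k / S) by (apply Rdiv_lt_0_compat; lra).
    assert (2 * k / S * s <= K0 * (1 + Cmod z)).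
    { unfold K0. replace (2 * k / S * 2 * (1 + Cmod z1) * (1 + Cmod z)) with (2 * k / S * (2 * ((1 + Cmod z1) * (1 + Cmod z)))) by ring.
      apply Rmult_le_compat_l; lra. }
    nra.
Qed.

(** * Inverse branches at a pole *)

Lemma Rpower_root_le (x v : R) (q : nat) : (0 < q)%nat -> 0 < x -> x ^ q <= v -> x <= Rpower v (/ INR q).
Proof.
  intros Hq Hx H. assert (Hq0 : 0 < INR q) by (apply lt_0_INR; auto).
  assert (Hxq : 0 < x ^ q) by (apply pow_lt; auto).
  replace x with (Rpower (x ^ q) (/ INR q)).
  - apply Rle_Rpower_l. left. apply Rinv_0_lt_compat; auto. lra.
  - rewrite <- Rpower_pow by auto. rewrite Rpower_mult, Rinv_r by lra. apply Rpower_1; auto.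
Qed.

(** For f = g/(w - b)^q the numerator of f' over (w - b)^(q+1) is g'(w)(w - b) - q g(w). Close to
    [b] the second term dominates, so f' does not vanish and is at most of order |w -
    b|^(-(q+1)). *)
Lemma pole_derivative f b (q : nat) : is_pole f b q -> exists d C0 c0, 0 < d /\ 0 < C0 /\ 0 < c0 /\
  forall w, Cmod (w - b) < d -> w <> b ->
    cholo f w /\ dC f w <> 0%C /\ Cmod (dC f w) <= C0 / Cmod (w - b) ^ (S q) /\
    c0 / Cmod (w - b) ^ q <= Cmod (f w) /\ Cmod (f w) <= C0 / Cmod (w - b) ^ q.
Proof.
  intros Hp. destruct (pole_local f b q Hp) as [d [c [g (Hd & Hd1 & Hc & Hgb & Hg & Hf)]]].
  destruct Hp as [Hq _]. assert (Hq1 : 1 <= INR q) by (apply (le_INR 1); lia).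
  destruct (ccont_bounded_disc g b (d / 2)) as [G [HG HGb]].
  { intros z Hz. apply cholo_ccont, Hg. lra. }
  set (G1 := 2 * G / (d / 4)). assert (HG1 : 0 < G1) by (unfold G1; apply Rdiv_lt_0_compat; lra).
  set (e := Rmin (d / 4) (c / (2 * G1))).
  assert (He : 0 < e) by (apply Rmin_glb_lt; [lra|apply Rdiv_lt_0_compat; lra]).
  assert (e1 : e <= d / 4) by apply Rmin_l. assert (e2 : e <= c / (2 * G1)) by apply Rmin_r.
  exists e, (G1 + INR q * G + G), c. assert (0 < INR q * G) by (apply Rmult_lt_0_compat; lra).
  split; [exact He|]. split. lra. split. lra.
  intros w Hw Hwb. destruct (Hf w ltac:(lra) Hwb) as [Hfw [Hcg E]].
  set (x := Cmod (w - b)) in *. assert (Hx : 0 < x) by (apply Cmod_sub_pos; auto).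
  assert (Hn : (w - b)%C <> 0%C) by (apply Cminus_eq_contra; auto).
  assert (Hxq : 0 < x ^ q) by (apply pow_lt; auto).
  assert (HGw : Cmod (g w) <= G) by (apply HGb; fold x; lra).
  destruct (Hg w ltac:(fold x; lra)) as [l Hl].
  assert (Hl1 : Cmod l <= G1).
  { apply (cauchy_estimate g w 0 l (d / 4) G); auto. lra.
    - intros z Hz. apply Hg. pose proof (Cmod_sub_trans z w b) as T. fold x in T. lra.
    - intros z Hz. replace (g z - 0)%C with (g z) by ring. apply HGb. pose proof (Cmod_sub_trans z w b) as T. fold x in T. lra. }
  assert (Hnq : Cpow (w - b) q <> 0%C) by (apply Cpow_nz; auto).
  assert (Hdf : cderiv f w ((l * (w - b) - INR q * g w) / Cpow (w - b) (S q))).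
  { apply cderiv_ext_loc with (f := fun w => (g w / Cpow (w - b) q)%C).
    - exists (Rmin (d - x) x). split. apply Rmin_glb_lt; lra. intros y Hy.
      pose proof (Rmin_l (d - x) x). pose proof (Rmin_r (d - x) x). pose proof (Cmod_sub_trans y w b) as T. fold x in T.
      symmetry. apply Hf. lra. intros ->. rewrite Cmod_sub_sym in Hy. fold x in Hy. lra.
    - assert (Hpw : cderiv (fun w => Cpow (w - b) q) w (INR q * Cpow (w - b) (pred q) * 1)).
      { apply (cderiv_pow (fun w => w - b)%C). eapply cderiv_eq; [|apply cderiv_minus; [apply cderiv_id|apply cderiv_const]]. ring. }
      eapply cderiv_eq; [|apply (cderiv_div g (fun w => Cpow (w - b) q)); eauto].
      destruct q as [|q']. lia. simpl pred. simpl Cpow in *. field.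
      assert (Cpow (w - b) q' <> 0%C) by (apply Cpow_nz; auto). split; auto. }
  rewrite (dC_eq _ _ _ Hdf).
  assert (HnS : Cpow (w - b) (S q) <> 0%C) by (apply Cpow_nz; auto).
  assert (HxS : 0 < x ^ S q) by (apply pow_lt; auto).
  assert (Hsmall : Cmod l * x < c).
  { apply Rle_lt_trans with (G1 * (c / (2 * G1))).
    - apply Rmult_le_compat; try lra. apply Cmod_ge_0.
    - replace (G1 * (c / (2 * G1))) with (c / 2) by (field; lra). lra. }
  split; [exact Hfw|]. split; [|split; [|split]].
  - intros K. assert (N0 : (l * (w - b) - INR q * g w)%C = 0%C).
    { rewrite <- (Cmult_0_l (Cpow (w - b) (S q))), <- K. field. exact HnS. }
    pose proof (Cmod_sub_ge (INR q * g w) (l * (w - b))) as T. rewrite Cmod_sub_sym, N0, Cmod_0, !Cmod_mult in T.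
    fold x in T. rewrite Cmod_R, Rabs_pos_eq in T by lra. nra.
  - rewrite Cmod_div, Cmod_pow by auto. fold x. unfold Rdiv. apply Rmult_le_compat_r. left. apply Rinv_0_lt_compat; auto.
    eapply Rle_trans. apply Cmod_sub_le. rewrite !Cmod_mult. fold x. rewrite Cmod_R, Rabs_pos_eq by lra.
    assert (Cmod l * x <= G1 * 1). { apply Rmult_le_compat; try lra. apply Cmod_ge_0. }
    assert (INR q * Cmod (g w) <= INR q * G) by (apply Rmult_le_compat_l; lra). lra.
  - rewrite E, Cmod_div, Cmod_pow by auto. fold x. unfold Rdiv. apply Rmult_le_compat_r. left. apply Rinv_0_lt_compat; auto. auto.
  - rewrite E, Cmod_div, Cmod_pow by auto. fold x. unfold Rdiv. apply Rmult_le_compat_r. left. apply Rinv_0_lt_compat; auto. lra.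
Qed.

(** 1/f = (w - b)^q / g vanishes at [b], so [disc_covering] makes it take all small values near [b];
    their reciprocals are the large values of [f]. *)
Lemma pole_value f b (q : nat) e : is_pole f b q -> 0 < e -> exists R1, 0 < R1 /\
  forall zt, R1 < Cmod zt -> exists w, Cmod (w - b) < e /\ w <> b /\ f w = zt.
Proof.
  intros Hp He. destruct (pole_local f b q Hp) as [d [c [g (Hd & Hd1 & Hc & Hgb & Hg & Hf)]]].
  destruct Hp as [Hq _].
  assert (Hg0 : forall w, Cmod (w - b) < d -> g w <> 0%C).
  { intros w Hw. destruct (classic (w = b)) as [->|Hwb]; auto. apply Cmod_gt_0. destruct (Hf w Hw Hwb) as [_ [K _]]. lra. }
  set (r := Rmin e d / 2). assert (Hr : 0 < r) by (unfold r; assert (0 < Rmin e d) by (apply Rmin_glb_lt; auto); lra).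
  assert (re : r < e) by (unfold r; pose proof (Rmin_l e d); lra).
  assert (rd : r < d) by (unfold r; pose proof (Rmin_r e d); assert (0 < Rmin e d) by (apply Rmin_glb_lt; auto); lra).
  destruct (ccont_bounded_disc g b r) as [G [HG HGb]].
  { intros z Hz. apply cholo_ccont, Hg. lra. }
  set (F := fun w => (Cpow (w - b) q / g w)%C).
  assert (Fb : F b = 0%C).
  { unfold F. destruct q. lia. simpl. replace (b - b)%C with (RtoC 0) by ring. field. apply Hg0. rewrite Cmod_sub_0; auto. }
  set (m := r ^ q / G). assert (Hm : 0 < m) by (unfold m; apply Rdiv_lt_0_compat; auto; apply pow_lt; auto).
  exists (2 / m). split. apply Rdiv_lt_0_compat; lra.
  intros zt Hzt. assert (Hz0 : 0 < Cmod zt) by (assert (0 < 2 / m) by (apply Rdiv_lt_0_compat; lra); lra).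
  assert (Hzn : zt <> 0%C) by (apply Cmod_gt_0; auto).
  destruct (disc_covering F b (/ zt) r m) as [w [Hw Ew]]; auto.
  - intros z Hz. unfold F. apply cholo_div. apply Hg0; lra. apply (cholo_pow (fun w => w - b)%C).
    apply cholo_minus. apply cholo_id. apply cholo_const. apply Hg; lra.
  - intros z Hz. rewrite Fb. replace (F z - 0)%C with (F z) by ring. unfold F.
    assert (K : g z <> 0%C) by (apply Hg0; lra). rewrite Cmod_div, Cmod_pow, Hz by auto. unfold m, Rdiv.
    apply Rmult_le_compat_l. apply pow_le; lra. apply Rinv_le_contravar. apply Cmod_gt_0; auto. apply HGb. lra.
  - rewrite Fb. replace (/ zt - 0)%C with (/ zt)%C by ring. rewrite Cmod_inv by auto.
    apply Rinv_lt_contravar in Hzt. replace (/ (2 / m)) with (m / 2) in Hzt by (field; lra). exact Hzt.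
    apply Rmult_lt_0_compat; auto. apply Rdiv_lt_0_compat; lra.
  - assert (Hwb : w <> b). { intros ->. rewrite Fb in Ew. apply (f_equal Cmod) in Ew. rewrite Cmod_0, Cmod_inv in Ew by auto.
      assert (0 < / Cmod zt) by (apply Rinv_0_lt_compat; auto). lra. }
    exists w. split. lra. split; auto. destruct (Hf w ltac:(lra) Hwb) as [_ [_ E]]. rewrite E.
    assert (K : g w <> 0%C) by (apply Hg0; lra).
    assert (K' : Cpow (w - b) q <> 0%C) by (apply Cpow_nz, Cminus_eq_contra; auto).
    replace zt with (/ F w)%C. unfold F. field. auto. rewrite Ew. field. auto.
Qed.

(** [lifting] applies with [Om] a punctured disc at the pole and [D] the disc of radius |zt|/2 about
    [zt]: a limit of lifts is neither the pole, where [f] blows up, nor on the outer circle, where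
    |f| is too small. *)
Lemma pole_branch f b (q : nat) e0 : meromorphic f -> is_pole f b q -> 0 < e0 ->
  exists R1 c3, 0 < R1 /\ 0 < c3 /\ forall zt, R1 <= Cmod zt -> exists chi, forall y, Cmod (y - zt) < Cmod zt / 2 ->
    Cmod (chi y - b) < e0 /\ ~ poles f (chi y) /\ f (chi y) = y /\
    exists l, cderiv chi y l /\ l <> 0%C /\ c3 * Rpower (Cmod y) (- (1 + / INR q)) <= Cmod l.
Proof.
  intros Hf Hp He0. destruct (pole_derivative f b q Hp) as [d [C0 [c0 (Hd & HC0 & Hc0 & HF)]]].
  assert (Hq : (0 < q)%nat) by apply Hp. assert (Hq0 : 0 < INR q) by (apply lt_0_INR; auto).
  set (e := Rmin d e0 / 2). assert (Hm : 0 < Rmin d e0) by (apply Rmin_glb_lt; auto).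
  pose proof (Rmin_l d e0). pose proof (Rmin_r d e0).
  assert (He : 0 < e) by (unfold e; lra). assert (ed : e < d) by (unfold e; lra). assert (ee0 : e < e0) by (unfold e; lra).
  destruct (pole_value f b q e Hp He) as [Rv [HRv Hval]].
  (* [B] bounds |f| on the circle |w - b| = e, and all values over the disc about [zt] exceed [B],
     so no lift can escape through that circle. *)
  set (B := C0 / e ^ q). assert (HB : 0 < B) by (unfold B; apply Rdiv_lt_0_compat; auto; apply pow_lt; auto).
  set (R1 := Rv + 2 * B + 1).
  set (c3 := Rpower c0 (1 + / INR q) / C0).
  assert (Hc3 : 0 < c3) by (unfold c3; apply Rdiv_lt_0_compat; auto; apply exp_pos).
  exists R1, c3. split. unfold R1; lra. split; auto.
  intros zt Hzt. destruct (Hval zt ltac:(unfold R1 in Hzt; lra)) as [x0 [Hx0 [Hx0b Ex0]]].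
  set (Om := fun w => w <> b /\ Cmod (w - b) < e). set (D := fun y => Cmod (y - zt) < Cmod zt / 2).
  assert (Hzt0 : 0 < Cmod zt / 2) by (unfold R1 in Hzt; lra).
  assert (HL : locally_regular f Om D).
  { intros z [Hzb Hz] _. split.
    - assert (0 < Cmod (z - b)) by (apply Cmod_sub_pos; auto).
      exists (Rmin (e - Cmod (z - b)) (Cmod (z - b))). split. apply Rmin_glb_lt; lra.
      intros x Hx. pose proof (Rmin_l (e - Cmod (z - b)) (Cmod (z - b))). pose proof (Rmin_r (e - Cmod (z - b)) (Cmod (z - b))).
      pose proof (Cmod_sub_trans x z b).
      assert (Hxb : x <> b) by (intros ->; rewrite Cmod_sub_sym in Hx; lra).
      split. split; auto; lra. apply HF; auto. lra.
    - apply HF; auto. lra. }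
  destruct (lifting f Om D zt x0) as [chi [_ Hchi]]; auto.
  - intros x y t Hx Hy Ht. apply segment_in_disc; auto.
  - intros x Hx. exists (Cmod zt / 2 - Cmod (x - zt)). split. unfold D in Hx; lra. unfold disk, D. intros w Hw. pose proof (Cmod_sub_trans w x zt). lra.
  - intros w gm Hw Hgm Hcont.
    assert (HwB : B < Cmod w).
    { pose proof (Cmod_sub_ge zt w) as T. rewrite Cmod_sub_sym in T. unfold D in Hw. unfold R1 in Hzt. lra. }
    assert (Hlim : forall e, 0 < e -> exists t0, t0 < 1 /\ forall t, t0 < t < 1 -> 0 <= t -> Cmod (f (gm t) - w) < e).
    { intros e' He'. destruct (segment_close zt w e' 1 He') as [d' [Hd' Hc]]. exists (1 - d'). split. lra.
      intros t Ht Ht0. destruct (Hgm t ltac:(lra)) as [_ E]. rewrite E.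
      specialize (Hc t ltac:(apply Rabs_def1; lra)). replace (zt + 1 * (w - zt))%C with w in Hc by ring. exact Hc. }
    destruct (cluster_point gm (Cmod b + e)) as [z Hz].
    { intros t0 Ht0. exists (Rmax ((t0 + 1) / 2) 0). pose proof (Rmax_l ((t0 + 1) / 2) 0). pose proof (Rmax_r ((t0 + 1) / 2) 0).
      assert (Rmax ((t0 + 1) / 2) 0 < 1) by (apply Rmax_lub_lt; lra).
      split. lra. split. lra. destruct (Hgm (Rmax ((t0 + 1) / 2) 0) ltac:(lra)) as [[_ K] _].
      pose proof (Cmod_sub_ge (gm (Rmax ((t0 + 1) / 2) 0)) b). lra. }
    assert (Hzb : z <> b).
    { intros ->. destruct (pole_blowup f b q (Cmod w + 1) Hp) as [d' [Hd' Hb]].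
      destruct (Hlim 1 Rlt_0_1) as [t0 [Ht0 Hl]]. destruct (Hz d' t0 Hd' Ht0) as [t [Ht [Ht' Hlt]]].
      destruct (Hgm t ltac:(lra)) as [[K1 _] _]. destruct (Hb _ Hlt K1) as [_ K2].
      specialize (Hl t Ht Ht'). pose proof (Cmod_sub_ge (f (gm t)) w). lra. }
    assert (Hze : Cmod (z - b) <= e).
    { apply Rnot_lt_le. intros K. destruct (Hz (Cmod (z - b) - e) 0 ltac:(lra) ltac:(lra)) as [t [Ht [Ht' Hlt]]].
      destruct (Hgm t ltac:(lra)) as [[_ K1] _]. pose proof (Cmod_sub_trans z (gm t) b) as T.
      rewrite (Cmod_sub_sym z (gm t)) in T. lra. }
    destruct (HF z ltac:(lra) Hzb) as (Hfz & _ & _ & _ & Hup).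
    assert (Efz : f z = w).
    { apply Cmod_sub_eq0. apply Rle_antisym; [|apply Cmod_ge_0]. apply Rnot_lt_le. intros Hlt.
      set (g := Cmod (f z - w)) in *.
      destruct (cholo_ccont _ _ Hfz (g / 2)) as [d' [Hd' Hc]]. lra.
      destruct (Hlim (g / 2)) as [t0 [Ht0 Hl]]. lra.
      destruct (Hz d' t0 Hd' Ht0) as [t [Ht [Ht' Hlt']]]. specialize (Hc _ Hlt'). specialize (Hl t Ht Ht').
      pose proof (Cmod_sub_trans (f z) (f (gm t)) w) as T. rewrite (Cmod_sub_sym (f z) (f (gm t))) in T. fold g in T. lra. }
    exists z. split; [|split; auto]. split; auto.
    destruct Hze as [K|K]; auto. exfalso. rewrite K, Efz in Hup. fold B in Hup. lra.
  - unfold D. rewrite Cmod_sub_0. exact Hzt0.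
  - split; auto.
  - exists chi. intros y Hy. destruct (Hchi y Hy) as ([H1 H2] & H3 & H4).
    destruct (HF (chi y) ltac:(lra) H1) as (G1 & G2 & G3 & G4 & _). rewrite H3 in G4.
    split. lra. split. apply cholo_not_pole; auto. split; auto.
    exists (/ dC f (chi y))%C. split; auto. split.
    { apply Cmod_gt_0. rewrite Cmod_inv by auto. apply Rinv_0_lt_compat, Cmod_gt_0; auto. }
    rewrite Cmod_inv by auto. apply Cmod_gt_0 in G2.
    set (t := Cmod (chi y - b)) in *. assert (Ht : 0 < t) by (apply Cmod_sub_pos; auto).
    (* With x = 1/|chi y - b| the lower bound for |f| gives x^q <= |y|/c0, so |f'| <= C0 x^(q+1) is
       at most C0 (|y|/c0)^(1 + 1/q). *)
    set (x := / t). assert (Hx : 0 < x) by (apply Rinv_0_lt_compat; auto).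
    assert (Hy0 : 0 < Cmod y). { assert (0 < c0 / t ^ q) by (apply Rdiv_lt_0_compat; auto; apply pow_lt; auto). lra. }
    assert (Hv : 0 < Cmod y / c0) by (apply Rdiv_lt_0_compat; auto).
    assert (Hxq : x ^ q <= Cmod y / c0).
    { unfold x. rewrite pow_inv. apply Rmult_le_reg_l with c0; auto. replace (c0 * (Cmod y / c0)) with (Cmod y) by (field; lra). exact G4. }
    assert (Hx1 : x <= Rpower (Cmod y / c0) (/ INR q)) by (apply Rpower_root_le; auto).
    assert (HdU : Cmod (dC f (chi y)) <= C0 * Rpower (Cmod y / c0) (1 + / INR q)).
    { eapply Rle_trans. exact G3. replace (C0 / t ^ S q) with (C0 * (x ^ q * x)).
      - rewrite Rpower_plus, Rpower_1 by auto. apply Rmult_le_compat_l. lra.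
        apply Rmult_le_compat; auto. apply pow_le; lra. lra.
      - unfold x. rewrite pow_inv. simpl. field. split. apply pow_nonzero; lra. lra. }
    assert (EP : Rpower (Cmod y / c0) (1 + / INR q) = Rpower (Cmod y) (1 + / INR q) / Rpower c0 (1 + / INR q)).
    { unfold Rdiv. rewrite <- Rpower_mult_distr by (auto; apply Rinv_0_lt_compat; auto).
      f_equal. unfold Rpower. rewrite ln_Rinv by auto. rewrite <- exp_Ropp. f_equal. ring. }
    rewrite EP in HdU. rewrite Rpower_Ropp. unfold c3.
    assert (P1 : 0 < Rpower (Cmod y) (1 + / INR q)) by apply exp_pos.
    assert (P2 : 0 < Rpower c0 (1 + / INR q)) by apply exp_pos.
    replace (Rpower c0 (1 + / INR q) / C0 * / Rpower (Cmod y) (1 + / INR q)) with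
      (/ (C0 * (Rpower (Cmod y) (1 + / INR q) / Rpower c0 (1 + / INR q)))) by (field; lra).
    apply Rinv_le_contravar; auto.
Qed.

(** * Finite sums and weighted words *)

Fixpoint rsum (u : nat -> R) (n : nat) : R :=
  match n with O => 0 | S k => rsum u k + u k end.

Lemma rsum_le u v n : (forall i, (i < n)%nat -> u i <= v i) -> rsum u n <= rsum v n.
Proof.
  induction n; simpl; intros H. lra. apply Rplus_le_compat. apply IHn. intros; apply H; lia. apply H; lia.
Qed.

Lemma rsum_lt u v n : (0 < n)%nat -> (forall i, (i < n)%nat -> u i < v i) -> rsum u n < rsum v n.
Proof.
  intros Hn H. destruct n. lia. simpl.
  assert (rsum u n <= rsum v n) by (apply rsum_le; intros i Hi; left; apply H; lia).
  specialize (H n ltac:(lia)). lra.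
Qed.

Lemma rsum_scal a u n : rsum (fun i => a * u i) n = a * rsum u n.
Proof. induction n; simpl. ring. rewrite IHn. ring. Qed.

Lemma rsum_plus u v n : rsum (fun i => u i + v i) n = rsum u n + rsum v n.
Proof. induction n; simpl. ring. rewrite IHn. ring. Qed.

Lemma rsum_0 n : rsum (fun _ => 0) n = 0.
Proof. induction n; simpl; lra. Qed.

Lemma rsum_exchange (u : nat -> nat -> R) m n :
  rsum (fun i => rsum (fun j => u i j) n) m = rsum (fun j => rsum (fun i => u i j) m) n.
Proof.
  induction m; simpl. rewrite rsum_0. reflexivity. rewrite IHm, <- rsum_plus. reflexivity.
Qed.

Lemma rsum_mono u m m' : (forall i, 0 <= u i) -> (m <= m')%nat -> rsum u m <= rsum u m'.
Proof. intros H Hle. induction Hle. lra. simpl. specialize (H m0). lra. Qed.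

Lemma rsum_term u m i : (forall i, 0 <= u i) -> (i < m)%nat -> u i <= rsum u m.
Proof.
  intros H Hi. apply Rle_trans with (rsum u (S i)). simpl.
  assert (0 <= rsum u i). { apply Rle_trans with (rsum u 0). simpl; lra. apply rsum_mono; auto; lia. } lra.
  apply rsum_mono; auto.
Qed.

Lemma rsum_ext u v n : (forall i, (i < n)%nat -> u i = v i) -> rsum u n = rsum v n.
Proof. intros H. apply Rle_antisym; apply rsum_le; intros i Hi; right; rewrite H; auto. Qed.

Fixpoint wprod (r : nat -> R) (om : nat -> nat) (n : nat) : R :=
  match n with O => 1 | S k => wprod r om k * r (om k) end.

Lemma wprod_pos r N om n : (forall i, (i < N)%nat -> 0 < r i) -> (forall k, (om k < N)%nat) -> 0 < wprod r om n.
Proof. intros Hr Ho. induction n; simpl. lra. apply Rmult_lt_0_compat; auto. Qed.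

Lemma wprod_ext r om om' n : (forall k, (k < n)%nat -> om k = om' k) -> wprod r om n = wprod r om' n.
Proof. induction n; simpl; intros H; auto. rewrite IHn, (H n); auto. Qed.

Lemma wprod_Rpower r t N om n : (forall i, (i < N)%nat -> 0 < r i) -> (forall k, (om k < N)%nat) ->
  wprod (fun i => Rpower (r i) t) om n = Rpower (wprod r om n) t.
Proof.
  intros Hr Ho. induction n; simpl. unfold Rpower. rewrite ln_1, Rmult_0_r, exp_0. reflexivity.
  rewrite IHn. apply Rpower_mult_distr; auto. eapply wprod_pos; eauto.
Qed.

Lemma rsum_if_unique (c : nat -> Prop) (j0 : nat) (w : R) n : 0 <= w -> (forall j, c j -> j = j0) ->
  rsum (fun j => if excluded_middle_informative (c j) then w else 0) n <= w.
Proof.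
  intros Hw Hc.
  assert (K : forall n, rsum (fun j => if excluded_middle_informative (c j) then w else 0) n <=
    if Nat.ltb j0 n then w else 0).
  { clear n. induction n; simpl. destruct j0; simpl; lra.
    destruct (excluded_middle_informative (c n)) as [Hn|Hn].
    - apply Hc in Hn. subst n. rewrite Nat.ltb_irrefl in IHn.
      replace (Nat.ltb j0 (S j0)) with true by (symmetry; apply Nat.ltb_lt; lia). lra.
    - destruct (Nat.ltb j0 n) eqn:E.
      + apply Nat.ltb_lt in E. replace (Nat.ltb j0 (S n)) with true by (symmetry; apply Nat.ltb_lt; lia). lra.
      + destruct (Nat.ltb j0 (S n)); lra. }
  eapply Rle_trans. apply K. destruct (Nat.ltb j0 n); lra.
Qed.

Lemma eventually_all (P : nat -> nat -> Prop) N :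
  (forall j, (j < N)%nat -> exists m0, forall m, (m0 <= m)%nat -> P j m) ->
  exists M, forall j, (j < N)%nat -> P j M.
Proof.
  intros H. assert (K : exists M, forall j, (j < N)%nat -> forall m, (M <= m)%nat -> P j m).
  { induction N. exists O. lia.
    destruct IHN as [M HM]. intros; apply H; lia. destruct (H N) as [m0 Hm0]. lia.
    exists (max M m0). intros j Hj m Hm. destruct (Nat.eq_dec j N) as [->|Hne].
    apply Hm0; lia. apply HM; lia. }
  destruct K as [M HM]. exists M. intros. apply HM; auto.
Qed.

Definition upd (om : nat -> nat) (n j k : nat) : nat := if Nat.eqb k n then j else om k.

(* Weighted Koenig argument: a family of cylinders of total weight at most 1/2 misses a word. *)
Lemma avoid_cylinders (N : nat) (p : nat -> R) (act : nat -> Prop) (om : nat -> nat -> nat) (len : nat -> nat) :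
  (forall i, (i < N)%nat -> 0 < p i) -> 1 <= rsum p N ->
  (forall i k, (om i k < N)%nat) ->
  (forall m, rsum (fun i => if excluded_middle_informative (act i) then wprod p (om i) (len i) else 0) m <= / 2) ->
  exists w : nat -> nat, (forall k, (w k < N)%nat) /\
    forall i, act i -> exists k, (k < len i)%nat /\ w k <> om i k.
Proof.
  intros Hp H1 Ho Hsum.
  assert (HN : (0 < N)%nat). { destruct N; [simpl in H1; lra|lia]. }
  set (cond := fun (w : nat -> nat) n i => act i /\ (n <= len i)%nat /\ forall k, (k < n)%nat -> om i k = w k).
  set (term := fun w n i => if excluded_middle_informative (cond w n i) then wprod p (om i) (len i) else 0).
  assert (Wp : forall i, 0 < wprod p (om i) (len i)) by (intros i; apply wprod_pos with N; auto).
  assert (Tp : forall w n i, 0 <= term w n i).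
  { intros w n i. unfold term. destruct (excluded_middle_informative _). left; auto. lra. }
  (* The cylinders contained in that of the current prefix of length [n] occupy at most half of its
     weight. *)
  set (Inv := fun (w : nat -> nat) n => forall m, rsum (term w n) m <= / 2 * wprod p w n).
  assert (Hstep : forall w n, (forall k, (w k < N)%nat) -> Inv w n ->
    exists j, (j < N)%nat /\ Inv (upd w n j) (S n)).
  { intros w n Hw HI. apply NNPP. intros Hno.
    (* If every letter failed, each would do so for some partial sum, and a common cut-off [M]
       exists because the terms are nonnegative. Adding over the letters contradicts [Inv]: the
       extended prefixes together weigh at least as much as the prefix, and a cylinder longer than
       the prefix continues it by one letter only. *)
    destruct (eventually_all (fun j m => / 2 * wprod p (upd w n j) (S n) < rsum (term (upd w n j) (S n)) m) N) as [M HM].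
    { intros j Hj. apply NNPP. intros Hm. apply Hno. exists j. split; auto. intros m. apply Rnot_lt_le. intros Hlt.
      apply Hm. exists m. intros m' Hm'. eapply Rlt_le_trans. exact Hlt. apply rsum_mono; auto. }
    assert (A : rsum (fun j => / 2 * wprod p (upd w n j) (S n)) N < rsum (fun j => rsum (term (upd w n j) (S n)) M) N).
    { apply rsum_lt; auto. }
    rewrite rsum_scal in A.
    assert (B : wprod p w n <= rsum (fun j => wprod p (upd w n j) (S n)) N).
    { rewrite (rsum_ext _ (fun j => wprod p w n * p j)).
      - rewrite rsum_scal. assert (0 < wprod p w n) by (apply wprod_pos with N; auto). nra.
      - intros j _. simpl. unfold upd at 2. rewrite Nat.eqb_refl. f_equal. apply wprod_ext.
        intros k Hk. unfold upd. destruct (Nat.eqb k n) eqn:E; auto. apply Nat.eqb_eq in E. lia. }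
    rewrite <- rsum_exchange in A.
    assert (D : rsum (fun i => rsum (fun j => term (upd w n j) (S n) i) N) M <= rsum (term w n) M).
    { apply rsum_le. intros i _. unfold term at 2. destruct (excluded_middle_informative (cond w n i)) as [Hc|Hc].
      - apply (rsum_if_unique (fun j => cond (upd w n j) (S n) i) (om i n)). left; auto.
        intros j (_ & _ & Hk). specialize (Hk n ltac:(lia)). unfold upd in Hk. rewrite Nat.eqb_refl in Hk. auto.
      - right. rewrite (rsum_ext _ (fun _ => 0)). apply rsum_0. intros j _. unfold term.
        destruct (excluded_middle_informative _) as [Hc'|]; auto. exfalso. apply Hc.
        destruct Hc' as (c1 & c2 & c3). split; auto. split. lia. intros k Hk. rewrite c3 by lia. unfold upd.
        destruct (Nat.eqb k n) eqn:E; auto. apply Nat.eqb_eq in E. lia. }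
    specialize (HI M). lra. }
  set (st := fun n => {w : nat -> nat | (forall k, (w k < N)%nat) /\ Inv w n}).
  assert (s0 : st O).
  { exists (fun _ => O). split. auto. intros m. eapply Rle_trans; [|eapply Rle_trans; [apply (Hsum m)|simpl; lra]].
    apply rsum_le. intros i _. unfold term. destruct (excluded_middle_informative _) as [Hc|].
    destruct (excluded_middle_informative (act i)) as [|Hn]. lra. destruct Hc. tauto.
    destruct (excluded_middle_informative (act i)). left; auto. lra. }
  assert (sS : forall n (s : st n), {s' : st (S n) | forall k, (k < n)%nat -> proj1_sig s' k = proj1_sig s k}).
  { intros n [w [Hw HI]]. apply constructive_indefinite_description.
    destruct (Hstep w n Hw HI) as [j [Hj HI']].
    assert (Hu : (forall k, (upd w n j k < N)%nat) /\ Inv (upd w n j) (S n)).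
    { split; auto. intros k. unfold upd. destruct (Nat.eqb k n); auto. }
    exists (exist _ (upd w n j) Hu). simpl. intros k Hk. unfold upd.
    destruct (Nat.eqb k n) eqn:E; auto. apply Nat.eqb_eq in E. lia. }
  set (sq := fix sq n : st n := match n with O => s0 | S k => proj1_sig (sS k (sq k)) end).
  set (w := fun k => proj1_sig (sq (S k)) k).
  assert (Hst : forall n k, (k < n)%nat -> proj1_sig (sq n) k = w k).
  { induction n; intros k Hk. lia. destruct (Nat.eq_dec k n) as [->|]. reflexivity.
    simpl. destruct (sS n (sq n)) as [s' Hs']. simpl. rewrite Hs' by lia. apply IHn. lia. }
  exists w. split.
  - intros k. unfold w. apply (proj2_sig (sq (S k))).
  - intros i Hi. apply NNPP. intros Hno.
    (* If [w] lay in cylinder [i], the prefix of length [len i] would be that cylinder, which then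
       fills the whole weight of the prefix and not just half of it. *)
    destruct (proj2_sig (sq (len i))) as [Hw HI].
    specialize (HI (S i)). set (v := proj1_sig (sq (len i))) in *.
    assert (Ev : forall k, (k < len i)%nat -> om i k = v k).
    { intros k Hk. unfold v. rewrite Hst by auto. apply NNPP. intros K. apply Hno. exists k. auto. }
    assert (T : term v (len i) i = wprod p (om i) (len i)).
    { unfold term. destruct (excluded_middle_informative _) as [|Hn]; auto. exfalso. apply Hn. split; auto. }
    pose proof (rsum_term (term v (len i)) (S i) i (Tp v (len i)) ltac:(lia)) as K.
    rewrite T in K. rewrite <- (wprod_ext p (om i) v) in HI by auto. specialize (Wp i). lra.
Qed.

(** * Hausdorff measure and the Moran bound *)

Lemma Rbar_lub_ub E x : E x -> Rbar_le x (Rbar_lub E).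
Proof. intros H. unfold Rbar_lub. destruct (Rbar_ex_lub E) as [s [H1 H2]]. simpl. auto. Qed.

Lemma Rbar_lub_least E b : (forall x, E x -> Rbar_le x b) -> Rbar_le (Rbar_lub E) b.
Proof. intros H. unfold Rbar_lub. destruct (Rbar_ex_lub E) as [s [H1 H2]]. simpl. auto. Qed.

Lemma Rbar_glb_lb E x : E x -> Rbar_le (Rbar_glb E) x.
Proof. intros H. unfold Rbar_glb. destruct (Rbar_ex_glb E) as [s [H1 H2]]. simpl. auto. Qed.

Lemma Rbar_glb_greatest E b : (forall x, E x -> Rbar_le b x) -> Rbar_le b (Rbar_glb E).
Proof. intros H. unfold Rbar_glb. destruct (Rbar_ex_glb E) as [s [H1 H2]]. simpl. auto. Qed.

Lemma diam_pow_finite t U : Rbar_le (diam U) (Finite 1) ->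
  exists d, diam_pow t U = Finite d /\ 0 <= d /\
    forall u v, U u -> U v -> u <> v -> 0 < t -> Rpower (Cmod (u - v)) t <= d.
Proof.
  intros H. unfold diam_pow. destruct (diam U) as [d| |] eqn:E; simpl in H; try tauto.
  - eexists. split. reflexivity. split.
    + destruct (Rlt_dec 0 d). left. apply exp_pos. lra.
    + intros u v Hu Hv Huv Ht.
      assert (K : Rbar_le (Cmod (u - v)) (diam U)) by (apply Rbar_lub_ub; exists u, v; auto).
      rewrite E in K. simpl in K. pose proof (Cmod_sub_pos u v Huv).
      destruct (Rlt_dec 0 d); [|lra]. apply Rle_Rpower_l. lra. lra.
  - exists 0. split; auto. split. lra. intros u v Hu Hv Huv Ht.
    assert (K : Rbar_le (Cmod (u - v)) (diam U)) by (apply Rbar_lub_ub; exists u, v; auto).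
    rewrite E in K. simpl in K. tauto.
Qed.

(** The premeasure at scale 1 is at most the measure, hence at most 0, and covers of arbitrarily
    small total exist. The last clause is the only form in which diameters are used later. *)
Lemma hausdorff_zero_cover t A eta : 0 < t -> 0 < eta -> hausdorff_measure t A = Finite 0 ->
  exists (U : nat -> C -> Prop) (d : nat -> R), (forall x, A x -> exists i, U i x) /\
    (forall n, rsum d n <= eta) /\ (forall i, 0 <= d i) /\
    forall i u v, U i u -> U i v -> u <> v -> Rpower (Cmod (u - v)) t <= d i.
Proof.
  intros Ht Heta H0.
  assert (Hpre : Rbar_le (hausdorff_pre t 1 A) (Finite 0)).
  { rewrite <- H0. apply Rbar_lub_ub. exists 1. split. lra. reflexivity. }
  assert (Hex : exists U, (forall i, Rbar_le (diam (U i)) (Finite 1)) /\ (forall x, A x -> exists i, U i x) /\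
    Rbar_le (Rbar_lub (fun v => exists n, v = psum t U n)) (Finite eta)).
  { apply NNPP. intros Hno.
    assert (K : Rbar_le (Finite eta) (hausdorff_pre t 1 A)).
    { apply Rbar_glb_greatest. intros s [U [H1 [H2 ->]]].
      destruct (Rbar_le_lt_dec (Finite eta) (Rbar_lub (fun v => exists n, v = psum t U n))) as [K|K]; auto.
      exfalso. apply Hno. exists U. split; auto. split; auto. apply Rbar_lt_le. exact K. }
    pose proof (Rbar_le_trans _ _ _ K Hpre) as L. simpl in L. lra. }
  destruct Hex as [U [Hd [Hc Hs]]].
  set (d := fun i => real (diam_pow t (U i))).
  assert (Hdp : forall i, diam_pow t (U i) = Finite (d i) /\ 0 <= d i /\
    forall u v, U i u -> U i v -> u <> v -> Rpower (Cmod (u - v)) t <= d i).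
  { intros i. destruct (diam_pow_finite t (U i) (Hd i)) as [x [E [Hx Hp]]]. unfold d. rewrite E. simpl. auto. }
  assert (Hps : forall n, psum t U n = Finite (rsum d n)).
  { induction n; simpl. reflexivity. rewrite IHn. destruct (Hdp n) as [-> _]. reflexivity. }
  exists U, d. split; auto. split; [|split].
  - intros n. assert (K : Rbar_le (psum t U n) (Finite eta)).
    { eapply Rbar_le_trans; [|exact Hs]. apply Rbar_lub_ub. exists n. reflexivity. }
    rewrite Hps in K. exact K.
  - intros i. apply Hdp.
  - intros i. apply Hdp.
Qed.

(** A covering set is charged with the longest prefix common to all words coded into it; the first
    disagreement, through [gap], bounds the weight of this cylinder by the t-th power of the
    diameter. For a cover of small total the charged cylinders weigh at most 1/2 altogether, and a
    word that avoids them codes an uncovered point. *)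
Lemma moran_lower (N : nat) (r : nat -> R) (gap t : R) (code : (nat -> nat) -> C) (A : C -> Prop) :
  0 < t -> 0 < gap -> (forall i, (i < N)%nat -> 0 < r i <= / 2) ->
  1 <= rsum (fun i => Rpower (r i) t) N ->
  (forall w w' n, (forall k, (w k < N)%nat) -> (forall k, (w' k < N)%nat) ->
     (forall k, (k < n)%nat -> w k = w' k) -> w n <> w' n ->
     gap * wprod r w n <= Cmod (code w - code w')) ->
  (forall w, (forall k, (w k < N)%nat) -> A (code w)) ->
  hausdorff_measure t A <> Finite 0.
Proof.
  intros Ht Hgap Hr Hsum Hsep HA H0.
  assert (Hr0 : forall i, (i < N)%nat -> 0 < r i) by (intros i Hi; apply Hr; auto).
  set (gt := Rpower gap t). assert (Hgt : 0 < gt) by apply exp_pos.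
  destruct (hausdorff_zero_cover t A (gt / 4) Ht ltac:(lra) H0) as [U [d [Hcov [Hd [Hd0 Hdiam]]]]].
  set (p := fun i => Rpower (r i) t).
  assert (Hp : forall i, (i < N)%nat -> 0 < p i) by (intros; apply exp_pos).
  set (a := Rpower (/ 2) t).
  assert (Ha : 0 < a < 1).
  { split. apply exp_pos. unfold a, Rpower. rewrite <- exp_0. apply exp_increasing.
    rewrite ln_Rinv by lra. pose proof ln_lt_2. nra. }
  assert (Hpa : forall i, (i < N)%nat -> p i <= a).
  { intros i Hi. apply Rle_Rpower_l. lra. apply Hr; auto. }
  assert (Hpn : forall w n, (forall k, (w k < N)%nat) -> wprod p w n <= a ^ n).
  { intros w n Hw. induction n; simpl. lra. rewrite (Rmult_comm a).
    apply Rmult_le_compat; auto. left. apply wprod_pos with N; auto. left; auto. }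
  set (word := fun w : nat -> nat => forall k, (w k < N)%nat).
  set (act := fun i => exists w, word w /\ U i (code w)).
  assert (HN : (0 < N)%nat). { destruct N; [simpl in Hsum; lra|lia]. }
  (* The terms [d i / gt] have total at most 1/4. The geometric terms, again of total at most 1/4,
     pay for a set that contains the code of a single word: all its prefixes are common, and one of
     small enough weight is taken. *)
  assert (Hcyl : forall i, exists wn : (nat -> nat) * nat, word (fst wn) /\
    (forall w', word w' -> U i (code w') -> forall k, (k < snd wn)%nat -> w' k = fst wn k) /\
    (act i -> wprod p (fst wn) (snd wn) <= d i / gt + / 4 * (/ 2) ^ (S i))).
  { intros i. destruct (classic (act i)) as [[w [Hw HU]]|Hn].
    2: { exists ((fun _ => O), O). split. intros k; auto. split; [|tauto]. simpl. intros; lia. }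
    set (Cyl := fun n => forall w', word w' -> U i (code w') -> forall k, (k < n)%nat -> w' k = w k).
    assert (H2 : 0 < (/ 2) ^ S i) by (apply pow_lt; lra).
    assert (Hdg : 0 <= d i / gt) by (apply Rdiv_le_0_compat; auto).
    destruct (classic (forall n, Cyl n)) as [Hall|Hnall].
    - destruct (pow_lt_1_zero a) with (y := / 4 * (/ 2) ^ S i) as [n Hn].
      { rewrite Rabs_pos_eq; lra. } { lra. }
      exists (w, n). split; auto. split. apply Hall. simpl fst; simpl snd. intros _.
      specialize (Hn n (le_n n)). rewrite Rabs_pos_eq in Hn by (apply pow_le; lra).
      specialize (Hpn w n Hw). lra.
    - assert (Hm : exists m, Cyl m /\ ~ Cyl (S m)).
      { apply NNPP. intros Hno. apply Hnall. induction n. intros w' _ _ k Hk. lia.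
        apply NNPP. intros K. apply Hno. exists n. auto. }
      destruct Hm as [m [Hm HSm]]. exists (w, m). split; auto. split. exact Hm. simpl fst; simpl snd. intros _.
      assert (Hw' : exists w', word w' /\ U i (code w') /\ w' m <> w m).
      { apply NNPP. intros Hno. apply HSm. intros w' Hw' HU' k Hk.
        destruct (Nat.eq_dec k m) as [->|]. apply NNPP. intros K. apply Hno. exists w'. auto. apply Hm; auto. lia. }
      destruct Hw' as [w' [Hw' [HU' Hne]]].
      assert (S1 : gap * wprod r w m <= Cmod (code w - code w')).
      { apply Hsep; auto. intros k Hk. symmetry. apply Hm; auto. }
      assert (Wp : 0 < wprod r w m) by (apply wprod_pos with N; auto).
      assert (Hne' : code w <> code w'). { intros E. rewrite E, Cmod_sub_0 in S1. nra. }
      specialize (Hdiam i _ _ HU HU' Hne').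
      assert (K : Rpower (gap * wprod r w m) t <= d i).
      { eapply Rle_trans; [|exact Hdiam]. apply Rle_Rpower_l. lra. split; auto. nra. }
      rewrite <- Rpower_mult_distr in K by auto. fold gt in K.
      unfold p. rewrite (wprod_Rpower r t N) by auto.
      assert (Rpower (wprod r w m) t <= d i / gt).
      { apply Rmult_le_reg_l with gt; auto. replace (gt * (d i / gt)) with (d i) by (field; lra). exact K. }
      lra. }
  set (wn := fun i => proj1_sig (constructive_indefinite_description _ (Hcyl i))).
  assert (Hwn : forall i, word (fst (wn i)) /\
    (forall w', word w' -> U i (code w') -> forall k, (k < snd (wn i))%nat -> w' k = fst (wn i) k) /\
    (act i -> wprod p (fst (wn i)) (snd (wn i)) <= d i / gt + / 4 * (/ 2) ^ (S i))).
  { intros i. unfold wn. destruct (constructive_indefinite_description _ (Hcyl i)) as [x Hx]. exact Hx. }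
  assert (Hgeo : forall m, rsum (fun i => / 4 * (/ 2) ^ (S i)) m <= / 4).
  { intros m. rewrite rsum_scal. assert (K : forall m, rsum (fun i => (/ 2) ^ S i) m = 1 - (/ 2) ^ m).
    { clear m. induction m. simpl. ring. cbn [rsum]. rewrite IHm. simpl. field. }
    rewrite K. assert (0 < (/ 2) ^ m) by (apply pow_lt; lra). lra. }
  destruct (avoid_cylinders N p act (fun i => fst (wn i)) (fun i => snd (wn i))) as [w [Hw Hav]]; auto.
  - intros i k. apply Hwn.
  - intros m. apply Rle_trans with (rsum (fun i => / gt * d i + / 4 * (/ 2) ^ (S i)) m).
    + apply rsum_le. intros i _. destruct (excluded_middle_informative (act i)) as [Hi|].
      * destruct (Hwn i) as (_ & _ & K). specialize (K Hi). unfold Rdiv in K. lra.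
      * assert (0 < (/ 2) ^ S i) by (apply pow_lt; lra). assert (0 < / gt) by (apply Rinv_0_lt_compat; auto).
        specialize (Hd0 i). nra.
    + rewrite rsum_plus, rsum_scal. specialize (Hgeo m). specialize (Hd m).
      apply (Rmult_le_compat_l (/ gt)) in Hd; [|left; apply Rinv_0_lt_compat; auto].
      replace (/ gt * (gt / 4)) with (/ 4) in Hd by (field; lra). lra.
  - destruct (Hcov _ (HA w Hw)) as [i Hi].
    assert (Hact : act i) by (exists w; auto).
    destruct (Hav i Hact) as [k [Hk Hne]]. apply Hne. apply (Hwn i); auto.
Qed.

(** * Limit sets of the non-autonomous system *)

Lemma geometric_limit (u : nat -> C) (K : R) :
  (forall m, Cmod (u (S m) - u m) <= K * (/ 2) ^ m) ->
  exists x, forall m, Cmod (u m - x) <= 4 * K * (/ 2) ^ m.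
Proof.
  intros H.
  assert (Hc : forall v : nat -> R, (forall m, Rabs (v (S m) - v m) <= K * (/ 2) ^ m) ->
    exists x, forall m, Rabs (v m - x) <= 2 * K * (/ 2) ^ m).
  { intros v Hv. destruct (nested_point (fun m => v m - 2 * K * (/ 2) ^ m) (fun m => v m + 2 * K * (/ 2) ^ m)) as [x Hx].
    - intros m. specialize (Hv m). apply Rabs_le_between in Hv. simpl. lra.
    - intros m. specialize (Hv m). apply Rabs_le_between in Hv. simpl. lra.
    - intros m. specialize (Hv m). pose proof (Rabs_pos (v (S m) - v m)). lra.
    - exists x. intros m. specialize (Hx m). apply Rabs_le. lra. }
  destruct (Hc (fun m => Re (u m))) as [x Hx].
  { intros m. rewrite <- Re_minus. eapply Rle_trans. apply Rabs_Re_le. auto. }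
  destruct (Hc (fun m => Im (u m))) as [y Hy].
  { intros m. rewrite <- Im_minus. eapply Rle_trans. apply Rabs_Im_le. auto. }
  exists (x, y). intros m. eapply Rle_trans. apply Cmod_le_Re_Im.
  rewrite Re_minus, Im_minus. simpl. specialize (Hx m). specialize (Hy m). simpl in *. lra.
Qed.

Lemma limit_le (a K : R) : (forall m, a <= K * (/ 2) ^ m) -> a <= 0.
Proof.
  intros H. apply Rnot_lt_le. intros Ha. destruct (half_pow_small K a Ha) as [n Hn]. specialize (H n). lra.
Qed.

(** Normality refers to the chordal metric, whose limits may be infinity. A bounded [u] rules this
    out for [p], and on bounded sets the chordal metric controls the Euclidean one. *)
Lemma chordal_close (M e : R) : 0 <= M -> 0 < e -> exists eta, 0 < eta /\
  forall u v p, Cmod u <= M -> chordal (Some u) p < eta -> chordal (Some v) p < eta -> Cmod (u - v) < e.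
Proof.
  intros HM He.
  assert (K : forall M eta, 0 <= M -> 0 < eta -> eta * (1 + M) <= 1 -> forall u p, Cmod u <= M -> chordal (Some u) p < eta ->
    exists x, p = Some x /\ Cmod (u - x) <= eta * (1 + M) ^ 2).
  { clear. intros M eta HM Heta Hs u p Hu Hc. pose proof (Cmod_ge_0 u) as Hu0.
    assert (Hsq : forall x, 0 <= x -> 0 < sqrt (1 + x ^ 2) <= 1 + x).
    { intros x Hx. split. apply sqrt_lt_R0. nra. apply Rle_trans with (sqrt ((1 + x) ^ 2)). apply sqrt_le_1_alt. nra.
      right. apply sqrt_pow2. lra. }
    pose proof (Hsq (Cmod u) Hu0) as [Q1 Q2].
    destruct p as [x|]; simpl in Hc.
    - exists x. split; auto. pose proof (Cmod_ge_0 x) as Hx0. pose proof (Hsq (Cmod x) Hx0) as [Q3 Q4].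
      change (Cmod u * (Cmod u * 1)) with (Cmod u ^ 2) in Hc. change (Cmod x * (Cmod x * 1)) with (Cmod x ^ 2) in Hc.
      rewrite sqrt_mult in Hc by nra.
      set (q := sqrt (1 + Cmod u ^ 2) * sqrt (1 + Cmod x ^ 2)) in *.
      assert (Hq : 0 < q) by (unfold q; apply Rmult_lt_0_compat; auto).
      apply (Rmult_lt_compat_r q) in Hc; auto.
      replace (2 * Cmod (u - x) / q * q) with (2 * Cmod (u - x)) in Hc by (field; lra).
      assert (Hxu : Cmod x <= M + Cmod (u - x)).
      { pose proof (Cmod_sub_ge x u). rewrite Cmod_sub_sym in H. lra. }
      pose proof (Cmod_ge_0 (u - x)) as Hd. set (dd := Cmod (u - x)) in *.
      assert (Hqb : q <= (1 + M) * (1 + M + dd)).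
      { unfold q. apply Rmult_le_compat; lra. }
      assert (eta * q <= eta * (1 + M) * (1 + M + dd)) by nra. nra.
    - exfalso. change (Cmod u * (Cmod u * 1)) with (Cmod u ^ 2) in Hc.
      apply (Rmult_lt_compat_r (sqrt (1 + Cmod u ^ 2))) in Hc; auto.
      replace (2 / sqrt (1 + Cmod u ^ 2) * sqrt (1 + Cmod u ^ 2)) with 2 in Hc by (field; lra). nra. }
  set (A := (3 + M) ^ 2). assert (HA : 1 <= A) by (unfold A; nra).
  set (eta := Rmin (/ A) (e / (4 * A))).
  assert (Heta : 0 < eta). { apply Rmin_glb_lt. apply Rinv_0_lt_compat; lra. apply Rdiv_lt_0_compat; lra. }
  assert (E1 : eta * A <= 1). { apply Rle_trans with (/ A * A). apply Rmult_le_compat_r. lra. apply Rmin_l. right; field; lra. }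
  assert (E2 : eta * A <= e / 4). { apply Rle_trans with (e / (4 * A) * A). apply Rmult_le_compat_r. lra. apply Rmin_r. right; field; lra. }
  exists eta. split; auto. intros u v p Hu Hc1 Hc2.
  destruct (K M eta HM Heta ltac:(unfold A in E1; nra) u p Hu Hc1) as [x [-> Hx]].
  assert (Hx' : Cmod (u - x) <= eta * A) by (unfold A; nra).
  assert (Hxm : Cmod x <= 1 + M). { pose proof (Cmod_sub_ge x u). rewrite Cmod_sub_sym in H. lra. }
  assert (Hsym : chordal (Some x) (Some v) < eta).
  { simpl in *. rewrite (Cmod_sub_sym x v), (Rmult_comm (1 + _)). exact Hc2. }
  destruct (K (1 + M) eta ltac:(lra) Heta ltac:(unfold A in E1; nra) x (Some v) Hxm Hsym) as [v' [Ev Hv]].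
  injection Ev as <-. assert (Hv' : Cmod (x - v) <= eta * A) by (unfold A; nra).
  pose proof (Cmod_sub_trans u x v). lra.
Qed.

(* T n i is an inverse branch of the composition of two consecutive maps hat f_{2n+2} o hat f_{2n+1}. *)
Definition ifs (f : C -> C) (lam c : nat -> C) (b : C) (s : R) (N : nat) (a : nat -> R)
  (T : nat -> nat -> C -> C) : Prop :=
  (forall n i y, (i < N)%nat -> Cmod (y - b) < s / 2 ->
     Cmod (T n i y - b) < s / 16 /\ ~ poles f (T n i y) /\
     ~ poles f (lam (2 * n)%nat * f (T n i y) + c (2 * n)%nat)%C /\
     (lam (2 * n + 1)%nat * f (lam (2 * n)%nat * f (T n i y) + c (2 * n)%nat) + c (2 * n + 1)%nat)%C = y /\
     exists l, cderiv (T n i) y l /\ l <> 0%C /\ a i <= Cmod l) /\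
  (forall n i j y y', (i < N)%nat -> (j < N)%nat -> i <> j -> Cmod (y - b) < s / 2 -> Cmod (y' - b) < s / 2 ->
     T n i y <> T n j y').

Lemma ifs_injective f lam c b s N a T n i y y' : ifs f lam c b s N a T -> (i < N)%nat ->
  Cmod (y - b) < s / 2 -> Cmod (y' - b) < s / 2 -> T n i y = T n i y' -> y = y'.
Proof.
  intros [H _] Hi Hy Hy' E. destruct (H n i y Hi Hy) as (_ & _ & _ & E1 & _).
  destruct (H n i y' Hi Hy') as (_ & _ & _ & E2 & _). rewrite E in E1. congruence.
Qed.

(** The maps send the disc of radius s/2 into that of radius s/16, so the Cauchy estimate with
    radius 3s/8 bounds their derivatives on the disc of radius s/8 by 1/3. *)
Lemma ifs_contract f lam c b s N a T n i y y' : 0 < s -> ifs f lam c b s N a T -> (i < N)%nat ->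
  Cmod (y - b) < s / 8 -> Cmod (y' - b) < s / 8 -> Cmod (T n i y - T n i y') <= / 2 * Cmod (y - y').
Proof.
  intros Hs [H _] Hi Hy Hy'. apply (mean_value_disc (T n i) b (s / 8) (/ 2)); auto.
  intros x Hx. destruct (H n i x Hi ltac:(lra)) as (_ & _ & _ & _ & l & Hl & _). exists l. split; auto.
  apply Rle_trans with (2 * (s / 16) / (3 * s / 8)).
  - apply (cauchy_estimate (T n i) x b l (3 * s / 8) (s / 16)); auto. lra.
    + intros z Hz. pose proof (Cmod_sub_trans z x b). destruct (H n i z Hi ltac:(lra)) as (_ & _ & _ & _ & l' & Hl' & _). exists l'; auto.
    + intros z Hz. pose proof (Cmod_sub_trans z x b). destruct (H n i z Hi ltac:(lra)) as (K & _). lra.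
  - replace (2 * (s / 16) / (3 * s / 8)) with (/ 3) by (field; lra). lra.
Qed.

(** A value [v] omitted on a disc about [y] is far from [T n i y]. This consequence of [koebe]
    separates points of one piece, with [v] the image of the other point, as well as different
    pieces, so it does the work of a distortion theorem. *)
Lemma ifs_expand f lam c b s N a T n i y v r : 0 < s -> ifs f lam c b s N a T -> (i < N)%nat ->
  Cmod (y - b) < s / 8 -> 0 < r -> r <= s / 4 ->
  (forall x, Cmod (x - y) < r -> T n i x <> v) -> r * a i <= 320 * PI * Cmod (T n i y - v).
Proof.
  intros Hs Hifs Hi Hy Hr0 Hr Hv. destruct (proj1 Hifs n i y Hi ltac:(lra)) as (_ & _ & _ & _ & l & Hl & _ & Ha).
  assert (Hin : forall x, Cmod (x - y) < r -> Cmod (x - b) < s / 2).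
  { intros x Hx. pose proof (Cmod_sub_trans x y b). lra. }
  apply Rle_trans with (r * Cmod l). apply Rmult_le_compat_l; lra.
  apply koebe; auto.
  - intros w Hw. destruct (proj1 Hifs n i w Hi (Hin w Hw)) as (_ & _ & _ & _ & l' & Hl' & _). exists l'; auto.
  - intros w w' Hw Hw'. apply (ifs_injective f lam c b s N a T n i); auto.
Qed.

Fixpoint approx (T : nat -> nat -> C -> C) (b : C) (w : nat -> nat) (m n : nat) : C :=
  match m with O => b | S k => T n (w n) (approx T b w k (S n)) end.

Fixpoint compT (T : nat -> nat -> C -> C) (w : nat -> nat) (n : nat) (y : C) : C :=
  match n with O => y | S k => compT T w k (T k (w k) y) end.

(** The maps change with the level, so a limit point [X n w] is kept for each level [n]; it is the
    position at time 2n of the orbit that starts at [X 0 w]. *)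
Lemma ifs_coding f lam c b s N a T : 0 < s -> ifs f lam c b s N a T ->
  exists X : nat -> (nat -> nat) -> C, forall w, (forall k, (w k < N)%nat) -> forall n,
    Cmod (X n w - b) <= s / 16 /\ X n w = T n (w n) (X (S n) w).
Proof.
  intros Hs Hifs.
  assert (Hin : forall w, (forall k, (w k < N)%nat) -> forall m n, Cmod (approx T b w m n - b) < s / 16).
  { intros w Hw. induction m; intros n; simpl. rewrite Cmod_sub_0; lra.
    apply (proj1 Hifs); auto. specialize (IHm (S n)). lra. }
  assert (Hd : forall w, (forall k, (w k < N)%nat) -> forall m n,
    Cmod (approx T b w (S m) n - approx T b w m n) <= s * (/ 2) ^ m).
  { intros w Hw. induction m; intros n.
    - specialize (Hin w Hw 1%nat n). simpl. simpl in Hin. lra.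
    - change (approx T b w (S (S m)) n) with (T n (w n) (approx T b w (S m) (S n))).
      change (approx T b w (S m) n) with (T n (w n) (approx T b w m (S n))).
      eapply Rle_trans. eapply ifs_contract; eauto; eapply Rlt_trans; try apply Hin; auto; lra.
      specialize (IHm (S n)). simpl pow. lra. }
  assert (Hx : forall n w, exists x, (forall k, (w k < N)%nat) -> forall m, Cmod (approx T b w m n - x) <= 4 * s * (/ 2) ^ m).
  { intros n w. destruct (classic (forall k, (w k < N)%nat)) as [Hw|Hw]; [|exists b; tauto].
    destruct (geometric_limit (fun m => approx T b w m n) s) as [x Hx]. intros m. apply Hd; auto. exists x. auto. }
  set (X := fun n w => proj1_sig (constructive_indefinite_description _ (Hx n w))).
  assert (HX : forall n w, (forall k, (w k < N)%nat) -> forall m, Cmod (approx T b w m n - X n w) <= 4 * s * (/ 2) ^ m).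
  { intros n w. unfold X. destruct (constructive_indefinite_description _ (Hx n w)) as [x Hxx]. exact Hxx. }
  assert (HXb : forall w, (forall k, (w k < N)%nat) -> forall n, Cmod (X n w - b) <= s / 16).
  { intros w Hw n. assert (Cmod (X n w - b) - s / 16 <= 0); [|lra]. apply limit_le with (4 * s). intros m.
    pose proof (Cmod_sub_trans (X n w) (approx T b w m n) b) as K. rewrite (Cmod_sub_sym (X n w) (approx T b w m n)) in K.
    specialize (HX n w Hw m). specialize (Hin w Hw m n). lra. }
  exists X. intros w Hw n. split. apply HXb; auto.
  apply Cmod_sub_eq0. apply Rle_antisym; [|apply Cmod_ge_0]. apply limit_le with (4 * s). intros m.
  pose proof (Cmod_sub_trans (X n w) (approx T b w (S m) n) (T n (w n) (X (S n) w))) as K.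
  rewrite (Cmod_sub_sym (X n w) (approx T b w (S m) n)) in K. pose proof (HX n w Hw (S m)) as K1.
  pose proof (HX (S n) w Hw m) as K2. simpl approx in K.
  assert (K3 : Cmod (T n (w n) (approx T b w m (S n)) - T n (w n) (X (S n) w)) <= / 2 * Cmod (approx T b w m (S n) - X (S n) w)).
  { eapply ifs_contract; eauto. specialize (Hin w Hw m (S n)); lra. specialize (HXb w Hw (S n)); lra. }
  simpl approx in K1. simpl pow in K1. lra.
Qed.

Lemma compT_orbit f lam c b s N a T w n y : 0 < s -> ifs f lam c b s N a T -> (forall k, (w k < N)%nat) ->
  Cmod (y - b) < s / 2 ->
  Fiter f lam c (2 * n) (compT T w n y) = y /\ Fdef f lam c (2 * n) (compT T w n y) /\
  exists l, cderiv (compT T w n) y l /\ l <> 0%C.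
Proof.
  intros Hs Hifs Hw. revert y. induction n; intros y Hy.
  - simpl. split; auto. split. intros k Hk. lia. exists 1%C. split. apply cderiv_id. apply C1_nz.
  - destruct (proj1 Hifs n (w n) y (Hw n) Hy) as (h1 & h2 & h3 & h4 & l & hl & hl0 & _).
    destruct (IHn (T n (w n) y) ltac:(lra)) as (I1 & I2 & m & Im1 & Im2).
    assert (E2 : (2 * S n = S (S (2 * n)))%nat) by lia. rewrite E2.
    assert (F1 : Fiter f lam c (S (2 * n)) (compT T w (S n) y) = (lam (2 * n)%nat * f (T n (w n) y) + c (2 * n)%nat)%C).
    { change (compT T w (S n) y) with (compT T w n (T n (w n) y)). 
      change (Fiter f lam c (S (2 * n)) (compT T w n (T n (w n) y))) with
        (lam (2 * n)%nat * f (Fiter f lam c (2 * n) (compT T w n (T n (w n) y))) + c (2 * n)%nat)%C.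
      rewrite I1. reflexivity. }
    split; [|split].
    + change (Fiter f lam c (S (S (2 * n))) (compT T w (S n) y)) with
        (lam (S (2 * n))%nat * f (Fiter f lam c (S (2 * n)) (compT T w (S n) y)) + c (S (2 * n))%nat)%C.
      rewrite F1. replace (S (2 * n)) with (2 * n + 1)%nat by lia. exact h4.
    + intros k Hk. destruct (Nat.lt_ge_cases k (2 * n)) as [K|K].
      * apply (I2 k K).
      * destruct (Nat.eq_dec k (2 * n)) as [->|K'].
        { change (compT T w (S n) y) with (compT T w n (T n (w n) y)). rewrite I1. exact h2. }
        replace k with (S (2 * n)) by lia. rewrite F1. exact h3.
    + exists (m * l)%C. split. apply (cderiv_comp (compT T w n) (T n (w n))); auto. apply Cmult_neq_0; auto.
Qed.

Lemma compT_lipschitz f lam c b s N a T w n y y' : 0 < s -> ifs f lam c b s N a T -> (forall k, (w k < N)%nat) ->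
  Cmod (y - b) < s / 8 -> Cmod (y' - b) < s / 8 ->
  Cmod (compT T w n y - compT T w n y') <= (/ 2) ^ n * Cmod (y - y').
Proof.
  intros Hs Hifs Hw. revert y y'. induction n; intros y y' Hy Hy'; simpl. lra.
  assert (K : forall x, Cmod (x - b) < s / 8 -> Cmod (T n (w n) x - b) < s / 8).
  { intros x Hx. destruct (proj1 Hifs n (w n) x (Hw n) ltac:(lra)) as [h _]. lra. }
  eapply Rle_trans. apply IHn; auto.
  pose proof (ifs_contract f lam c b s N a T n (w n) y y' Hs Hifs (Hw n) Hy Hy').
  assert (0 < (/ 2) ^ n) by (apply pow_lt; lra). nra.
Qed.

Lemma cholo_Fiter f lam c n z : meromorphic f -> Fdef f lam c n z -> cholo (Fiter f lam c n) z.
Proof.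
  intros Hf. induction n; intros Hd. apply cholo_id.
  simpl. apply cholo_plus; [|apply cholo_const]. apply cholo_mult. apply cholo_const.
  apply (cholo_comp f (Fiter f lam c n)). apply meromorphic_cholo; auto.
  apply IHn. intros k Hk. apply Hd. lia.
Qed.

Lemma strictly_increasing_ge (psi : nat -> nat) : (forall k, (psi k < psi (S k))%nat) -> forall k, (k <= psi k)%nat.
Proof. intros H. induction k. lia. specialize (H k). lia. Qed.

(** Preimages of a fixed point [y0] under the iterates of even order accumulate at [z], while the
    orbit of [z] stays away from [y0]; this contradicts equicontinuity, hence normality. The
    composed inverse branches are the univalent pullbacks, over discs of the fixed radius s/4. *)
Lemma ifs_radial f lam c b s N a T X w : meromorphic f -> 0 < s -> ifs f lam c b s N a T ->
  (forall k, (w k < N)%nat) ->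
  (forall n, Cmod (X n w - b) <= s / 16 /\ X n w = T n (w n) (X (S n) w)) ->
  radial_julia f lam c (X O w).
Proof.
  intros Hf Hs Hifs Hw HX. set (z := X O w).
  assert (HXn : forall n, z = compT T w n (X n w)).
  { induction n. reflexivity. rewrite IHn. simpl. f_equal. apply HX. }
  assert (HXb : forall n, Cmod (X n w - b) < s / 8) by (intros n; destruct (HX n); lra).
  assert (Horb : forall n, Fiter f lam c (2 * n) z = X n w /\ Fdef f lam c (2 * n) z).
  { intros n. rewrite (HXn n). specialize (HXb n).
    destruct (compT_orbit f lam c b s N a T w n (X n w)) as (h1 & h2 & _); auto. lra. }
  assert (Hdef : forall n, Fdef f lam c n z).
  { intros n k Hk. destruct (Horb n) as [_ K]. apply K. lia. }
  split; [|split]; auto.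
  - intros [U (HUo & HUz & HUd & Hnorm)].
    (* s/9 is chosen between s/16 and s/8: [y0] belongs to the disc where the inverse branches
       contract but keeps the distance s/9 - s/16 = 7s/144 from all points [X n w]. *)
    set (y0 := (b + RtoC (s / 9))%C).
    assert (Hy0 : Cmod (y0 - b) = s / 9).
    { unfold y0. replace (b + RtoC (s / 9) - b)%C with (RtoC (s / 9)) by ring. rewrite Cmod_R. apply Rabs_pos_eq. lra. }
    set (e := 7 * s / 144). assert (He : 0 < e) by (unfold e; lra).
    assert (Hsep : forall n, e <= Cmod (y0 - X n w)).
    { intros n. pose proof (Cmod_sub_trans y0 (X n w) b). destruct (HX n). unfold e. lra. }
    set (M := Cmod b + s). pose proof (Cmod_ge_0 b).
    assert (HMX : forall n, Cmod (X n w) <= M).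
    { intros n. pose proof (Cmod_sub_ge (X n w) b). specialize (HXb n). unfold M. lra. }
    assert (HMy : Cmod y0 <= M). { pose proof (Cmod_sub_ge y0 b). unfold M. lra. }
    destruct (chordal_close M (e / 4) ltac:(unfold M; lra) ltac:(lra)) as [eta [Heta Hch]].
    destruct (Hnorm (fun k => (2 * k)%nat)) as [psi [Hpsi [h Hcv]]]. { intros k; lia. }
    destruct (Hcv z HUz) as [r [Hr Hrr]]. destruct (Hrr eta Heta) as [K HK].
    destruct (cholo_ccont _ _ (cholo_Fiter f lam c (2 * psi K) z Hf (Hdef _)) (e / 4)) as [d [Hd Hcont]]. lra.
    destruct (HUo z HUz) as [rU [HrU HUb]].
    assert (Hm : 0 < Rmin d (Rmin r rU)) by (repeat apply Rmin_glb_lt; auto).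
    destruct (half_pow_small s (Rmin d (Rmin r rU)) Hm) as [k0 Hk0].
    set (k := max k0 K). set (n := psi k).
    assert (Hnk : (k0 <= n)%nat). { pose proof (strictly_increasing_ge psi Hpsi k). unfold n, k in *. lia. }
    set (wk := compT T w n y0).
    assert (Hwk : Cmod (wk - z) < Rmin d (Rmin r rU)).
    { eapply Rle_lt_trans; [|exact Hk0]. rewrite (HXn n). unfold wk.
      eapply Rle_trans. apply (compT_lipschitz f lam c b s N a T w n y0 (X n w)); auto. lra.
      rewrite Rmult_comm. apply Rmult_le_compat.
      - apply Cmod_ge_0.
      - apply pow_le; lra.
      - pose proof (Cmod_sub_trans y0 b (X n w)). rewrite (Cmod_sub_sym b) in H0. specialize (HXb n). lra.
      - replace n with (k0 + (n - k0))%nat by lia. rewrite pow_add. rewrite <- (Rmult_1_r ((/ 2) ^ k0)) at 2.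
        apply Rmult_le_compat_l. apply pow_le; lra. rewrite <- (pow1 (n - k0)). apply pow_incr. lra. }
    pose proof (Rmin_l d (Rmin r rU)) as m1. pose proof (Rmin_r d (Rmin r rU)) as m2.
    pose proof (Rmin_l r rU) as m3. pose proof (Rmin_r r rU) as m4.
    assert (HUw : U wk) by (apply HUb; unfold disk; lra).
    destruct (compT_orbit f lam c b s N a T w n y0) as (Fy & _ & _); auto. lra. fold wk in Fy.
    assert (HKk : (K <= k)%nat) by (unfold k; lia).
    (* The limit [h] is only an intermediary: at [wk] and at [z] the k-th and the K-th iterates of
       the subsequence are close to each other, and the K-th is a fixed function, continuous at [z].
       So [y0] and [X n w] would be within 3e/4 of each other. *)
    assert (C1 : Cmod (y0 - Fiter f lam c (2 * psi K) wk) < e / 4).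
    { apply (Hch _ _ (h wk)); auto.
      - rewrite <- Fy at 1. apply (HK k wk HKk HUw). unfold disk; lra.
      - apply (HK K wk (le_n K) HUw). unfold disk; lra. }
    assert (C2 : Cmod (X n w - X (psi K) w) < e / 4).
    { apply (Hch _ _ (h z)); auto.
      - rewrite <- (proj1 (Horb n)). apply (HK k z HKk HUz). unfold disk. rewrite Cmod_sub_0; auto.
      - rewrite <- (proj1 (Horb (psi K))). apply (HK K z (le_n K) HUz). unfold disk. rewrite Cmod_sub_0; auto. }
    specialize (Hcont wk ltac:(lra)). rewrite (proj1 (Horb (psi K))) in Hcont.
    pose proof (Cmod_sub_trans y0 (Fiter f lam c (2 * psi K) wk) (X n w)) as T1.
    pose proof (Cmod_sub_trans (Fiter f lam c (2 * psi K) wk) (X (psi K) w) (X n w)) as T2.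
    rewrite (Cmod_sub_sym (X (psi K) w)) in T2. specialize (Hsep n). lra.
  - exists (s / 4). split. lra. intros K. exists (2 * K)%nat. split. lia.
    destruct (Horb K) as [E _].
    assert (Hin : forall y, Cmod (y - X K w) < s / 4 -> Cmod (y - b) < s / 2).
    { intros y Hy. pose proof (Cmod_sub_trans y (X K w) b). specialize (HXb K). lra. }
    (* The pullback is the image of the disc under the composed inverse branch; the disc lies in the
       one of radius s/2 about [b] where the branches are defined. *)
    exists (fun v => exists y, Cmod (y - X K w) < s / 4 /\ v = compT T w K y). split; [|split; [|split; [|split]]].
    + intros v [y [Hy ->]].
      destruct (compT_orbit f lam c b s N a T w K y) as (_ & _ & l & Hl & Hl0); auto.
      destruct (local_inverse (compT T w K) y l (s / 4 - Cmod (y - X K w))) as [r [m (Hr & HrR & Hm & _ & Hsur)]]; auto. lra.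
      { intros x Hx. pose proof (Cmod_sub_trans x y (X K w)).
        destruct (compT_orbit f lam c b s N a T w K x) as (_ & _ & l' & Hl' & _); auto. apply Hin; lra. exists l'; auto. }
      exists m. split; auto. intros u Hu. destruct (Hsur u Hu) as [x [Hx Ex]]. exists x. split; auto.
      pose proof (Cmod_sub_trans x y (X K w)). lra.
    + exists (X K w). split. rewrite Cmod_sub_0; lra. apply HXn.
    + intros v [y [Hy ->]]. destruct (compT_orbit f lam c b s N a T w K y) as (_ & h2 & _); auto.
    + intros v1 v2 [y1 [Hy1 ->]] [y2 [Hy2 ->]] Ev.
      destruct (compT_orbit f lam c b s N a T w K y1) as (g1 & _); auto.
      destruct (compT_orbit f lam c b s N a T w K y2) as (g2 & _); auto. congruence.
    + rewrite E. unfold disk. intros y. split.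
      * intros Hy. exists (compT T w K y). split. exists y. auto. apply (compT_orbit f lam c b s N a T); auto.
      * intros [v [[y' [Hy' ->]] Ev]]. destruct (compT_orbit f lam c b s N a T w K y') as (g1 & _); auto.
        rewrite g1 in Ev. subst y'. exact Hy'.
Qed.

Lemma finite_min_pos (N : nat) (u : nat -> R) : (forall i, (i < N)%nat -> 0 < u i) ->
  exists m, 0 < m /\ forall i, (i < N)%nat -> m <= u i.
Proof.
  induction N; intros H. exists 1. split. lra. intros; lia.
  destruct IHN as [m [Hm K]]. intros; apply H; lia.
  exists (Rmin m (u N)). split. apply Rmin_glb_lt; auto.
  intros i Hi. destruct (Nat.eq_dec i N) as [->|]. apply Rmin_r.
  eapply Rle_trans. apply Rmin_l. apply K. lia.
Qed.

Lemma compT_ext T w w' n y : (forall k, (k < n)%nat -> w k = w' k) -> compT T w n y = compT T w' n y.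
Proof. revert y. induction n; intros y H; simpl; auto. rewrite H by lia. apply IHn. intros; apply H; lia. Qed.

(** Dividing the derivative bounds by the Koebe constant gives ratios by which distances shrink at
    most, and these are the ratios for [moran_lower]. *)
Lemma ifs_hausdorff f lam c b s N a T t : meromorphic f -> 0 < s -> ifs f lam c b s N a T -> 0 < t ->
  (forall i, (i < N)%nat -> 0 < a i) ->
  1 <= rsum (fun i => Rpower (a i / (320 * PI)) t) N ->
  hausdorff_measure t (radial_julia f lam c) <> Finite 0.
Proof.
  intros Hf Hs Hifs Ht Ha Hsum. pose proof PI_RGT_0 as Hpi.
  destruct (ifs_coding f lam c b s N a T Hs Hifs) as [X HX].
  set (r := fun i => a i / (320 * PI)).
  assert (Hr : forall i, (i < N)%nat -> 0 < r i) by (intros i Hi; apply Rdiv_lt_0_compat; auto; lra).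
  assert (Hdiv : forall x i v, x * a i <= 320 * PI * v -> r i * x <= v).
  { intros x i v H. unfold r. apply Rmult_le_reg_l with (320 * PI). lra.
    replace (320 * PI * (a i / (320 * PI) * x)) with (x * a i) by (field; lra). exact H. }
  assert (Hexp : forall n i y y', (i < N)%nat -> Cmod (y - b) < s / 8 -> Cmod (y' - b) < s / 8 ->
    r i * Cmod (y - y') <= Cmod (T n i y - T n i y')).
  { intros n i y y' Hi Hy Hy'. destruct (classic (y = y')) as [->|Hne].
    { rewrite !Cmod_sub_0. lra. }
    apply Hdiv. apply (ifs_expand f lam c b s N a T n i y); auto.
    - apply Cmod_sub_pos; auto.
    - pose proof (Cmod_sub_trans y b y'). rewrite (Cmod_sub_sym b) in H. lra.
    - intros x Hx E. assert (x = y').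
      { apply (ifs_injective f lam c b s N a T n i); auto. pose proof (Cmod_sub_trans x y b).
        pose proof (Cmod_sub_trans y b y'). rewrite (Cmod_sub_sym b) in H0. lra. lra. }
      subst x. rewrite Cmod_sub_sym in Hx. lra. }
  destruct (finite_min_pos N r Hr) as [m [Hm Hmr]].
  apply (moran_lower N r (m * (s / 4)) t (X O)); auto.
  - nra.
  (* The Koebe lower bound and the contraction by 1/2, compared at one pair of points, give
     [r i <= / 2]. *)
  - intros i Hi. split; auto.
    set (y := (b + RtoC (s / 16))%C).
    assert (Hy : Cmod (b - y) = s / 16).
    { rewrite Cmod_sub_sym. unfold y. replace (b + RtoC (s / 16) - b)%C with (RtoC (s / 16)) by ring. rewrite Cmod_R. apply Rabs_pos_eq. lra. }
    assert (Hb : Cmod (b - b) < s / 8) by (rewrite Cmod_sub_0; lra).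
    assert (Hyb : Cmod (y - b) < s / 8) by (rewrite Cmod_sub_sym; lra).
    pose proof (Hexp O i b y Hi Hb Hyb). pose proof (ifs_contract f lam c b s N a T O i b y Hs Hifs Hi Hb Hyb).
    rewrite Hy in *. nra.
  - intros w w' n Hw Hw' Hagree Hne.
    assert (Hc : forall w, (forall k, (w k < N)%nat) -> forall n, X O w = compT T w n (X n w)).
    { clear -HX. intros w Hw. induction n. reflexivity. rewrite IHn. simpl. f_equal. apply HX; auto. }
    rewrite (Hc w Hw n), (Hc w' Hw' n). rewrite <- (compT_ext T w w' n (X n w')) by auto.
    assert (Hlow : forall n x x', Cmod (x - b) < s / 8 -> Cmod (x' - b) < s / 8 ->
      wprod r w n * Cmod (x - x') <= Cmod (compT T w n x - compT T w n x')).
    { clear -Hexp Hw Hr Hifs Hs. induction n; intros x x' Hx Hx'; simpl. lra.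
      assert (K : forall x, Cmod (x - b) < s / 8 -> Cmod (T n (w n) x - b) < s / 8).
      { intros u Hu. destruct (proj1 Hifs n (w n) u (Hw n) ltac:(lra)) as [h _]. lra. }
      eapply Rle_trans; [|apply IHn; auto].
      rewrite Rmult_assoc. apply Rmult_le_compat_l. left; apply wprod_pos with N; auto. auto. }
    destruct (HX w Hw n) as [b1 e1]. destruct (HX w' Hw' n) as [b2 e2].
    destruct (HX w Hw (S n)) as [b3 _]. destruct (HX w' Hw' (S n)) as [b4 _].
    eapply Rle_trans; [|apply Hlow; lra]. rewrite Rmult_comm. apply Rmult_le_compat_l.
    left; apply wprod_pos with N; auto.
    (* The first differing letters choose disjoint pieces at level [n], so the image of the disc of
       radius s/4 about [X (S n) w] omits [X n w']; [m] is a lower bound for all ratios. *)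
    apply Rle_trans with (r (w n) * (s / 4)). apply Rmult_le_compat_r. lra. auto.
    rewrite e1, e2. apply Hdiv. apply (ifs_expand f lam c b s N a T n (w n) (X (S n) w)); auto; try lra.
    intros x Hx. apply (proj2 Hifs); auto. pose proof (Cmod_sub_trans x (X (S n) w) b). lra. lra.
  - intros w Hw. apply (ifs_radial f lam c b s N a T X); auto.
Qed.

(** * Riemann sums on regular grids and the proximity integral *)

Lemma ex_RInt_local (v : R -> R) (a b : R) : a <= b ->
  (forall t, a <= t <= b -> exists d, 0 < d /\ forall x y, a <= x -> x <= t -> t <= y -> y <= b -> y - x < d -> ex_RInt v x y) ->
  ex_RInt v a b.
Proof.
  intros Hab H. apply (cousin (fun x0 x1 _ _ => ex_RInt v x0 x1) a b 0 0); auto; try lra.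
  - intros x0 x1 y0 y1 _ _ _ _ _ _ h1 h2 _ _. eapply ex_RInt_Chasles; eauto.
  - intros t y Ht _. destruct (H t Ht) as [d [Hd K]]. exists d. auto.
Qed.

(** A regular subdivision whose tags all have the same offset [t0] from the left endpoints; on a
    circle its tags are a rotated set of roots of unity. *)
Fixpoint grid (h t0 : R) (i j : nat) : @SF_seq R :=
  match j with
  | O => SF_nil (INR i * h)
  | S k => SF_cons (INR i * h, t0 + INR i * h) (grid h t0 (S i) k)
  end.

Lemma grid_head h t0 i j : SF_h (grid h t0 i j) = INR i * h.
Proof. destruct j; reflexivity. Qed.

Lemma grid_last h t0 i j d : seq.last d (SF_lx (grid h t0 i j)) = INR (i + j) * h.
Proof.
  revert i d. induction j; intros i d. simpl. rewrite Nat.add_0_r. reflexivity.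
  simpl grid. rewrite SF_lx_cons.
  change (seq.last d (fst (INR i * h, t0 + INR i * h) :: SF_lx (grid h t0 (S i) j))) with
    (seq.last (INR i * h) (SF_lx (grid h t0 (S i) j))).
  rewrite IHj. f_equal. f_equal. lia.
Qed.

Lemma grid_step h t0 i j : 0 <= h -> seq_step (SF_lx (grid h t0 i j)) <= h.
Proof.
  intros Hh. revert i. induction j; intros i. simpl. exact Hh.
  simpl grid. rewrite SF_lx_cons. unfold seq_step. simpl seq.head. simpl seq.behead.
  specialize (IHj (S i)). unfold seq_step in IHj. unfold SF_lx in *. simpl in *.
  apply Rmax_lub; auto. rewrite grid_head, S_INR. rewrite Rabs_pos_eq; lra.
Qed.

Lemma grid_pointed h t0 i j : 0 <= t0 <= h -> pointed_subdiv (grid h t0 i j).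
Proof.
  intros Ht. revert i. induction j; intros i k Hk.
  - unfold SF_size in Hk. simpl in Hk. lia.
  - simpl grid. rewrite SF_lx_cons. change (SF_ly (SF_cons (INR i * h, t0 + INR i * h) (grid h t0 (S i) j))) with
      ((t0 + INR i * h) :: SF_ly (grid h t0 (S i) j))%list.
    simpl grid in Hk. rewrite SF_size_cons in Hk. destruct k.
    + simpl seq.nth. rewrite grid_head, S_INR. simpl. lra.
    + simpl seq.nth. apply (IHj (S i) k). lia.
Qed.

Lemma grid_sum (v : R -> R) h t0 i j :
  Riemann_sum v (grid h t0 i j) = h * rsum (fun k => v (t0 + INR (i + k) * h)) j.
Proof.
  assert (Hshift : forall (u : nat -> R) n, rsum u (S n) = u O + rsum (fun k => u (S k)) n).
  { intros u. induction n. simpl; ring. change (rsum u (S (S n))) with (rsum u (S n) + u (S n)). rewrite IHn. simpl. ring. }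
  revert i. induction j; intros i. unfold Riemann_sum. simpl. rewrite Rmult_0_r. reflexivity.
  simpl grid. rewrite Riemann_sum_cons, IHj, grid_head. simpl fst. simpl snd.
  rewrite Hshift, Nat.add_0_r. unfold plus, scal; simpl; unfold mult; simpl.
  rewrite (rsum_ext (fun k => v (t0 + INR (S (i + k)) * h)) (fun k => v (t0 + INR (i + S k) * h))).
  2: { intros k _. replace (i + S k)%nat with (S (i + k)) by lia. reflexivity. }
  match goal with |- (?a - ?b) * ?c + _ = _ => replace (a - b) with h end. ring.
  destruct i; simpl; ring.
Qed.

(** The offset may depend on [n]. The excess 1 in a sum of [n] terms becomes L/n after
    multiplication by the mesh and disappears in the limit. *)
Lemma RInt_le_of_grids (v : R -> R) (L B : R) : 0 < L -> ex_RInt v 0 L ->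
  (forall n, (0 < n)%nat -> exists t0, 0 <= t0 <= L / INR n /\
     rsum (fun k => v (t0 + INR k * (L / INR n))) n <= INR n * B + 1) ->
  RInt v 0 L <= L * B.
Proof.
  intros HL Hex H. apply Rnot_lt_le. intros Hlt.
  set (e := (RInt v 0 L - L * B) / 2). assert (He : 0 < e) by (unfold e; lra).
  pose proof (RInt_correct (V := R_CompleteNormedModule) v 0 L Hex) as HI.
  assert (Hloc : locally (RInt v 0 L) (fun y => Rabs (y - RInt v 0 L) < e)).
  { exists (mkposreal e He). intros y Hy. exact Hy. }
  specialize (HI _ Hloc). destruct HI as [d Hd].
  destruct (INR_unbounded (L / d + L / e + 1)) as [n Hn].
  assert (0 < L / d) by (apply Rdiv_lt_0_compat; auto; apply cond_pos).
  assert (0 < L / e) by (apply Rdiv_lt_0_compat; auto).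
  assert (Hn0 : 0 < INR n) by lra. assert (Hn1 : (0 < n)%nat) by (apply INR_lt; simpl; lra).
  destruct (H n Hn1) as [t0 [Ht0 Hs]]. set (h := L / INR n) in *.
  assert (Hh : 0 < h) by (unfold h; apply Rdiv_lt_0_compat; auto).
  assert (Hend : INR n * h = L) by (unfold h; field; lra).
  specialize (Hd (grid h t0 0 n)).
  assert (Hstep : seq_step (SF_lx (grid h t0 0 n)) < d).
  { eapply Rle_lt_trans. apply grid_step. lra. unfold h. apply Rmult_lt_reg_r with (INR n); auto.
    unfold Rdiv. rewrite Rmult_assoc, Rinv_l by lra. pose proof (cond_pos d).
    assert (K : L / d < INR n) by lra. apply (Rmult_lt_compat_r d) in K; auto. replace (L / d * d) with L in K by (field; lra). lra. }
  specialize (Hd Hstep). rewrite Rmin_left, Rmax_right in Hd by lra.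
  assert (Hpt : pointed_subdiv (grid h t0 0 n) /\ SF_h (grid h t0 0 n) = 0 /\
    seq.last (SF_h (grid h t0 0 n)) (SF_lx (grid h t0 0 n)) = L).
  { split. apply grid_pointed. lra. split. rewrite grid_head. simpl. ring. rewrite grid_last. simpl plus. exact Hend. }
  specialize (Hd Hpt). rewrite grid_sum in Hd. simpl plus in Hd.
  rewrite sign_eq_1 in Hd by lra. unfold scal in Hd; simpl in Hd; unfold mult in Hd; simpl in Hd. rewrite Rmult_1_l in Hd.
  assert (Hsum : h * rsum (fun k => v (t0 + INR k * h)) n <= L * B + h).
  { apply (Rmult_le_compat_l h) in Hs; [|lra]. replace (h * (INR n * B + 1)) with (INR n * h * B + h) in Hs by ring.
    rewrite Hend in Hs. exact Hs. }
  assert (Hhe : h < e).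
  { unfold h. apply Rmult_lt_reg_r with (INR n); auto. unfold Rdiv. rewrite Rmult_assoc, Rinv_l by lra.
    assert (K : L / e < INR n) by lra. apply (Rmult_lt_compat_r e) in K; auto. replace (L / e * e) with L in K by (field; lra). lra. }
  apply Rabs_def2 in Hd. unfold e in *. lra.
Qed.

Lemma logplus_ge0 x : 0 <= logplus x.
Proof. apply Rmax_l. Qed.

Lemma logplus_eq x : logplus x = ln (Rmax 1 x).
Proof.
  unfold logplus. destruct (Rle_dec x 1) as [H|H].
  - rewrite (Rmax_left 1 x) by lra. rewrite ln_1. apply Rmax_left.
    destruct (Rlt_dec 0 x) as [Hx|Hx].
    + rewrite <- ln_1. destruct (Req_dec x 1) as [->|]. lra. left. apply ln_increasing; lra.
    + unfold ln. destruct (Rlt_dec 0 x); [contradiction|apply Rle_refl].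
  - rewrite (Rmax_right 1 x) by lra. apply Rmax_right. rewrite <- ln_1. left. apply ln_increasing; lra.
Qed.

Lemma ln_le_sub x : 0 < x -> ln x <= x - 1.
Proof.
  intros Hx. rewrite <- (ln_exp (x - 1)). destruct (Req_dec x 1) as [->|].
  { right. f_equal. replace (1 - 1) with 0 by ring. rewrite exp_0. reflexivity. }
  left. apply ln_increasing; auto. pose proof (exp_ineq1 (x - 1)). lra.
Qed.

Lemma logplus_lipschitz x y : Rabs (logplus x - logplus y) <= Rabs (x - y).
Proof.
  assert (K : forall x y, x <= y -> 0 <= logplus y - logplus x <= y - x).
  { clear. intros x y Hxy. rewrite !logplus_eq.
    assert (1 <= Rmax 1 x) by apply Rmax_l.
    assert (H1 : Rmax 1 x <= Rmax 1 y) by (apply Rle_max_compat_l; auto).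
    assert (H2 : Rmax 1 y - Rmax 1 x <= y - x) by (unfold Rmax; destruct (Rle_dec 1 x), (Rle_dec 1 y); lra).
    split.
    - destruct H1 as [H1|H1]. assert (ln (Rmax 1 x) < ln (Rmax 1 y)) by (apply ln_increasing; lra). lra. rewrite H1. lra.
    - rewrite <- ln_div by lra. eapply Rle_trans. apply ln_le_sub. apply Rdiv_lt_0_compat; lra.
      apply Rle_trans with (Rmax 1 y - Rmax 1 x); auto.
      apply Rmult_le_reg_r with (Rmax 1 x). lra.
      replace ((Rmax 1 y / Rmax 1 x - 1) * Rmax 1 x) with (Rmax 1 y - Rmax 1 x) by (field; lra). nra. }
  destruct (Rle_dec x y) as [H|H].
  - specialize (K x y H). rewrite (Rabs_minus_sym x y), (Rabs_minus_sym (logplus x)), !Rabs_pos_eq; lra.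
  - specialize (K y x ltac:(lra)). rewrite !Rabs_pos_eq; lra.
Qed.

Lemma Rmin_lipschitz x y M : Rabs (Rmin x M - Rmin y M) <= Rabs (x - y).
Proof.
  unfold Rmin. destruct (Rle_dec x M), (Rle_dec y M); split_Rabs; lra.
Qed.

Lemma Cpolar_Cexp r t : 0 < r -> Cpolar r t = Cexp (ln r, t).
Proof.
  intros Hr. unfold Cpolar, Cexp, Re, Im. simpl. rewrite exp_ln by auto.
  unfold Cmult, RtoC. simpl. f_equal; ring.
Qed.

Lemma Cmod_Cpolar r t : 0 < r -> Cmod (Cpolar r t) = r.
Proof. intros Hr. rewrite Cpolar_Cexp, Cmod_Cexp by auto. simpl. apply exp_ln; auto. Qed.

Lemma Cpolar_cont r t e : 0 < r -> 0 < e -> exists d, 0 < d /\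
  forall s, Rabs (s - t) < d -> Cmod (Cpolar r s - Cpolar r t) < e.
Proof.
  intros Hr He. destruct (cderiv_ccont _ _ _ (cderiv_Cexp (ln r, t)) e He) as [d [Hd H]].
  exists d. split; auto. intros s Hs. rewrite !Cpolar_Cexp by auto. apply H. rewrite Cmod_vertical. exact Hs.
Qed.

Lemma Cpolar_inj_local r s t : 0 < r -> Rabs (s - t) < PI -> Cpolar r s = Cpolar r t -> s = t.
Proof.
  intros Hr Hst E. unfold Cpolar, Cmult, RtoC in E. simpl in E. injection E as E1 E2.
  assert (C1 : cos s = cos t) by (apply Rmult_eq_reg_l with r; lra).
  assert (S1 : sin s = sin t) by (apply Rmult_eq_reg_l with r; lra).
  assert (Z : sin (s - t) = 0) by (rewrite sin_minus, C1, S1; ring).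
  apply Rabs_def2 in Hst. destruct (Rtotal_order s t) as [H|[H|H]]; auto; exfalso.
  - assert (0 < sin (t - s)) by (apply sin_gt_0; lra). replace (t - s) with (- (s - t)) in H0 by ring. rewrite sin_neg in H0. lra.
  - assert (0 < sin (s - t)) by (apply sin_gt_0; lra). lra.
Qed.

(** Near the angle of a pole on the circle the truncated integrand equals [M] except at that single
    angle; near any other angle it is continuous. *)
Lemma ex_RInt_prox f r M : meromorphic f -> 0 < r ->
  ex_RInt (fun t => Rmin (logplus (Cmod (f (Cpolar r t)))) M) 0 (2 * PI).
Proof.
  intros Hf Hr. pose proof PI_RGT_0. apply ex_RInt_local. lra.
  intros t _. destruct (classic (poles f (Cpolar r t))) as [[m Hp]|Hnp].
  - destruct (pole_blowup f (Cpolar r t) m (exp (Rabs M)) Hp) as [d1 [Hd1 Hb]].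
    destruct (Cpolar_cont r t d1 Hr Hd1) as [d2 [Hd2 Hc]].
    set (d := Rmin d2 PI). assert (Hd : 0 < d) by (apply Rmin_glb_lt; lra).
    assert (dd2 : d <= d2) by apply Rmin_l. assert (dpi : d <= PI) by apply Rmin_r.
    assert (Hc' : forall s, s <> t -> Rabs (s - t) < d -> M = Rmin (logplus (Cmod (f (Cpolar r s)))) M).
    { intros s Hst Hs. symmetry. apply Rmin_right.
      destruct (Hb (Cpolar r s)) as [_ K]. apply Hc; lra.
      { intros E. apply Hst. apply (Cpolar_inj_local r); auto. lra. }
      assert (1 <= exp (Rabs M)). { rewrite <- exp_0. destruct (Rabs_pos M) as [Q|Q]. left; apply exp_increasing; auto. rewrite <- Q; lra. }
      rewrite logplus_eq, Rmax_right by lra. apply Rle_trans with (Rabs M). apply Rle_abs.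
      rewrite <- (ln_exp (Rabs M)). left. apply ln_increasing; auto. apply exp_pos. }
    exists d. split; auto. intros x y _ Hxt Hty _ Hxy.
    apply ex_RInt_Chasles with t.
    + apply ex_RInt_ext with (f := fun _ => M); [|apply ex_RInt_const].
      rewrite Rmin_left, Rmax_right by lra. intros s Hs. apply Hc'. lra. apply Rabs_def1; lra.
    + apply ex_RInt_ext with (f := fun _ => M); [|apply ex_RInt_const].
      rewrite Rmin_left, Rmax_right by lra. intros s Hs. apply Hc'. lra. apply Rabs_def1; lra.
  - destruct (nonpole_open f _ Hf Hnp) as [d1 [Hd1 Hb]].
    destruct (Cpolar_cont r t d1 Hr Hd1) as [d2 [Hd2 Hc]].
    exists d2. split; auto. intros x y _ Hxt Hty _ Hxy.
    apply (ex_RInt_continuous (V := R_CompleteNormedModule)). rewrite Rmin_left, Rmax_right by lra. intros s Hs.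
    assert (Hs' : Rabs (s - t) < d2) by (apply Rabs_def1; lra).
    destruct (Hb (Cpolar r s) (Hc s Hs')) as [_ Hh].
    apply continuous_eps. intros e He. destruct (cholo_ccont _ _ Hh e He) as [e1 [He1 Hf1]].
    destruct (Cpolar_cont r s e1 Hr He1) as [e2 [He2 Hc2]].
    exists e2. split; auto. intros u Hu.
    eapply Rle_lt_trans. apply Rmin_lipschitz. eapply Rle_lt_trans. apply logplus_lipschitz.
    specialize (Hf1 _ (Hc2 u Hu)). pose proof (Cmod_sub_ge (f (Cpolar r u)) (f (Cpolar r s))).
    pose proof (Cmod_sub_ge (f (Cpolar r s)) (f (Cpolar r u))). rewrite (Cmod_sub_sym (f (Cpolar r s))) in H1.
    apply Rabs_def1; lra.
Qed.

Lemma polar_form z r : 0 < r -> Cmod z = r -> exists t, 0 <= t < 2 * PI /\ z = Cpolar r t.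
Proof.
  intros Hr Hz. pose proof PI_RGT_0 as Hpi. destruct z as [a b].
  assert (Hab : a ^ 2 + b ^ 2 = r ^ 2).
  { pose proof (Cmod2_alt (a, b)) as K. rewrite Hz in K. simpl in *. lra. }
  set (x := a / r). set (y := b / r).
  assert (Ea : a = r * x) by (unfold x; field; lra). assert (Eb : b = r * y) by (unfold y; field; lra).
  assert (Hxy : x ^ 2 + y ^ 2 = 1).
  { unfold x, y. replace ((a / r) ^ 2 + (b / r) ^ 2) with ((a ^ 2 + b ^ 2) / r ^ 2) by (field; lra). rewrite Hab. field. lra. }
  assert (Hx : -1 <= x <= 1) by nra.
  pose proof (acos_bound x) as Hac. pose proof (cos_acos x Hx) as Hc. pose proof (sin_acos x Hx) as Hs.
  assert (Hsq : sqrt (1 - x ^ 2) = Rabs y).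
  { replace (1 - x ^ 2) with (y ^ 2) by lra. rewrite <- Rsqr_pow2. apply sqrt_Rsqr_abs. }
  assert (Hs' : sin (acos x) = Rabs y). { rewrite Hs, <- Hsq. f_equal. unfold Rsqr. ring. }
  destruct (Rle_dec 0 y) as [Hy|Hy].
  - exists (acos x). split. lra. unfold Cpolar, Cmult, RtoC; simpl. rewrite Hc, Hs', Rabs_pos_eq by auto. f_equal; lra.
  - exists (2 * PI - acos x). assert (acos x <> 0). { intros K. rewrite K, sin_0 in Hs'. symmetry in Hs'. apply Rabs_eq_0 in Hs'. lra. }
    split. lra. unfold Cpolar, Cmult, RtoC; simpl.
    rewrite cos_minus, sin_minus, cos_2PI, sin_2PI, Hc, Hs', Rabs_left by lra. f_equal; lra.
Qed.

(** * Jensen's inequality *)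

Fixpoint Cprod (F : nat -> C) (n : nat) : C :=
  match n with O => 1 | S k => Cprod F k * F k end%C.

Lemma cholo_Cprod (F : nat -> C -> C) z n : (forall k, (k < n)%nat -> cholo (F k) z) ->
  cholo (fun w => Cprod (fun k => F k w) n) z.
Proof.
  induction n; intros H; simpl. apply cholo_const.
  apply cholo_mult. apply IHn. intros; apply H; lia. apply H; lia.
Qed.

Lemma Cprod_ge (F : nat -> C) A n : 0 <= A -> (forall k, (k < n)%nat -> A <= Cmod (F k)) -> A ^ n <= Cmod (Cprod F n).
Proof.
  intros HA. induction n; intros H; simpl. rewrite Cmod_1. lra.
  rewrite Cmod_mult, (Rmult_comm A). apply Rmult_le_compat; auto. apply pow_le; auto.
Qed.

Lemma Cprod_le_exp (F : nat -> C) (x : nat -> R) n : (forall k, (k < n)%nat -> Cmod (F k) <= exp (x k)) ->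
  Cmod (Cprod F n) <= exp (rsum x n).
Proof.
  induction n; intros H; simpl. rewrite Cmod_1, exp_0. lra.
  rewrite Cmod_mult, exp_plus. apply Rmult_le_compat; auto using Cmod_ge_0.
Qed.

Lemma Cprod_locally_bounded (F : nat -> C -> C) (ok : C -> Prop) a n :
  (forall k, (k < n)%nat -> exists d B, 0 < d /\ forall z, Cmod (z - a) < d -> ok z -> Cmod (F k z) <= B) ->
  exists d B, 0 < d /\ forall z, Cmod (z - a) < d -> ok z -> Cmod (Cprod (fun k => F k z) n) <= B.
Proof.
  induction n; intros H.
  - exists 1, 1. split. lra. intros. simpl. rewrite Cmod_1. lra.
  - destruct IHn as [d1 [B1 [Hd1 H1]]]. intros; apply H; lia. destruct (H n) as [d2 [B2 [Hd2 H2]]]. lia.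
    exists (Rmin d1 d2), (B1 * B2). split. apply Rmin_glb_lt; auto. intros z Hz Hok. simpl. rewrite Cmod_mult.
    pose proof (Rmin_l d1 d2). pose proof (Rmin_r d1 d2).
    apply Rmult_le_compat; auto using Cmod_ge_0. apply H1; auto; lra. apply H2; auto; lra.
Qed.

Lemma punctured_avoid (E : list C) d : 0 < d -> exists z, z <> 0%C /\ Cmod z < d /\ ~ In z E.
Proof.
  intros Hd. set (E' := filter (fun a => if Ceq_dec a 0 then false else true) E).
  assert (H0 : ~ In (RtoC 0) E').
  { unfold E'. intros H. apply filter_In in H. destruct H as [_ H]. destruct (Ceq_dec 0 0); congruence. }
  destruct (not_In_open E' 0 H0) as [d' [Hd' Hav]].
  destruct (exists_near 0 (Rmin d d')) as [z [Hz Hz0]]. apply Rmin_glb_lt; auto.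
  pose proof (Rmin_l d d'). pose proof (Rmin_r d d'). exists z. split; auto.
  assert (Ez : (z - 0)%C = z) by ring. split. rewrite Ez in Hz. lra.
  intros Hin. apply (Hav z ltac:(lra)). unfold E'. apply filter_In. split; auto. destruct (Ceq_dec z 0); congruence.
Qed.

Lemma rsum_periodic (v : R -> R) (h : R) (n : nat) (t : R) : (forall x, v (x + INR n * h) = v x) ->
  forall k, rsum (fun j => v (t + INR k * h + INR j * h)) n = rsum (fun j => v (t + INR j * h)) n.
Proof.
  intros Hp.
  assert (K : forall s, rsum (fun j => v (s + h + INR j * h)) n = rsum (fun j => v (s + INR j * h)) n).
  { intros s. assert (Q : forall m, rsum (fun j => v (s + h + INR j * h)) m + v s = rsum (fun j => v (s + INR j * h)) m + v (s + INR m * h)).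
    { induction m. simpl. rewrite Rmult_0_l, Rplus_0_r. reflexivity.
      cbn [rsum]. replace (s + h + INR m * h) with (s + INR (S m) * h) by (rewrite S_INR; ring). lra. }
    specialize (Q n). rewrite Hp in Q. lra. }
  induction k. apply rsum_ext. intros j _. f_equal. change (INR 0) with 0. ring.
  rewrite <- IHk, <- (K (t + INR k * h)). apply rsum_ext. intros j _. f_equal. rewrite S_INR. ring.
Qed.

(* Averaging u over n-th roots of unity turns the maximum principle into a bound on Riemann sums of log |u|. *)
Lemma jensen (E : list C) (u : C -> C) (v : R -> R) (r A C1 : R) : 0 < r -> 0 < A ->
  (forall a, In a E -> Cmod a <= r) ->
  (forall z, Cmod z <= r -> ~ In z E -> cholo u z) ->
  (forall a, In a E -> exists d B, 0 < d /\ forall z, Cmod (z - a) < d -> ~ In z E -> Cmod (u z) <= B) ->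
  (exists d, 0 < d /\ forall z, z <> 0%C -> Cmod z < d -> ~ In z E -> A <= Cmod (u z)) ->
  (forall t, v (t + 2 * PI) = v t) ->
  (forall t, ~ In (Cpolar r t) E -> Cmod (u (Cpolar r t)) <= exp (C1 - v t)) ->
  ex_RInt v 0 (2 * PI) ->
  RInt v 0 (2 * PI) <= 2 * PI * (C1 - ln A).
Proof.
  intros Hr HA HEr Hhol HEb [d0 [Hd0 H0]] Hper Hcirc Hex. pose proof PI_RGT_0 as Hpi.
  apply RInt_le_of_grids; auto. lra.
  intros n Hn. assert (Hn0 : 0 < INR n) by (apply lt_0_INR; auto).
  set (h := 2 * PI / INR n). assert (Hh : 0 < h) by (unfold h; apply Rdiv_lt_0_compat; lra).
  assert (Hnh : INR n * h = 2 * PI) by (unfold h; field; lra).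
  set (rot := fun k : nat => Cexp (0, INR k * h)%R).
  assert (Hrot : forall k z, Cmod (rot k * z) = Cmod z).
  { intros k z. rewrite Cmod_mult. unfold rot. rewrite Cmod_Cexp. simpl. rewrite exp_0. ring. }
  set (rinv := fun k : nat => Cexp (0, - (INR k * h))%R).
  assert (Hri : forall k, (rot k * rinv k)%C = 1%C).
  { intros k. unfold rot, rinv. rewrite <- Cexp_plus. rewrite <- Cexp_0. f_equal. unfold Cplus, RtoC; simpl. f_equal; ring. }
  (* The points at which some factor of [U] may be singular. *)
  set (En := flat_map (fun k => map (fun a => rinv k * a)%C E) (seq 0 n)).
  assert (HEn1 : forall z, ~ In z En -> forall k, (k < n)%nat -> ~ In (rot k * z)%C E).
  { intros z Hz k Hk Hin. apply Hz. unfold En. apply in_flat_map. exists k. split. apply in_seq. lia.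
    apply in_map_iff. exists (rot k * z)%C. split; auto.
    replace (rinv k * (rot k * z))%C with ((rot k * rinv k) * z)%C by ring. rewrite Hri. ring. }
  assert (HEn2 : forall a, In a En -> Cmod a <= r).
  { intros a Ha. unfold En in Ha. apply in_flat_map in Ha. destruct Ha as [k [_ Ha]]. apply in_map_iff in Ha.
    destruct Ha as [e [<- He]]. rewrite <- (Hrot k). replace (rot k * (rinv k * e))%C with ((rot k * rinv k) * e)%C by ring.
    rewrite Hri, Cmult_1_l. auto. }
  set (U := fun z => Cprod (fun k => u (rot k * z)%C) n).
  assert (Hrc : forall k z, cholo (fun w => rot k * w)%C z).
  { intros k z. apply cholo_mult. apply cholo_const. apply cholo_id. }
  (* Near 0 each factor of [U] has modulus at least [A], so by the maximum principle |U| cannot stay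
     below A^n/e on the whole circle. The factor exp(-1) is the source of the excess 1 in the grid
     sums. *)
  assert (Hex1 : exists z, Cmod z = r /\ ~ In z En /\ A ^ n * exp (-1) < Cmod (U z)).
  { apply NNPP. intros Hno.
    assert (HAn : 0 < A ^ n) by (apply pow_lt; auto). assert (He1 : 0 < exp (-1) < 1).
    { split. apply exp_pos. rewrite <- exp_0. apply exp_increasing. lra. }
    destruct (punctured_avoid En (Rmin d0 r)) as [z [Hz0 [Hzd HzE]]]. apply Rmin_glb_lt; auto.
    pose proof (Rmin_l d0 r). pose proof (Rmin_r d0 r).
    assert (K1 : A ^ n <= Cmod (U z)).
    { apply Cprod_ge. lra. intros k Hk. apply H0; [| |apply HEn1; auto].
      - apply Cmult_neq_0; auto. apply Cexp_nz.
      - rewrite Hrot. lra. }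
    assert (K2 : Cmod (U z) <= A ^ n * exp (-1)).
    { assert (Ez : forall w : C, (w - 0)%C = w) by (intros w; ring).
      apply (max_principle_exc En U 0 r); auto.
      - nra.
      - intros w Hw HwE. rewrite Ez in Hw. apply (cholo_Cprod (fun k w => u (rot k * w)%C)). intros k Hk.
        apply (cholo_comp u (fun w => rot k * w)%C); auto. apply Hhol. rewrite Hrot; auto. auto.
      - intros a Ha. apply (Cprod_locally_bounded (fun k w => u (rot k * w)%C) (fun w => ~ In w En)).
        intros k Hk.
        assert (Q : exists d B, 0 < d /\ forall y, Cmod (y - rot k * a) < d -> ~ In y E -> Cmod (u y) <= B).
        { destruct (classic (In (rot k * a)%C E)) as [Hin|Hout]. auto.
          destruct (cholo_ccont u (rot k * a)%C) with (e := 1) as [d [Hd Hc]]; try lra.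
          apply Hhol; auto. rewrite Hrot. auto.
          exists d, (Cmod (u (rot k * a)%C) + 1). split; auto. intros y Hy _. specialize (Hc y Hy).
          pose proof (Cmod_sub_ge (u y) (u (rot k * a)%C)). lra. }
        destruct Q as [d [B [Hd Q]]]. exists d, B. split; auto. intros y Hy HyE. apply Q; auto.
        replace (rot k * y - rot k * a)%C with (rot k * (y - a))%C by ring. rewrite Hrot. exact Hy.
      - intros w Hw HwE. rewrite Ez in Hw. apply Rnot_lt_le. intros K. apply Hno. exists w. auto.
      - rewrite Ez. lra. }
    nra. }
  destruct Hex1 as [z [Hz [HzE HU]]]. destruct (polar_form z r Hr Hz) as [th [Hth Ez]].
  assert (Hrotz : forall k, (rot k * z)%C = Cpolar r (th + INR k * h)).
  { intros k. rewrite Ez, !Cpolar_Cexp by auto. unfold rot. rewrite <- Cexp_plus. f_equal.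
    unfold Cplus; simpl. f_equal; ring. }
  assert (HUe : Cmod (U z) <= exp (rsum (fun k => C1 - v (th + INR k * h)) n)).
  { apply Cprod_le_exp. intros k Hk. rewrite Hrotz. apply Hcirc. rewrite <- Hrotz. auto. }
  assert (Hs : rsum (fun k => v (th + INR k * h)) n <= INR n * (C1 - ln A) + 1).
  { assert (E1 : rsum (fun k => C1 - v (th + INR k * h)) n = INR n * C1 - rsum (fun k => v (th + INR k * h)) n).
    { assert (Q : forall (x : nat -> R) m, rsum (fun k => C1 - x k) m = INR m * C1 - rsum x m).
      { intros x. induction m. simpl; ring. cbn [rsum]. rewrite IHm, S_INR. ring. }
      apply (Q (fun k => v (th + INR k * h))). }
    rewrite E1 in HUe.
    assert (E2 : A ^ n * exp (-1) = exp (INR n * ln A - 1)).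
    { unfold Rminus. rewrite exp_plus. f_equal. rewrite <- Rpower_pow by auto. reflexivity. }
    rewrite E2 in HU. assert (K : exp (INR n * ln A - 1) < exp (INR n * C1 - rsum (fun k => v (th + INR k * h)) n)) by lra.
    apply exp_lt_inv in K. lra. }
  (* The offset of a grid has to lie in [0, h]; reducing the angle by a multiple of [h] leaves the
     sum over a full period unchanged. *)
  assert (Hfl : exists k : nat, INR k * h <= th < (INR k + 1) * h).
  { assert (K : forall m : nat, th < INR m * h -> exists k : nat, INR k * h <= th < (INR k + 1) * h).
    { induction m; intros Hm. simpl in Hm. lra.
      destruct (Rlt_dec th (INR m * h)) as [Q|Q]; auto. exists m. rewrite S_INR in Hm. lra. }
    apply (K n). lra. }
  destruct Hfl as [k Hk]. exists (th - INR k * h). split. lra.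
  rewrite <- (rsum_periodic v h n (th - INR k * h)) with (k := k).
  - replace (th - INR k * h + INR k * h) with th by ring. exact Hs.
  - intros x. rewrite Hnh. apply Hper.
Qed.

(** * Growth of the characteristic when the sum over the b-points is bounded *)

Definition bpt f (b z : C) : Prop := ~ poles f z /\ f z = b.

(** |f - b| is comparable to |z - a|^(zb - pb) near [a]; the exponent is split to keep both parts
    natural numbers. *)
Definition order_at f (b a : C) (zb pb : nat) : Prop :=
  exists c K d, 0 < c /\ 0 < K /\ 0 < d /\ d <= 1 /\ forall z, Cmod (z - a) < d -> z <> a ->
    cholo f z /\ c * Cmod (z - a) ^ zb <= Cmod (f z - b) * Cmod (z - a) ^ pb /\
    Cmod (f z - b) * Cmod (z - a) ^ pb <= K * Cmod (z - a) ^ zb.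

Lemma order_at_pole f b a (m : nat) : is_pole f a m -> order_at f b a 0 m.
Proof.
  intros Hp. destruct (pole_derivative f a m Hp) as [d [K [c (Hd & HK & Hc & HF)]]].
  destruct (pole_blowup f a m (2 * Cmod b) Hp) as [d1 [Hd1 HB]]. pose proof (Cmod_ge_0 b).
  exists (c / 2), (K + Cmod b), (Rmin 1 (Rmin d d1)). pose proof (Rmin_l 1 (Rmin d d1)). pose proof (Rmin_r 1 (Rmin d d1)).
  pose proof (Rmin_l d d1). pose proof (Rmin_r d d1).
  repeat split; try lra. repeat apply Rmin_glb_lt; lra.
  - apply HF; auto; lra.
  - destruct (HF z ltac:(lra) H5) as (_ & _ & _ & h & _). destruct (HB z ltac:(lra) H5) as [_ hb].
    assert (Hx : 0 < Cmod (z - a)) by (apply Cmod_sub_pos; auto). assert (Hxm : 0 < Cmod (z - a) ^ m) by (apply pow_lt; auto).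
    pose proof (Cmod_sub_ge (f z) b). simpl.
    apply (Rmult_le_compat_r (Cmod (z - a) ^ m)) in h; [|lra].
    replace (c / Cmod (z - a) ^ m * Cmod (z - a) ^ m) with c in h by (field; lra). nra.
  - destruct (HF z ltac:(lra) H5) as (_ & _ & _ & _ & h).
    assert (Hx : 0 < Cmod (z - a)) by (apply Cmod_sub_pos; auto). assert (Hxm : 0 < Cmod (z - a) ^ m) by (apply pow_lt; auto).
    pose proof (Cmod_sub_le (f z) b). simpl.
    apply (Rmult_le_compat_r (Cmod (z - a) ^ m)) in h; [|lra].
    replace (K / Cmod (z - a) ^ m * Cmod (z - a) ^ m) with K in h by (field; lra).
    assert (Cmod (z - a) ^ m <= 1) by (rewrite <- (pow1 m); apply pow_incr; lra). nra.
Qed.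

(** [b] is not a critical value, so its preimages are simple. *)
Lemma order_at_bpt f b a : meromorphic f -> ~ sing_set f b -> bpt f b a -> order_at f b a 1 0.
Proof.
  intros Hf Hs [Hnp Hb]. destruct (nonpole_open f a Hf Hnp) as [d1 [Hd1 Hh]].
  assert (Hl : dC f a <> 0%C).
  { intros E. apply Hs. left. exists a. split; auto. split; auto.
    apply is_derive_cderiv. rewrite <- E. apply dC_spec, meromorphic_cholo; auto. }
  pose proof (dC_spec f a (meromorphic_cholo f a Hf Hnp)) as Hd. apply Cmod_gt_0 in Hl. set (x := Cmod (dC f a)) in *.
  destruct (Hd (x / 2) ltac:(lra)) as [d2 [Hd2 Hw]].
  exists (x / 2), (2 * x), (Rmin 1 (Rmin d1 d2)). pose proof (Rmin_l 1 (Rmin d1 d2)). pose proof (Rmin_r 1 (Rmin d1 d2)).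
  pose proof (Rmin_l d1 d2). pose proof (Rmin_r d1 d2).
  split. lra. split. lra. split. repeat apply Rmin_glb_lt; lra. split. lra.
  intros z Hz Hza. split. apply Hh; lra. simpl. rewrite !Rmult_1_r.
  specialize (Hw z ltac:(lra)). rewrite Hb in Hw.
  pose proof (Cmod_sub_ge (dC f a * (z - a)) (- (f z - b - dC f a * (z - a)))) as T1.
  replace (dC f a * (z - a) - - (f z - b - dC f a * (z - a)))%C with (f z - b)%C in T1 by ring.
  pose proof (Cmod_triangle (f z - b - dC f a * (z - a)) (dC f a * (z - a))) as T2.
  replace (f z - b - dC f a * (z - a) + dC f a * (z - a))%C with (f z - b)%C in T2 by ring.
  rewrite Cmod_opp, Cmod_mult in T1. rewrite Cmod_mult in T2. fold x in T1, T2. lra.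
Qed.

Lemma order_at_regular f b a : meromorphic f -> ~ poles f a -> f a <> b -> order_at f b a 0 0.
Proof.
  intros Hf Hnp Hb. destruct (nonpole_open f a Hf Hnp) as [d1 [Hd1 Hh]].
  assert (Hx : 0 < Cmod (f a - b)) by (apply Cmod_sub_pos; auto). set (x := Cmod (f a - b)) in *.
  destruct (cholo_ccont _ _ (meromorphic_cholo f a Hf Hnp) (x / 2) ltac:(lra)) as [d2 [Hd2 Hw]].
  exists (x / 2), (2 * x), (Rmin 1 (Rmin d1 d2)). pose proof (Rmin_l 1 (Rmin d1 d2)). pose proof (Rmin_r 1 (Rmin d1 d2)).
  pose proof (Rmin_l d1 d2). pose proof (Rmin_r d1 d2).
  split. lra. split. lra. split. repeat apply Rmin_glb_lt; lra. split. lra.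
  intros z Hz Hza. split. apply Hh; lra. simpl. rewrite !Rmult_1_r. specialize (Hw z ltac:(lra)).
  pose proof (Cmod_sub_trans (f z) (f a) b) as T1. pose proof (Cmod_sub_trans (f a) (f z) b) as T2.
  rewrite (Cmod_sub_sym (f a) (f z)) in T2. fold x in T1, T2. lra.
Qed.

Lemma order_at_exists f b a : meromorphic f -> ~ sing_set f b -> exists zb pb, order_at f b a zb pb /\
  ((bpt f b a /\ zb = 1%nat) \/ (~ bpt f b a /\ zb = 0%nat)).
Proof.
  intros Hf Hs. destruct (classic (poles f a)) as [[m Hm]|Hnp].
  - exists 0%nat, m. split. apply order_at_pole; auto. right. split; auto. intros [K _]. apply K. exists m; auto.
  - destruct (classic (f a = b)) as [E|E].
    + exists 1%nat, 0%nat. split. apply order_at_bpt; auto. split; auto. left. split; auto. split; auto.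
    + exists 0%nat, 0%nat. split. apply order_at_regular; auto. right. split; auto. intros [_ K]; auto.
Qed.

Lemma discrete_finite (Q : C -> Prop) (R : R) :
  (forall a, exists d, 0 < d /\ forall z, Cmod (z - a) < d -> z <> a -> ~ Q z) ->
  exists l : list C, NoDup l /\ forall z, In z l <-> Q z /\ Cmod z <= R.
Proof.
  intros H.
  assert (K : exists l : list C, forall z, Cmod (z - 0) <= R -> Q z -> In z l).
  { apply (disc_compact (fun A => exists l : list C, forall z, A z -> Q z -> In z l)).
    - exists nil. tauto.
    - intros A B [l1 H1] [l2 H2]. exists (l1 ++ l2). intros z [Hz|Hz] Hq; apply in_or_app; auto.
    - intros A B HAB [l1 H1]. exists l1. auto.
    - intros a _. destruct (H a) as [d [Hd Hw]]. exists d. split; auto. exists (a :: nil). intros z Hz Hq.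
      left. apply NNPP. intros Hne. apply (Hw z Hz); auto. }
  destruct K as [l Hl].
  exists (nodup Ceq_dec (filter (fun z => if excluded_middle_informative (Q z /\ Cmod z <= R) then true else false) l)).
  split. apply NoDup_nodup. intros z. rewrite nodup_In, filter_In.
  destruct (excluded_middle_informative (Q z /\ Cmod z <= R)) as [Hq|Hq]; split; try tauto.
  - intros _. split; auto. apply Hl; [|tauto]. replace (z - 0)%C with z by ring. tauto.
  - intros [_ K]. discriminate.
Qed.

Lemma order_at_discrete f b a : meromorphic f -> ~ sing_set f b -> exists d, 0 < d /\
  forall z, Cmod (z - a) < d -> z <> a -> ~ bpt f b z /\ ~ poles f z.
Proof.
  intros Hf Hs. destruct (order_at_exists f b a Hf Hs) as [zb [pb [(c & K & d & Hc & HK & Hd & _ & H) _]]].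
  exists d. split; auto. intros z Hz Hza. destruct (H z Hz Hza) as (h1 & h2 & _). split; [|apply cholo_not_pole; auto].
  intros [_ E]. rewrite E, Cmod_sub_0 in h2. assert (0 < Cmod (z - a) ^ zb) by (apply pow_lt, Cmod_sub_pos; auto). nra.
Qed.

Fixpoint lsum (h : C -> R) (Z : list C) : R :=
  match Z with nil => 0 | a :: Z' => h a + lsum h Z' end.

Lemma lsum_le h h' Z : (forall a, In a Z -> h a <= h' a) -> lsum h Z <= lsum h' Z.
Proof. induction Z; simpl; intros H. lra. apply Rplus_le_compat; auto. Qed.

Lemma lsum_scal x h Z : lsum (fun a => x * h a) Z = x * lsum h Z.
Proof. induction Z; simpl. ring. rewrite IHZ. ring. Qed.

Fixpoint zfac (Z : list C) (K : R) (z : C) : C :=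
  match Z with nil => 1 | a :: Z' => (z - a) / RtoC K * zfac Z' K z end%C.

Lemma RtoC_nz (x : R) : x <> 0 -> RtoC x <> 0%C.
Proof. intros H E. apply RtoC_inj in E. auto. Qed.

Lemma Cmod_div_R (z : C) (K : R) : 0 < K -> Cmod (z / RtoC K) = Cmod z / K.
Proof. intros H. rewrite Cmod_div by (apply RtoC_nz; lra). rewrite Cmod_R, Rabs_pos_eq; lra. Qed.

Lemma cholo_zfac (Z : list C) (K : R) z : 0 < K -> cholo (zfac Z K) z.
Proof.
  intros HK. induction Z; simpl. apply cholo_const. apply (cholo_mult (fun z => (z - a) / RtoC K)%C (zfac Z K)); auto.
  apply cholo_div. apply RtoC_nz; lra. apply cholo_minus. apply cholo_id. apply cholo_const. apply cholo_const.
Qed.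

Lemma zfac_le1 (Z : list C) (K : R) z : 0 < K -> (forall a, In a Z -> Cmod (z - a) <= K) -> Cmod (zfac Z K z) <= 1.
Proof.
  intros HK. induction Z; simpl; intros H. rewrite Cmod_1. lra.
  rewrite Cmod_mult, Cmod_div_R by auto. rewrite <- (Rmult_1_r 1). apply Rmult_le_compat; auto using Cmod_ge_0.
  apply Rdiv_le_0_compat; auto using Cmod_ge_0.
  apply Rmult_le_reg_r with K; auto. unfold Rdiv. rewrite Rmult_assoc, Rinv_l by lra. rewrite Rmult_1_r, Rmult_1_l. auto.
Qed.

Lemma zfac_le_factor (Z : list C) (K : R) z (a : C) : 0 < K -> (forall a, In a Z -> Cmod (z - a) <= K) -> In a Z ->
  Cmod (zfac Z K z) <= Cmod (z - a) / K.
Proof.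
  intros HK. induction Z as [|a' Z IH]; simpl; intros H Hin. tauto.
  rewrite Cmod_mult, Cmod_div_R by auto. destruct Hin as [->|Hin].
  - rewrite <- (Rmult_1_r (Cmod (z - a) / K)) at 2. apply Rmult_le_compat_l.
    apply Rdiv_le_0_compat; auto using Cmod_ge_0. apply zfac_le1; auto.
  - rewrite <- (Rmult_1_l (Cmod (z - a) / K)). apply Rmult_le_compat; auto using Cmod_ge_0.
    apply Rdiv_le_0_compat; auto using Cmod_ge_0.
    apply Rmult_le_reg_r with K; auto. unfold Rdiv. rewrite Rmult_assoc, Rinv_l by lra. rewrite Rmult_1_r, Rmult_1_l. auto.
Qed.

Lemma zfac_linear (Z : list C) (K : R) (a : C) : 0 < K -> In a Z -> exists B, 0 < B /\ forall z, Cmod (z - a) <= 1 -> Cmod (zfac Z K z) <= B * Cmod (z - a).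
Proof.
  intros HK. induction Z as [|a' Z IH]; simpl; intros Hin. tauto. destruct Hin as [->|Hin].
  - destruct (ccont_bounded_disc (zfac Z K) a 1) as [B [HB H]]. { intros; apply cholo_ccont, cholo_zfac; auto. }
    exists (B / K). split. apply Rdiv_lt_0_compat; auto. intros z Hz. rewrite Cmod_mult, Cmod_div_R by auto.
    replace (B / K * Cmod (z - a)) with (Cmod (z - a) / K * B) by (unfold Rdiv; ring). apply Rmult_le_compat_l; auto.
    apply Rdiv_le_0_compat; auto using Cmod_ge_0.
  - destruct (IH Hin) as [B [HB H]].
    destruct (ccont_bounded_disc (fun z => (z - a') / RtoC K)%C a 1) as [B' [HB' H']].
    { intros. apply cholo_ccont, cholo_div. apply RtoC_nz; lra. apply cholo_minus. apply cholo_id. apply cholo_const. apply cholo_const. }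
    exists (B' * B). split. nra. intros z Hz. rewrite Cmod_mult, Rmult_assoc. apply Rmult_le_compat; auto using Cmod_ge_0.
Qed.

(** Near 0 each |z - a| is at least |a|/2, whence the 2 in the logarithm. *)
Lemma zfac_lower (Z : list C) (K : R) : 0 < K -> (forall a : C, In a Z -> a <> 0%C) -> exists d, 0 < d /\ forall z, Cmod z < d ->
  exp (- lsum (fun a => ln (2 * K / Cmod a)) Z) <= Cmod (zfac Z K z).
Proof.
  intros HK. induction Z as [|a Z IH]; intros H.
  - exists 1. split. lra. intros. simpl. rewrite Ropp_0, exp_0, Cmod_1. lra.
  - destruct IH as [d [Hd IH]]. { intros; apply H; right; auto. }
    assert (Ha : 0 < Cmod a) by (apply Cmod_gt_0, H; left; auto).
    exists (Rmin d (Cmod a / 2)). split. apply Rmin_glb_lt; lra. intros z Hz.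
    pose proof (Rmin_l d (Cmod a / 2)). pose proof (Rmin_r d (Cmod a / 2)).
    simpl. rewrite Ropp_plus_distr, exp_plus, Cmod_mult, Cmod_div_R by auto.
    apply Rmult_le_compat; try (left; apply exp_pos); [|apply IH; lra].
    assert (0 < 2 * K / Cmod a) by (apply Rdiv_lt_0_compat; lra).
    rewrite <- ln_Rinv, exp_ln by (auto; apply Rinv_0_lt_compat; auto).
    apply Rmult_le_reg_r with K; auto. replace (Cmod (z - a) / K * K) with (Cmod (z - a)) by (field; lra).
    replace (/ (2 * K / Cmod a) * K) with (Cmod a / 2) by (field; lra).
    pose proof (Cmod_sub_ge a z). rewrite Cmod_sub_sym in H3. lra.
Qed.

Fixpoint lfac (L : list (C * nat)) (r : R) (z : C) : C :=
  match L with nil => 1 | (p, m) :: L' => Cpow (RtoC r / (z - p)) m * lfac L' r z end%C.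

Lemma cholo_lfac (L : list (C * nat)) (r : R) z : ~ In z (map fst L) -> cholo (lfac L r) z.
Proof.
  induction L as [|[p m] L IH]; simpl; intros H. apply cholo_const.
  apply (cholo_mult (fun z => Cpow (RtoC r / (z - p)) m) (lfac L r)); auto.
  apply (cholo_pow (fun z => RtoC r / (z - p))%C). apply cholo_div. apply Cminus_eq_contra. intros ->; tauto.
  apply cholo_const. apply cholo_minus. apply cholo_id. apply cholo_const.
Qed.

Lemma lfac_le1 (L : list (C * nat)) (r : R) z : 0 < r -> (forall p m, In (p, m) L -> r <= Cmod (z - p)) -> Cmod (lfac L r z) <= 1.
Proof.
  intros Hr. induction L as [|[p m] L IH]; simpl; intros H. rewrite Cmod_1. lra.
  specialize (H p m (or_introl eq_refl)) as Hp. rewrite Cmod_mult, Cmod_pow.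
  rewrite Cmod_div by (apply Cmod_gt_0; lra). rewrite Cmod_R, Rabs_pos_eq by lra.
  assert (Hq : 0 <= r / Cmod (z - p) <= 1).
  { split. apply Rdiv_le_0_compat; lra. apply Rmult_le_reg_r with (Cmod (z - p)). lra. unfold Rdiv. rewrite Rmult_assoc, Rinv_l by lra. lra. }
  rewrite <- (Rmult_1_r 1). apply Rmult_le_compat; auto using Cmod_ge_0. apply pow_le; lra.
  rewrite <- (pow1 m). apply pow_incr. lra. apply IH. intros p' m' Hin. apply (H p' m'). auto.
Qed.

Lemma ccont_lb (h : C -> C) a : ccont h a -> exists d B, 0 < d /\ 0 < B /\ forall z, Cmod (z - a) < d -> Cmod (h z) <= B.
Proof.
  intros H. destruct (H 1 Rlt_0_1) as [d [Hd Hc]]. pose proof (Cmod_ge_0 (h a)).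
  exists d, (Cmod (h a) + 1). split; auto. split. lra. intros z Hz. specialize (Hc z Hz). pose proof (Cmod_sub_ge (h z) (h a)). lra.
Qed.

Lemma lfac_singular (L : list (C * nat)) (r : R) p (m : nat) : 0 < r -> NoDup (map fst L) -> In (p, m) L ->
  exists d B, 0 < d /\ 0 < B /\ forall z, Cmod (z - p) < d -> z <> p -> Cmod (lfac L r z) * Cmod (z - p) ^ m <= B.
Proof.
  intros Hr. induction L as [|[p' m'] L IH]; intros Hnd Hin; simpl in Hin. tauto.
  simpl in Hnd. apply NoDup_cons_iff in Hnd. destruct Hnd as [Hni Hnd]. destruct Hin as [E|Hin].
  - injection E as -> ->. destruct (ccont_lb (lfac L r) p) as [d [B [Hd [HB H]]]]. { apply cholo_ccont, cholo_lfac; auto. }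
    exists d, (r ^ m * B). split; auto. assert (0 < r ^ m) by (apply pow_lt; auto). split. nra.
    intros z Hz Hzp. assert (Hx : 0 < Cmod (z - p)) by (apply Cmod_sub_pos; auto).
    assert (Hxm : 0 < Cmod (z - p) ^ m) by (apply pow_lt; auto).
    simpl. rewrite Cmod_mult, Cmod_pow. rewrite Cmod_div by (apply Cmod_gt_0; lra). rewrite Cmod_R, Rabs_pos_eq by lra.
    unfold Rdiv. rewrite Rpow_mult_distr, pow_inv.
    replace (r ^ m * / Cmod (z - p) ^ m * Cmod (lfac L r z) * Cmod (z - p) ^ m) with (r ^ m * Cmod (lfac L r z)) by (field; lra).
    apply Rmult_le_compat_l. lra. auto.
  - destruct (IH Hnd Hin) as [d [B [Hd [HB H]]]].
    destruct (ccont_lb (fun z => Cpow (RtoC r / (z - p')) m') p) as [d' [B' [Hd' [HB' H']]]].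
    { apply cholo_ccont. apply (cholo_pow (fun z => RtoC r / (z - p'))%C). apply cholo_div.
      apply Cminus_eq_contra. intros ->. apply Hni. apply in_map_iff. exists (p', m); auto.
      apply cholo_const. apply cholo_minus. apply cholo_id. apply cholo_const. }
    exists (Rmin d d'), (B' * B). split. apply Rmin_glb_lt; auto. split. nra. intros z Hz Hzp.
    pose proof (Rmin_l d d'). pose proof (Rmin_r d d'). simpl. rewrite Cmod_mult, Rmult_assoc.
    apply Rmult_le_compat; auto using Cmod_ge_0. apply Rmult_le_pos. apply Cmod_ge_0. apply pow_le, Cmod_ge_0.
    apply H'; lra. apply H; auto; lra.
Qed.

(** Near 0 one has |z - p| <= 2|p|, and the numerator 2r compensates for it, so the bound is exactly
    the exponential of the counting sum. At the same time 2r is at most the distance from the circle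
    of radius 3r to any pole of modulus at most r. *)
Lemma lfac_lower (L : list (C * nat)) (r : R) : 0 < r -> (forall (p : C) m, In (p, m) L -> p <> 0%C) -> exists d, 0 < d /\
  forall z, z <> 0%C -> Cmod z < d -> exp (sum_poles r L) <= Cmod (lfac L (2 * r) z).
Proof.
  intros Hr. induction L as [|[p m] L IH]; intros H.
  - exists 1. split. lra. intros. simpl. rewrite exp_0, Cmod_1. lra.
  - destruct IH as [d [Hd IH]]. { intros p' m' Hin; apply (H p' m'); right; auto. }
    assert (Hp : 0 < Cmod p) by (apply Cmod_gt_0, (H p m); left; auto).
    exists (Rmin d (Cmod p)). split. apply Rmin_glb_lt; lra. intros z Hz0 Hz.
    pose proof (Rmin_l d (Cmod p)). pose proof (Rmin_r d (Cmod p)).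
    simpl sum_poles. simpl lfac. rewrite exp_plus, Cmod_mult.
    apply Rmult_le_compat; try (left; apply exp_pos); [|apply IH; auto; lra].
    assert (Hzp : 0 < Cmod (z - p)). { pose proof (Cmod_sub_ge p z). rewrite Cmod_sub_sym in H2. lra. }
    rewrite Cmod_pow, Cmod_div by (apply Cmod_gt_0; auto). rewrite Cmod_R, Rabs_pos_eq by lra.
    assert (Hq : 0 < r / Cmod p) by (apply Rdiv_lt_0_compat; auto).
    change (exp (INR m * ln (r / Cmod p))) with (Rpower (r / Cmod p) (INR m)). rewrite Rpower_pow by auto.
    apply pow_incr. split. lra. pose proof (Cmod_sub_le z p).
    apply Rmult_le_reg_r with (Cmod p * Cmod (z - p)). apply Rmult_lt_0_compat; auto.
    replace (r / Cmod p * (Cmod p * Cmod (z - p))) with (r * Cmod (z - p)) by (field; lra).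
    replace (2 * r / Cmod (z - p) * (Cmod p * Cmod (z - p))) with (2 * r * Cmod p) by (field; lra). nra.
Qed.

Lemma ln_nonneg x : 1 <= x -> 0 <= ln x.
Proof. intros H. rewrite <- ln_1. destruct H as [H| <-]; [left; apply ln_increasing; lra|lra]. Qed.

Lemma pow_le1 x (n : nat) : 0 <= x <= 1 -> 0 <= x ^ n <= 1.
Proof. intros H. split. apply pow_le; lra. rewrite <- (pow1 n). apply pow_incr. lra. Qed.

Lemma pow_div (x y : R) (n : nat) : (x / y) ^ n = x ^ n / y ^ n.
Proof. unfold Rdiv. rewrite Rpow_mult_distr, pow_inv. reflexivity. Qed.

(* u = (z/(Kr))^zb (2r/z)^pb zfac lfac / (f - b) has no zeros where |f - b| < s to spoil Jensen's
   inequality: the factor of zfac at the centre of the component of {|f - b| < s} cancels |f - b|. *)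
Lemma nevanlinna_key f b s C2 : meromorphic f -> ~ sing_set f b -> 0 < s -> 0 < C2 ->
  (forall z, ~ poles f z -> Cmod (f z - b) < s ->
     exists a, bpt f b a /\ Cmod (z - a) <= C2 * (1 + Cmod a) * Cmod (f z - b) /\ Cmod a <= 2 * Cmod z + 1) ->
  exists C1 K, 1 <= K /\ forall r, 1 <= r -> forall Z : list C,
    (forall a, In a Z <-> (bpt f b a /\ a <> 0%C) /\ Cmod a <= 9 * r) ->
    forall L : list (C * nat), NoDup (map fst L) ->
    List.Forall (fun pm : C * nat => is_pole f (fst pm) (snd pm) /\ 0 < Cmod (fst pm) <= r) L ->
    forall M, RInt (fun t => Rmin (logplus (Cmod (f (Cpolar (3 * r) t)))) M) 0 (2 * PI) <=
      2 * PI * (C1 + ln (K * r) + lsum (fun a => ln (2 * (K * r) / Cmod a)) Z - sum_poles r L).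
Proof.
  intros Hf Hs Hs0 HC2 Hsize. pose proof (Cmod_ge_0 b) as Hb0.
  destruct (order_at_exists f b 0 Hf Hs) as [zb [pb [(c0 & K0 & d0 & Hc0 & HK0 & Hd0 & Hd01 & H0) Hzb]]].
  (* The first logarithm bounds log+|f| - log|f - b| where |f - b| >= s, the second bounds log+|f|
     where |f - b| < s. *)
  set (D1 := ln (1 + (Cmod b + 1) / s) + ln (1 + Cmod b + s)).
  assert (Hq : 0 < (Cmod b + 1) / s) by (apply Rdiv_lt_0_compat; lra).
  assert (HD1a : 0 <= ln (1 + (Cmod b + 1) / s)) by (apply ln_nonneg; lra).
  assert (HD1b : 0 <= ln (1 + Cmod b + s)) by (apply ln_nonneg; lra).
  (* On |z| = 3r the 12 makes [K * r] a bound for |z - a| with |a| <= 9r. A centre [a] with |a| <=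
     2|z| + 1 has 1 + |a| <= 8r, so 8 C2 r bounds C2 (1 + |a|); such a centre is also within the
     radius 9r of [Z]. *)
  set (K := 12 + 8 * C2). exists (D1 + ln K0), K. split. unfold K; lra.
  intros r Hr Z HZ L HLnd HL M. set (R := 3 * r). set (kr := K * r).
  assert (Hkr : 12 * r + 8 * C2 * r = kr) by (unfold kr, K; ring).
  assert (HC2r : 0 < C2 * r) by nra. assert (Hkr0 : 1 <= kr) by lra.
  destruct (discrete_finite (poles f) R) as [PP [_ HPP]].
  { intros a. destruct (order_at_discrete f b a Hf Hs) as [d [Hd H]]. exists d. split; auto. intros z Hz Hza. apply H; auto. }
  set (Z1 := filter (fun a => if Rle_dec (Cmod a) R then true else false) Z).
  assert (HZ1 : forall a, In a Z1 <-> In a Z /\ Cmod a <= R).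
  { intros a. unfold Z1. rewrite filter_In. destruct (Rle_dec (Cmod a) R); split; try tauto. intros [_ E]; discriminate. }
  (* All poles up to the radius 3r are exceptional, also those that do not occur in [L]; at the
     latter 1/(f - b) is small and [u] is bounded anyway. *)
  set (E := RtoC 0 :: Z1 ++ PP).
  assert (HE : forall a, In a E <-> a = 0%C \/ (In a Z /\ Cmod a <= R) \/ (poles f a /\ Cmod a <= R)).
  { intros a. unfold E. simpl. rewrite in_app_iff, HZ1, HPP. intuition. }
  assert (HLp : forall (p : C) m, In (p, m) L -> is_pole f p m /\ 0 < Cmod p <= r).
  { intros p m Hin. rewrite Forall_forall in HL. apply (HL (p, m) Hin). }
  assert (HLf : forall p, In p (map fst L) -> poles f p /\ 0 < Cmod p <= r).
  { intros p Hin. apply in_map_iff in Hin. destruct Hin as [[p' m] [<- Hin]]. simpl. destruct (HLp p' m Hin). split; auto. exists m; auto. }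
  set (u1 := fun z => (Cpow (z / RtoC kr) zb * Cpow (RtoC (2 * r) / z) pb)%C).
  set (u2 := fun z => (zfac Z kr z * lfac L (2 * r) z)%C).
  set (u := fun z => (u1 z * u2 z / (f z - b))%C).
  assert (Hnz2r : RtoC (2 * r) <> 0%C) by (apply RtoC_nz; lra).
  assert (Hu1h : forall z, z <> 0%C -> cholo u1 z).
  { intros z Hz. unfold u1. apply cholo_mult.
    - apply (cholo_pow (fun z => z / RtoC kr)%C). apply cholo_div. apply RtoC_nz; lra. apply cholo_id. apply cholo_const.
    - apply (cholo_pow (fun z => RtoC (2 * r) / z)%C). apply cholo_div; auto. apply cholo_const. apply cholo_id. }
  assert (Hreg : forall z, Cmod z <= R -> ~ In z E -> z <> 0%C /\ ~ poles f z /\ (f z - b)%C <> 0%C).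
  { intros z Hz HzE. rewrite HE in HzE. assert (z <> 0%C) by tauto. assert (Hnp : ~ poles f z) by tauto.
    split; auto. split; auto. apply Cminus_eq_contra. intros Ez. apply HzE. right; left. split; auto. apply HZ.
    split; [split; auto|]. split; auto. unfold R in *. lra. }
  assert (Hmu1 : forall z, z <> 0%C -> Cmod (u1 z) = (Cmod z / kr) ^ zb * (2 * r / Cmod z) ^ pb).
  { intros z Hz. unfold u1. rewrite Cmod_mult, !Cmod_pow, Cmod_div_R by lra. rewrite Cmod_div by auto.
    rewrite Cmod_R, (Rabs_pos_eq (2 * r)) by lra. reflexivity. }
  assert (Hlfb : forall a, ~ poles f a \/ a = 0%C -> exists d B, 0 < d /\ 0 < B /\ forall z, Cmod (z - a) < d -> Cmod (u2 z) <= B).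
  { intros a Ha. apply ccont_lb, cholo_ccont. apply cholo_mult. apply cholo_zfac; lra. apply cholo_lfac. intros Hin.
    apply HLf in Hin. destruct Ha as [Ha| ->]. tauto. rewrite Cmod_0 in Hin. lra. }
  set (ls := lsum (fun a => ln (2 * kr / Cmod a)) Z).
  (* The lower bound for |u| near 0: [u1] cancels the order of f - b at 0 up to the constants
     kr^(-zb) and (2r)^pb >= 1, and f - b contributes 1/K0. *)
  set (A := (/ kr) ^ zb * exp (- ls) * exp (sum_poles r L) / K0).
  assert (HA : 0 < A).
  { unfold A. assert (0 < (/ kr) ^ zb) by (apply pow_lt, Rinv_0_lt_compat; lra).
    apply Rdiv_lt_0_compat; auto. repeat apply Rmult_lt_0_compat; auto; apply exp_pos. }
  assert (HlnA : ln A = - INR zb * ln kr - ls + sum_poles r L - ln K0).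
  { unfold A. assert (0 < (/ kr) ^ zb) by (apply pow_lt, Rinv_0_lt_compat; lra).
    assert (0 < exp (- ls)) by apply exp_pos. assert (0 < exp (sum_poles r L)) by apply exp_pos.
    rewrite ln_div, !ln_mult, !ln_exp by (auto; repeat apply Rmult_lt_0_compat; auto).
    rewrite ln_pow by (apply Rinv_0_lt_compat; lra). rewrite ln_Rinv by lra. ring. }
  assert (Hzb1 : INR zb * ln kr <= ln kr).
  { pose proof (ln_nonneg kr Hkr0). destruct Hzb as [[_ ->]|[_ ->]]; simpl; lra. }
  assert (Hconc : RInt (fun t => Rmin (logplus (Cmod (f (Cpolar R t)))) M) 0 (2 * PI) <= 2 * PI * (D1 - ln A)).
  2: { eapply Rle_trans. exact Hconc. pose proof PI_RGT_0. apply Rmult_le_compat_l. lra. rewrite HlnA. fold kr ls. lra. }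
  apply (jensen E u (fun t => Rmin (logplus (Cmod (f (Cpolar R t)))) M) R A D1); auto.
  - unfold R; lra.
  - intros a Ha. apply HE in Ha. destruct Ha as [->|[[_ H]|[_ H]]]; auto. rewrite Cmod_0. unfold R; lra.
  - intros z Hz HzE. destruct (Hreg z Hz HzE) as (h1 & h2 & h3).
    unfold u, u2. apply cholo_div; auto.
    + apply cholo_mult; auto. apply cholo_mult. apply cholo_zfac; lra. apply cholo_lfac. intros Hin. apply HLf in Hin. tauto.
    + apply cholo_minus. apply meromorphic_cholo; auto. apply cholo_const.
  - intros a Ha.
    assert (Hcore : exists d B, 0 < d /\ forall z, Cmod (z - a) < d -> z <> a -> Cmod (u1 z) * Cmod (u2 z) <= B * Cmod (f z - b)).
    { destruct (classic (a = 0%C)) as [->|Ha0].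
      - destruct (Hlfb 0%C (or_intror eq_refl)) as [d [B [Hd [HB H]]]].
        set (x1 := (/ kr) ^ zb). set (x2 := (2 * r) ^ pb).
        assert (Hx1 : 0 < x1) by (apply pow_lt, Rinv_0_lt_compat; lra). assert (Hx2 : 0 < x2) by (apply pow_lt; lra).
        exists (Rmin d d0), (x1 * x2 * B / c0). split. apply Rmin_glb_lt; auto. intros z Hz Hz0.
        pose proof (Rmin_l d d0). pose proof (Rmin_r d d0). specialize (H z ltac:(lra)).
        destruct (H0 z ltac:(lra) Hz0) as (_ & h1 & _). replace (z - 0)%C with z in h1 by ring.
        rewrite Hmu1 by auto. rewrite !pow_div. fold x2.
        assert (Hy : 0 < Cmod z) by (apply Cmod_gt_0; auto).
        set (y1 := Cmod z ^ zb) in *. set (y2 := Cmod z ^ pb) in *.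
        assert (Hy1 : 0 < y1) by (apply pow_lt; auto). assert (Hy2 : 0 < y2) by (apply pow_lt; auto).
        assert (K1 : y1 / y2 <= Cmod (f z - b) / c0).
        { apply Rmult_le_reg_r with (y2 * c0). nra. replace (y1 / y2 * (y2 * c0)) with (c0 * y1) by (field; lra).
          replace (Cmod (f z - b) / c0 * (y2 * c0)) with (Cmod (f z - b) * y2) by (field; lra). exact h1. }
        apply Rle_trans with (x1 * x2 * (y1 / y2) * B).
        + replace (y1 / kr ^ zb * (x2 / y2)) with (x1 * x2 * (y1 / y2)) by (unfold x1; rewrite pow_inv; field; split; [lra|apply pow_nonzero; lra]).
          apply Rmult_le_compat_l; auto. apply Rmult_le_pos. nra. apply Rdiv_le_0_compat; lra.
        + replace (x1 * x2 * B / c0 * Cmod (f z - b)) with (x1 * x2 * (Cmod (f z - b) / c0) * B) by (field; lra).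
          apply Rmult_le_compat_r. lra. apply Rmult_le_compat_l. nra. exact K1.
      - destruct (ccont_lb u1 a) as [d1 [B1 [Hd1 [HB1 H1]]]]. { apply cholo_ccont; auto. }
        assert (Hrest : exists d B, 0 < d /\ 0 <= B /\ forall z, Cmod (z - a) < d -> z <> a -> Cmod (u2 z) <= B * Cmod (f z - b)).
        { apply HE in Ha. destruct Ha as [K1|[[HaZ HaR]|[[m Hm] HaR]]]; [tauto| |].
          - apply HZ in HaZ. destruct HaZ as [[Hbp _] Ha9].
            destruct (order_at_bpt f b a Hf Hs Hbp) as (c & K1 & d & Hc & HK1 & Hd & Hd1' & H).
            assert (HaZ : In a Z) by (apply HZ; auto).
            destruct (zfac_linear Z kr a ltac:(lra) HaZ) as [B2 [HB2 H2]].
            destruct (ccont_lb (lfac L (2 * r)) a) as [d3 [B3 [Hd3 [HB3 H3]]]].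
            { apply cholo_ccont, cholo_lfac. intros Hin. apply HLf in Hin. destruct Hbp. tauto. }
            exists (Rmin d d3), (B2 * B3 / c). split. apply Rmin_glb_lt; auto. split. apply Rdiv_le_0_compat; nra.
            intros z Hz Hza. pose proof (Rmin_l d d3). pose proof (Rmin_r d d3).
            destruct (H z ltac:(lra) Hza) as (_ & h1 & _). simpl in h1. rewrite !Rmult_1_r in h1.
            specialize (H2 z ltac:(lra)). specialize (H3 z ltac:(lra)). unfold u2. rewrite Cmod_mult.
            apply Rle_trans with (B2 * Cmod (z - a) * B3). apply Rmult_le_compat; auto using Cmod_ge_0.
            apply Rmult_le_reg_r with c; auto. replace (B2 * B3 / c * Cmod (f z - b) * c) with (B2 * B3 * Cmod (f z - b)) by (field; lra).
            replace (B2 * Cmod (z - a) * B3 * c) with (B2 * B3 * (c * Cmod (z - a))) by ring. apply Rmult_le_compat_l; nra.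
          - destruct (ccont_lb (zfac Z kr) a) as [d2 [B2 [Hd2 [HB2 H2]]]]. { apply cholo_ccont, cholo_zfac; lra. }
            (* If [a] is listed in [L], the order recorded there is the power that compensates
               [lfac]; otherwise [lfac] is bounded near [a]. *)
            assert (Hl : exists (m' : nat) d B, is_pole f a m' /\ 0 < d /\ 0 < B /\ forall z, Cmod (z - a) < d -> z <> a ->
              Cmod (lfac L (2 * r) z) * Cmod (z - a) ^ m' <= B).
            { destruct (classic (In a (map fst L))) as [Hin|Hout].
              - apply in_map_iff in Hin. destruct Hin as [[p m'] [Ep Hin]]. simpl in Ep. subst p.
                destruct (lfac_singular L (2 * r) a m' ltac:(lra) HLnd Hin) as [d [B [Hd [HB H]]]].
                exists m', d, B. split; auto. apply (HLp a m' Hin).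
              - destruct (ccont_lb (lfac L (2 * r)) a) as [d [B [Hd [HB H]]]]. { apply cholo_ccont, cholo_lfac; auto. }
                exists m, (Rmin d 1), B. split; auto. split. apply Rmin_glb_lt; lra. split; auto. intros z Hz _.
                pose proof (Rmin_l d 1). pose proof (Rmin_r d 1). specialize (H z ltac:(lra)).
                pose proof (Cmod_ge_0 (z - a)). pose proof (pow_le1 (Cmod (z - a)) m ltac:(lra)). pose proof (Cmod_ge_0 (lfac L (2 * r) z)). nra. }
            destruct Hl as [m' [d3 [B3 (Hp & Hd3 & HB3 & H3)]]].
            destruct (order_at_pole f b a m' Hp) as (c & K1 & d & Hc & HK1 & Hd & Hd1' & H).
            exists (Rmin d2 (Rmin d d3)), (B2 * B3 / c). split. repeat apply Rmin_glb_lt; auto. split. apply Rdiv_le_0_compat; nra.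
            intros z Hz Hza. pose proof (Rmin_l d2 (Rmin d d3)). pose proof (Rmin_r d2 (Rmin d d3)). pose proof (Rmin_l d d3). pose proof (Rmin_r d d3).
            destruct (H z ltac:(lra) Hza) as (_ & h1 & _). simpl in h1. rewrite Rmult_1_r in h1.
            specialize (H2 z ltac:(lra)). specialize (H3 z ltac:(lra) Hza). unfold u2. rewrite Cmod_mult.
            assert (Hx : 0 < Cmod (z - a) ^ m') by (apply pow_lt, Cmod_sub_pos; auto). set (x := Cmod (z - a) ^ m') in *.
            pose proof (Cmod_ge_0 (lfac L (2 * r) z)) as Hl0. set (lf := Cmod (lfac L (2 * r) z)) in *.
            pose proof (Cmod_ge_0 (f z - b)) as Hf0. set (fb := Cmod (f z - b)) in *.
            apply Rle_trans with (B2 * lf). apply Rmult_le_compat_r; auto.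
            replace (B2 * B3 / c * fb) with (B2 * (B3 * / c * fb)) by (unfold Rdiv; ring). apply Rmult_le_compat_l. lra.
            apply Rmult_le_reg_r with (x * c). nra.
            replace (B3 * / c * fb * (x * c)) with (B3 * (fb * x)) by (field; lra).
            replace (lf * (x * c)) with (lf * x * c) by ring.
            apply Rmult_le_compat; try lra. nra. }
        destruct Hrest as [d2 [B2 [Hd2 [HB2 H2]]]].
        exists (Rmin d1 d2), (B1 * B2). split. apply Rmin_glb_lt; auto. intros z Hz Hza.
        pose proof (Rmin_l d1 d2). pose proof (Rmin_r d1 d2). rewrite Rmult_assoc.
        apply Rmult_le_compat; auto using Cmod_ge_0. apply H1; lra. apply H2; auto; lra. }
    destruct Hcore as [d [B [Hd H]]].
    destruct (order_at_discrete f b a Hf Hs) as [d' [Hd' Hdisc]].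
    exists (Rmin d d'), B. split. apply Rmin_glb_lt; auto. intros z Hz HzE.
    pose proof (Rmin_l d d'). pose proof (Rmin_r d d').
    assert (Hza : z <> a) by (intros ->; auto). specialize (H z ltac:(lra) Hza).
    destruct (Hdisc z ltac:(lra) Hza) as [Hnb Hnp].
    assert (Hne : (f z - b)%C <> 0%C). { apply Cminus_eq_contra. intros Ez. apply Hnb. split; auto. }
    unfold u. rewrite Cmod_div, Cmod_mult by auto. apply Cmod_gt_0 in Hne.
    apply Rmult_le_reg_r with (Cmod (f z - b)); auto. unfold Rdiv. rewrite Rmult_assoc, Rinv_l by lra. lra.
  - destruct (zfac_lower Z kr ltac:(lra)) as [d1 [Hd1 H1]]. { intros a Ha. apply HZ in Ha. tauto. }
    destruct (lfac_lower L r ltac:(lra)) as [d2 [Hd2 H2]]. { intros p m Hin. destruct (HLp p m Hin) as [_ K1]. apply Cmod_gt_0. lra. }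
    exists (Rmin d0 (Rmin d1 d2)). split. repeat apply Rmin_glb_lt; auto. intros z Hz0 Hz HzE.
    pose proof (Rmin_l d0 (Rmin d1 d2)). pose proof (Rmin_r d0 (Rmin d1 d2)). pose proof (Rmin_l d1 d2). pose proof (Rmin_r d1 d2).
    destruct (H0 z ltac:(replace (z - 0)%C with z by ring; lra) Hz0) as (_ & h1 & h2). replace (z - 0)%C with z in h1, h2 by ring.
    specialize (H1 z ltac:(lra)). specialize (H2 z Hz0 ltac:(lra)).
    assert (Hy : 0 < Cmod z) by (apply Cmod_gt_0; auto).
    assert (Hy1 : 0 < Cmod z ^ zb) by (apply pow_lt; auto). assert (Hy2 : 0 < Cmod z ^ pb) by (apply pow_lt; auto).
    assert (Hfb : 0 < Cmod (f z - b)).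
    { pose proof (Cmod_ge_0 (f z - b)) as K1. destruct K1 as [K1|K1]; auto. rewrite <- K1 in h1. nra. }
    unfold u, u2. rewrite Cmod_div by (apply Cmod_gt_0; auto). rewrite Cmod_mult, Hmu1, Cmod_mult by auto.
    unfold A. rewrite !pow_div, pow_inv.
    set (y1 := Cmod z ^ zb) in *. set (y2 := Cmod z ^ pb) in *. set (x1 := kr ^ zb).
    assert (Hx1 : 0 < x1) by (apply pow_lt; lra).
    assert (Hx2 : 1 <= (2 * r) ^ pb) by (apply pow_R1_Rle; lra). set (x2 := (2 * r) ^ pb) in *.
    fold ls in H1. set (e1 := exp (- ls)) in *. set (e2 := exp (sum_poles r L)) in *.
    assert (He1 : 0 < e1) by apply exp_pos. assert (He2 : 0 < e2) by apply exp_pos.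
    assert (K1 : / K0 <= y1 / y2 / Cmod (f z - b)).
    { apply Rmult_le_reg_r with (K0 * (Cmod (f z - b) * y2)). repeat apply Rmult_lt_0_compat; auto.
      replace (/ K0 * (K0 * (Cmod (f z - b) * y2))) with (Cmod (f z - b) * y2) by (field; lra).
      replace (y1 / y2 / Cmod (f z - b) * (K0 * (Cmod (f z - b) * y2))) with (K0 * y1) by (field; lra). exact h2. }
    assert (K2 : e1 * e2 <= Cmod (zfac Z kr z) * Cmod (lfac L (2 * r) z)) by (apply Rmult_le_compat; lra).
    assert (HK0i : 0 < / K0) by (apply Rinv_0_lt_compat; auto). assert (Hx1i : 0 < / x1) by (apply Rinv_0_lt_compat; auto).
    replace (/ x1 * e1 * e2 / K0) with (/ x1 * (1 * (e1 * e2) * / K0)) by (unfold Rdiv; ring).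
    replace (y1 / x1 * (x2 / y2) * (Cmod (zfac Z kr z) * Cmod (lfac L (2 * r) z)) / Cmod (f z - b)) with
      (/ x1 * (x2 * (Cmod (zfac Z kr z) * Cmod (lfac L (2 * r) z)) * (y1 / y2 / Cmod (f z - b)))) by (unfold Rdiv; ring).
    assert (He12 : 0 < e1 * e2) by (apply Rmult_lt_0_compat; auto).
    apply Rmult_le_compat_l. lra. apply Rmult_le_compat; try lra. apply Rmult_le_compat; lra.
  - intros t. unfold Cpolar. rewrite cos_plus, sin_plus, cos_2PI, sin_2PI.
    replace (cos t * 1 - sin t * 0) with (cos t) by ring. replace (sin t * 1 + cos t * 0) with (sin t) by ring. reflexivity.
  - intros t HtE. set (z := Cpolar R t) in *. assert (HzR : Cmod z = R) by (apply Cmod_Cpolar; unfold R; lra).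
    destruct (Hreg z ltac:(lra) HtE) as (h1 & h2 & h3).
    unfold u. rewrite Cmod_div, Cmod_mult by auto. apply Cmod_gt_0 in h3. set (fb := Cmod (f z - b)) in *.
    rewrite Hmu1 by auto. rewrite HzR.
    assert (Q1 : 0 <= (R / kr) ^ zb <= 1).
    { apply pow_le1. split. apply Rdiv_le_0_compat; unfold R; lra. apply Rmult_le_reg_r with kr. lra. unfold Rdiv. rewrite Rmult_assoc, Rinv_l by lra. unfold R; lra. }
    assert (Q2 : 0 <= (2 * r / R) ^ pb <= 1).
    { apply pow_le1. split. apply Rdiv_le_0_compat; unfold R; lra. apply Rmult_le_reg_r with R. unfold R; lra. unfold Rdiv. rewrite Rmult_assoc, Rinv_l by (unfold R; lra). unfold R; lra. }
    assert (Hin : forall a, In a Z -> Cmod (z - a) <= kr).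
    { intros a Ha. apply HZ in Ha. pose proof (Cmod_sub_le z a). unfold R in *; lra. }
    assert (Q3 : Cmod (zfac Z kr z) <= 1) by (apply zfac_le1; auto; lra).
    assert (Q4 : Cmod (lfac L (2 * r) z) <= 1).
    { apply lfac_le1. lra. intros p m Hp. destruct (HLp p m Hp). pose proof (Cmod_sub_ge z p). unfold R in *; lra. }
    pose proof (Cmod_ge_0 (zfac Z kr z)) as P3. pose proof (Cmod_ge_0 (lfac L (2 * r) z)) as P4.
    assert (Hexpm : forall x, 0 < x -> exp (- ln x) = / x) by (intros x Hx; rewrite exp_Ropp, exp_ln; auto).
    destruct (Rlt_dec fb s) as [Hlt|Hge].
    + 
      (* Here |f - b| may be small. The linear factor of the centre [a] makes up for it: |z - a|/kr
         <= |f z - b| by the choice of [K]. *)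
      destruct (Hsize z h2 Hlt) as [a [Hba [Hza Haz]]]. fold fb in Hza. rewrite HzR in Haz.
      assert (Hfac : Cmod (z - a) / kr <= fb).
      { apply Rmult_le_reg_r with kr. lra. replace (Cmod (z - a) / kr * kr) with (Cmod (z - a)) by (field; lra).
        eapply Rle_trans. exact Hza. rewrite Rmult_comm. apply Rmult_le_compat_l. lra.
        pose proof (Cmod_ge_0 a). unfold R in *. nra. }
      assert (Hprod : (R / kr) ^ zb * Cmod (zfac Z kr z) <= fb).
      (* 0 is left out of [Z]; if it is the centre itself, then zb = 1 and the factor (z/kr)^zb
         takes over. *)
      { destruct (classic (a = 0%C)) as [Ea|Ea].
        - destruct Hzb as [[_ ->]|[Hnb _]]. 2: { exfalso. apply Hnb. rewrite <- Ea. exact Hba. }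
          subst a. replace (z - 0)%C with z in Hfac by ring. rewrite HzR in Hfac. simpl. rewrite Rmult_1_r.
          assert (0 <= R / kr) by (apply Rdiv_le_0_compat; unfold R; lra). nra.
        - assert (HaZ : In a Z). { apply HZ. split; auto. unfold R in *; lra. }
          pose proof (zfac_le_factor Z kr z a ltac:(lra) Hin HaZ). nra. }
      apply Rle_trans with 1.
      * apply Rmult_le_reg_r with fb; auto. unfold u2. rewrite Cmod_mult. unfold Rdiv at 1. rewrite Rmult_assoc, Rinv_l by lra. rewrite Rmult_1_r, Rmult_1_l.
        replace ((R / kr) ^ zb * (2 * r / R) ^ pb * (Cmod (zfac Z kr z) * Cmod (lfac L (2 * r) z))) with
          ((R / kr) ^ zb * Cmod (zfac Z kr z) * ((2 * r / R) ^ pb * Cmod (lfac L (2 * r) z))) by ring.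
        rewrite <- (Rmult_1_r fb). apply Rmult_le_compat; nra.
      * rewrite <- exp_0. assert (Hv : Rmin (logplus (Cmod (f z))) M <= D1).
        { eapply Rle_trans. apply Rmin_l. rewrite logplus_eq. apply Rle_trans with (ln (1 + Cmod b + s)); [|unfold D1; lra].
          assert (Rmax 1 (Cmod (f z)) <= 1 + Cmod b + s). { apply Rmax_lub. lra. pose proof (Cmod_sub_ge (f z) b). fold fb in H. lra. }
          assert (1 <= Rmax 1 (Cmod (f z))) by apply Rmax_l.
          destruct H as [H|H]. left; apply ln_increasing; lra. rewrite H; lra. }
        destruct (Req_dec (D1 - Rmin (logplus (Cmod (f z))) M) 0) as [->|]. lra. left. apply exp_increasing. lra.
    + apply Rle_trans with (/ fb).
      * apply Rmult_le_reg_r with fb; auto. unfold u2. rewrite Cmod_mult. unfold Rdiv at 1. rewrite Rmult_assoc, Rinv_l by lra. rewrite Rmult_1_r.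
        rewrite <- (Rmult_1_r 1). apply Rmult_le_compat; try nra.
      * rewrite <- Hexpm by auto.
        assert (Hv : Rmin (logplus (Cmod (f z))) M - ln fb <= D1).
        { assert (Hmin : Rmin (logplus (Cmod (f z))) M <= ln (Rmax 1 (Cmod (f z)))) by (rewrite <- logplus_eq; apply Rmin_l).
          assert (Hm : Rmax 1 (Cmod (f z)) <= (1 + (Cmod b + 1) / s) * fb).
          { assert (1 <= fb / s). { apply Rmult_le_reg_r with s; auto. unfold Rdiv. rewrite Rmult_assoc, Rinv_l by lra. lra. }
            replace ((1 + (Cmod b + 1) / s) * fb) with (fb + Cmod b * (fb / s) + fb / s) by (field; lra).
            apply Rmax_lub. nra. pose proof (Cmod_sub_ge (f z) b). fold fb in H1. nra. }
          assert (1 <= Rmax 1 (Cmod (f z))) by apply Rmax_l.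
          assert (ln (Rmax 1 (Cmod (f z))) <= ln ((1 + (Cmod b + 1) / s) * fb)).
          { destruct Hm as [Hm|Hm]. left; apply ln_increasing; lra. rewrite Hm; lra. }
          rewrite ln_mult in H1 by lra. unfold D1. lra. }
        destruct (Req_dec (- ln fb) (D1 - Rmin (logplus (Cmod (f z))) M)) as [->|]. lra. left. apply exp_increasing. lra.
  - apply ex_RInt_prox; auto. unfold R; lra.
Qed.

Lemma ln_le_Rpower x tau : 0 < tau -> ln x <= Rpower x tau / tau.
Proof.
  intros Ht. assert (K : tau * ln x <= Rpower x tau - 1).
  { replace (tau * ln x) with (ln (Rpower x tau)) by (unfold Rpower; apply ln_exp). apply ln_le_sub. apply exp_pos. }
  apply Rmult_le_reg_l with tau; auto. replace (tau * (Rpower x tau / tau)) with (Rpower x tau) by (field; lra). lra.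
Qed.

(** The least upper bound may be [m_infty], for instance of an empty set, and its real value is then
    0; hence the hypothesis [0 <= B]. *)
Lemma real_lub_le (E : Rbar -> Prop) (B : R) : 0 <= B -> (forall x, E x -> Rbar_le x (Finite B)) -> real (Rbar_lub E) <= B.
Proof.
  intros HB H. pose proof (Rbar_lub_least E (Finite B) H) as K. destruct (Rbar_lub E); simpl in *; lra || tauto.
Qed.

Lemma Rpower_ge1 x t : 1 <= x -> 0 <= t -> 1 <= Rpower x t.
Proof.
  intros Hx Ht. unfold Rpower. rewrite <- exp_0 at 1. assert (0 <= t * ln x) by (apply Rmult_le_pos; auto; apply ln_nonneg; auto).
  destruct H as [H|H]. left; apply exp_increasing; auto. rewrite <- H; lra.
Qed.

Lemma Rpower_pos x t : 0 < Rpower x t.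
Proof. apply exp_pos. Qed.

(** The inequality of [nevanlinna_key] bounds both parts of the characteristic: the proximity
    integral with the empty list of poles, the counting sum with truncation at 0, where the integral
    vanishes. *)
Lemma nev_T_bound f b s C2 tau B0 : meromorphic f -> ~ sing_set f b -> 0 < s -> 0 < C2 -> 0 < tau ->
  (forall z, ~ poles f z -> Cmod (f z - b) < s ->
     exists a, bpt f b a /\ Cmod (z - a) <= C2 * (1 + Cmod a) * Cmod (f z - b) /\ Cmod a <= 2 * Cmod z + 1) ->
  (forall Z : list C, NoDup Z -> (forall a, In a Z -> bpt f b a /\ a <> 0%C) -> lsum (fun a => Rpower (Cmod a) (- tau)) Z <= B0) ->
  exists Ct, 0 < Ct /\ forall r, 3 <= r -> nev_T f r <= Ct * Rpower r tau.
Proof.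
  intros Hf Hs Hs0 HC2 Htau Hsize Hsum. pose proof PI_RGT_0 as Hpi.
  destruct (nevanlinna_key f b s C2 Hf Hs Hs0 HC2 Hsize) as [C1 [K [HK Hkey]]].
  set (k1 := Rpower K tau / tau). set (k2 := Rpower (2 * K) tau / tau * B0).
  assert (HB0 : 0 <= B0). { specialize (Hsum nil (NoDup_nil C)). simpl in Hsum. apply Hsum. tauto. }
  assert (Hk1 : 0 < k1) by (unfold k1; apply Rdiv_lt_0_compat; auto; apply Rpower_pos).
  assert (Hk2 : 0 <= k2). { unfold k2. apply Rmult_le_pos; auto. left; apply Rdiv_lt_0_compat; auto; apply Rpower_pos. }
  set (Cb := Rabs C1 + k1 + k2). pose proof (Rabs_pos C1) as HC1. assert (HCb : 0 < Cb) by (unfold Cb; lra).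
  assert (Hmain : forall r, 1 <= r -> forall L : list (C * nat), NoDup (map fst L) ->
    List.Forall (fun pm : C * nat => is_pole f (fst pm) (snd pm) /\ 0 < Cmod (fst pm) <= r) L ->
    forall M, RInt (fun t => Rmin (logplus (Cmod (f (Cpolar (3 * r) t)))) M) 0 (2 * PI) <=
      2 * PI * (Cb * Rpower r tau - sum_poles r L)).
  { intros r Hr L HLnd HL M.
    destruct (discrete_finite (fun z => bpt f b z /\ z <> 0%C) (9 * r)) as [Z [HZnd HZ]].
    { intros a. destruct (order_at_discrete f b a Hf Hs) as [d [Hd H]]. exists d. split; auto.
      intros z Hz Hza [K1 _]. destruct (H z Hz Hza). tauto. }
    eapply Rle_trans. apply (Hkey r Hr Z HZ L HLnd HL M). apply Rmult_le_compat_l. lra.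
    assert (Hrt : 1 <= Rpower r tau) by (apply Rpower_ge1; lra).
    assert (A1 : C1 <= Rabs C1 * Rpower r tau). { pose proof (Rle_abs C1). nra. }
    assert (A2 : ln (K * r) <= k1 * Rpower r tau).
    { eapply Rle_trans. apply (ln_le_Rpower _ tau Htau). rewrite <- Rpower_mult_distr by lra. unfold k1, Rdiv. right; ring. }
    (* The inequality ln x <= x^tau/tau turns the logarithmic sum into the sum of |a|^(-tau), at the
       price of r^tau. *)
    assert (A3 : lsum (fun a => ln (2 * (K * r) / Cmod a)) Z <= k2 * Rpower r tau).
    { apply Rle_trans with (lsum (fun a => Rpower (2 * K) tau / tau * Rpower r tau * Rpower (Cmod a) (- tau)) Z).
      - apply lsum_le. intros a Ha. apply HZ in Ha. destruct Ha as [[_ Ha0] _]. apply Cmod_gt_0 in Ha0.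
        eapply Rle_trans. apply (ln_le_Rpower _ tau Htau).
        assert (Rpower (2 * (K * r) / Cmod a) tau = Rpower (2 * K) tau * Rpower r tau * Rpower (Cmod a) (- tau)).
        { rewrite Rpower_Ropp. unfold Rdiv. rewrite <- Rpower_mult_distr by (try (apply Rinv_0_lt_compat; auto); nra).
          replace (2 * (K * r)) with (2 * K * r) by ring. rewrite <- (Rpower_mult_distr (2 * K) r) by lra. f_equal.
          unfold Rpower. rewrite ln_Rinv by auto. rewrite <- exp_Ropp. f_equal. ring. }
        rewrite H. unfold Rdiv. right; ring.
      - rewrite lsum_scal. specialize (Hsum Z HZnd ltac:(intros a Ha; apply HZ in Ha; tauto)).
        unfold k2. assert (0 < Rpower (2 * K) tau / tau) by (apply Rdiv_lt_0_compat; auto; apply Rpower_pos).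
        pose proof (Rpower_pos r tau).
        replace (Rpower (2 * K) tau / tau * B0 * Rpower r tau) with (Rpower (2 * K) tau / tau * Rpower r tau * B0) by ring.
        apply Rmult_le_compat_l; auto. nra. }
    unfold Cb. lra. }
  set (pm := Rabs (pole_mult f 0)). pose proof (Rabs_pos (pole_mult f 0)) as Hpm. fold pm in Hpm.
  exists (2 * Cb + pm / tau + 1). assert (0 <= pm / tau) by (apply Rdiv_le_0_compat; lra). split. lra.
  intros r Hr. pose proof (Rpower_pos r tau) as Hrt. unfold nev_T.
  assert (P1 : prox f r <= Cb * Rpower r tau).
  { unfold prox. apply Rmult_le_reg_l with (2 * PI). lra.
    rewrite <- Rmult_assoc, Rinv_r, Rmult_1_l by lra.
    apply real_lub_le. apply Rmult_le_pos; [lra|]. nra.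
    intros x [M ->]. simpl.
    (* The inequality at r/3 concerns the circle of radius r; this is the reason for r >= 3. *)
    pose proof (Hmain (r / 3) ltac:(lra) nil (NoDup_nil C) (List.Forall_nil _) M) as K1.
    replace (3 * (r / 3)) with r in K1 by field. eapply Rle_trans. exact K1. apply Rmult_le_compat_l. lra. simpl.
    rewrite Rminus_0_r. apply Rmult_le_compat_l. lra. apply Rle_Rpower_l; lra. }
  assert (P2 : count_poles f r <= Cb * Rpower r tau + pm / tau * Rpower r tau).
  { unfold count_poles. apply Rplus_le_compat.
    - apply real_lub_le. nra. intros x [L (HLnd & HL & ->)]. simpl.
      pose proof (Hmain r ltac:(lra) L HLnd HL 0) as K1.
      rewrite (RInt_ext _ (fun _ => 0)) in K1.
      2: { intros t _. apply Rmin_right. apply logplus_ge0. }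
      rewrite RInt_const in K1. unfold scal in K1; simpl in K1; unfold mult in K1; simpl in K1. rewrite Rmult_0_r in K1.
      assert (0 <= Cb * Rpower r tau - sum_poles r L); [|lra].
      apply Rmult_le_reg_l with (2 * PI). lra. rewrite Rmult_0_r. exact K1.
    - apply Rle_trans with (pm * ln r).
      + apply Rmult_le_compat_r. apply ln_nonneg; lra. apply Rle_abs.
      + pose proof (ln_le_Rpower r tau Htau). unfold Rdiv. rewrite Rmult_assoc. apply Rmult_le_compat_l. auto.
        unfold Rdiv in H0. lra. }
  nra.
Qed.

Lemma ln_nonpos x : x <= 0 -> ln x = 0.
Proof. intros H. unfold ln. destruct (Rlt_dec 0 x); [exfalso; apply (Rlt_irrefl 0); eapply Rlt_le_trans; eassumption|reflexivity]. Qed.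

Lemma order_le f rho tau Ct : 0 < tau -> 0 < Ct -> (forall r, 3 <= r -> nev_T f r <= Ct * Rpower r tau) ->
  order f = Finite rho -> rho <= tau.
Proof.
  intros Ht HC H Ho. apply Rnot_lt_le. intros Hlt. set (e := (rho - tau) / 2). assert (He : 0 < e) by (unfold e; lra).
  (* Beyond [R0] the factor [Ct] is at most r^e. *)
  set (R0 := Rmax 3 (exp (Rabs (ln Ct) / e))).
  assert (K : Rbar_le (order f) (Finite (tau + e))).
  { eapply Rbar_le_trans. apply Rbar_glb_lb. exists R0. reflexivity.
    apply Rbar_lub_least. intros x [r [Hr [Hr1 ->]]]. simpl.
    pose proof (Rmax_l 3 (exp (Rabs (ln Ct) / e))) as m1. pose proof (Rmax_r 3 (exp (Rabs (ln Ct) / e))) as m2. fold R0 in m1, m2.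
    assert (Hlr : 0 < ln r) by (rewrite <- ln_1; apply ln_increasing; lra).
    assert (HlC : ln Ct <= e * ln r).
    { assert (Rabs (ln Ct) / e < ln r). { rewrite <- (ln_exp (Rabs (ln Ct) / e)). apply ln_increasing. apply exp_pos. lra. }
      apply (Rmult_lt_compat_l e) in H0; auto. replace (e * (Rabs (ln Ct) / e)) with (Rabs (ln Ct)) in H0 by (field; lra).
      pose proof (Rle_abs (ln Ct)). lra. }
    apply Rmult_le_reg_r with (ln r); auto. replace (ln (nev_T f r) / ln r * ln r) with (ln (nev_T f r)) by (field; lra).
    (* [ln] has the value 0 at nonpositive arguments, so the quotient is 0 in this case. *)
    destruct (Rle_dec (nev_T f r) 0) as [Hn|Hn].
    - rewrite ln_nonpos by auto. nra.
    - specialize (H r ltac:(lra)). apply Rle_trans with (ln (Ct * Rpower r tau)).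
      + destruct H as [H|H]. left; apply ln_increasing; lra. rewrite H; lra.
      + rewrite ln_mult by (auto; apply Rpower_pos). unfold Rpower. rewrite ln_exp. lra. }
  rewrite Ho in K. simpl in K. unfold e in *. lra.
Qed.

(** * Choice of the inverse branches and the dimension bound *)

Lemma lsum_app h (Z1 Z2 : list C) : lsum h (Z1 ++ Z2) = lsum h Z1 + lsum h Z2.
Proof. induction Z1; simpl. ring. rewrite IHZ1. ring. Qed.

Lemma lsum_filter h (p : C -> bool) Z :
  lsum h Z = lsum h (filter p Z) + lsum h (filter (fun a => negb (p a)) Z).
Proof. induction Z; simpl. ring. destruct (p a); simpl; rewrite IHZ; ring. Qed.

Lemma lsum_incl h (Z Z' : list C) : (forall a, 0 <= h a) -> NoDup Z -> incl Z Z' -> lsum h Z <= lsum h Z'.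
Proof.
  intros Hh. revert Z'. induction Z as [|a Z IH]; intros Z' Hnd Hinc.
  - simpl. clear -Hh. induction Z'; simpl. lra. specialize (Hh a). lra.
  - apply NoDup_cons_iff in Hnd. destruct Hnd as [Hna Hnd].
    assert (Ha : In a Z') by (apply Hinc; left; auto). destruct (in_split a Z' Ha) as [Z1 [Z2 ->]].
    rewrite lsum_app. simpl. assert (K : lsum h Z <= lsum h (Z1 ++ Z2)).
    { apply IH; auto. intros x Hx. assert (Hx' : In x (Z1 ++ a :: Z2)) by (apply Hinc; right; auto).
      apply in_app_or in Hx'. apply in_or_app. destruct Hx' as [|[->|]]; auto. tauto. }
    rewrite lsum_app in K. lra.
Qed.

Lemma lsum_rsum h (Z : list C) : lsum h Z = rsum (fun i => h (nth i Z 0%C)) (length Z).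
Proof.
  assert (Hshift : forall (u : nat -> R) n, rsum u (S n) = u O + rsum (fun k => u (S k)) n).
  { intros u. induction n. simpl; ring. change (rsum u (S (S n))) with (rsum u (S n) + u (S n)). rewrite IHn. simpl. ring. }
  induction Z; simpl length. reflexivity. rewrite Hshift. simpl. rewrite IHZ. reflexivity.
Qed.

Lemma Rpower_comparable (x y al : R) : 0 < y -> y / 2 <= x <= 2 * y -> Rpower x al <= Rpower 2 (Rabs al) * Rpower y al.
Proof.
  intros Hy Hx. replace x with (x / y * y) by (field; lra).
  assert (Hq : / 2 <= x / y <= 2).
  { split; apply Rmult_le_reg_r with y; auto; replace (x / y * y) with x by (field; lra); lra. }
  rewrite <- Rpower_mult_distr by lra. apply Rmult_le_compat_r. left; apply Rpower_pos.
  assert (K : al * ln (x / y) <= Rabs al * ln 2).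
  { assert (Hl : Rabs (ln (x / y)) <= ln 2).
    { apply Rabs_le. split.
      - rewrite <- ln_Rinv by lra. destruct (proj1 Hq) as [Q|Q]. left; apply ln_increasing; lra. rewrite Q; lra.
      - destruct (proj2 Hq) as [Q|Q]. left; apply ln_increasing; lra. rewrite Q; lra. }
    eapply Rle_trans. apply Rle_abs. rewrite Rabs_mult. apply Rmult_le_compat_l; auto. apply Rabs_pos. }
  unfold Rpower. destruct K as [K|K]. left; apply exp_increasing; auto. rewrite K; lra.
Qed.

Lemma Rpower_neg_le (x y k : R) : 0 < x -> x <= y -> 0 <= k -> Rpower y (- k) <= Rpower x (- k).
Proof.
  intros Hx Hxy Hk. rewrite !Rpower_Ropp. apply Rinv_le_contravar. apply Rpower_pos. apply Rle_Rpower_l; auto.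
Qed.

(* One inverse branch of hat f_{2n+2} o hat f_{2n+1}: first the branch of f over the disc at b, then the branch at the pole b. *)
Lemma inverse_step f b q S s s0 Q al R0 R1 c3 z psi chi (l0 c0 l1 c1 : C) :
  meromorphic f -> (0 < q)%nat -> 0 < s -> s <= S -> s <= s0 -> 0 < Q -> 0 < c3 ->
  (forall x, R0 < Cmod x -> ~ poles f x -> disk b s0 (f x) ->
     forall l, is_derive f x l -> Cmod l <= Q * Rpower (Cmod x) al) ->
  1 <= R1 -> 2 * R0 <= R1 -> R1 <= Cmod z -> 64 <= R1 ->
  branch f b S psi -> psi b = z -> (forall w, Cmod (w - b) < s -> Cmod (psi w - z) <= Cmod z / 4) ->
  (forall y, Cmod (y - z) < Cmod z / 2 ->
    Cmod (chi y - b) < s / 16 /\ ~ poles f (chi y) /\ f (chi y) = y /\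
    exists l, cderiv chi y l /\ l <> 0%C /\ c3 * Rpower (Cmod y) (- (1 + / INR q)) <= Cmod l) ->
  l0 <> 0%C -> l1 <> 0%C -> Cmod (/ l0 - 1) < / 16 -> Cmod (/ l1 - 1) < / 16 -> Cmod (/ l1 - 1) * (1 + Cmod b) <= s / 16 ->
  Cmod c0 <= 1 -> Cmod c1 <= s / 16 ->
  forall y, Cmod (y - b) < s / 2 ->
    let w := ((y - c1) / l1)%C in let x := psi w in let v := ((x - c0) / l0)%C in
    Cmod (w - b) < s /\ Cmod (v - z) < Cmod z / 2 /\
    Cmod (chi v - b) < s / 16 /\ ~ poles f (chi v) /\ f (chi v) = v /\ (l0 * v + c0)%C = x /\ ~ poles f x /\ f x = w /\ (l1 * w + c1)%C = y /\
    exists l, cderiv (fun y => chi ((psi ((y - c1) / l1) - c0) / l0)%C) y l /\ l <> 0%C /\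
      c3 / (4 * Q * Rpower 2 (1 + / INR q) * Rpower 2 (Rabs al)) * Rpower (Cmod z) (- (al + 1 + / INR q)) <= Cmod l.
Proof.
  intros Hf Hq Hs HsS Hss0 HQ Hc3 HM2 HR1 HR0 Hz HR1' Hpsi Hpsib Hpsiz Hchi Hl0 Hl1 Hi0 Hi1 Hi1b Hc0 Hc1 y Hy w x v.
  assert (Hinv : forall m : C, m <> 0%C -> Cmod (/ m - 1) < / 16 -> 15 / 16 < Cmod (/ m) < 17 / 16).
  { intros m Hm Hmi. pose proof (Cmod_sub_ge (/ m) 1) as T1. pose proof (Cmod_sub_ge 1 (/ m)) as T2.
    rewrite (Cmod_sub_sym 1) in T2. rewrite Cmod_1 in *. lra. }
  destruct (Hinv l0 Hl0 Hi0) as [I0a I0b]. destruct (Hinv l1 Hl1 Hi1) as [I1a I1b].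
  pose proof (Cmod_ge_0 b) as Hb0.
  (* The margins between s/2 and s here, and between |z|/4 and |z|/2 in [Hv], absorb the two affine
     perturbations. *)
  assert (Hw : Cmod (w - b) < s).
  { unfold w. replace ((y - c1) / l1 - b)%C with (/ l1 * ((y - b) - c1) + (/ l1 - 1) * b)%C by (field; auto).
    eapply Rle_lt_trans. apply Cmod_triangle. rewrite !Cmod_mult.
    pose proof (Cmod_sub_le (y - b) c1). pose proof (Cmod_ge_0 (y - b - c1)). pose proof (Cmod_ge_0 (/ l1 - 1)). nra. }
  destruct (Hpsi w ltac:(lra)) as (p1 & p2 & p3 & p4). fold x in p1, p2, p3, p4.
  pose proof (Hpsiz w Hw) as Hxz. fold x in Hxz.
  assert (Hv : Cmod (v - z) < Cmod z / 2).
  { unfold v. replace ((x - c0) / l0 - z)%C with (/ l0 * ((x - z) - c0) + (/ l0 - 1) * z)%C by (field; auto).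
    eapply Rle_lt_trans. apply Cmod_triangle. rewrite !Cmod_mult.
    pose proof (Cmod_sub_le (x - z) c0). pose proof (Cmod_ge_0 (x - z - c0)). pose proof (Cmod_ge_0 (/ l0 - 1)). nra. }
  destruct (Hchi v Hv) as (h1 & h2 & h3 & lc & h4 & h5 & h6).
  assert (Ev : (l0 * v + c0)%C = x) by (unfold v; field; auto).
  assert (Ew : (l1 * w + c1)%C = y) by (unfold w; field; auto).
  do 9 (split; [assumption|]).
  exists (lc * (/ l0 * (/ dC f x * / l1)))%C. split; [|split].
  - apply (cderiv_comp chi (fun y => (psi ((y - c1) / l1) - c0) / l0)%C). exact h4.
    apply cderiv_ext with (f := fun y => (/ l0 * (psi ((y - c1) / l1) - c0))%C). { intros; field; auto. }
    apply cderiv_scal.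
    assert (Ha : cderiv (fun y => ((y - c1) / l1)%C) y (/ l1)).
    { apply cderiv_ext with (f := fun y => (/ l1 * (y - c1))%C). { intros; field; auto. }
      eapply cderiv_eq; [|apply cderiv_scal, cderiv_minus; [apply cderiv_id|apply cderiv_const]]. ring. }
    eapply cderiv_eq; [|apply cderiv_minus; [apply (cderiv_comp psi (fun y => (y - c1) / l1)%C); [exact p4|exact Ha]|apply cderiv_const]].
    ring.
  - assert (N : forall m : C, m <> 0%C -> (/ m)%C <> 0%C).
    { intros m Hm E. apply (f_equal Cmod) in E. rewrite Cmod_inv, Cmod_0 in E by auto. apply Cmod_gt_0 in Hm. apply Rinv_0_lt_compat in Hm. lra. }
    repeat apply Cmult_neq_0; auto.
  - rewrite !Cmod_mult. assert (Hz0 : 0 < Cmod z) by lra. set (Z := Cmod z) in *.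
    set (k := 1 + / INR q) in *. assert (Hq0 : 0 < / INR q) by (apply Rinv_0_lt_compat, lt_0_INR; auto).
    assert (Hxm : Z / 2 <= Cmod x <= 2 * Z).
    { pose proof (Cmod_sub_ge x z) as T1. pose proof (Cmod_sub_ge z x) as T2. rewrite (Cmod_sub_sym z) in T2. fold Z in T1, T2. lra. }
    assert (Hvm : 0 < Cmod v <= 2 * Z).
    { pose proof (Cmod_sub_ge v z) as T1. pose proof (Cmod_sub_ge z v) as T2. rewrite (Cmod_sub_sym z) in T2. fold Z in T1, T2. lra. }
    (* (M2) applies at [x], whose modulus is at least 3|z|/4 > R0 and whose image [w] lies in the
       disc of radius [s0]. An upper bound for |f' x| is a lower bound for the derivative of
       [psi]. *)
    assert (Hd : Cmod (dC f x) <= Q * (Rpower 2 (Rabs al) * Rpower Z al)).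
    { apply Rle_trans with (Q * Rpower (Cmod x) al).
      - assert (3 / 4 * Z <= Cmod x).
        { pose proof (Cmod_sub_ge z x) as T2. rewrite (Cmod_sub_sym z) in T2. fold Z in T2. lra. }
        apply HM2; auto. lra. unfold disk. rewrite p2. lra. apply is_derive_cderiv, dC_spec, meromorphic_cholo; auto.
      - apply Rmult_le_compat_l. lra. apply Rpower_comparable; auto. }
    assert (Pd : 0 < Cmod (dC f x)) by (apply Cmod_gt_0; auto).
    set (A2 := Rpower 2 (Rabs al)) in *. set (Ak := Rpower 2 k). set (Zk := Rpower Z k). set (Za := Rpower Z al) in *.
    assert (PA2 : 0 < A2) by apply Rpower_pos. assert (PAk : 0 < Ak) by apply Rpower_pos.
    assert (PZk : 0 < Zk) by apply Rpower_pos. assert (PZa : 0 < Za) by apply Rpower_pos.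
    assert (Hlc : c3 * / (Ak * Zk) <= Cmod lc).
    { eapply Rle_trans; [|exact h6]. apply Rmult_le_compat_l. lra.
      replace (/ (Ak * Zk)) with (Rpower (2 * Z) (- k)).
      { apply Rpower_neg_le; unfold k; lra. }
      rewrite Rpower_Ropp, <- Rpower_mult_distr by lra. reflexivity. }
    assert (Hid : / (Q * (A2 * Za)) <= Cmod (/ dC f x)).
    { rewrite Cmod_inv by auto. apply Rinv_le_contravar; auto. }
    assert (EZ : Rpower Z (- (al + 1 + / INR q)) = / (Zk * Za)).
    { rewrite Rpower_Ropp. f_equal. unfold Zk, Za. rewrite <- Rpower_plus. f_equal. unfold k. ring. }
    rewrite EZ.
    assert (Pq : 0 < / (Q * (A2 * Za))) by (apply Rinv_0_lt_compat; repeat apply Rmult_lt_0_compat; auto).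
    assert (Pl : 0 < c3 * / (Ak * Zk)) by (apply Rmult_lt_0_compat; auto; apply Rinv_0_lt_compat, Rmult_lt_0_compat; auto).
    (* Each of |1/l0| and |1/l1| is at least 1/2, whence the 4. *)
    replace (c3 / (4 * Q * Ak * A2) * / (Zk * Za)) with (c3 * / (Ak * Zk) * (/ 2 * (/ (Q * (A2 * Za)) * / 2))) by (field; repeat split; lra).
    apply Rmult_le_compat; [lra|lra|exact Hlc|]. apply Rmult_le_compat; [lra|lra|lra|]. apply Rmult_le_compat; lra.
Qed.

Theorem theorem4p1 :
  forall (f0 : C -> C) (rho : R),
    meromorphic f0 ->
    order f0 = Finite rho ->
  forall (b : C) (q : nat),
    (* (M1) *)
    is_pole f0 b q ->
    ~ in_closure (sing_set f0) b ->
  forall (s0 Q alpha : R),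
    (* (M2) *)
    0 < s0 -> 0 < Q -> - 1 - / INR q < alpha ->
    (exists R0 : R, forall z : C, R0 < Cmod z -> ~ poles f0 z ->
        disk b s0 (f0 z) ->
        forall l : C, is_derive f0 z l -> Cmod l <= Q * Rpower (Cmod z) alpha) ->
  exists eps delta : R, 0 < eps /\ 0 < delta /\
    forall lam c : nat -> C,
      (forall n, lam n <> 0%C /\ disk 1%C delta (lam n) /\ disk 1%C delta (/ lam n)%C) ->
      (forall n, Cmod (c n) < eps) ->
      Rbar_le (Finite (rho / (alpha + 1 + / INR q)))
              (HD (radial_julia f0 lam c)).
Proof.
  intros f rho Hf Hord b q Hpole Hcl s0 Q al Hs0 HQ Hal [R0 HM2].
  assert (Hq : (0 < q)%nat) by apply Hpole.
  assert (HS : exists S, 0 < S /\ forall w, Cmod (w - b) < S -> ~ sing_set f w).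
  { apply NNPP. intros Hno. apply Hcl. intros r Hr. apply NNPP. intros Hno'. apply Hno. exists r. split; auto.
    intros w Hw Hsw. apply Hno'. exists w. split; auto. }
  destruct HS as [S [HS Hsing]].
  assert (Hsb : ~ sing_set f b) by (apply Hsing; rewrite Cmod_sub_0; auto).
  destruct (branch_size f b S Hf HS Hsing) as [sg [K2 (Hsg & HsgS & HK2 & Hsize)]].
  (* The third bound limits the displacement of a branch with centre [a] to (1 + |a|)/8. This is at
     most |a|/4 when |a| >= 1, and it gives |a| <= 2|z| + 1 for every value [z] on the disc of
     radius [s]. *)
  set (s := Rmin (Rmin sg s0) (/ (8 * K2))).
  assert (Hs : 0 < s). { repeat apply Rmin_glb_lt; auto. apply Rinv_0_lt_compat; lra. }
  assert (s_sg : s <= sg) by (eapply Rle_trans; [apply Rmin_l|apply Rmin_l]).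
  assert (s_s0 : s <= s0) by (eapply Rle_trans; [apply Rmin_l|apply Rmin_r]).
  assert (sK : K2 * s <= / 8).
  { apply Rle_trans with (K2 * / (8 * K2)). apply Rmult_le_compat_l. lra. apply Rmin_r. right. field. lra. }
  assert (Hs2 : forall psi, branch f b S psi -> forall w, Cmod (w - b) < s ->
    Cmod (psi w - psi b) <= K2 * (1 + Cmod (psi b)) * Cmod (w - b) /\ Cmod (psi w - psi b) <= (1 + Cmod (psi b)) / 8).
  { intros psi Hp w Hw. assert (K := Hsize psi Hp w ltac:(lra)). split; auto. eapply Rle_trans. exact K.
    pose proof (Cmod_ge_0 (psi b)). pose proof (Cmod_ge_0 (w - b)).
    apply Rle_trans with (K2 * (1 + Cmod (psi b)) * s). apply Rmult_le_compat_l; nra. nra. }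
  destruct (pole_branch f b q (s / 16) Hf Hpole ltac:(lra)) as [R1 [c3 (HR1 & Hc3 & Hchi)]].
  (* Centres of modulus at least [RR] lie in the range of [pole_branch] and, by a factor 2, beyond
     the threshold of (M2); the 64 makes translations of length at most 1 negligible against them.
     [R0] may be negative. *)
  set (RR := 64 + R1 + 2 * Rabs R0). pose proof (Rabs_pos R0) as pR0. pose proof (Rle_abs R0) as pR0'.
  pose proof (Cmod_ge_0 b) as Hb0.
  (* [c] acts at both ends of a pair: near [b] it is measured against [s], near infinity against 1.
     The divisor 1 + |b| in [delta] is there because (1/lambda - 1) b displaces the centre [b]
     itself. *)
  set (eps := Rmin 1 (s / 16)). set (delta := Rmin (/ 16) (s / (16 * (1 + Cmod b)))).
  assert (Heps : 0 < eps) by (apply Rmin_glb_lt; lra).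
  assert (Hdel : 0 < delta) by (apply Rmin_glb_lt; [lra|apply Rdiv_lt_0_compat; lra]).
  exists eps, delta. split; auto. split; auto. intros lam c Hlam Hc.
  set (be := al + 1 + / INR q). assert (Hbe : 0 < be) by (unfold be; lra).
  (* HD is an infimum, so it remains to exclude zero measure at an exponent [t] below the bound;
     [tau = t * be] is then below [rho]. *)
  apply Rbar_glb_greatest. intros xx [t (Ht & -> & Hmeas)]. simpl. apply Rnot_lt_le. intros Hlt.
  set (tau := t * be). assert (Htau : 0 < tau) by (unfold tau; nra).
  assert (Htr : tau < rho).
  { unfold tau. apply (Rmult_lt_compat_r be) in Hlt; auto. replace (rho / be * be) with rho in Hlt by (field; lra). exact Hlt. }
  set (c4 := c3 / (4 * Q * Rpower 2 (1 + / INR q) * Rpower 2 (Rabs al))).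
  assert (Hc4 : 0 < c4).
  { unfold c4. apply Rdiv_lt_0_compat; auto. repeat apply Rmult_lt_0_compat; try lra; apply Rpower_pos. }
  pose proof PI_RGT_0 as Hpi. set (c5 := c4 / (320 * PI)). assert (Hc5 : 0 < c5) by (unfold c5; apply Rdiv_lt_0_compat; lra).
  (* The t-th power of c5 |z|^(-be) is kk |z|^(-tau). If no finite set of b-points beyond [RR] had
     total weight 1, the sums of |z|^(-tau) over all finite sets of nonzero b-points would be
     bounded by 1/kk plus the finite contribution of [l0], and the order would be at most tau <
     rho. *)
  assert (HJ : exists J : list C, NoDup J /\ (forall z, In z J -> bpt f b z /\ RR <= Cmod z) /\
    1 <= lsum (fun z => Rpower (c5 * Rpower (Cmod z) (- be)) t) J).
  { apply NNPP. intros Hno.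
    destruct (discrete_finite (fun z => bpt f b z /\ z <> 0%C) RR) as [l0 [_ Hl0]].
    { intros a. destruct (order_at_discrete f b a Hf Hsb) as [d [Hd H]]. exists d. split; auto.
      intros z Hz Hza [K1 _]. destruct (H z Hz Hza). tauto. }
    set (h := fun a => Rpower (Cmod a) (- tau)).
    assert (Hh : forall a, 0 <= h a) by (intros a; left; apply Rpower_pos).
    set (kk := Rpower c5 t). assert (Hkk : 0 < kk) by apply Rpower_pos.
    destruct (nev_T_bound f b s K2 tau (/ kk + lsum h l0)) as [Ct [HCt HT]]; auto.
    (* The b-point attached to [z] is the centre of the branch through [z]. *)
    - intros z Hz Hzb. destruct (branch_exists f b S z Hf Hsing Hz ltac:(lra)) as [psi [Hpsi Epsi]].
      exists (psi b). destruct (Hs2 psi Hpsi (f z) Hzb) as [k1 k2]. rewrite Epsi in k1, k2.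
      split; [|split; auto].
      + destruct (Hpsi b) as (p1 & p2 & _). rewrite Cmod_sub_0; auto. split; auto.
      + pose proof (Cmod_sub_ge (psi b) z). rewrite (Cmod_sub_sym (psi b)) in H.
        pose proof (Cmod_ge_0 z). lra.
    - intros Z HZnd HZ. rewrite (lsum_filter h (fun a => if Rle_dec RR (Cmod a) then true else false)).
      apply Rplus_le_compat.
      + set (J := filter (fun a => if Rle_dec RR (Cmod a) then true else false) Z).
        assert (HJ : forall z, In z J -> bpt f b z /\ RR <= Cmod z).
        { intros z Hz. unfold J in Hz. apply filter_In in Hz. destruct Hz as [Hz1 Hz2]. split. apply HZ; auto.
          destruct (Rle_dec RR (Cmod z)); auto. discriminate. }
        apply Rnot_lt_le. intros Hgt. apply Hno. exists J. split. apply NoDup_filter; auto. split; auto.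
        apply Rle_trans with (kk * lsum h J).
        * apply (Rmult_lt_compat_l kk) in Hgt; auto. rewrite Rinv_r in Hgt by lra. left. exact Hgt.
        * rewrite <- lsum_scal. apply lsum_le. intros a Ha. unfold kk, h.
          rewrite <- Rpower_mult_distr by (auto; apply Rpower_pos). right. f_equal. rewrite Rpower_mult. f_equal. unfold tau. ring.
      + apply lsum_incl; auto. apply NoDup_filter; auto. intros a Ha. apply filter_In in Ha. destruct Ha as [Ha1 Ha2].
        apply Hl0. split. apply HZ; auto. destruct (Rle_dec RR (Cmod a)); [discriminate|lra].
    - pose proof (order_le f rho tau Ct Htau HCt HT Hord). lra. }
  destruct HJ as [J [HJnd [HJ HJs]]].
  set (N := length J). set (zz := fun i => nth i J 0%C).
  assert (Hzz : forall i, (i < N)%nat -> bpt f b (zz i) /\ RR <= Cmod (zz i)).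
  { intros i Hi. apply HJ. apply nth_In. exact Hi. }
  set (PSI := fun z => epsilon (inhabits (fun x : C => x)) (fun psi => branch f b S psi /\ psi b = z)).
  assert (HPSI : forall i, (i < N)%nat -> branch f b S (PSI (zz i)) /\ PSI (zz i) b = zz i).
  { intros i Hi. apply (epsilon_spec (inhabits (fun x : C => x)) (fun psi => branch f b S psi /\ psi b = zz i)).
    destruct (Hzz i Hi) as [[h1 h2] _]. destruct (branch_exists f b S (zz i) Hf Hsing h1) as [psi [Hp Ep]].
    rewrite h2, Cmod_sub_0; auto. rewrite h2 in Ep. exists psi. auto. }
  set (chiP := fun (z : C) (chi : C -> C) => forall y, Cmod (y - z) < Cmod z / 2 ->
    Cmod (chi y - b) < s / 16 /\ ~ poles f (chi y) /\ f (chi y) = y /\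
    exists l, cderiv chi y l /\ l <> 0%C /\ c3 * Rpower (Cmod y) (- (1 + / INR q)) <= Cmod l).
  set (CHI := fun z => epsilon (inhabits (fun x : C => x)) (chiP z)).
  assert (HCHI : forall i, (i < N)%nat -> chiP (zz i) (CHI (zz i))).
  { intros i Hi. apply (epsilon_spec (inhabits (fun x : C => x)) (chiP (zz i))). apply Hchi.
    destruct (Hzz i Hi) as [_ K]. unfold RR in K. lra. }
  set (T := fun (n i : nat) (y : C) =>
    CHI (zz i) ((PSI (zz i) ((y - c (2 * n + 1)%nat) / lam (2 * n + 1)%nat) - c (2 * n)%nat) / lam (2 * n)%nat)%C).
  assert (Hstep : forall n i y, (i < N)%nat -> Cmod (y - b) < s / 2 ->
    let w := ((y - c (2 * n + 1)%nat) / lam (2 * n + 1)%nat)%C in let x := PSI (zz i) w in let v := ((x - c (2 * n)%nat) / lam (2 * n)%nat)%C in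
    Cmod (w - b) < s /\ Cmod (v - zz i) < Cmod (zz i) / 2 /\
    Cmod (T n i y - b) < s / 16 /\ ~ poles f (T n i y) /\ f (T n i y) = v /\
    (lam (2 * n)%nat * v + c (2 * n)%nat)%C = x /\ ~ poles f x /\ f x = w /\ (lam (2 * n + 1)%nat * w + c (2 * n + 1)%nat)%C = y /\
    exists l, cderiv (T n i) y l /\ l <> 0%C /\ c4 * Rpower (Cmod (zz i)) (- be) <= Cmod l).
  { intros n i y Hi Hy. destruct (Hzz i Hi) as [_ HzR]. destruct (HPSI i Hi) as [Hb1 Hb2].
    assert (Hd : forall k, Cmod (/ lam k - 1) < delta) by (intros k; apply (Hlam k)).
    assert (d1 : delta <= / 16) by apply Rmin_l. assert (d2 : delta <= s / (16 * (1 + Cmod b))) by apply Rmin_r.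
    assert (e1 : eps <= 1) by apply Rmin_l. assert (e2 : eps <= s / 16) by apply Rmin_r.
    apply (inverse_step f b q S s s0 Q al R0 RR c3 (zz i) (PSI (zz i)) (CHI (zz i))); auto; try (unfold RR in *; lra).
    - intros w Hw. destruct (Hs2 (PSI (zz i)) Hb1 w Hw) as [_ K]. rewrite Hb2 in K. unfold RR in HzR. lra.
    - apply HCHI; auto.
    - apply Hlam.
    - apply Hlam.
    - specialize (Hd (2 * n)%nat). lra.
    - specialize (Hd (2 * n + 1)%nat). lra.
    - specialize (Hd (2 * n + 1)%nat). apply Rle_trans with (s / (16 * (1 + Cmod b)) * (1 + Cmod b)).
      apply Rmult_le_compat_r; lra. right. field. lra.
    - specialize (Hc (2 * n)%nat). lra.
    - specialize (Hc (2 * n + 1)%nat). lra. }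
  apply (ifs_hausdorff f lam c b s N (fun i => c4 * Rpower (Cmod (zz i)) (- be)) T t); auto.
  - split.
    + intros n i y Hi Hy. destruct (Hstep n i y Hi Hy) as (_ & _ & h3 & h4 & h5 & h6 & h7 & h8 & h9 & h10).
      split; auto. split; auto. rewrite h5, h6. split; auto. split; auto. rewrite h8. exact h9.
    + intros n i j y y' Hi Hj Hij Hy Hy' E.
      destruct (Hstep n i y Hi Hy) as (g1 & _ & _ & _ & g5 & g6 & _ & g8 & _).
      destruct (Hstep n j y' Hj Hy') as (k1 & _ & _ & _ & k5 & k6 & _ & k8 & _).
      (* Applying [f] and undoing the affine maps twice shows that the two branches agree at a
         common point, so they are the same branch, with the same centre; [NoDup] then identifies
         the indices. *)
      rewrite E, k5 in g5. rewrite <- g5, k6 in g6. rewrite <- g6, k8 in g8.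
      destruct (HPSI i Hi) as [Bi Ei]. destruct (HPSI j Hj) as [Bj Ej].
      apply Hij. apply (proj1 (NoDup_nth J 0%C) HJnd i j Hi Hj). fold (zz i) (zz j).
      rewrite <- Ei, <- Ej. symmetry.
      apply (branch_unique f b S (PSI (zz j)) (PSI (zz i)) ((y' - c (2 * n + 1)%nat) / lam (2 * n + 1)%nat)%C b Hf Hsing Bj Bi).
      lra. rewrite Cmod_sub_0; auto. rewrite g6. rewrite <- g8. reflexivity.
  - intros i Hi. apply Rmult_lt_0_compat; auto. apply Rpower_pos.
  - rewrite lsum_rsum in HJs. eapply Rle_trans. exact HJs. right. apply rsum_ext. intros i Hi. f_equal. unfold c5, zz. field. lra.
Qed.
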